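(* Let $n\in\mathbb N$ ($n\ge1$) and $s=2s'\in2\mathbb Z$. The space $(\Sigma^1_{4n+2,2})_{\mathrm{inv}}$ of $\mathrm{Sp}(n+1)$-invariant $1$-twisted spin$^{\mathbb C}$ spinors on $\mathbb{CP}^{2n+1}=\mathrm{Sp}(n+1)/(\mathrm U(1)\times\mathrm{Sp}(n))$ associated to the spin$^{\mathbb C}$ structure $\mathrm{Sp}(n+1)\times_{\phi_s}\mathrm{Spin}^{\mathbb C}(4n+2)$ is $$\mathrm{span}_{\mathbb C}\{\omega^{(n+1+s')/2},\,y_1\wedge\omega^{(n-1+s')/2}\}\otimes\hat1\ \oplus\ \mathrm{span}_{\mathbb C}\{\omega^{(n+1-s')/2},\,y_1\wedge\omega^{(n-1-s')/2}\}\otimes\hat y_1$$ if $n\not\equiv s'\bmod 2$, and is $0$ otherwise; here negative powers of $\omega$ are defined to be zero. In particular, the $\mathrm{Sp}(n+1)$-invariant spinor type satisfies $$\sigma(\mathbb{CP}^{2n+1},\mathrm{Sp}(n+1))=\begin{cases}1,&n\text{ odd},\\2,&n\text{ even}.\end{cases}$$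
   Context: Matrices: $E^{(N)}_{i,j}$ has $-1$ at $(i,j)$, $+1$ at $(j,i)$; $F^{(N)}_{i,j}$ ($i\neq j$) has $1$ at $(i,j)$, $(j,i)$; $F^{(N)}_{i,i}$ has a single $1$ at $(i,i)$; $B_0(X,Y)=-\mathrm{Re}\,\mathrm{tr}(XY)$; ${\rm i},{\rm j},{\rm k}$ quaternion units. Setting: $H=\mathrm U(1)\times\mathrm{Sp}(n)$ block-diagonal in $\mathrm{Sp}(n+1)$. Reductive complement $\mathfrak m=\mathcal V\oplus\mathcal H$, $\mathcal V=\mathrm{span}_{\mathbb R}\{\xi_2=-{\rm k}F^{(n+1)}_{1,1},\xi_3={\rm j}F^{(n+1)}_{1,1}\}$, $\mathcal H=\mathrm{span}_{\mathbb R}\{e_{4p}={\rm j}F^{(n+1)}_{1,p+1},e_{4p+1}={\rm k}F^{(n+1)}_{1,p+1},e_{4p+2}={\rm i}F^{(n+1)}_{1,p+1},e_{4p+3}=E^{(n+1)}_{1,p+1}\}_{p=1}^n$. Invariant metrics $g_{a,t}=aB_0|_{\mathcal H\times\mathcal H}+2at\,B_0|_{\mathcal V\times\mathcal V}$, $a,t>0$, with orthonormal basis $\xi_l^{a,t}=\xi_l/\sqrt{2ta}$, $e_q^{a,t}=e_q/\sqrt{2a}$; orientation $(\xi_2^{a,t},\xi_3^{a,t},e_4^{a,t},\dots,e_{4n+3}^{a,t})$. $\sigma:H\to\mathrm{SO}(4n+2)$ is the isotropy representation. $\mathrm{Spin}^r(N)=(\mathrm{Spin}(N)\times\mathrm{Spin}(r))/\langle(-1,-1)\rangle$,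 $\mathrm{Spin}^{\mathbb C}=\mathrm{Spin}^2$. $\varphi_s:H\to\mathrm U(1)\cong\mathrm{SO}(2)$, $(z,A)\mapsto z^s$ ($e^{{\rm i}\theta}$ is rotation by $\theta$, $\hat e_1\mapsto\cos\theta\,\hat e_1+\sin\theta\,\hat e_2$); $\phi_s$ is the unique lift of $\sigma\times\varphi_s$ to $\mathrm{Spin}^{\mathbb C}(4n+2)$. Spinors: $\Sigma_N$ is the spin representation. Put $y_1=\frac1{\sqrt2}(\xi_2^{a,t}+{\rm i}\xi_3^{a,t})$, $y_{2p}=\frac1{\sqrt2}(e_{4p}^{a,t}+{\rm i}e_{4p+1}^{a,t})$, $y_{2p+1}=\frac1{\sqrt2}(e_{4p+2}^{a,t}+{\rm i}e_{4p+3}^{a,t})$ (complex ${\rm i}$) and $x_q=\overline{y_q}$. Then $\Sigma_{4n+2}=\Lambda^\bullet\mathrm{span}_{\mathbb C}\{y_1,\dots,y_{2n+1}\}$ with Clifford action $x_q\cdot\eta={\rm i}\sqrt2\,x_q\lrcorner\eta$, $y_q\cdot\eta={\rm i}\sqrt2\,y_q\wedge\eta$ ($x_q\lrcorner y_l=\delta_{ql}$, $v\cdot v=-|v|^2$). $\Sigma_2$ has basis $\hat1,\hat y_1$ in the same model with $\hat y_1=\frac1{\sqrt2}(\hat e_1+{\rm i}\hat e_2)$. $\omega=\sum_{p=1}^ny_{2p}\wedge y_{2p+1}$, $\omega^k$ its exterior powers. For odd $m$, $\Sigma^m_{N,r}=\Sigma_N\otimes\Sigma_r^{\otimes m}$;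 for an invariant spin$^r$ structure $G\times_\phi\mathrm{Spin}^r(N)$ on $G/H$, invariant $m$-twisted spin$^r$ spinors are elements of $\Sigma^m_{N,r}$ fixed by $\phi(H)$, and $(\Sigma^m_{N,r})_{\mathrm{inv}}$ is the space of these. A $G$-invariant spin$^r$ structure on the oriented Riemannian $M=G/H$ is a principal $\mathrm{Spin}^r(N)$-bundle $P$ with an equivariant map $\Phi:P\to FM$ to the oriented orthonormal frame bundle ($\mathrm{Spin}^r(N)$ acting on $FM$ through $[\mu,\nu]\mapsto\lambda_N(\mu)$, $\lambda_N$ the double cover $\mathrm{Spin}(N)\to\mathrm{SO}(N)$), with a smooth $G$-action on $P$ by bundle homomorphisms making $\Phi$ $G$-equivariant. The $G$-invariant spinor type $\sigma(M,G)$ is the minimum $r\in\mathbb N$ such that $M$ admits a $G$-invariant spin$^r$ structure with $(\Sigma^m_{N,r})_{\mathrm{inv}}\neq0$ for some odd $m$ ($N=\dim M$). *)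

(* Defs.v *)
From HB Require Import structures.
From mathcomp Require Import all_boot all_order all_algebra.
From mathcomp Require Import all_classical all_reals all_analysis.
From mathcomp Require Import complex.
From mathcomp Require Import ring.

Set Implicit Arguments.
Unset Strict Implicit.
Unset Printing Implicit Defensive.

Import Order.TTheory GRing.Theory Num.Theory.
Import numFieldNormedType.Exports.

Local Open Scope classical_set_scope.
Local Open Scope ring_scope.

(** * Quaternions *)

Record quat (R : Type) := Quat { qr : R; qi : R; qj : R; qk : R }.

Section QuatRing.
Variable R : realDomainType.
Implicit Types x y z : quat R.

Definition quat_tuple x := (qr x, qi x, qj x, qk x).
Definition tuple_quat (u : R * R * R * R) :=
  let: (a, b, c, d) := u in Quat a b c d.
Lemma quat_tupleK : cancel quat_tuple tuple_quat. Proof. by case. Qed.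

HB.instance Definition _ := Equality.copy (quat R) (can_type quat_tupleK).
HB.instance Definition _ := Choice.copy (quat R) (can_type quat_tupleK).

Definition qadd x y :=
  Quat (qr x + qr y) (qi x + qi y) (qj x + qj y) (qk x + qk y).
Definition qopp x := Quat (- qr x) (- qi x) (- qj x) (- qk x).
Definition qmul x y := Quat
  (qr x * qr y - qi x * qi y - qj x * qj y - qk x * qk y)
  (qr x * qi y + qi x * qr y + qj x * qk y - qk x * qj y)
  (qr x * qj y - qi x * qk y + qj x * qr y + qk x * qi y)
  (qr x * qk y + qi x * qj y - qj x * qi y + qk x * qr y).

Let qaddA : associative qadd.
Proof. by move=> x y z; congr Quat => /=; ring. Qed.
Let qaddC : commutative qadd.
Proof. by move=> x y; congr Quat => /=; ring. Qed.
Let qadd0 : left_id (Quat 0 0 0 0) qadd.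
Proof. by case=> a b c d; congr Quat => /=; ring. Qed.
Let qaddN : left_inverse (Quat 0 0 0 0) qopp qadd.
Proof. by move=> x; congr Quat => /=; ring. Qed.

HB.instance Definition _ :=
  GRing.isZmodule.Build (quat R) qaddA qaddC qadd0 qaddN.

Let qmulA : associative qmul.
Proof. by move=> x y z; congr Quat => /=; ring. Qed.
Let qmul1 : left_id (Quat 1 0 0 0) qmul.
Proof. by case=> a b c d; congr Quat => /=; ring. Qed.
Let qmulr1 : right_id (Quat 1 0 0 0) qmul.
Proof. by case=> a b c d; congr Quat => /=; ring. Qed.
Let qmulDl : left_distributive qmul qadd.
Proof. by move=> x y z; congr Quat => /=; ring. Qed.
Let qmulDr : right_distributive qmul qadd.
Proof. by move=> x y z; congr Quat => /=; ring. Qed.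
Let qone_neq0 : Quat 1 0 0 0 != 0 :> quat R.
Proof. by apply/eqP => -[] /eqP; rewrite oner_eq0. Qed.

HB.instance Definition _ := GRing.Zmodule_isNzRing.Build (quat R)
  qmulA qmul1 qmulr1 qmulDl qmulDr qone_neq0.

Definition qconj x := Quat (qr x) (- qi x) (- qj x) (- qk x).
Definition q_i : quat R := Quat 0 1 0 0.
Definition q_j : quat R := Quat 0 0 1 0.
Definition q_k : quat R := Quat 0 0 0 1.

(* The embedding of the complex numbers as span(1, i). *)
Definition quat_of_complex (z : R[i]) : quat R :=
  Quat (complex.Re z) (complex.Im z) 0 0.

Definition rscale (k : nat) (c : R) (X : 'M[quat R]_k) : 'M[quat R]_k :=
  Quat c 0 0 0 *: X.

End QuatRing.

(** * Smooth structures *)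

(* Smooth manifolds are treated as differential spaces (Sikorski): a set [dom]
   together with its family [dsm] of smooth real functions; smooth maps are the
   maps that pull smooth functions back to smooth functions.  The functions in
   [dsm] are total functions on the ambient type, of which only the values on
   [dom] matter.  The topology is the initial one for [dsm]. *)

Section Smooth.
Context {R : realType}.

Fixpoint Ck (m k : nat) (F : 'rV[R]_k -> R) : Prop :=
  if m is m'.+1 then
    continuous F /\
    forall i : 'I_k, (forall x, derivable F x (delta_mx 0 i)) /\
                     Ck m' (fun x => 'D_(delta_mx 0 i) F x)
  else continuous F.

Definition Cinfty (k : nat) (F : 'rV[R]_k -> R) : Prop := forall m, Ck m F.

(* The smallest differential structure on [D] containing [gens]: functions that
   locally are smooth functions of finitely many generators, locality being
   with respect to the initial topology of the generators. *)
Definition generated (T : Type) (D : set T) (gens : set (T -> R)) :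
    set (T -> R) :=
  [set f | forall x, D x ->
    exists (k : nat) (u : 'I_k -> T -> R) (F : 'rV[R]_k -> R) (e : R),
      [/\ forall i, gens (u i), Cinfty F, 0 < e &
          forall y, D y -> (forall i, `|u i y - u i x| < e) ->
            f y = F (\row_i u i y)]].

Record dspace := DSpace {
  dpt :> Type;
  dom : set dpt;
  dsm : set (dpt -> R) }.

Definition smooth_map (X Y : dspace) (f : X -> Y) : Prop :=
  (forall x, dom x -> dom (f x)) /\
  (forall g, dsm g -> dsm (fun x => g (f x))).

Definition diffeo (X Y : dspace) (f : X -> Y) : Prop :=
  smooth_map f /\
  exists g : Y -> X, [/\ smooth_map g, forall x, dom x -> g (f x) = x &
                         forall y, dom y -> f (g y) = y].

Definition dspace_prod (X Y : dspace) : dspace :=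
  let D := [set z : X * Y | dom z.1 /\ dom z.2] in
  @DSpace (X * Y)%type D
    (generated D ([set f | exists2 g, dsm g & f = g \o fst] `|`
                  [set f | exists2 g, dsm g & f = g \o snd])).

Definition dspace_sub (X : dspace) (U : set X) : dspace :=
  let D := [set x : X | dom x /\ U x] in
  @DSpace X D (generated D (@dsm X)).

(* Quotient by an equivalence relation; [cls x] is the class of [x], points of
   the quotient are the classes. *)
Definition dspace_quot (X : dspace) (cls : X -> set X) : dspace :=
  @DSpace (set X) [set cls x | x in dom (d := X)]
    [set f : set X -> R | dsm (d := X) (fun x => f (cls x))].

Definition dspace_open (X : dspace) (U : set X) : Prop :=
  U `<=` dom (d := X) /\
  forall x, U x ->
    exists (k : nat) (u : 'I_k -> X -> R) (e : R),
      [/\ forall i, dsm (u i), 0 < e &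
          forall y, dom y -> (forall i, `|u i y - u i x| < e) -> U y].

(* The condition [tot_complete] says that the total space is a differential
   space; being locally diffeomorphic to [U x K], it is then a smooth manifold
   as soon as [M] and [K] are.  Local triviality implies that [ract] is simply
   transitive on fibres. *)
Record principal_bundle (M K : dspace) (kmul : K -> K -> K) := PrincipalBundle {
  tot :> dspace;
  pr : tot -> M;
  ract : tot -> K -> tot;
  tot_complete : generated (dom (d := tot)) (dsm (d := tot))
                   `<=` dsm (d := tot);
  pr_smooth : smooth_map pr;
  ract_smooth :
    @smooth_map (dspace_prod tot K) tot (fun z => ract z.1 z.2);
  ractM : forall p k l, dom p -> dom k -> dom l ->
    ract (ract p k) l = ract p (kmul k l);
  loc_triv : forall x : M, dom x ->
    exists (U : set M) (psi : tot -> M * K),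
      [/\ dspace_open U, U x,
          @diffeo (dspace_sub (pr @^-1` U)) (dspace_prod (dspace_sub U) K) psi,
          forall p, dom p -> U (pr p) -> (psi p).1 = pr p &
          forall p k, dom p -> U (pr p) -> dom k ->
            psi (ract p k) = (pr p, kmul (psi p).2 k)] }.

End Smooth.

Arguments dspace R : clear implicits.

(** * Clifford algebra, spin groups, spinors *)

Section Spin.
Context {R : realType}.
Local Notation C := (R[i]).

(* Number of inversions when juxtaposing the increasing enumerations of A, B. *)
Definition inversions (N : nat) (A B : {set 'I_N}) : nat :=
  #|[set p : 'I_N * 'I_N | [&& p.1 \in A, p.2 \in B & (p.2 < p.1)%N]]%SET|.

(* The real Clifford algebra of R^N with v.v = -|v|^2, in the basis
   e_A = e_{a_1} ... e_{a_l}, A = {a_1 < ... < a_l}. *)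
Definition Cl (N : nat) : Type := {ffun {set 'I_N} -> R}.

Definition cl1 (N : nat) : Cl N := [ffun A => (A == finset.set0)%:R].

Definition clmul (N : nat) (x y : Cl N) : Cl N :=
  [ffun D => \sum_(A : {set 'I_N})
     \sum_(B : {set 'I_N} | (A :\: B :|: B :\: A)%SET == D)
       (-1) ^+ (inversions A B + #|(A :&: B)%SET|) * x A * y B].

Definition clopp (N : nat) (x : Cl N) : Cl N := [ffun A => - x A].

Definition clvec (N : nat) (v : 'rV[R]_N) : Cl N :=
  [ffun A => \sum_(i : 'I_N | A == [set i]%SET) v 0 i].

Definition Spin (N : nat) : set (Cl N) :=
  [set mu | exists vs : seq 'rV[R]_N,
     [/\ ~~ odd (size vs), forall v, v \in vs -> \sum_i v 0 i ^+ 2 = 1 &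
         mu = foldr (fun v x => clmul (clvec v) x) (cl1 N) vs]].

(* [spin_cover mu B] says that lambda_N(mu) = B, i.e. mu v mu^-1 = B v. *)
Definition spin_cover (N : nat) (mu : Cl N) (B : 'M[R]_N) : Prop :=
  forall v : 'rV[R]_N, clmul mu (clvec v) = clmul (clvec (v *m B^T)) mu.

Definition Spin_space (N : nat) : dspace R :=
  @DSpace R (Cl N) (@Spin N)
    (generated (@Spin N) [set f | exists A, f = fun x : Cl N => x A]).

(* Elements of Spin^r(N) are the classes {(mu,nu), (-mu,-nu)}. *)
Definition spinr_cls (N r : nat) (x : Cl N * Cl r) : set (Cl N * Cl r) :=
  [set x; (clopp x.1, clopp x.2)].

Definition Spinr (N r : nat) : dspace R :=
  @dspace_quot R (dspace_prod (Spin_space N) (Spin_space r))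
    (@spinr_cls N r).

Definition spinr_mul (N r : nat) (X Y : Spinr N r) : Spinr N r :=
  [set z | exists x y, [/\ X x, Y y & z = (clmul x.1 y.1, clmul x.2 y.2)]].

(* The exterior algebra of the complex span of y_0, ..., y_{k-1}, in the basis
   y_A = y_{a_1} /\ ... /\ y_{a_l}, A = {a_1 < ... < a_l}. *)
Definition ext (k : nat) : Type := {ffun {set 'I_k} -> C}.

Definition ebasis (k : nat) (A : {set 'I_k}) : ext k :=
  [ffun B => (B == A)%:R].

Definition escale (k : nat) (c : C) (x : ext k) : ext k :=
  [ffun A => c * x A].

Definition wedge (k : nat) (x y : ext k) : ext k :=
  [ffun D => \sum_(A : {set 'I_k}) \sum_(B : {set 'I_k} |
      [disjoint A & B] && ((A :|: B)%SET == D))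
        (-1) ^+ inversions A B * x A * y B].

Definition int_prod (k : nat) (q : 'I_k) (x : ext k) : ext k :=
  [ffun A : {set 'I_k} => if q \in A then 0
             else (-1) ^+ #|[set a in A | (a < q)%N]%SET| * x (q |: A)%SET].

Definition isqrt2 : C := (0 +i* Num.sqrt 2)%C.

Definition cliff_y (k : nat) (q : 'I_k) (x : ext k) : ext k :=
  escale isqrt2 (wedge (ebasis [set q]%SET) x).

Definition cliff_x (k : nat) (q : 'I_k) (x : ext k) : ext k :=
  escale isqrt2 (int_prod q x).

Definition grading (k : nat) (x : ext k) : ext k :=
  [ffun A : {set 'I_k} => (-1) ^+ #|A| * x A].

(* Clifford action of the j-th basis vector of R^N on Sigma_N, where
   y_q = (e_{2q} + i e_{2q+1}) / sqrt 2 and x_q = (e_{2q} - i e_{2q+1}) / sqrt 2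
   (indices from 0).  For odd N the last vector acts by i times the grading. *)
Definition cliff_gen (N : nat) (j : 'I_N) (x : ext N./2) : ext N./2 :=
  if (insub (j./2 : nat) : option 'I_(N./2)) is Some q then
    if odd j then escale isqrt2^-1 (cliff_y q x - cliff_x q x)
    else escale (((Num.sqrt 2)^-1)%:C)%C (cliff_y q x + cliff_x q x)
  else escale 'i%C (grading x).

Definition spin_rep (N : nat) (mu : Cl N) (x : ext N./2) : ext N./2 :=
  \sum_(A : {set 'I_N}) escale ((mu A)%:C)%C (foldr (@cliff_gen N) x (enum A)).

(* Sigma_N (x) Sigma_r^{(x) m}, in the basis of tensors of basis vectors. *)
Definition tspinor (N r m : nat) : Type :=
  {ffun {set 'I_N./2} * {ffun 'I_m -> {set 'I_r./2}} -> C}.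

Definition tensor (N r m : nat) (x : ext N./2) (z : 'I_m -> ext r./2) :
    tspinor N r m :=
  [ffun b : {set 'I_N./2} * {ffun 'I_m -> {set 'I_r./2}} =>
     x b.1 * \prod_i z i (b.2 i)].

Definition tspin_act (N r m : nat) (mu : Cl N) (nu : Cl r)
    (psi : tspinor N r m) : tspinor N r m :=
  \sum_(b : {set 'I_N./2} * {ffun 'I_m -> {set 'I_r./2}})
    [ffun c => psi b *
       tensor (spin_rep mu (ebasis b.1))
              (fun i => spin_rep nu (ebasis (b.2 i))) c].

End Spin.

Arguments Cl R N : clear implicits.
Arguments ext R k : clear implicits.
Arguments Spin R N : clear implicits.
Arguments Spinr R N r : clear implicits.
Arguments tspinor R N r m : clear implicits.

(** * The homogeneous space CP^{2n+1} = Sp(n+1) / (U(1) x Sp(n)) *)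

Section Homogeneous.
Context {R : realType}.
Local Notation C := (R[i]).
Local Notation H := (quat R).

Definition ctrans (k : nat) (A : 'M[H]_k) : 'M[H]_k :=
  (map_mx (@qconj R) A)^T.

Definition Sp (k : nat) : set 'M[H]_k := [set A | ctrans A *m A = 1%:M].

Definition qcoords (k : nat) : set ('M[H]_k -> R) :=
  [set f | exists i j : 'I_k,
     [\/ f = fun A : 'M[H]_k => qr (A i j), f = fun A : 'M[H]_k => qi (A i j),
         f = fun A : 'M[H]_k => qj (A i j) | f = fun A : 'M[H]_k => qk (A i j)]].

Definition mx_space (k : nat) (D : set 'M[H]_k) : dspace R :=
  DSpace D (generated D (@qcoords k)).

Definition Sp_space (k : nat) : dspace R := mx_space (@Sp k).

Definition Emx (k : nat) (i j : 'I_k) : 'M[H]_k :=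
  delta_mx j i - delta_mx i j.
Definition Fmx (k : nat) (i j : 'I_k) : 'M[H]_k :=
  if i == j then delta_mx i i else delta_mx i j + delta_mx j i.

Definition B0 (k : nat) (X Y : 'M[H]_k) : R := - qr (\tr (X *m Y)).

Section Fixed_n.
Variable n : nat.

Definition Ndim : nat := (4 * n)%N.+2.

Definition emb (z : C) (A : 'M[H]_n) : 'M[H]_n.+1 :=
  (block_mx ((quat_of_complex z)%:M : 'M[H]_1) 0 0 A : 'M[H]_(1 + n)).

Definition Hgrp : set 'M[H]_n.+1 :=
  [set h | exists (z : C) (A : 'M[H]_n), [/\ `|z| = 1, Sp A & h = emb z A]].

(* xi_2, xi_3, e_4, ..., e_{4n+3}, labelled by l = 2, ..., 4n+3;
   row and column indices of matrices start at 0. *)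
Definition mbasis (l : nat) : 'M[H]_n.+1 :=
  if l == 2%N then - (q_k R *: Fmx ord0 ord0)
  else if l == 3%N then q_j R *: Fmx ord0 ord0
  else let p : 'I_n.+1 := inord (l %/ 4)%N in
    match (l %% 4)%N with
    | 0 => q_j R *: Fmx ord0 p
    | 1 => q_k R *: Fmx ord0 p
    | 2 => q_i R *: Fmx ord0 p
    | _ => Emx ord0 p
    end.

Definition mspace : set 'M[H]_n.+1 :=
  [set X | exists c : 'I_Ndim -> R, X = \sum_j rscale (c j) (mbasis (j + 2)%N)].

(* Components with respect to m = V (+) H: V is the (1,1) entry. *)
Definition vert (X : 'M[H]_n.+1) : 'M[H]_n.+1 :=
  X ord0 ord0 *: delta_mx ord0 ord0.
Definition horiz (X : 'M[H]_n.+1) : 'M[H]_n.+1 := X - vert X.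

Variables a t : R.

Definition gmetric (X Y : 'M[H]_n.+1) : R :=
  a * B0 (horiz X) (horiz Y) + 2 * a * t * B0 (vert X) (vert Y).

Definition onbasis (j : 'I_Ndim) : 'M[H]_n.+1 :=
  rscale (Num.sqrt (if (j < 2)%N then 2 * t * a else 2 * a))^-1
         (mbasis (j + 2)%N).

Definition isotropy (h : 'M[H]_n.+1) : 'M[R]_Ndim :=
  \matrix_(i, j) gmetric (onbasis i) (h *m onbasis j *m ctrans h).

Definition so2 (w : C) : 'M[R]_2 :=
  \matrix_(i, j) if i == j then complex.Re w
                 else if i == 0 then - complex.Im w else complex.Im w.

(* phi is a lift of sigma x varphi_s to a Lie group homomorphism
   H -> Spin^C(4n+2). *)
Definition spinc_lift (s : int)
    (phi : 'M[H]_n.+1 -> set (Cl R Ndim * Cl R 2)) : Prop :=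
  [/\ @smooth_map R (mx_space Hgrp) (Spinr R Ndim 2) phi,
      forall h h', Hgrp h -> Hgrp h' ->
        phi (h *m h') = spinr_mul (phi h) (phi h') &
      forall z A, `|z| = 1 -> Sp A ->
        forall mu nu, phi (emb z A) (mu, nu) ->
          spin_cover mu (isotropy (emb z A)) /\ spin_cover nu (so2 (z ^ s))].

Definition inv_spinors (r m : nat)
    (phi : 'M[H]_n.+1 -> set (Cl R Ndim * Cl R r)) : set (tspinor R Ndim r m) :=
  [set psi | forall h, Hgrp h ->
     forall mu nu, phi h (mu, nu) -> tspin_act mu nu psi = psi].

(** ** Base manifold and frame bundle *)

Definition coset (g : 'M[H]_n.+1) : set 'M[H]_n.+1 := [set g *m h | h in Hgrp].

Definition CP_space : dspace R := dspace_quot (X := Sp_space n.+1) coset.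

(* Oriented orthonormal frames of (m, g_{a,t}). *)
Definition is_frame (b : 'I_Ndim -> 'M[H]_n.+1) : Prop :=
  [/\ forall j, mspace (b j),
      forall i j, gmetric (b i) (b j) = (i == j)%:R &
      0 < \det (\matrix_(i, j) gmetric (onbasis i) (b j))].

Definition frame_space : dspace R :=
  @DSpace R ('I_Ndim -> 'M[H]_n.+1) is_frame
    (generated is_frame
       [set f | exists j g, qcoords g /\ f = fun b => g (b j)]).

(* T(G/H) = G x_H m with (g, X) ~ (g h, h^-1 X h); correspondingly a frame at gH
   is a class of pairs (g, b), b a frame of m.  On H, [ctrans] is the inverse. *)
Definition frame_cls (x : 'M[H]_n.+1 * ('I_Ndim -> 'M[H]_n.+1)) :
    set ('M[H]_n.+1 * ('I_Ndim -> 'M[H]_n.+1)) :=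
  [set (x.1 *m h, (fun j => ctrans h *m x.2 j *m h)) | h in Hgrp].

Definition FM_space : dspace R :=
  dspace_quot (X := dspace_prod (Sp_space n.+1) frame_space) frame_cls.

Definition FM_proj (S : FM_space) : CP_space := [set x.1 | x in S].

Definition FM_left (g : 'M[H]_n.+1) (S : FM_space) : FM_space :=
  [set (g *m x.1, x.2) | x in S].

Definition FM_right (S : FM_space) (B : 'M[R]_Ndim) : FM_space :=
  [set (x.1, (fun j => \sum_i rscale (B i j) (x.2 i))) | x in S].

Definition CP_left (g : 'M[H]_n.+1) (S : CP_space) : CP_space :=
  [set g *m x | x in S].

(** ** Invariant spin^r structures and the invariant spinor type *)

Record inv_spinr_structure (r : nat) := InvSpinr {
  bundle :> principal_bundle CP_space (@spinr_mul R Ndim r);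
  Phi : bundle -> FM_space;
  Phi_smooth : smooth_map Phi;
  Phi_over : forall p : bundle, dom p -> FM_proj (Phi p) = pr p;
  Phi_equiv : forall (p : bundle) mu nu B, dom p ->
    Spin R Ndim mu -> Spin R r nu -> spin_cover mu B ->
    Phi (ract p (spinr_cls (mu, nu))) = FM_right (Phi p) B;
  lact : 'M[H]_n.+1 -> bundle -> bundle;
  lact_smooth : @smooth_map R (dspace_prod (Sp_space n.+1) bundle) bundle
                  (fun z => lact z.1 z.2);
  lact1 : forall p : bundle, dom p -> lact 1%:M p = p;
  lactM : forall g g' (p : bundle), Sp g -> Sp g' -> dom p ->
    lact g (lact g' p) = lact (g *m g') p;
  lact_ract : forall g (p : bundle) k, Sp g -> dom p -> dom k ->
    lact g (ract p k) = ract (lact g p) k;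
  lact_pr : forall g (p : bundle), Sp g -> dom p ->
    pr (lact g p) = CP_left g (pr p);
  lact_Phi : forall g (p : bundle), Sp g -> dom p ->
    Phi (lact g p) = FM_left g (Phi p) }.

(* A point p over the frame [1, onbasis] identifies P with
   G x_phi Spin^r(4n+2) via [g, k] |-> g p k, where h p = p phi(h). *)
Definition isotropy_lift (r : nat) (P : inv_spinr_structure r)
    (phi : 'M[H]_n.+1 -> set (Cl R Ndim * Cl R r)) : Prop :=
  exists p : P,
    [/\ dom p, Phi p = frame_cls (1%:M, onbasis) &
        forall h, Hgrp h ->
          dom (d := Spinr R Ndim r) (phi h) /\ lact h p = ract p (phi h)].

Definition admits_inv_spinor (r : nat) : Prop :=
  exists (P : inv_spinr_structure r)
         (phi : 'M[H]_n.+1 -> set (Cl R Ndim * Cl R r)) (m : nat),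
    [/\ isotropy_lift P phi, odd m &
        exists2 psi, inv_spinors (m := m) phi psi & psi <> 0].

Definition spinor_type (r : nat) : Prop :=
  [/\ (1 <= r)%N, admits_inv_spinor r &
      forall r', (1 <= r')%N -> admits_inv_spinor r' -> (r <= r')%N].

End Fixed_n.

(** ** The explicit spinors *)

Section Explicit.
Variable n : nat.

(* y_q, 1 <= q <= 2n+1. *)
Definition yform (q : nat) : ext R (Ndim n)./2 :=
  if (insub q.-1 : option 'I_((Ndim n)./2)) is Some i then ebasis [set i]%SET
  else 0.

Definition omega : ext R (Ndim n)./2 :=
  \sum_(1 <= p < n.+1) wedge (yform (2 * p)%N) (yform (2 * p + 1)%N).

Definition omega_pow (k : int) : ext R (Ndim n)./2 :=
  if k is Posz j then iter j (wedge omega) (ebasis finset.set0) else 0.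

Definition hat1 : ext R 2./2 := ebasis finset.set0.
Definition haty1 : ext R 2./2 := ebasis [set ord0]%SET.

Definition span2 (u v : ext R (Ndim n)./2) : set (ext R (Ndim n)./2) :=
  [set w | exists c d : C, w = escale c u + escale d v].

Definition tensor_with (W : set (ext R (Ndim n)./2)) (z : ext R 2./2) :
    set (tspinor R (Ndim n) 2 1) :=
  [set tensor (r := 2) (m := 1) w (fun _ => z) | w in W].

Definition direct_sum (V : zmodType) (A B S : set V) : Prop :=
  A `&` B = [set 0] /\ S = [set x | exists u v, [/\ A u, B v & x = u + v]].

End Explicit.

End Homogeneous.

(* Main.v *)
(* Let h = (z, A) in U(1) x Sp(n), identify the horizontal space with row vectors
   v in H^n, and let Omega be multiplication by omega.  The isotropy
   representation is v |-> z v A^*, with the vertical plane rotated by z^2.  Since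
   Sp(n) is generated by 1 + u (q - 1) u^* with u a unit column and q a unit
   quaternion, and q = c + s j may be taken up to conjugation, every h has exactly
   one lift mu(h) in Spin(4n+2) acting on the vacuum 1 by z^(n+1): on a generator
   of Sp(n) it is a product of two plane rotations that fixes the vacuum and
   commutes with Omega and with y_1.  Uniqueness makes mu multiplicative, and mu is
   smooth because its Clifford coefficients are traces of operators whose entries
   are polynomial in h.

   Write a spinor as x0 (x) 1 + x1 (x) y_1-hat.  It is invariant iff x0 and x1 are
   Sp(n)-invariant with prescribed U(1)-weight.  The diagonal torus of Sp(n) kills
   every y_D in which D separates some pair {2p, 2p+1}, transpositions of
   coordinates make the remaining coefficients depend on the number of pairs only,
   and so Sp(n)-invariants are spanned by omega^k and y_1 /\ omega^k; the
   U(1)-weight then selects k, by a parity condition.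

   For n odd, s = 0 gives invariant spin spinors.  For n even, h = (i, i 1) has
   mu(h)^2 = -1, so a Spin(1)-lift +-mu(h) of the isotropy fixes no nonzero spinor.
   The invariant bundle Sp(n+1) x_H Spin^r is the quotient of
   Sp(n+1) x Spin(4n+2) x Spin(r) by H and the sign; it is locally trivial because
   CP^(2n+1) and Spin^r have smooth local sections, given by explicit formulas. *)

From HB Require Import structures.
From mathcomp Require Import all_boot all_order all_algebra.
From mathcomp Require Import all_classical all_reals all_analysis.
From mathcomp Require Import complex ring lra zify fingroup perm.
Require Import Defs.

Set Implicit Arguments.
Unset Strict Implicit.
Unset Printing Implicit Defensive.
Import Order.TTheory GRing.Theory Num.Theory.
Import numFieldNormedType.Exports.
Local Open Scope classical_set_scope.
Local Open Scope ring_scope.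

(** * Smooth functions *)

Section SmoothFunctions.
Context {R : realType}.

(** Smooth maps are tested on functions that are locally a [Cinfty] function, defined on all of R^k,
    of finitely many generators. Inverse and square root are not of that kind, so a cut-off first
    makes their argument positive everywhere; a function on a quotient that is smooth only near a
    point must be multiplied by a bump function. A product with a quotient factor carries the
    structure generated by its factors, so smoothness of the two actions on the bundle does not pass
    down from upstairs by definition; the local sections supply it. Signs are handled by algebra
    instead of covering theory: the eigenvalue on the vacuum replaces path lifting. Uniqueness of
    phi_s rests on squares: two homomorphic lifts over the same rotations differ by signs, a sign
    disappears on h h, and U(1) as well as the chosen generators of Sp(n) consist of squares. For
    this reason the generators are carried as [jcx c s * jcx c s]; the same c and s are the
    half-angle data of the plane rotations that lift them. *)

Lemma is_derive_cvg (V : normedModType R) (f : V -> R) (x v : V) (d : R) :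
  is_derive x v f d <->
  (fun h : R => h^-1 * (f (h *: v + x) - f x)) @ 0^' --> d.
Proof.
split=> [[fd <-]|fd]; first exact: fd.
by split; [apply/cvg_ex; exists d|exact: cvg_lim fd].
Qed.

Lemma line_MVT (k : nat) (F : 'rV[R]_k -> R) (v z : 'rV[R]_k) (s : R) :
  (forall x, derivable F x v) ->
  exists2 c : R, `|c| <= `|s| & F (s *: v + z) - F z = s * 'D_v F (c *: v + z).
Proof.
move=> dF.
pose f (r : R) := F (r *: v + z).
have df (r : R) : is_derive r 1 f ('D_v F (r *: v + z)).
  apply/is_derive_cvg; rewrite /f.
  have := (is_derive_cvg F (r *: v + z) v _).1 (derivableP (dF _)).
  apply: cvg_trans; apply: near_eq_cvg; near=> h.
  by rewrite [h *: 1]mulr1 scalerDl addrA.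
have cf : continuous f.
  move=> r; apply/differentiable_continuous/derivable1_diffP.
  exact: (@ex_derive _ _ _ _ _ _ _ (df r)).
have [s0|s0] := leP 0 s.
  have [c /[!in_itv]/= /andP[c0 cs] e] := MVT_segment s0 (fun r _ => df r) (continuous_subspaceT cf).
  exists c; first by rewrite !ger0_norm// (le_trans c0 cs).
  by move: e; rewrite /f scale0r add0r subr0 mulrC.
have [c /[!in_itv]/= /andP[c0 cs] e] := MVT_segment (ltW s0) (fun r _ => df r) (continuous_subspaceT cf).
exists c; first by rewrite !ler0_norm ?lerN2// ltW.
move: e; rewrite /f scale0r add0r sub0r mulrN => /(congr1 -%R).
by rewrite opprB opprK mulrC.
Unshelve. all: by end_near.
Qed.

(** Pass from y to y + d one coordinate at a time and apply the mean value theorem on each segment.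
    Of the intermediate points only their closeness to y is recorded, which is all that continuity
    of the partial derivatives needs. *)
Lemma telescoping_MVT (k : nat) (F : 'rV[R]_k -> R) (y d : 'rV[R]_k) :
  (forall i x, derivable F x (delta_mx 0 i)) ->
  exists2 z : 'I_k -> 'rV[R]_k,
    (forall i j, `|z i 0 j - y 0 j| <= `|d 0 j|) &
    F (y + d) - F y = \sum_i d 0 i * 'D_(delta_mx 0 i) F (z i).
Proof.
move=> dF; pose h (m : nat) : 'rV[R]_k := \row_j (if (j < m)%N then d 0 j else 0).
have hS (i : 'I_k) : h i.+1 = d 0 i *: delta_mx 0 i + h i.
  apply/rowP => j; rewrite !mxE eqxx /= ltnS; case: (eqVneq j i) => [->|ji].
    by rewrite leqnn ltnn mulr1 addr0.
  by rewrite leq_eqVlt -[(j == i :> nat)]/(j == i) (negPf ji) mulr0 add0r.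
have hk : h k = d by apply/rowP => j; rewrite mxE ltn_ord.
have h0 : h 0%N = 0 by apply/rowP => j; rewrite !mxE.
have /choice [c /all_and2[cd ce]] : forall i : 'I_k, exists c : R, `|c| <= `|d 0 i| /\
    F (y + h i.+1) - F (y + h i) = d 0 i * 'D_(delta_mx 0 i) F (c *: delta_mx 0 i + (y + h i)).
  move=> i; have [c c1 c2] := line_MVT (y + h i) (d 0 i) (dF i).
  by exists c; split=> //; rewrite -c2 hS addrCA.
exists (fun i => c i *: delta_mx 0 i + (y + h i)).
  move=> i j; rewrite !mxE addrCA [y 0 j + _]addrC addrK.
  case: (eqVneq j i) => [->|ji]; first by rewrite ltnn eqxx mulr1 addr0.
  by rewrite mulr0 add0r; case: ifP => //; rewrite normr0.
rewrite -{1}hk -{2}[y]addr0 -h0 -(telescope_sumr (fun m => F (y + h m)))//.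
by rewrite big_mkord; apply: eq_bigr => i _; rewrite ce.
Qed.

(** Continuous partial derivatives of F suffice: the difference quotient is a sum of partials at
    intermediate points times difference quotients of the [G i], and these points tend to y. *)
Lemma chain_rule (k : nat) (V : normedModType R) (F : 'rV[R]_k -> R)
    (G : 'I_k -> V -> R) (x v : V) (dG : 'I_k -> R) :
  (forall i x, derivable F x (delta_mx 0 i)) ->
  (forall i, continuous (fun x => 'D_(delta_mx 0 i) F x)) ->
  (forall i, is_derive x v (G i) (dG i)) ->
  is_derive x v (fun y => F (\row_i G i y))
    (\sum_i 'D_(delta_mx 0 i) F (\row_i G i x) * dG i).
Proof.
move=> dF cF GdG; apply/is_derive_cvg.
set y := \row_i G i x.
pose d (h : R) : 'rV[R]_k := \row_i (G i (h *: v + x) - G i x).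
have /choice[z /all_and2[zd ze]] : forall h : R, exists z : 'I_k -> 'rV[R]_k,
   (forall i j, `|z i 0 j - y 0 j| <= `|d h 0 j|) /\
    F (y + d h) - F y = \sum_i d h 0 i * 'D_(delta_mx 0 i) F (z i).
  by move=> h; have [z] := telescoping_MVT y (d h) dF; exists z.
have -> : (fun h => h^-1 * (F (\row_i G i (h *: v + x)) - F y)) =
   (fun h => \sum_i 'D_(delta_mx 0 i) F (z h i) * (h^-1 * (G i (h *: v + x) - G i x))).
  apply/funext => h; have -> : \row_i G i (h *: v + x) = y + d h.
    by apply/rowP => j; rewrite !mxE addrC subrK.
  rewrite ze mulr_sumr; apply: eq_bigr => i _; rewrite mxE; ring.
(* The [G i] are only known to be differentiable along v; their increment tends to 0 because it is h
   times a convergent quotient. *)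
have dc i : (fun h => d h 0 i) @ 0^' --> (0 : R).
  have -> : (fun h => d h 0 i) = (fun h => G i (h *: v + x) - G i x) by apply/funext => h; rewrite mxE.
  have h0 : (fun h : R => h) @ 0^' --> (0 : R) by apply: cvg_within_filter; exact: cvg_id.
  have := cvgM h0 ((is_derive_cvg _ _ _ _).1 (GdG i)); rewrite mul0r => q.
  have {}q := q (@dnbhs_filter _ _).
  apply: (cvg_trans _ q); apply: near_eq_cvg; near=> h; rewrite /= mulVKf//.
  by near: h; exact: nbhs_dnbhs_neq.
apply: cvg_big => [|i _]; first exact: add_continuous.
apply: cvgM; last exact/is_derive_cvg.
have /cvgrPdist_lt cFy := cF i y.
apply/cvgrPdist_lt => e e0; have /nbhs_ballP[r /= r0 rP] := cFy e e0.
have : \forall h \near 0^', forall j, `|d h 0 j| < r.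
  apply: filter_forall => j.
  have /cvgrPdist_lt/(_ r r0) := dc j; apply: filterS => h; by rewrite sub0r normrN.
apply: filterS => h hr; apply: rP; split=> // a j; rewrite ord1 /ball/= distrC.
exact: le_lt_trans (zd _ _ _) (hr j).
Unshelve. all: by end_near.
Qed.

(** Turns a directional derivative into an ordinary one, so that the chain rule in one variable
    applies. *)
Lemma is_derive_line (V : normedModType R) (f : V -> R) (x v : V) (d : R) :
  is_derive x v f d <-> is_derive (0 : R) (1 : R) (fun h : R => f (h *: v + x)) d.
Proof.
split=> /is_derive_cvg fd; apply/is_derive_cvg; apply: cvg_trans fd;
  apply: near_eq_cvg; near=> h; rewrite /= addr0 [h *: 1]mulr1 scale0r add0r//.
Unshelve. all: by end_near.
Qed.

Lemma is_derive_comp1 (V : normedModType R) (phi : R -> R) (f : V -> R) (x v : V) (p d : R) :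
  is_derive (f x) 1 phi p -> is_derive x v f d ->
  is_derive x v (phi \o f) (p * d).
Proof.
move=> dphi /is_derive_line df; apply/is_derive_line.
by apply: (@is_derive1_comp R phi (fun h => f (h *: v + x))); rewrite ?scale0r ?add0r.
Qed.

(* The derivatives of [x |-> exp (- 1 / x)], extended by 0 to [x <= 0], are combinations of these. *)
Definition flat (m : nat) (x : R) : R := if 0 < x then x ^- m * expR (- x^-1) else 0.

(** From e^(1/x) >= x^-(m+1) / (m+1)!. Applied to m + 1, it bounds the difference quotient of
    [flat m] at 0 by a multiple of h, so the derivative there is 0. *)
Lemma flat_bound (m : nat) (x : R) : 0 < x -> x ^- m * expR (- x^-1) <= (m.+1)`!%:R * x.
Proof.
move=> x0; have := @expR_ge1Dxn R (x^-1) m; rewrite invr_ge0 (ltW x0) => /(_ isT) le.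
have : x^-1 ^+ m.+1 / (m.+1)`!%:R <= expR x^-1 by apply: le_trans le; rewrite lerDr.
rewrite ler_pdivrMr ?ltr0n ?fact_gt0// => {}le.
rewrite expRN ler_pdivrMr ?expR_gt0//.
have -> : x ^- m = x * x^-1 ^+ m.+1 by rewrite exprS mulVKf ?gt_eqF// exprVn.
by rewrite [_ * x]mulrC -mulrA ler_pM2l// mulrC.
Qed.

Lemma is_derive_flat (m : nat) (x : R) : is_derive x 1 (flat m) (flat m.+2 x - m%:R * flat m.+1 x).
Proof.
have [x0|x0|<-] := ltgtP 0 x.
- have nx : x != 0 by rewrite gt_eqF.
  have : is_derive x 1 (fun x => x ^- m * expR (- x^-1)) (flat m.+2 x - m%:R * flat m.+1 x).
    have d1 : is_derive x 1 (fun x : R => x^-1) (- x ^- 2).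
      by apply: is_derive_eq (is_deriveV nx (is_derive_id x 1)) _; rewrite [_ *: _]mulr1.
    have d2 : is_derive x 1 (fun x : R => expR (- x^-1)) (x ^- 2 * expR (- x^-1)).
      have dn : is_derive x 1 (fun x : R => - x^-1) (x ^- 2).
        by have := is_deriveN d1; rewrite opprK.
      by have := @is_derive_comp1 _ expR (fun x : R => - x^-1) _ _ _ _ (is_derive_expR _) dn; rewrite mulrC.
    have d3 : is_derive x 1 (fun x : R => x ^- m) (- (m%:R * x ^- m.+1)).
      have := is_deriveX m d1.
      have -> : (fun x : R => x^-1) ^+ m = (fun x => x ^- m).
        by apply/funext => y; rewrite fctE exprVn.
      congr (is_derive _ _ _ _); rewrite /GRing.scale/=.
      case: m => [|m]; first by rewrite !mul0r oppr0.
      by rewrite -[m.+1.-1]/m -!exprVn mulrN -mulrA -exprD addn2.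
    have := is_deriveM d3 d2; congr (is_derive _ _ _ _).
    rewrite /flat x0 /GRing.scale/= -!exprVn !exprS; ring.
  apply: near_eq_is_derive; near=> y; rewrite /flat.
  by rewrite ifT//; near: y; exact: lt_nbhsr.
- rewrite /flat (ltNge 0 x) (ltW x0)/= mulr0 subr0.
  apply: (@near_eq_is_derive _ _ _ (cst 0)); near=> y; rewrite /flat ifF//.
  by apply/negbTE; rewrite -leNgt ltW//; near: y; exact: lt_nbhsl.
apply/is_derive_cvg; rewrite /flat ltxx mulr0 !subr0.
apply/cvgrPdist_le => e e0; near=> h; rewrite sub0r normrN addr0 [h *: 1]mulr1.
case: ifPn => h0; last by rewrite subr0 mulr0 normr0 ltW.
rewrite subr0 mulrA -exprVn -exprS exprVn ger0_norm; last first.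
  by rewrite mulr_ge0 ?expR_ge0// invr_ge0 exprn_ge0// ltW.
apply: le_trans (flat_bound _ h0) _; rewrite mulrC -ler_pdivlMr ?ltr0n ?fact_gt0//.
rewrite -[h]gtr0_norm//; near: h; apply: (@dnbhs0_le R); rewrite divr_gt0 ?ltr0n ?fact_gt0//.
Unshelve. all: by end_near.
Qed.

Lemma CinftyP (k : nat) (F : 'rV[R]_k -> R) : Cinfty F ->
  [/\ continuous F, forall i x, derivable F x (delta_mx 0 i) &
      forall i, Cinfty (fun x => 'D_(delta_mx 0 i) F x)].
Proof.
move=> FC; split; first exact: FC 0%N.
- by move=> i x; have [_ /(_ i)[+ _]] := FC 1%N; apply.
- by move=> i m; have [_ /(_ i)[_ +]] := FC m.+1; apply.
Qed.

(* Closed under partial derivatives, hence contained in [Cinfty]. *)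
Inductive sm (k : nat) : ('rV[R]_k -> R) -> Prop :=
| sm_cst (c : R) : sm (fun _ => c)
| sm_coord i : sm (fun x => x 0 i)
| sm_add f g : sm f -> sm g -> sm (fun x => f x + g x)
| sm_mul f g : sm f -> sm g -> sm (fun x => f x * g x)
| sm_flat m f : sm f -> sm (fun x => flat m (f x))
| sm_inv f : sm f -> (forall x, 0 < f x) -> sm (fun x => (f x)^-1)
| sm_sqrt f : sm f -> (forall x, 0 < f x) -> sm (fun x => Num.sqrt (f x))
| sm_comp l (F : 'rV[R]_l -> R) g : Cinfty F -> (forall i, sm (g i)) ->
    sm (fun x => F (\row_i g i x)).

Lemma sm_sum (k : nat) (I : finType) (f : I -> 'rV[R]_k -> R) :
  (forall i, sm (f i)) -> sm (fun x => \sum_i f i x).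
Proof.
move=> fs; elim: (index_enum I) => [|i s ih].
  by under eq_fun do rewrite big_nil; exact: sm_cst.
by under eq_fun do rewrite big_cons; exact: sm_add.
Qed.

(** The derivative is found again inside [sm]; this is the closure property that the induction on
    the order in [sm_Cinfty] runs on. *)
Lemma sm_derive (k : nat) (f : 'rV[R]_k -> R) i : sm f ->
  exists2 f', sm f' & forall x, is_derive x (delta_mx 0 i) f (f' x).
Proof.
elim=> {f}.
- move=> c; exists (fun _ => 0); first exact: sm_cst.
  by move=> x; exact: is_derive_cst.
- move=> j; exists (fun _ => (j == i)%:R); first exact: sm_cst.
  move=> x; apply/is_derive_cvg; apply: (cvg_trans _ (@cvg_cst _ ((j == i)%:R : R) _ (0 : R)^' _)).
  apply: near_eq_cvg; near=> h; rewrite !mxE eqxx/= addrK mulKf//.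
  by near: h; exact: nbhs_dnbhs_neq.
- move=> f g _ [f' sf df] _ [g' sg dg]; exists (fun x => f' x + g' x); first exact: sm_add.
  by move=> x; exact: (is_deriveD (df x) (dg x)).
- move=> f g sf0 [f' sf df] sg0 [g' sg dg]; exists (fun x => f x * g' x + g x * f' x).
    by apply: sm_add; exact: sm_mul.
  by move=> x; exact: (is_deriveM (df x) (dg x)).
- move=> m f sf0 [f' sf df].
  exists (fun x => (flat m.+2 (f x) + - m%:R * flat m.+1 (f x)) * f' x).
    by apply: sm_mul => //; apply: sm_add; [|apply: sm_mul; [exact: sm_cst|]]; exact: sm_flat.
  move=> x; rewrite mulNr; apply: (is_derive_comp1 (is_derive_flat m (f x)) (df x)).
- move=> f sf0 [f' sf df] f0; exists (fun x => (-1 * ((f x)^-1 * (f x)^-1)) * f' x).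
    by apply: sm_mul => //; apply: sm_mul; [exact: sm_cst|apply: sm_mul; exact: sm_inv].
  move=> x; have fx : f x != 0 by rewrite gt_eqF.
  have dV : is_derive (f x) 1 (fun y : R => y^-1) (-1 * ((f x)^-1 * (f x)^-1)).
    have := is_deriveV fx (is_derive_id (f x) 1); congr (is_derive _ _ _ _).
    by rewrite [_ *: _]mulr1 mulN1r -expr2 exprVn.
  exact: (is_derive_comp1 dV (df x)).
- move=> f sf0 [f' sf df] f0; exists (fun x => (2 * Num.sqrt (f x))^-1 * f' x).
    apply: sm_mul => //; apply: sm_inv.
      by apply: sm_mul; [exact: sm_cst|exact: sm_sqrt].
    by move=> x; rewrite mulr_gt0// sqrtr_gt0.
  by move=> x; exact: (is_derive_comp1 (is_derive1_sqrt (f0 x)) (df x)).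
- move=> l F g /CinftyP[cF dF F'] sg gd.
  have /choice[g' g'P] : forall j, exists g', sm g' /\ forall x, is_derive x (delta_mx 0 i) (g j) (g' x).
    by move=> j; have [g' ? ?] := gd j; exists g'.
  exists (fun x => \sum_j 'D_(delta_mx 0 j) F (\row_j g j x) * g' j x).
    by apply: sm_sum => j; apply: sm_mul; [exact: (sm_comp (F' j) sg)|exact: (g'P j).1].
  move=> x; apply: chain_rule => //.
  - by move=> j; have [] := CinftyP (F' j).
  - by move=> j; exact: (g'P j).2.
Unshelve. all: by end_near.
Qed.

Lemma continuous_row (T : topologicalType) (k : nat) (g : 'I_k -> T -> R) (x : T) :
  (forall i, {for x, continuous (g i)}) ->
  {for x, continuous (fun y => \row_i g i y)}.
Proof.
move=> cg; apply/cvg_ballP => e e0.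
have : \forall y \near x, forall j, ball (g j x) e (g j y).
  by apply: filter_forall => j; have /cvg_ballP/(_ e e0) := cg j.
by apply: filterS => y h; split=> // a j; rewrite !mxE.
Qed.

Lemma sm_continuous (k : nat) (f : 'rV[R]_k -> R) : sm f -> continuous f.
Proof.
elim=> {f}.
- by move=> c; exact: cst_continuous.
- by move=> i; exact: coord_continuous.
- by move=> f g _ cf _ cg x; exact: (continuousD (cf x) (cg x)).
- by move=> f g _ cf _ cg x; exact: (continuousM (cf x) (cg x)).
- move=> m f _ cf x; apply: (@continuous_comp _ _ _ f (flat m)); first exact: cf.
  apply/differentiable_continuous/derivable1_diffP.
  exact: (@ex_derive _ _ _ _ _ _ _ (is_derive_flat m (f x))).
- by move=> f _ cf f0 x; apply: (continuousV _ (cf x)); rewrite gt_eqF.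
- move=> f _ cf f0 x; apply: (@continuous_comp _ _ _ f Num.sqrt); first exact: cf.
  exact: sqrt_continuous.
- move=> l F g /CinftyP[cF _ _] _ cg x.
  apply: (@continuous_comp _ _ _ (fun x => \row_i g i x) F); last exact: cF.
  by apply: continuous_row => i; exact: cg.
Qed.

Lemma sm_Cinfty (k : nat) (f : 'rV[R]_k -> R) : sm f -> Cinfty f.
Proof.
move=> sf m; elim: m f sf => [|m ih] f sf; first exact: sm_continuous.
split; first exact: sm_continuous.
move=> i; have [f' sf' df] := sm_derive i sf; split.
  by move=> x; exact: (@ex_derive _ _ _ _ _ _ _ (df x)).
have -> : (fun x => 'D_(delta_mx 0 i) f x) = f'.
  by apply/funext => x; exact: (@derive_val _ _ _ _ _ _ _ (df x)).
exact: ih.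
Qed.

(** The standard smooth transition from 0 to 1. The denominator is positive because x and 1 - x are
    never both nonpositive. *)
Definition bstep (x : R) : R := flat 0 x / (flat 0 x + flat 0 (1 - x)).

Lemma flat_ge0 m x : 0 <= flat m x.
Proof.
rewrite /flat; case: ifP => // x0.
by rewrite mulr_ge0 ?expR_ge0// invr_ge0 exprn_ge0// ltW.
Qed.

Lemma flat_gt0 m x : 0 < x -> 0 < flat m x.
Proof. by move=> x0; rewrite /flat x0 mulr_gt0 ?expR_gt0// invr_gt0 exprn_gt0. Qed.

Lemma bstep_den x : 0 < flat 0 x + flat 0 (1 - x).
Proof.
have [x0|x0] := ltP 0 x; first by rewrite ltr_pwDl ?flat_ge0 ?flat_gt0.
by rewrite ltr_wpDl ?flat_ge0 ?flat_gt0//; lra.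
Qed.

Lemma bstep0 x : x <= 0 -> bstep x = 0.
Proof. by move=> x0; rewrite /bstep {1}/flat ltNge x0 mul0r. Qed.

Lemma bstep1 x : 1 <= x -> bstep x = 1.
Proof.
move=> x1; rewrite /bstep; have := bstep_den x.
have -> : flat 0 (1 - x) = 0 by rewrite /flat ifF//; apply/negbTE; rewrite -leNgt; lra.
by rewrite addr0 => p; rewrite divff ?gt_eqF.
Qed.

Lemma bstep_ge0 x : 0 <= bstep x.
Proof. by rewrite divr_ge0 ?flat_ge0// ltW// bstep_den. Qed.

Lemma bstep_le1 x : bstep x <= 1.
Proof. by rewrite ler_pdivrMr ?bstep_den// mul1r lerDl flat_ge0. Qed.

Lemma sm_bstep k (f : 'rV[R]_k -> R) : sm f -> sm (fun x => bstep (f x)).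
Proof.
move=> sf; apply: sm_mul; first exact: sm_flat.
apply: sm_inv; last by move=> x; exact: bstep_den.
apply: sm_add; first exact: sm_flat.
apply: (@sm_flat _ _ (fun x => 1 - f x)); apply: sm_add; first exact: sm_cst.
have -> : (fun x => - f x) = (fun x => -1 * f x) by apply/funext => x; rewrite mulN1r.
by apply: sm_mul => //; exact: sm_cst.
Qed.

(* Positive everywhere and equal to the identity on [x >= d], so that [1 / x] and [sqrt x] can be
   composed with it without leaving [Cinfty]. *)
Definition pcut (d x : R) : R :=
  bstep (2 / d * x - 1) * x + (1 - bstep (2 / d * x - 1)) * d.

Lemma pcut_id (d x : R) : 0 < d -> d <= x -> pcut d x = x.
Proof.
move=> d0 dx; rewrite /pcut bstep1 ?mul1r ?subrr ?mul0r ?addr0//.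
rewrite lerBrDl mulrAC ler_pdivlMr//; lra.
Qed.

(** The weight vanishes for x <= d / 2, where the value is d. Wherever it is nonzero x is positive,
    and the value is a convex combination of two positive numbers. *)
Lemma pcut_gt0 (d x : R) : 0 < d -> 0 < pcut d x.
Proof.
move=> d0; have [xd|xd] := leP (2 / d * x - 1) 0.
  by rewrite /pcut bstep0// mul0r add0r subr0 mul1r.
have x0 : 0 < x.
  by move: xd; rewrite subr_gt0 mulrAC ltr_pdivlMr// mul1r => xd; lra.
have := bstep_ge0 (2 / d * x - 1); have := bstep_le1 (2 / d * x - 1).
rewrite /pcut; set b := bstep _; rewrite le_eqVlt => /orP[/eqP->|b1] b0; first lra.
have : 0 < (1 - b) * d by rewrite mulr_gt0//; lra.
have : 0 <= b * x by rewrite mulr_ge0// ltW.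
lra.
Qed.

Lemma sm_opp k (f : 'rV[R]_k -> R) : sm f -> sm (fun x => - f x).
Proof.
move=> sf; have -> : (fun x => - f x) = (fun x => -1 * f x) by apply/funext => x; rewrite mulN1r.
by apply: sm_mul => //; exact: sm_cst.
Qed.

Lemma sm_pcut k (f : 'rV[R]_k -> R) d : sm f -> sm (fun x => pcut d (f x)).
Proof.
move=> sf.
have sb : sm (fun x => bstep (2 / d * f x - 1)).
  by apply: sm_bstep; apply: sm_add; [apply: sm_mul => //|]; exact: sm_cst.
apply: sm_add; apply: sm_mul => //; last exact: sm_cst.
by apply: sm_add; [exact: sm_cst|exact: sm_opp].
Qed.
End SmoothFunctions.

(** * Differential spaces and their quotients *)

Section DifferentialSpaces.
Context {R : realType}.

Section Germ.
Variables (T : Type) (D : set T) (gens : set (T -> R)).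

(** Together with [germ] this is the pointwise content of [dspace_open] and [generated]:
    neighbourhoods in the initial topology of [gens], and functions smooth near x. Smoothness can
    then be proved one point at a time. *)
Definition nearD (x : T) (P : T -> Prop) : Prop :=
  exists (k : nat) (u : 'I_k -> T -> R) (e : R),
    [/\ forall i, gens (u i), 0 < e &
        forall y, D y -> (forall i, `|u i y - u i x| < e) -> P y].

Definition germ (x : T) (f : T -> R) : Prop :=
  exists (k : nat) (u : 'I_k -> T -> R) (F : 'rV[R]_k -> R) (e : R),
    [/\ forall i, gens (u i), Cinfty F, 0 < e &
        forall y, D y -> (forall i, `|u i y - u i x| < e) -> f y = F (\row_i u i y)].

Lemma nearD_all x (P : T -> Prop) : (forall y, D y -> P y) -> nearD x P.
Proof. by move=> h; exists 0%N, (fun _ _ => 0), 1; split=> [[]//|//|y Dy _]; exact: h. Qed.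

Lemma nearD_sub x (P Q : T -> Prop) :
  (forall y, D y -> P y -> Q y) -> nearD x P -> nearD x Q.
Proof. by move=> h [k [u [e [? ? uP]]]]; exists k, u, e; split=> // y Dy /(uP _ Dy)/h; exact. Qed.

Lemma nearD_pt x P : D x -> nearD x P -> P x.
Proof. by move=> Dx [k [u [e [_ e0 uP]]]]; apply: uP => // i; rewrite subrr normr0. Qed.

Lemma finpos_min (I : finType) (e : I -> R) : (forall i, 0 < e i) ->
  exists2 r, 0 < r & forall i, r <= e i.
Proof.
move=> e0; exists (\big[Num.min/1]_i e i).
  by elim/big_ind: _ => // x y x0 y0; rewrite lt_min x0.
by move=> i; rewrite (bigD1 i)//= ge_min lexx.
Qed.

(** A finite intersection of neighbourhoods: the generators of all members are indexed together by a
    sigma type, and the least radius is taken. *)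
Lemma nearD_family (I : finType) (P : I -> T -> Prop) x :
  (forall i, nearD x (P i)) ->
  nearD x (fun y => forall i, P i y).
Proof.
move=> h; have /choice[p H] : forall i, exists p : {k : nat & (('I_k -> T -> R) * R)%type},
    [/\ forall j, gens ((tagged p).1 j), 0 < (tagged p).2 &
       forall y, D y -> (forall j, `|(tagged p).1 j y - (tagged p).1 j x| < (tagged p).2) -> P i y].
  by move=> i; have [k [u [e ?]]] := h i; exists (existT _ k (u, e)).
pose k i := tag (p i); pose u i := (tagged (p i)).1.
have [r r0 re] : exists2 r, 0 < r & forall i, r <= (tagged (p i)).2.
  by apply: finpos_min => i; have [] := H i.
exists #|{: {i : I & 'I_(k i)}}|, (fun j => u (tag (enum_val j)) (tagged (enum_val j))), r.
split=> //; first by move=> j; have [gi _ _] := H (tag (enum_val j)); exact: gi.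
move=> y Dy hy i; have [_ _ +] := H i; apply=> // j.
by apply: lt_le_trans (re i); have := hy (enum_rank (Tagged (fun i => 'I_(k i)) j)); rewrite enum_rankK.
Qed.

Lemma nearD_and x (P Q : T -> Prop) :
  nearD x P -> nearD x Q -> nearD x (fun y => P y /\ Q y).
Proof.
move=> hP hQ; have := @nearD_family bool (fun b => if b then P else Q) x.
by move=> h; apply: nearD_sub (h _) => [y _ py|[]//]; split; [exact: (py true)|exact: (py false)].
Qed.

(** The generators that witness the agreement of f and g are put in front of those of g, and the
    smooth function ignores them. *)
Lemma germ_near x f g : nearD x (fun y => f y = g y) -> germ x g -> germ x f.
Proof.
move=> [k [u [e [gu e0 fg]]]] [l [v [F [r [gv CF r0 gF]]]]].
have [d d0 de] := @finpos_min bool (fun b => if b then e else r) (ltac:(by case)).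
exists (k + l)%N, (fun i => match fintype.split i with inl i => u i | inr i => v i end).
exists (fun X => F (\row_i X 0 (rshift k i))), d; split=> //.
- by move=> i; case: fintype.split.
- by apply: sm_Cinfty; apply: sm_comp => // i; exact: sm_coord.
- move=> y Dy hy; rewrite fg ?gF//.
  + congr F; apply/rowP => i; rewrite !mxE.
    by rewrite -[rshift k i]/(unsplit (inr i)) unsplitK.
  + move=> i; apply: lt_le_trans (de false).
    by have := hy (unsplit (inr i)); rewrite unsplitK.
  + move=> i; apply: lt_le_trans (de true).
    by have := hy (unsplit (inl i)); rewrite unsplitK.
Qed.

Lemma germ_gen x f : gens f -> germ x f.
Proof.
move=> gf; exists 1%N, (fun _ => f), (fun X => X 0 0), 1; split=> //.
  by apply: sm_Cinfty; exact: sm_coord.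
by move=> y _ _; rewrite mxE.
Qed.

(** Finitely many germs are expressed through one common tuple of generators, which is what
    composing a function of several variables with them requires. *)
Lemma germ_family l (f : 'I_l -> T -> R) x : (forall i, germ x (f i)) ->
  exists (k : nat) (u : 'I_k -> T -> R) (F : 'I_l -> 'rV[R]_k -> R) (e : R),
    [/\ forall i, gens (u i), forall i, sm (F i), 0 < e &
        forall y, D y -> (forall i, `|u i y - u i x| < e) ->
          forall i, f i y = F i (\row_j u j y)].
Proof.
move=> h; have /choice[p H] : forall i, exists p : {k : nat & (('I_k -> T -> R) * ('rV[R]_k -> R) * R)%type},
    [/\ forall j, gens ((tagged p).1.1 j), Cinfty (tagged p).1.2, 0 < (tagged p).2 &
       forall y, D y -> (forall j, `|(tagged p).1.1 j y - (tagged p).1.1 j x| < (tagged p).2) ->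
         f i y = (tagged p).1.2 (\row_j (tagged p).1.1 j y)].
  by move=> i; have [k [u [F [e ?]]]] := h i; exists (existT _ k (u, F, e)).
pose k i := tag (p i); pose u i := (tagged (p i)).1.1; pose F i := (tagged (p i)).1.2.
have [r r0 re] : exists2 r, 0 < r & forall i, r <= (tagged (p i)).2.
  by apply: finpos_min => i; have [] := H i.
exists #|{: {i : 'I_l & 'I_(k i)}}|, (fun j => u (tag (enum_val j)) (tagged (enum_val j))).
exists (fun i X => F i (\row_j X 0 (enum_rank (Tagged (fun i => 'I_(k i)) j)))), r; split=> //.
- by move=> j; have [gi _ _ _] := H (tag (enum_val j)); exact: gi.
- by move=> i; apply: sm_comp => [|j]; [have [] := H i|exact: sm_coord].
- move=> y Dy hy i; have [_ _ _ ->//] := H i.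
  + by congr (F i); apply/rowP => j; rewrite !mxE enum_rankK.
  + move=> j; apply: lt_le_trans (re i).
    by have := hy (enum_rank (Tagged (fun i => 'I_(k i)) j)); rewrite enum_rankK.
Qed.

Lemma germ_comp l (G : 'rV[R]_l -> R) (f : 'I_l -> T -> R) x : Cinfty G ->
  (forall i, germ x (f i)) -> germ x (fun y => G (\row_i f i y)).
Proof.
move=> CG /germ_family[k [u [F [e [gu sF e0 H]]]]].
exists k, u, (fun X => G (\row_i F i X)), e; split=> //.
  by apply: sm_Cinfty; exact: sm_comp.
by move=> y Dy hy; congr G; apply/rowP => i; rewrite !mxE H.
Qed.

Lemma germ_sm l (G : 'rV[R]_l -> R) (f : 'I_l -> T -> R) x : sm G ->
  (forall i, germ x (f i)) -> germ x (fun y => G (\row_i f i y)).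
Proof. by move=> sG; apply: germ_comp; exact: sm_Cinfty. Qed.

Lemma germ_sm1 (G : 'rV[R]_1 -> R) (f : T -> R) x : sm G ->
  germ x f -> germ x (fun y => G (\row_i f y)).
Proof. by move=> sG gf; apply: (@germ_sm 1%N G (fun _ => f)). Qed.

Lemma germ_cst x (c : R) : germ x (fun _ => c).
Proof. by apply: (@germ_sm 0%N (fun _ => c) (fun _ _ => 0) x (sm_cst _ c)) => -[]. Qed.

Lemma germ_bin (G : R -> R -> R) x f g : sm (fun X : 'rV[R]_2 => G (X 0 0) (X 0 1)) ->
  germ x f -> germ x g -> germ x (fun y => G (f y) (g y)).
Proof.
move=> sG gf gg; have := @germ_sm 2%N _ (fun i => if i == 0 then f else g) x sG.
move=> /(_ _); under eq_fun do rewrite !mxE /=; apply=> i.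
by case: ifP.
Qed.

Lemma germD x f g : germ x f -> germ x g -> germ x (fun y => f y + g y).
Proof. by apply: (@germ_bin +%R); apply: sm_add; exact: sm_coord. Qed.

Lemma germM x f g : germ x f -> germ x g -> germ x (fun y => f y * g y).
Proof. by apply: (@germ_bin *%R); apply: sm_mul; exact: sm_coord. Qed.

Lemma germN x f : germ x f -> germ x (fun y => - f y).
Proof.
move=> gf; have := germM (germ_cst x (-1)) gf; by under eq_fun do rewrite mulN1r.
Qed.

Lemma germB x f g : germ x f -> germ x g -> germ x (fun y => f y - g y).
Proof. by move=> gf gg; apply: germD => //; exact: germN. Qed.

Lemma germ_sum (I : Type) (r : seq I) (P : pred I) (f : I -> T -> R) x :
  (forall i, P i -> germ x (f i)) -> germ x (fun y => \sum_(i <- r | P i) f i y).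
Proof.
move=> gf; elim: r => [|i r ih].
  by under eq_fun do rewrite big_nil; exact: germ_cst.
under eq_fun do rewrite big_cons; case Pi : (P i) => //.
by apply: germD => //; exact: gf.
Qed.

Lemma germ_prod (I : Type) (r : seq I) (P : pred I) (f : I -> T -> R) x :
  (forall i, P i -> germ x (f i)) -> germ x (fun y => \prod_(i <- r | P i) f i y).
Proof.
move=> gf; elim: r => [|i r ih].
  by under eq_fun do rewrite big_nil; exact: germ_cst.
under eq_fun do rewrite big_cons; case Pi : (P i) => //.
by apply: germM => //; exact: gf.
Qed.

Lemma germX x f n : germ x f -> germ x (fun y => f y ^+ n).
Proof.
move=> gf; elim: n => [|n ih]; first exact: germ_cst.
by under eq_fun do rewrite exprS; exact: germM.
Qed.

Lemma germ_bstep x f : germ x f -> germ x (fun y => bstep (f y)).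
Proof.
move=> gf; have := germ_sm1 (sm_bstep (@sm_coord R 1 0)) gf.
by under eq_fun do rewrite mxE.
Qed.

Lemma germ_cont x f (e : R) : D x -> germ x f -> 0 < e ->
  nearD x (fun y => `|f y - f x| < e).
Proof.
move=> Dx [k [u [F [r [gu CF r0 fF]]]]] e0.
have /cvgrPdist_lt/(_ e e0)/nbhs_ballP[d /= d0 dP] := CF 0%N (\row_i u i x).
exists k, u, (Num.min r d); split=> //; first by rewrite lt_min r0.
move=> y Dy hy; rewrite !fF//; last 2 first.
- by move=> i; rewrite subrr normr0.
- by move=> i; have := hy i; rewrite lt_min => /andP[].
rewrite distrC; apply: dP; split=> // a i; rewrite !mxE /ball/= distrC.
by have := hy i; rewrite lt_min => /andP[].
Qed.

Lemma germ_gt x f (c : R) : D x -> germ x f -> c < f x -> nearD x (fun y => c < f y).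
Proof.
move=> Dx gf cf; apply: nearD_sub (germ_cont Dx gf (e := f x - c) _); last by rewrite subr_gt0.
by move=> y _; rewrite ltr_norml => /andP[]; lra.
Qed.

(** Near x the function f exceeds f(x) / 2 and so equals its cut-off [pcut (f x / 2)], which is
    positive everywhere; G can then be composed without leaving [Cinfty]. *)
Lemma germ_pos (G : R -> R) x f :
  (forall k (h : 'rV[R]_k -> R), sm h -> (forall X, 0 < h X) -> sm (fun X => G (h X))) ->
  D x -> germ x f -> 0 < f x -> germ x (fun y => G (f y)).
Proof.
move=> sG Dx gf f0.
have d0 : 0 < f x / 2 by rewrite divr_gt0.
have near : nearD x (fun y => G (f y) = G (pcut (f x / 2) (f y))).
  apply: nearD_sub (germ_gt Dx gf (c := f x / 2) _); last lra.
  by move=> y _ h; rewrite pcut_id// ltW.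
apply: germ_near near _.
have s : sm (fun X : 'rV[R]_1 => G (pcut (f x / 2) (X 0 0))).
  by apply: sG => [|X]; [exact: sm_pcut (sm_coord _)|exact: pcut_gt0].
by have := germ_sm1 s gf; under eq_fun do rewrite mxE.
Qed.

Lemma germV x f : D x -> germ x f -> 0 < f x -> germ x (fun y => (f y)^-1).
Proof. by apply: germ_pos => k h; exact: sm_inv. Qed.

Lemma germ_sqrt x f : D x -> germ x f -> 0 < f x -> germ x (fun y => Num.sqrt (f y)).
Proof. by apply: germ_pos => k h; exact: sm_sqrt. Qed.

End Germ.

Lemma nearD_pull (S T : Type) (DS : set S) (DT : set T) gS gT (f : S -> T) x P :
  DS x -> (forall g, gT g -> germ DS gS x (g \o f)) ->
  nearD DS gS x (fun y => DT (f y)) ->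
  nearD DT gT (f x) P -> nearD DS gS x (fun y => P (f y)).
Proof.
move=> Dx gf Df [k [u [e [gu e0 uP]]]].
have := nearD_family (fun i : 'I_k => germ_cont Dx (gf _ (gu i)) e0).
move=> /(nearD_and Df); apply: nearD_sub => y _ [Dfy h]; exact: uP.
Qed.

(** Smoothness of a map need only be checked on generators of the target; the continuity needed to
    pull the neighbourhood back comes from [germ_cont]. *)
Lemma germ_pull (S T : Type) (DS : set S) (DT : set T) gS gT (f : S -> T) x h :
  DS x -> (forall g, gT g -> germ DS gS x (g \o f)) ->
  nearD DS gS x (fun y => DT (f y)) ->
  germ DT gT (f x) h -> germ DS gS x (h \o f).
Proof.
move=> Dx gf Df [k [u [F [e [gu CF e0 hF]]]]].
have near : nearD DT gT (f x) (fun y => h y = F (\row_i u i y)) by exists k, u, e.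
apply: germ_near (nearD_pull Dx gf Df near) _.
apply: germ_comp CF _ => i; exact: gf (gu i).
Qed.

Lemma gens_generated T (D : set T) (gens : set (T -> R)) f : gens f -> generated D gens f.
Proof. by move=> gf x Dx; exact: germ_gen. Qed.

Definition dnear (X : dspace R) := nearD (dom (d := X)) (dsm (d := X)).
Definition dgerm (X : dspace R) := germ (dom (d := X)) (dsm (d := X)).
(** Sikorski's axioms in one inclusion: the structure is closed under localisation and under
    composition with smooth functions of several variables. *)
Definition complete (X : dspace R) :=
  generated (dom (d := X)) (dsm (d := X)) `<=` dsm (d := X).

Lemma completeP (X : dspace R) (f : X -> R) : complete X ->
  (forall x, dom x -> dgerm x f) -> dsm f.
Proof. by move=> cX gf; apply: cX. Qed.

Lemma complete_generated T (D : set T) gens : complete (DSpace D (generated D gens)).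
Proof.
move=> f gf x Dx; have gf' := gf x Dx.
apply: (@germ_pull _ _ _ _ gens (generated D gens) id) gf' => //.
  by move=> g; exact.
exact: nearD_all.
Qed.

Lemma complete_quot (X : dspace R) (cls : X -> set X) :
  complete X -> complete (dspace_quot cls).
Proof.
move=> cX f gf; change (dsm (d := X) (f \o cls)); apply: completeP => // x Dx.
have Dq : dom (d := dspace_quot cls) (cls x) by exists x.
apply: (@germ_pull _ _ _ _ _ (@dsm _ (dspace_quot cls)) cls) (gf _ Dq) => //.
  by move=> g gq; exact: germ_gen.
by apply: nearD_all => y Dy; exists y.
Qed.

Lemma complete_prod (X Y : dspace R) : complete (dspace_prod X Y).
Proof. exact: complete_generated. Qed.

Lemma complete_sub (X : dspace R) (U : set X) : complete (dspace_sub U).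
Proof. exact: complete_generated. Qed.

(* Smoothness of a map at a point. *)
Definition sat (X Y : dspace R) (f : X -> Y) (x : X) : Prop :=
  dnear x (fun y => dom (f y)) /\ forall g, dsm g -> dgerm x (g \o f).

Section Sat.
Implicit Types X Y Z : dspace R.

Lemma sat_dom X Y (f : X -> Y) x : dom x -> sat f x -> dom (f x).
Proof. by move=> Dx [h _]; exact: nearD_pt h. Qed.

Lemma sat_near X Y (f : X -> Y) x P : dom x -> sat f x ->
  dnear (f x) P -> dnear x (fun y => P (f y)).
Proof. by move=> Dx [Df gf]; exact: nearD_pull. Qed.

Lemma sat_germ X Y (f : X -> Y) x h : dom x -> sat f x ->
  dgerm (f x) h -> dgerm x (h \o f).
Proof. by move=> Dx [Df gf]; exact: germ_pull. Qed.

Lemma sat_smooth X Y (f : X -> Y) x : smooth_map f -> sat f x.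
Proof.
move=> [Df gf]; split; first by apply: nearD_all => y /Df.
by move=> g /gf; exact: germ_gen.
Qed.

Lemma smooth_sat X Y (f : X -> Y) : complete X -> (forall x, dom x -> dom (f x)) ->
  (forall x, dom x -> sat f x) -> smooth_map f.
Proof.
move=> cX Df sf; split=> // g gY; apply: completeP => // x Dx.
exact: (sf x Dx).2.
Qed.

Lemma sat_gen X T (D : set T) gens (f : X -> T) x : dom x ->
  dnear x (fun y => D (f y)) -> (forall g, gens g -> dgerm x (g \o f)) ->
  @sat X (DSpace D (generated D gens)) f x.
Proof.
move=> Dx Df gf; split=> // g gY.
by apply: germ_pull (gY _ (nearD_pt Dx Df)).
Qed.

Lemma sat_comp X Y Z (f : X -> Y) (g : Y -> Z) x : dom x ->
  sat f x -> sat g (f x) -> sat (g \o f) x.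
Proof.
move=> Dx sf [Dg gg]; split; first exact: sat_near sf Dg.
by move=> h /gg; exact: sat_germ.
Qed.

Lemma sat_local X Y (f g : X -> Y) x : dnear x (fun y => f y = g y) -> sat g x -> sat f x.
Proof.
move=> fg [Dg gg]; split; first by apply: nearD_sub (nearD_and fg Dg) => y _ [->].
move=> h /gg; apply: germ_near; by apply: nearD_sub fg => y _ /= ->.
Qed.

Lemma sat_id X x : sat (@id X) x.
Proof. by apply: sat_smooth; split. Qed.

Lemma sat_fst X Y z : @sat (dspace_prod X Y) X fst z.
Proof.
apply: sat_smooth; split=> [z' []//|g gX].
by apply: gens_generated; left; exists g.
Qed.

Lemma sat_snd X Y z : @sat (dspace_prod X Y) Y snd z.
Proof.
apply: sat_smooth; split=> [z' []//|g gX].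
by apply: gens_generated; right; exists g.
Qed.

Lemma sat_pair X Y Z (f : X -> Y) (g : X -> Z) x : dom x -> sat f x -> sat g x ->
  @sat X (dspace_prod Y Z) (fun x => (f x, g x)) x.
Proof.
move=> Dx [Df sf] [Dg sg]; apply: sat_gen => //; first exact: nearD_and.
by move=> h [[k kY ->]|[k kY ->]]; [exact: sf|exact: sg].
Qed.

Lemma sat_sub X Y (U : set Y) (f : X -> Y) x : dom x -> sat f x ->
  dnear x (fun y => U (f y)) -> @sat X (dspace_sub U) f x.
Proof.
move=> Dx [Df sf] Uf; apply: sat_gen => //; exact: nearD_and.
Qed.

Lemma sat_incl X Y (U : set X) (f : X -> Y) x : sat f x -> @sat (dspace_sub U) Y f x.
Proof.
have near P : dnear x P -> @dnear (dspace_sub U) x P.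
  move=> [k [u [e [gu e0 uP]]]]; exists k, u, e; split=> //; last by move=> y [Dy _]; exact: uP.
  by move=> i; exact: gens_generated.
move=> [/near Df sf]; split=> // g /sf [k [u [F [e [gu CF e0 h]]]]].
by exists k, u, F, e; split=> // [i|y [Dy _]]; [exact: gens_generated|exact: h].
Qed.

Lemma smooth_cls X (cls : X -> set X) : @smooth_map _ X (dspace_quot cls) cls.
Proof. by split=> // x Dx; exists x. Qed.

(* Functions on the quotient that are smooth near a point upstairs extend, after
   multiplication by a bump function, to globally smooth functions. *)
Lemma quot_germ X (cls : X -> set X) (f : set X -> R) (q : set X) : complete X ->
  @dnear (dspace_quot cls) q (fun q' => forall x, dom x -> cls x = q' -> dgerm x (f \o cls)) ->
  @dgerm (dspace_quot cls) q f.
Proof.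
move=> cX [k [u [e [gu e0 uP]]]].
(* Squares keep the distance smooth. A factor is 1 when the distance is at most e / 2 and 0 when its
   square is at least e^2 / 2. Since e^2 / 2 < e^2, at a point outside the ball the product vanishes
   on a whole neighbourhood, whatever f does there. *)
pose chi q' := \prod_(i < k) (1 - bstep (4 / e ^+ 2 * (u i q' - u i q) ^+ 2 - 1)).
have e2 : 0 < e ^+ 2 by rewrite exprn_gt0.
have gchi : @dsm _ (dspace_quot cls) (fun q' => chi q' * f q').
  change (dsm (d := X) ((fun q' => chi q' * f q') \o cls)).
  apply: completeP => // x Dx.
  have chig : dgerm x (chi \o cls).
    apply: germ_prod => i _; apply: germB; first exact: germ_cst.
    apply: germ_bstep; apply: germB; last exact: germ_cst.
    apply: germM; first exact: germ_cst.
    apply: germX; apply: germB; last exact: germ_cst.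
    by apply: germ_gen; exact: gu i.
  have [h|/existsNP[i /negP]] := pselect (forall i, `|u i (cls x) - u i q| < e).
    by apply: germM => //; apply: uP => //; exists x.
  rewrite -leNgt => h.
  have : dgerm x (fun y => (u i (cls y) - u i q) ^+ 2).
    by apply: germX; apply: germB; [apply: germ_gen; exact: gu i|exact: germ_cst].
  move=> gd; have near := germ_gt Dx gd (c := e ^+ 2 / 2).
  apply: (@germ_near _ _ _ _ _ (fun _ => 0)); last exact: germ_cst.
  apply: nearD_sub (near _) => [y Dy h2|]; last first.
    rewrite -[X in _ < X]real_normK ?num_real//; apply: (@lt_le_trans _ _ (e ^+ 2)).
      by rewrite ltr_pdivrMr// ltr_pMr// ltr1n.
    by rewrite lerXn2r ?nnegrE// ltW.
  rewrite /= /chi (bigD1 i)//= bstep1 ?subrr ?mul0r//.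
  have -> : 4 / e ^+ 2 * (u i (cls y) - u i q) ^+ 2 = 2 * ((u i (cls y) - u i q) ^+ 2 / (e ^+ 2 / 2)).
    by field; rewrite gt_eqF.
  have : 1 <= (u i (cls y) - u i q) ^+ 2 / (e ^+ 2 / 2).
    by rewrite ler_pdivlMr ?divr_gt0// mul1r ltW.
  lra.
apply: (@germ_near _ _ _ _ _ (fun q' => chi q' * f q')); last exact: germ_gen.
exists k, u, (e / 2); split=> //; first by rewrite divr_gt0.
move=> q' Dq' h; rewrite /chi big1 ?mul1r// => i _; rewrite bstep0 ?subr0//.
rewrite subr_le0 mulrAC ler_pdivrMr// mul1r.
have : `|u i q' - u i q| ^+ 2 <= (e / 2) ^+ 2 by rewrite lerXn2r ?nnegrE ?(ltW (h i))// divr_ge0// ltW.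
rewrite real_normK ?num_real// expr_div_n; lra.
Qed.

Lemma sat_quot X Y (cls : X -> set X) (f : set X -> Y) (q : set X) : complete X ->
  @dom _ (dspace_quot cls) q ->
  @dnear (dspace_quot cls) q (fun q' => forall x, dom x -> cls x = q' -> sat (f \o cls) x) ->
  @sat (dspace_quot cls) Y f q.
Proof.
move=> cX Dq h; split.
  by apply: nearD_sub h => _ [x Dx <-] /(_ x Dx erefl)[Df _]; exact: nearD_pt Df.
move=> g gY; apply: quot_germ => //.
by apply: nearD_sub h => q' _ sf x Dx xq; exact: (sf x Dx xq).2.
Qed.

(** The structure on the product of a quotient with Y is generated by the two factors and is not
    defined as a quotient of X x Y. A local section rewrites f near (q, y) as a map on X x Y
    composed with a smooth map. *)
Lemma sat_section X Y Z (cls : X -> set X) (f : set X * Y -> Z) (s : set X -> X) q y :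
  @dom _ (dspace_quot cls) q -> dom y ->
  @sat (dspace_quot cls) X s q ->
  @dnear (dspace_quot cls) q (fun q' => cls (s q') = q') ->
  @sat (dspace_prod X Y) Z (fun z => f (cls z.1, z.2)) (s q, y) ->
  @sat (dspace_prod (dspace_quot cls) Y) Z f (q, y).
Proof.
move=> Dq Dy ss sq sf.
have Dz : @dom _ (dspace_prod (dspace_quot cls) Y) (q, y) by [].
pose g : dspace_prod X Y -> Z := fun z => f (cls z.1, z.2).
pose h : dspace_prod (dspace_quot cls) Y -> dspace_prod X Y := fun z => (s z.1, z.2).
apply: (@sat_local _ _ _ (g \o h)).
  have := sat_near Dz (sat_fst (X := dspace_quot cls) (q, y)) sq.
  by apply: nearD_sub => -[q' y'] _ /= e; rewrite /g /h /= e.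
apply: (@sat_comp _ (dspace_prod X Y)) => //.
apply: sat_pair => //; last exact: sat_snd.
apply: (@sat_comp (dspace_prod (dspace_quot cls) Y) (dspace_quot cls) X fst s (q, y)) => //.
exact: sat_fst.
Qed.

End Sat.
End DifferentialSpaces.

(** * Clifford algebra and spin group *)

Section Parity.
Variable N : nat.
Implicit Types A B C D : {set 'I_N}.

(** Addition in F_2^N: up to sign, the product of the monomials e_A and e_B is the monomial of this
    set. *)
Definition sdiff A B : {set 'I_N} := (A :\: B :|: B :\: A)%SET.

Lemma in_sdiff A B x : (x \in sdiff A B) = (x \in A) (+) (x \in B).
Proof. by rewrite !inE; case: (x \in A); case: (x \in B). Qed.

Lemma sdiffA A B C : sdiff A (sdiff B C) = sdiff (sdiff A B) C.
Proof. by apply/setP => x; rewrite !in_sdiff addbA. Qed.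

Lemma sdiffC A B : sdiff A B = sdiff B A.
Proof. by apply/setP => x; rewrite !in_sdiff addbC. Qed.

Lemma sdiffK A B : sdiff A (sdiff A B) = B.
Proof. by apply/setP => x; rewrite !in_sdiff addbA addbb. Qed.

Lemma sdiff0 A : sdiff A finset.set0 = A.
Proof. by apply/setP => x; rewrite !in_sdiff inE addbF. Qed.

Lemma sdiff0l A : sdiff finset.set0 A = A.
Proof. by rewrite sdiffC sdiff0. Qed.

Lemma sdiffv A : sdiff A A = finset.set0.
Proof. by apply/setP => x; rewrite in_sdiff addbb inE. Qed.

Lemma sdiff_eq A B D : (sdiff A B == D) = (B == sdiff A D).
Proof. by apply/eqP/eqP => [<-|->]; rewrite sdiffK. Qed.

Lemma sdiff_inj A : injective (sdiff A).
Proof. by move=> B C e; rewrite -[B](sdiffK A) e sdiffK. Qed.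

(* [psg (par A B)] is the sign in [e_A e_B = +- e_(sdiff A B)]; the diagonal [a = b] accounts for
   [e_a ^ 2 = -1]. *)
Definition par A B : bool := \big[addb/false]_(a in A) \big[addb/false]_(b in B) (b <= a)%N.

Lemma odd_sum (I : finType) (P : pred I) (f : I -> nat) :
  odd (\sum_(i | P i) f i) = \big[addb/false]_(i | P i) odd (f i).
Proof. by elim/big_rec2: _ => // i x y _ <-; rewrite oddD. Qed.

(** Counting pairs with b <= a instead of b < a absorbs the cardinality of the intersection. As a
    sum over pairs, the exponent becomes bilinear over F_2. *)
Lemma par_def A B : odd (inversions A B + #|(A :&: B)%SET|) = par A B.
Proof.
have -> : (inversions A B + #|(A :&: B)%SET| = \sum_(a in A) \sum_(b in B) (b <= a))%N.
  have -> : inversions A B = (\sum_(a in A) \sum_(b in B) (b < a))%N.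
    rewrite pair_big_dep /= /inversions -sum1_card [LHS]big_mkcond [RHS]big_mkcond /=.
    by apply: eq_bigr => -[a b] _; rewrite inE /=; case: (a \in A) (b \in B) (b < a)%N => [][][].
  have -> : #|(A :&: B)%SET| = (\sum_(a in A) \sum_(b in B) (b == a))%N.
    rewrite -sum1_card big_mkcond [RHS]big_mkcond; apply: eq_bigr => a _; rewrite inE.
    case: (a \in A) => //=; rewrite big_mkcond (bigD1 a)//= eqxx big1 => [|b ba].
      by rewrite addn0.
    by rewrite (negPf ba); case: ifP.
  rewrite -big_split; apply: eq_bigr => a _ /=; rewrite -big_split; apply: eq_bigr => b _ /=.
  by rewrite -val_eqE /=; case: ltngtP.
by rewrite odd_sum; apply: eq_bigr => a _; rewrite odd_sum; apply: eq_bigr => b _; case: leqP.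
Qed.

Lemma big_addb_sdiff A B (f : 'I_N -> bool) :
  \big[addb/false]_(i in sdiff A B) f i =
  \big[addb/false]_(i in A) f i (+) \big[addb/false]_(i in B) f i.
Proof.
rewrite big_mkcond [X in X (+) _]big_mkcond [X in _ (+) X]big_mkcond -big_split.
by apply: eq_bigr => i _; rewrite in_sdiff; case: (i \in A) (i \in B) (f i) => [][][].
Qed.

Lemma par_sdiffl A B C : par (sdiff A B) C = par A C (+) par B C.
Proof. exact: big_addb_sdiff. Qed.

Lemma par_sdiffr A B C : par C (sdiff A B) = par C A (+) par C B.
Proof. by rewrite /par -big_split; apply: eq_bigr => i _; exact: big_addb_sdiff. Qed.

Lemma par0l A : par finset.set0 A = false.
Proof. by rewrite /par big_set0. Qed.

Lemma par0r A : par A finset.set0 = false.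
Proof. by rewrite /par big1// => a _; rewrite big_set0. Qed.

Lemma par1l i A : par [set i]%SET A = \big[addb/false]_(b in A) (b <= i)%N.
Proof. by rewrite /par big_set1. Qed.

Lemma par1r i A : par A [set i]%SET = \big[addb/false]_(b in A) (i <= b)%N.
Proof. by apply: eq_bigr => a _; rewrite big_set1. Qed.

Lemma par11 i j : par [set i]%SET [set j]%SET = (j <= i)%N.
Proof. by rewrite par1l big_set1. Qed.

Lemma odd_card A : odd #|A| = \big[addb/false]_(b in A) true.
Proof. by rewrite -sum1_card odd_sum. Qed.

(** Every b in A is counted once, except b = i, which is counted twice. Oddness of the right side
    means that e_i and e_A anticommute. *)
Lemma par1C i A : par [set i]%SET A (+) par A [set i]%SET = odd #|A| (+) (i \in A).
Proof.
rewrite par1l par1r odd_card -big_split.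
have -> : (i \in A) = \big[addb/false]_(b in A) (b == i).
  have [iA|niA] := boolP (i \in A).
    by rewrite (bigD1 i)//= eqxx big1// => b /andP[_ /negPf].
  by rewrite big1// => b bA; apply/negbTE; apply: contraNneq niA => <-.
rewrite -big_split; apply: eq_bigr => b _ /=.
by rewrite -val_eqE; case: (ltngtP b i).
Qed.

(** For odd |A| choose i outside A, which exists because N is even; for even |A| choose i in A. This
    is the source of both the triviality of the centre and the vanishing of traces. *)
Lemma exists_anticomm A : ~~ odd N -> A != finset.set0 ->
  exists i, par [set i]%SET A = ~~ par A [set i]%SET.
Proof.
move=> eN A0; suff [i hi] : exists i, odd #|A| (+) (i \in A).
  by exists i; have := par1C i A; rewrite hi; case: par; case: par.
have [oA|eA] := boolP (odd #|A|).
  suff [i iA] : exists i, i \notin A by exists i; rewrite (negPf iA).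
  apply/existsP; rewrite -negb_forall; apply: contra eN => /forallP h.
  by have -> : N = #|A| by rewrite -[LHS]card_ord; apply: eq_card => i; rewrite h.
by have [i iA] := set0Pn _ A0; exists i; rewrite iA.
Qed.

End Parity.

(** * Monomials in anticommuting operators of square -1 *)

Section CliffordFamily.
Variables (N : nat) (V : zmodType) (E : 'I_N -> V -> V).
Hypothesis EB : forall i, {morph E i : x y / x - y}.
Hypothesis EE : forall i x, E i (E i x) = - x.
Hypothesis EC : forall i j x, i != j -> E i (E j x) = - E j (E i x).

Let E0 i : E i 0 = 0. Proof. by have := EB i 0 0; rewrite !subrr. Qed.
Let EN i x : E i (- x) = - E i x. Proof. by rewrite -sub0r EB E0 sub0r. Qed.

Definition cop (A : {set 'I_N}) (x : V) : V := foldr E x (enum A).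

Definition sgb (b : bool) (x : V) : V := if b then - x else x.

Lemma sgbD a b x : sgb a (sgb b x) = sgb (a (+) b) x.
Proof. by case: a; case: b; rewrite //= opprK. Qed.

Let copl (s : seq 'I_N) (A : {set 'I_N}) x := foldr E x [seq i <- s | i \in A].

Let Esgb i b x : E i (sgb b x) = sgb b (E i x).
Proof. by case: b; rewrite /= ?EN. Qed.

Let ltordered : rel 'I_N := fun i j => (i < j)%N.

Let copl_ext (s : seq 'I_N) (A B : {set 'I_N}) x : {in s, A =i B} -> copl s A x = copl s B x.
Proof. by move=> AB; rewrite /copl (eq_in_filter AB). Qed.

Let copl_cons b s A x : copl (b :: s) A x = if b \in A then E b (copl s A x) else copl s A x.
Proof. by rewrite /copl /=; case: ifP. Qed.

(** Along the sorted list E_i moves past the smaller indices of A, each costing a sign. At its own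
    place it is inserted, or it meets itself and E_i^2 = -1 gives the sign that the diagonal case b
    = i of the count records. *)
Let E_copl (s : seq 'I_N) i A x : i \in s -> sorted ltordered s -> uniq s ->
  E i (copl s A x) = sgb (\big[addb/false]_(b <- s | b \in A) (b <= i)%N) (copl s (sdiff [set i]%SET A) x).
Proof.
elim: s => // b s ih; rewrite inE => ibs so /andP[nbs us].
have lt : {in s, forall c, ltordered b c}.
  by apply/allP; apply: order_path_min so => y x' z; exact: ltn_trans.
have so' : sorted ltordered s by exact: path_sorted so.
case/predU1P: ibs => [->{i ih}|is_].
  have ext : copl s (sdiff [set b]%SET A) x = copl s A x.
    apply: copl_ext => c cs; rewrite in_sdiff inE; suff /negPf -> : c != b by [].
    by apply: contraTneq cs => ->.
  rewrite big_cons; have -> : \big[addb/false]_(c <- s | c \in A) (c <= b)%N = false.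
    rewrite big_seq_cond big1// => c /andP[cs _]; apply/negbTE; rewrite -ltnNge; exact: lt.
  rewrite leqnn !copl_cons ext in_sdiff set11 /=.
  by case: (b \in A) => /=; rewrite ?EE.
have bi : (b < i)%N by exact: lt.
have nb : i != b by rewrite -val_eqE gtn_eqF.
rewrite big_cons !copl_cons in_sdiff inE eq_sym (negPf nb) /=.
case: (b \in A) => /=; last exact: ih.
rewrite EC// ih// Esgb (ltnW bi); by case: (\big[addb/false]_(_ <- s | _) _); rewrite /= ?opprK.
Qed.

Lemma E_cop i A x : E i (cop A x) = sgb (par [set i]%SET A) (cop (sdiff [set i]%SET A) x).
Proof.
have copE B : cop B x = copl (enum 'I_N) B x by rewrite /cop /copl {1}/enum_mem -enumT.
rewrite !copE E_copl ?mem_enum ?enum_uniq//; last first.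
  by have := iota_ltn_sorted 0 N; rewrite -val_enum_ord sorted_map.
by rewrite par1l big_enum_cond.
Qed.

(** Induction on |A|: split off one element i, writing A as {i} plus the rest in F_2^N. The signs
    match because [par] is additive in each argument. *)
Lemma cop_cop A B x : cop A (cop B x) = sgb (par A B) (cop (sdiff A B) x).
Proof.
have [n] := ubnP #|A|; elim: n A => // n ih A; rewrite ltnS => cA.
have [->|/set0Pn[i iA]] := eqVneq A finset.set0.
  by rewrite par0l sdiff0l /cop enum_set0.
have eA : A = sdiff [set i]%SET (A :\ i)%SET.
  by apply/setP => j; rewrite in_sdiff !inE; case: eqVneq => [->|].
have cE y : cop A y = sgb (par [set i]%SET (A :\ i)%SET) (E i (cop (A :\ i)%SET y)).
  by rewrite E_cop sgbD addbb -eA.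
rewrite cE ih; last by move: cA; rewrite (cardsD1 i A) iA.
rewrite Esgb E_cop !sgbD sdiffA -eA; congr (sgb _ _).
have -> : par A B = par [set i]%SET B (+) par (A :\ i)%SET B by rewrite -par_sdiffl -eA.
rewrite par_sdiffr.
case: (par [set i]%SET (A :\ i)%SET); case: (par (A :\ i)%SET B); by case: (par [set i]%SET B).
Qed.

End CliffordFamily.

(** * The Clifford algebra as an algebra over the reals *)

Section ClRing.
Variables (R : realType) (N : nat).
Implicit Types x y z : Cl R N.

HB.instance Definition _ := GRing.Zmodule.copy (Cl R N) {ffun {set 'I_N} -> R}.

Definition psg (K : pzRingType) (b : bool) : K := (-1) ^+ b.

Lemma psgD (K : pzRingType) a b : psg K (a (+) b) = psg K a * psg K b.
Proof. exact: signr_addb. Qed.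

Lemma psgE (K : pzRingType) m : (-1) ^+ m = psg K (odd m).
Proof. by rewrite /psg signr_odd. Qed.

Lemma clmulE x y D : clmul x y D =
  \sum_(A : {set 'I_N}) psg R (par A (sdiff A D)) * x A * y (sdiff A D).
Proof.
rewrite ffunE; apply: eq_bigr => A _.
rewrite (big_pred1 (sdiff A D)) => [|B]; last by rewrite -/(sdiff A B) sdiff_eq.
by rewrite psgE par_def.
Qed.

(** Associativity is the cocycle identity of the sign, and the bilinearity of [par] gives it. *)
Let clmulA : associative (@clmul R N).
Proof.
move=> x y z; apply/ffunP => D; rewrite !clmulE.
under eq_bigr do rewrite clmulE mulr_sumr.
under [RHS]eq_bigr do rewrite clmulE mulr_sumr mulr_suml.
rewrite [RHS]exchange_big; apply: eq_bigr => C _ /=.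
rewrite [RHS](reindex_inj (@sdiff_inj _ C)) /=; apply: eq_bigr => B _.
rewrite sdiffK -sdiffA; set X := sdiff B (sdiff C D).
have -> : sdiff C (sdiff B D) = X by rewrite /X sdiffA [sdiff C B]sdiffC -sdiffA.
have -> : sdiff C D = sdiff B X by rewrite sdiffK.
rewrite par_sdiffr par_sdiffl !psgD; ring.
Qed.

Let clmul1l : left_id (@cl1 R N) (@clmul R N).
Proof.
move=> x; apply/ffunP => D; rewrite clmulE (bigD1 finset.set0)//= big1 => [|A A0].
  by rewrite sdiff0l par0l ffunE eqxx !mul1r addr0.
by rewrite ffunE (negPf A0) mulr0 mul0r.
Qed.

Let clmul1r : right_id (@cl1 R N) (@clmul R N).
Proof.
move=> x; apply/ffunP => D; rewrite clmulE (bigD1 D)//= big1 => [|A AD].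
  by rewrite sdiffv par0r ffunE eqxx mul1r mulr1 addr0.
rewrite [X in _ * X = _]ffunE sdiff_eq sdiff0 eq_sym (negPf AD) mulr0//.
Qed.

Let clmulDl : left_distributive (@clmul R N) +%R.
Proof.
move=> x y z; apply/ffunP => D; rewrite [RHS]ffunE !clmulE -big_split.
by apply: eq_bigr => A _; rewrite ffunE mulrDr mulrDl.
Qed.

Let clmulDr : right_distributive (@clmul R N) +%R.
Proof.
move=> x y z; apply/ffunP => D; rewrite [RHS]ffunE !clmulE -big_split.
by apply: eq_bigr => A _; rewrite ffunE mulrDr.
Qed.

Let cl1_neq0 : @cl1 R N != 0.
Proof. by apply/eqP => /ffunP/(_ finset.set0)/eqP; rewrite !ffunE eqxx oner_eq0. Qed.

HB.instance Definition _ := GRing.Zmodule_isNzRing.Build (Cl R N)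
  clmulA clmul1l clmul1r clmulDl clmulDr cl1_neq0.

Definition clscale (c : R) x : Cl R N := [ffun A => c * x A].

Let clscaleA a b x : clscale a (clscale b x) = clscale (a * b) x.
Proof. by apply/ffunP => A; rewrite !ffunE mulrA. Qed.
Let clscale1 : left_id 1 clscale.
Proof. by move=> x; apply/ffunP => A; rewrite !ffunE mul1r. Qed.
Let clscaleDr : right_distributive clscale +%R.
Proof. by move=> c x y; apply/ffunP => A; rewrite !ffunE mulrDr. Qed.
Let clscaleDl x : {morph clscale^~ x : a b / a + b}.
Proof. by move=> a b; apply/ffunP => A; rewrite !ffunE mulrDl. Qed.

HB.instance Definition _ := GRing.Zmodule_isLmodule.Build R (Cl R N)
  clscaleA clscale1 clscaleDr clscaleDl.

Let clscaleAl (c : R) x y : c *: (x * y) = (c *: x) * y.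
Proof.
apply/ffunP => D; rewrite [LHS]ffunE [RHS]clmulE [(x * y) D]clmulE mulr_sumr.
by apply: eq_bigr => A _; rewrite ffunE; ring.
Qed.

HB.instance Definition _ := GRing.Lmodule_isLalgebra.Build R (Cl R N) clscaleAl.

Let clscaleAr (c : R) x y : c *: (x * y) = x * (c *: y).
Proof.
apply/ffunP => D; rewrite [LHS]ffunE [RHS]clmulE [(x * y) D]clmulE mulr_sumr.
by apply: eq_bigr => A _; rewrite ffunE; ring.
Qed.

HB.instance Definition _ := GRing.Lalgebra_isAlgebra.Build R (Cl R N) clscaleAr.

Lemma clmul_mul x y : clmul x y = x * y. Proof. by []. Qed.
Lemma clopp_opp x : clopp x = - x. Proof. by apply/ffunP => A; rewrite !ffunE. Qed.
Lemma clscaleE c x A : (c *: x) A = c * x A. Proof. by rewrite ffunE. Qed.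
Lemma claddE x y A : (x + y) A = x A + y A. Proof. by rewrite ffunE. Qed.
Lemma cloppE x A : (- x) A = - x A. Proof. by rewrite ffunE. Qed.
Lemma cl1E A : (1 : Cl R N) A = (A == finset.set0)%:R. Proof. by rewrite ffunE. Qed.

Definition clE (i : 'I_N) : Cl R N := [ffun A => (A == [set i]%SET)%:R].

Lemma clE_mul i x D : (clE i * x) D =
  psg R (par [set i]%SET (sdiff [set i]%SET D)) * x (sdiff [set i]%SET D).
Proof.
rewrite -clmul_mul clmulE (bigD1 [set i]%SET)//= big1 => [|A Ai].
  by rewrite ffunE eqxx mulr1 addr0.
by rewrite ffunE (negPf Ai) mulr0 mul0r.
Qed.

Lemma mul_clE i x D : (x * clE i) D =
  psg R (par (sdiff [set i]%SET D) [set i]%SET) * x (sdiff [set i]%SET D).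
Proof.
have e : sdiff (sdiff [set i]%SET D) D = [set i]%SET by rewrite -sdiffA sdiffv sdiff0.
rewrite -clmul_mul clmulE (bigD1 (sdiff [set i]%SET D))//= big1 => [|A Ai].
  by rewrite e ffunE eqxx mulr1 addr0.
rewrite [clE i _]ffunE; suff /negPf -> : sdiff A D != [set i]%SET by rewrite mulr0.
by apply: contraNneq Ai => <-; rewrite -sdiffA sdiffv sdiff0.
Qed.

Lemma clvecE (v : 'rV[R]_N) : clvec v = \sum_i v 0 i *: clE i.
Proof.
apply/ffunP => A; rewrite ffunE sum_ffunE big_mkcond; apply: eq_bigr => i _.
by rewrite clscaleE ffunE; case: eqP; rewrite ?mulr1 ?mulr0.
Qed.

Lemma clvec_delta i : clvec (delta_mx 0 i) = clE i.
Proof.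
rewrite clvecE (bigD1 i)//= mxE !eqxx scale1r big1 ?addr0// => j ji.
by rewrite mxE eqxx (negPf ji) scale0r.
Qed.

Lemma clvec_is_linear : linear (@clvec R N).
Proof.
move=> c u v; rewrite !clvecE scaler_sumr -big_split; apply: eq_bigr => i _.
by rewrite !mxE scalerA scalerDl.
Qed.
HB.instance Definition _ := GRing.isLinear.Build R 'rV[R]_N (Cl R N) *:%R (@clvec R N) clvec_is_linear.

Lemma clE_sqr i : clE i * clE i = -1.
Proof.
apply/ffunP => D; rewrite clE_mul ffunE sdiff_eq sdiffv cloppE cl1E.
case: eqP => [->|]; last by rewrite mulr0 oppr0.
by rewrite sdiff0 par11 leqnn mulr1 /psg expr1.
Qed.

Lemma clE_anti i j : i != j -> clE i * clE j = - (clE j * clE i).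
Proof.
move=> ij; apply/ffunP => D; rewrite cloppE !clE_mul !ffunE !sdiff_eq.
rewrite (sdiffC [set j]%SET [set i]%SET).
case: eqP => [->|]; last by rewrite !mulr0 oppr0.
rewrite sdiffK [sdiff [set i]%SET [set j]%SET]sdiffC sdiffK !par11 !mulr1.
by have := ij; rewrite -val_eqE /=; case: ltngtP; rewrite /psg ?expr0 ?expr1 ?opprK.
Qed.

Definition vdot (u v : 'rV[R]_N) : R := \sum_i u 0 i * v 0 i.

Lemma clvec_anti u v : clvec u * clvec v + clvec v * clvec u = (- (2 * vdot u v))%:A.
Proof.
rewrite !clvecE !mulr_suml.
under eq_bigr do rewrite mulr_sumr.
under [X in _ + X]eq_bigr do rewrite mulr_sumr.
rewrite [X in _ + X]exchange_big -big_split /= /vdot mulr_sumr -sumrN scaler_suml.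
apply: eq_bigr => i _; rewrite -big_split /= (bigD1 i)//= big1 => [|j ji].
  rewrite addr0; set w := - _; rewrite -!scalerAl -!scalerAr !scalerA clE_sqr -scalerDl scalerN -scaleNr.
  by congr (_ *: _); rewrite /w; ring.
rewrite -!scalerAl -!scalerAr !scalerA [v _ _ * _]mulrC -scalerDr clE_anti 1?eq_sym//.
by rewrite addNr scaler0.
Qed.

Lemma clvec_sqr v : clvec v * clvec v = (- vdot v v)%:A.
Proof.
have := clvec_anti v v; rewrite -mulr2n -[- (2 * _)]mulrN -scaler_nat => /(congr1 (GRing.scale 2^-1)).
by rewrite !scalerA mulVf ?pnatr_eq0// scale1r mulKf ?pnatr_eq0.
Qed.

End ClRing.

(** * The spin group and the rotations that it covers *)

Section SpinGroup.
Variables (R : realType) (N : nat).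
Implicit Types (x y mu nu : Cl R N) (u v : 'rV[R]_N) (B : 'M[R]_N).

(** The inner product for which the monomials e_A are orthonormal. Multiplication by a unit vector
    is isometric for it, so elements of the spin group have norm one. *)
Definition clip x y : R := \sum_A x A * y A.

Lemma clipC x y : clip x y = clip y x.
Proof. by apply: eq_bigr => A _; rewrite mulrC. Qed.

Lemma clipDl x y z : clip (x + y) z = clip x z + clip y z.
Proof. by rewrite -big_split; apply: eq_bigr => A _; rewrite claddE mulrDl. Qed.

Lemma clipZl c x z : clip (c *: x) z = c * clip x z.
Proof. by rewrite mulr_sumr; apply: eq_bigr => A _; rewrite clscaleE mulrA. Qed.

Lemma clipNl x z : clip (- x) z = - clip x z.
Proof. by rewrite -scaleN1r clipZl mulN1r. Qed.

Lemma clip_suml (I : Type) (r : seq I) (P : pred I) (f : I -> Cl R N) z :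
  clip (\sum_(i <- r | P i) f i) z = \sum_(i <- r | P i) clip (f i) z.
Proof.
elim/big_rec2: _ => [|i a b _ <-]; last by rewrite clipDl.
by rewrite /clip big1// => A _; rewrite ffunE mul0r.
Qed.

(** Multiplication by e_i permutes the orthonormal monomials up to sign and has square -1, hence it
    is skew. *)
Lemma clip_clE i x y : clip (clE R i * x) y = - clip x (clE R i * y).
Proof.
rewrite /clip [in RHS](reindex_inj (@sdiff_inj _ [set i]%SET)) /= -sumrN.
apply: eq_bigr => A _; rewrite !clE_mul sdiffK par_sdiffr par11 leqnn psgD.
by rewrite /psg expr1; ring.
Qed.

Lemma clip_clvec v x y : clip (clvec v * x) y = - clip x (clvec v * y).
Proof.
rewrite !clvecE !mulr_suml clip_suml [clip x _]clipC clip_suml -sumrN.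
apply: eq_bigr => i _; rewrite -!scalerAl !clipZl clip_clE mulrN.
by congr (- (_ * _)); exact: clipC.
Qed.

Lemma clip_unit v x : vdot v v = 1 -> clip (clvec v * x) (clvec v * x) = clip x x.
Proof.
move=> v1; by rewrite clip_clvec mulrA clvec_sqr v1 scaleN1r mulN1r clipC clipNl opprK.
Qed.

Lemma clip11 : clip 1 1 = 1.
Proof.
rewrite /clip (bigD1 finset.set0)//= cl1E eqxx mulr1 big1 ?addr0// => A A0.
by rewrite cl1E (negPf A0) mulr0.
Qed.

Definition vprod (vs : seq 'rV[R]_N) : Cl R N := foldr (fun v x => clvec v * x) 1 vs.

Definition unitv v := vdot v v = 1.

Lemma unitvE v : (\sum_i v 0 i ^+ 2 = 1) = unitv v.
Proof. by rewrite /unitv /vdot; under eq_bigr do rewrite expr2. Qed.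

Lemma SpinP mu : Spin R N mu <->
  exists vs, [/\ ~~ odd (size vs), forall v, v \in vs -> unitv v & mu = vprod vs].
Proof.
by split=> -[vs [ev uv ->]]; exists vs; split=> // v /uv; rewrite unitvE.
Qed.

Lemma vprod_cat s t : vprod (s ++ t) = vprod s * vprod t.
Proof. by elim: s => [|v s ih] /=; rewrite ?mul1r// ih mulrA. Qed.

Lemma Spin1 : Spin R N 1.
Proof. by apply/SpinP; exists [::]. Qed.

Lemma SpinM mu nu : Spin R N mu -> Spin R N nu -> Spin R N (mu * nu).
Proof.
move=> /SpinP[s [es us ->]] /SpinP[t [et ut ->]]; apply/SpinP; exists (s ++ t).
rewrite size_cat oddD (negPf es) (negPf et) vprod_cat; split=> // v.
by rewrite mem_cat => /orP[/us|/ut].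
Qed.

Lemma unitvN v : unitv v -> unitv (- v).
Proof. by rewrite /unitv => <-; apply: eq_bigr => i _; rewrite !mxE mulrNN. Qed.

Lemma vprod_unit_clip s : (forall v, v \in s -> unitv v) ->
  forall x, clip (vprod s * x) (vprod s * x) = clip x x.
Proof.
elim: s => [|v s ih] us x /=; first by rewrite mul1r.
rewrite -mulrA clip_unit; last by apply: us; rewrite mem_head.
by apply: ih => w ws; apply: us; rewrite inE ws orbT.
Qed.

Lemma Spin_clip mu x : Spin R N mu -> clip (mu * x) (mu * x) = clip x x.
Proof. by move=> /SpinP[s [_ us ->]]; exact: vprod_unit_clip. Qed.

Lemma clvec_unit_inv v : unitv v -> clvec v * clvec (- v) = 1.
Proof. by move=> u1; rewrite linearN mulrN clvec_sqr u1 scaleN1r opprK. Qed.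

Lemma Spin_inv mu : Spin R N mu ->
  exists nu, [/\ Spin R N nu, mu * nu = 1 & nu * mu = 1].
Proof.
move=> /SpinP[s [es us ->]]; exists (vprod (rev (map -%R s))).
have inv t : (forall v, v \in t -> unitv v) ->
    vprod t * vprod (rev (map -%R t)) = 1 /\ vprod (rev (map -%R t)) * vprod t = 1.
  elim: t => [|v t ih] ut; first by rewrite /= mulr1.
  have [ih1 ih2] : vprod t * vprod (rev (map -%R t)) = 1 /\ vprod (rev (map -%R t)) * vprod t = 1.
    by apply: ih => w wt; apply: ut; rewrite inE wt orbT.
  have v1 : unitv v by apply: ut; rewrite mem_head.
  rewrite /= rev_cons -cats1 vprod_cat /= mulr1; split.
    by rewrite mulrA -[clvec v * _ * _]mulrA ih1 mulr1 clvec_unit_inv.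
  have := clvec_unit_inv (unitvN v1); rewrite opprK => vv.
  by rewrite mulrA -[_ * clvec (- v) * _]mulrA vv mulr1.
split; [|exact: (inv s us).1|exact: (inv s us).2].
apply/SpinP; exists (rev (map -%R s)); rewrite size_rev size_map; split=> // v.
by rewrite mem_rev => /mapP[w /us w1 ->]; exact: unitvN.
Qed.

Lemma SpinN mu : (0 < N)%N -> Spin R N mu -> Spin R N (- mu).
Proof.
move=> N0 Smu; rewrite -mulN1r; apply: SpinM => //; apply/SpinP.
pose e : 'rV[R]_N := delta_mx 0 (Ordinal N0).
have e1 : unitv e.
  rewrite /unitv /vdot (bigD1 (Ordinal N0))//= big1 => [|i iN].
    by rewrite !mxE !eqxx mulr1 addr0.
  by rewrite !mxE (negPf iN) andbF mulr0.
exists [:: e; e]; split=> //; first by move=> v; rewrite !inE orbb => /eqP->.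
by rewrite /= mulr1 clvec_sqr e1 scaleN1r.
Qed.

(** For nonempty A some generator anticommutes with e_A; commuting with that generator forces the
    coefficient at A to equal its own opposite. *)
Lemma central_scalar x : ~~ odd N ->
  (forall i, clE R i * x = x * clE R i) -> x = (x finset.set0)%:A.
Proof.
move=> eN cx; apply/ffunP => A; rewrite clscaleE cl1E.
have [->|A0] := eqVneq A finset.set0; first by rewrite mulr1.
rewrite mulr0; have [i hi] := exists_anticomm eN A0.
have /ffunP/(_ (sdiff [set i]%SET A)) := cx i.
rewrite clE_mul mul_clE sdiffK hi /psg.
by case: par; rewrite /= ?expr0 ?expr1 ?mul1r ?mulN1r => h; apply/eqP; lra.
Qed.

(** The quotient of two elements over the same rotation commutes with all vectors, so it is a real
    scalar, and preservation of the norm makes its square 1. *)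
Lemma cover_unique mu nu B : ~~ odd N -> Spin R N mu -> Spin R N nu ->
  spin_cover mu B -> spin_cover nu B -> nu = mu \/ nu = - mu.
Proof.
move=> eN Smu Snu cm cn; have [mi [Smi mm im]] := Spin_inv Smu.
have cen : mi * nu = ((mi * nu) finset.set0)%:A.
  apply: central_scalar => // i; rewrite -clvec_delta.
  set e := delta_mx 0 i.
  have /(congr1 (fun x => mi * x * mi)) := cm e.
  rewrite !clmul_mul !mulrA im mul1r -!mulrA mm mulr1 !mulrA => h.
  by rewrite h -!mulrA; congr (_ * _); have := cn e; rewrite !clmul_mul => ->.
have e : nu = (mi * nu) finset.set0 *: mu.
  by rewrite -{1}[nu]mul1r -mm -mulrA {1}cen -scalerAr mulr1.
set c := (mi * nu) _ in e.
have : c * c = 1.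
  have := Spin_clip 1 Snu; rewrite clip11 mulr1 e clipZl clipC clipZl.
  by have := Spin_clip 1 Smu; rewrite clip11 mulr1 => ->; rewrite mulr1.
rewrite -expr2 => /eqP; rewrite sqrf_eq1 e => /orP[]/eqP ->.
  by left; rewrite scale1r.
by right; rewrite scaleN1r.
Qed.

Lemma spin_cover1 : spin_cover (1 : Cl R N) 1%:M.
Proof. by move=> v; rewrite !clmul_mul trmx1 mulmx1 mul1r mulr1. Qed.

Lemma coverM mu nu B B' : spin_cover mu B -> spin_cover nu B' ->
  spin_cover (mu * nu) (B *m B').
Proof.
move=> c c' v; have := c' v; have := c (v *m B'^T); rewrite !clmul_mul => h h'.
by rewrite -mulrA h' mulrA h trmx_mul mulmxA mulrA.
Qed.

Lemma coverN mu B : spin_cover mu B -> spin_cover (- mu) B.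
Proof. by move=> c v; have := c v; rewrite !clmul_mul mulNr mulrN => ->. Qed.

(* The entries of the rotation covered by [mu], as polynomials in the coefficients of [mu]. *)
Definition lam mu : 'M[R]_N := \matrix_(i, j) clip (clE R i * mu) (mu * clE R j).

(** Covering says mu e_j = (B e_j) mu. Pairing with e_i mu extracts the entry, because the elements
    e_k mu are again orthonormal. *)
Lemma lam_cover mu B : Spin R N mu -> spin_cover mu B -> B = lam mu.
Proof.
move=> Smu c; apply/matrixP => i j; rewrite mxE -(clvec_delta R j).
have -> : mu * clvec (delta_mx 0 j) = clvec (delta_mx 0 j *m B^T) * mu by exact: c.
rewrite [in RHS]clipC [in RHS]clvecE mulr_suml clip_suml (bigD1 i)//= big1 => [|k ki].
  rewrite -scalerAl clipZl -clvec_delta clip_unit.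
    by have := Spin_clip 1 Smu; rewrite mulr1 clip11 => ->; rewrite -rowE !mxE mulr1 addr0.
  rewrite /vdot (bigD1 i)//= big1 => [|k ki]; first by rewrite !mxE !eqxx mulr1 addr0.
  by rewrite !mxE (negPf ki) andbF mulr0.
rewrite -scalerAl clipZl; suff : clip (clE R k * mu) (clE R i * mu) = 0 by move=> ->; rewrite mulr0.
have := clip_clE k mu (clE R i * mu); have := clip_clE i mu (clE R k * mu).
rewrite [clip (clE R i * mu) _]clipC => e1 e2.
have : clip mu (clE R i * (clE R k * mu)) = - clip mu (clE R k * (clE R i * mu)).
  by rewrite !mulrA clE_anti 1?eq_sym// mulNr clipC -scaleN1r clipZl mulN1r clipC.
by lra.
Qed.

(** Conjugation by the unit vector v in the Clifford algebra: v is fixed and its orthogonal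
    complement is negated. *)
Definition rho v : 'M[R]_N := 2 *: (v^T *m v) - 1%:M.

Lemma vdot_mx u v : u *m v^T = (vdot u v)%:M.
Proof.
apply/matrixP => i j; rewrite !mxE !ord1 eqxx mulr1n; apply: eq_bigr => k _.
by rewrite !mxE.
Qed.

Lemma rhoE u v : u *m (rho v)^T = (2 * vdot u v) *: v - u.
Proof.
rewrite /rho linearB /= linearZ /= trmx_mul trmxK trmx1 mulmxBr mulmx1.
by rewrite -scalemxAr mulmxA vdot_mx mul_scalar_mx scalerA.
Qed.

Lemma cover_rho v : unitv v -> spin_cover (clvec v) (rho v).
Proof.
move=> v1 u; rewrite !clmul_mul rhoE linearB linearZ /= mulrBl -scalerAl clvec_sqr v1.
have -> : vdot u v = vdot v u by apply: eq_bigr => i _; rewrite mulrC.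
have /(canRL (addrK _)) -> := clvec_anti v u.
by rewrite scalerA mulrN1.
Qed.

(** Sylvester's identity: factoring one block matrix in two ways gives det(1 - 2 v^T v) = 1 - 2 v
    v^T = -1, and the overall factor -1 contributes (-1)^N. *)
Lemma det_rho v : unitv v -> \det (rho v) = - (-1) ^+ N.
Proof.
move=> v1.
pose M : 'M[R]_(1 + N) := block_mx 1%:M v (2 *: v^T) 1%:M.
have e1 : M = block_mx 1%:M 0 (2 *: v^T) 1%:M *m block_mx 1%:M v 0 (1%:M - 2 *: (v^T *m v)).
  rewrite mulmx_block ?mul1mx ?mulmx1 ?mul0mx ?mulmx0 ?mul1mx ?addr0.
  by rewrite -scalemxAl addrC subrK.
have e2 : M = block_mx 1%:M v 0 1%:M *m block_mx (1%:M - 2 *: (v *m v^T)) 0 (2 *: v^T) 1%:M.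
  rewrite mulmx_block ?mul1mx ?mulmx1 ?mul0mx ?mulmx0 ?mul1mx ?addr0 ?add0r.
  by rewrite -scalemxAr subrK.
have : \det M = \det (1%:M - 2 *: (v^T *m v)).
  by rewrite e1 det_mulmx det_lblock det_ublock !det1 !mul1r.
rewrite {}e2 det_mulmx det_lblock det_ublock !det1 !mul1r mulr1 vdot_mx v1.
rewrite det_mx11 !mxE eqxx mulr1n => e.
have -> : rho v = -1 *: (1%:M - 2 *: (v^T *m v)) by rewrite scaleN1r opprB.
by rewrite detZ -e mulrBr !mulr1; ring.
Qed.

Lemma vprod_cover s : (forall v, v \in s -> unitv v) ->
  exists B, spin_cover (vprod s) B /\ \det B = (- (-1) ^+ N) ^+ size s.
Proof.
elim: s => [_|v s ih us].
  by exists 1%:M; split; [exact: spin_cover1|rewrite det1].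
have [|B [cB dB]] := ih; first by move=> w ws; apply: us; rewrite inE ws orbT.
have v1 : unitv v by apply: us; rewrite mem_head.
exists (rho v *m B); split; first by apply: coverM cB; exact: cover_rho.
by rewrite det_mulmx det_rho// dB -exprS.
Qed.

Lemma Spin_cover mu : Spin R N mu -> spin_cover mu (lam mu) /\ \det (lam mu) = 1.
Proof.
move=> Smu; have /SpinP[s [es us e]] := Smu.
have [B [cB dB]] := vprod_cover us; rewrite -e in cB.
rewrite -(lam_cover Smu cB); split=> //.
rewrite dB -[size s]odd_double_half (negPf es) add0n -mul2n exprM sqrrN.
by rewrite sqrr_sign expr1n.
Qed.

Lemma lamM mu nu : Spin R N mu -> Spin R N nu -> lam (mu * nu) = lam mu *m lam nu.
Proof.
move=> Sm Sn; rewrite [RHS](@lam_cover (mu * nu))//; first exact: SpinM.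
by apply: coverM; [exact: (Spin_cover Sm).1|exact: (Spin_cover Sn).1].
Qed.

Lemma lam1 : lam 1 = 1%:M.
Proof. by rewrite -(lam_cover Spin1 spin_cover1). Qed.

Lemma lam_opp mu : (0 < N)%N -> Spin R N mu -> lam (- mu) = lam mu.
Proof.
move=> N0 Sm; rewrite -(@lam_cover (- mu) (lam mu))//; first exact: SpinN.
by apply: coverN; exact: (Spin_cover Sm).1.
Qed.

(* The covering identity at [v], multiplied by itself, compares the norms of [v] and [v *m B^T]. *)
Lemma cover_vdot mu B u v : Spin R N mu -> spin_cover mu B ->
  vdot (u *m B^T) (v *m B^T) = vdot u v.
Proof.
move=> Sm c; have [mi [_ mm im]] := Spin_inv Sm.
have conj w : clvec (w *m B^T) = mu * clvec w * mi.
  by have := c w; rewrite !clmul_mul => ->; rewrite -mulrA mm mulr1.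
have := clvec_anti (u *m B^T) (v *m B^T).
have mul w w' : clvec (w *m B^T) * clvec (w' *m B^T) = mu * (clvec w * clvec w') * mi.
  by rewrite !conj -!mulrA [mi * (mu * _)]mulrA im mul1r.
rewrite !mul -mulrDl -mulrDr clvec_anti -scalerAr mulr1 -scalerAl mm.
move=> /ffunP/(_ finset.set0); rewrite !clscaleE cl1E eqxx !mulr1; lra.
Qed.

Lemma lam_orth mu : Spin R N mu -> (lam mu)^T *m lam mu = 1%:M.
Proof.
move=> Sm; have [c _] := Spin_cover Sm.
apply/matrixP => i j; have := cover_vdot (delta_mx 0 i) (delta_mx 0 j) Sm c.
have -> : vdot (delta_mx 0 i *m (lam mu)^T) (delta_mx 0 j *m (lam mu)^T) = ((lam mu)^T *m lam mu) i j.
  rewrite /vdot mxE; apply: eq_bigr => k _; rewrite -!rowE !mxE//.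
move=> ->; rewrite /vdot (bigD1 i)//= big1 => [|k ki]; last by rewrite !mxE (negPf ki) andbF mul0r.
by rewrite !mxE !eqxx mul1r addr0.
Qed.

End SpinGroup.

(** The only unit vectors are e and -e, with e e = -1, so products alternate between +-1 and +-e
    according to the parity of their length. *)
Lemma Spin_1P (R : realType) (mu : Cl R 1) : Spin R 1 mu -> mu = 1 \/ mu = -1.
Proof.
move=> /SpinP[s [es us ->]].
have sq : forall s : seq 'rV[R]_1, (forall v, v \in s -> unitv v) ->
   if odd (size s) then vprod s = clE R 0 \/ vprod s = - clE R 0 else vprod s = 1 \/ vprod s = -1.
  elim=> [_|v s' ih us']; first by left.
  have := ih (fun w ws => us' w (mem_behead (s := v :: s') ws)).
  have v1 : unitv v by apply: us'; rewrite mem_head.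
  have : v 0 0 = 1 \/ v 0 0 = -1.
    move: v1; rewrite /unitv /vdot big_ord1 -expr2 => /eqP.
    by rewrite sqrf_eq1 => /orP[]/eqP; [left|right].
  rewrite /= clvecE big_ord1; case: (odd _) => /= -[]-> []->;
    rewrite ?scale1r ?scaleN1r ?mulNr ?mulrN ?mulr1 ?opprK ?clE_sqr ?opprK; by [left|right].
by have := sq s us; rewrite (negPf es).
Qed.

(** * The spin representation *)

Section Fock.
Variable R : realType.
Local Notation C := (R[i]).

Section ExtModule.
Variable k : nat.
Implicit Types (x y : ext R k) (p q : 'I_k) (A B D : {set 'I_k}).

HB.instance Definition _ := GRing.Zmodule.copy (ext R k) {ffun {set 'I_k} -> C}.

Let escaleA a b x : escale a (escale b x) = escale (a * b) x.
Proof. by apply/ffunP => A; rewrite !ffunE mulrA. Qed.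
Let escale1 : left_id 1 (@escale R k).
Proof. by move=> x; apply/ffunP => A; rewrite !ffunE mul1r. Qed.
Let escaleDr : right_distributive (@escale R k) +%R.
Proof. by move=> c x y; apply/ffunP => A; rewrite !ffunE mulrDr. Qed.
Let escaleDl x : {morph (@escale R k)^~ x : a b / a + b}.
Proof. by move=> a b; apply/ffunP => A; rewrite !ffunE mulrDl. Qed.

HB.instance Definition _ := GRing.Zmodule_isLmodule.Build C (ext R k)
  escaleA escale1 escaleDr escaleDl.

Lemma escaleE c x : escale c x = c *: x. Proof. by []. Qed.
Lemma extZE c x A : (c *: x) A = c * x A. Proof. by rewrite ffunE. Qed.
Lemma extDE x y A : (x + y) A = x A + y A. Proof. by rewrite ffunE. Qed.
Lemma extNE x A : (- x) A = - x A. Proof. by rewrite ffunE. Qed.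
Lemma ext0E A : (0 : ext R k) A = 0. Proof. by rewrite ffunE. Qed.
Lemma ext_sumE (I : Type) (r : seq I) (P : pred I) (f : I -> ext R k) A :
  (\sum_(i <- r | P i) f i) A = \sum_(i <- r | P i) f i A.
Proof. by elim/big_rec2: _ => [|i a b _ <-]; rewrite ffunE. Qed.
Lemma ebasisE (A B : {set 'I_k}) : ebasis A B = (B == A)%:R :> C.
Proof. by rewrite ffunE. Qed.

Lemma ext_basis x : x = \sum_A x A *: ebasis A.
Proof.
apply/ffunP => B; rewrite ext_sumE (bigD1 B)//= extZE ebasisE eqxx mulr1.
by rewrite big1 ?addr0// => A AB; rewrite extZE ebasisE eq_sym (negPf AB) mulr0.
Qed.

(** Parity of the number of factors of y_D that y_q has to pass to reach its place. *)
Definition ltp (q : 'I_k) (D : {set 'I_k}) : bool := \big[addb/false]_(b in D) (b < q)%N.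

Lemma ltp_sdiff q p D : ltp q (sdiff [set p]%SET D) = ltp q D (+) (p < q)%N.
Proof. by rewrite /ltp big_addb_sdiff big_set1 addbC. Qed.

Lemma odd_ltp (q : 'I_k) (D : {set 'I_k}) : odd #|[set a in D | (a < q)%N]%SET| = ltp q D.
Proof.
rewrite -sum1_card odd_sum /ltp [LHS]big_mkcond [RHS]big_mkcond; apply: eq_bigr => b _.
by rewrite inE; case: (b \in D); case: (b < q)%N.
Qed.

Lemma wedge_ebasis A x D :
  wedge (ebasis A) x D = if A \subset D then (-1) ^+ inversions A (D :\: A)%SET * x (D :\: A)%SET else 0.
Proof.
rewrite ffunE (bigD1 A)//= [X in _ + X]big1 ?addr0; last first.
  by move=> B BA; apply: big1 => E' _; rewrite ebasisE (negPf BA) mulr0 mul0r.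
case: ifPn => [AD|nAD].
  rewrite (big_pred1 (D :\: A)%SET) => [|B]; first by rewrite ebasisE eqxx mulr1.
  rewrite -finset.setI_eq0; apply/andP/eqP => [[/eqP/setP dAB /eqP/setP AB]|->].
    apply/setP => i; have := dAB i; have := AB i; rewrite !inE => <-.
    by case: (i \in A); case: (i \in B).
  split; apply/eqP/setP => i; have := fintype.subsetP AD i; rewrite !inE;
    by case: (i \in A) => [|_]; case: (i \in D) => //= /(_ isT).
apply: big1 => B /andP[_ /eqP AB]; case/negP: nAD; rewrite -AB; exact: finset.subsetUl.
Qed.

Lemma inversions1 q B : q \notin B -> odd (inversions [set q]%SET B) = ltp q B.
Proof.
move=> qB; rewrite -(odd_ltp q B); congr (odd _).
have inj : injective (fun b : 'I_k => (q, b)) by move=> b c [].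
rewrite /inversions -(card_imset _ inj); apply: eq_card => -[a b]; rewrite inE /=.
apply/and3P/imsetP => [[/set1P-> bB bq]|[c + [-> ->]]].
  by exists b => //; rewrite inE bB.
by rewrite !inE => /andP[? ?]; rewrite eqxx.
Qed.

(** Creation and annihilation operators, the closed forms of wedging with y_q and contracting with
    x_q ([wedge1E], [int_prodE]). Both carry the same sign and differ only in the support. *)
Definition crea q x : ext R k :=
  [ffun D : {set 'I_k} => if q \in D then psg C (ltp q D) * x (sdiff [set q]%SET D) else 0].
Definition anni q x : ext R k :=
  [ffun D : {set 'I_k} => if q \in D then 0 else psg C (ltp q D) * x (sdiff [set q]%SET D)].

Lemma wedge1E q x : wedge (ebasis [set q]%SET) x = crea q x.
Proof.
apply/ffunP => D; rewrite wedge_ebasis ffunE finset.sub1set; case: ifP => // qD.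
have -> : sdiff [set q]%SET D = (D :\: [set q])%SET.
  by apply/setP => i; rewrite in_sdiff !inE; case: eqVneq => [->|]; rewrite ?qD.
rewrite psgE inversions1 ?inE ?eqxx//; congr (psg _ _ * _).
have -> : (D :\: [set q])%SET = sdiff [set q]%SET D.
  by apply/setP => i; rewrite in_sdiff !inE; case: eqVneq => [->|]; rewrite ?qD.
by rewrite ltp_sdiff ltnn addbF.
Qed.

Lemma int_prodE q x : int_prod q x = anni q x.
Proof.
apply/ffunP => D; rewrite !ffunE; case: ifPn => // qD.
rewrite psgE odd_ltp; congr (_ * x _).
by apply/setP => i; rewrite in_sdiff !inE; case: eqVneq => [->|]; rewrite ?(negPf qD).
Qed.

(** The canonical anticommutation relations. For p <> q the two orders differ in whether p < q or q
    < p enters the sign, and exactly one of these holds. *)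
Lemma crea_anni_anti p q x : crea p (anni q x) + anni q (crea p x) = (p == q)%:R *: x.
Proof.
apply/ffunP => D; rewrite extDE extZE !ffunE !in_sdiff !inE [q == p]eq_sym.
case: (eqVneq p q) => [->|pq] /=.
  by case: (q \in D); rewrite /= ?mul1r ?addr0 ?add0r ltp_sdiff ltnn addbF sdiffK mulrA -psgD addbb mul1r.
rewrite mul0r; case: (p \in D); case: (q \in D) => //=; rewrite ?addr0 ?mulr0 ?addr0//.
rewrite !ltp_sdiff !sdiffA [sdiff [set q]%SET _]sdiffC !mulrA -!psgD -mulrDl.
have : p != q :> nat by [].
case: (ltp p D); case: (ltp q D); case: ltngtP; rewrite /psg ?expr0 ?expr1 ?addNr ?subrr ?mul0r//.
Qed.

Lemma crea_anti p q x : crea p (crea q x) = - crea q (crea p x).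
Proof.
apply/ffunP => D; rewrite extNE !ffunE !in_sdiff !inE [q == p]eq_sym.
case: (eqVneq p q) => [->|pq] /=; first by case: (q \in D); rewrite ?mulr0 oppr0.
case: (p \in D); case: (q \in D) => //=; rewrite ?mulr0 ?oppr0//.
rewrite !ltp_sdiff !sdiffA [sdiff [set q]%SET _]sdiffC !mulrA -!psgD -mulNr; congr (_ * _).
have : p != q :> nat by [].
case: (ltp p D); case: (ltp q D); case: ltngtP; rewrite /psg ?expr0 ?expr1 ?opprK//.
Qed.

Lemma crea_linear q : linear (crea q).
Proof.
move=> c x y; apply/ffunP => D; rewrite extDE extZE !ffunE.
by case: ifP => _; rewrite ?mulr0 ?addr0// mulrDr; congr (_ + _); ring.
Qed.
HB.instance Definition _ q := GRing.isLinear.Build C (ext R k) (ext R k) *:%R (crea q) (crea_linear q).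

Lemma anni_linear q : linear (anni q).
Proof.
move=> c x y; apply/ffunP => D; rewrite extDE extZE !ffunE.
by case: ifP => _; rewrite ?mulr0 ?addr0// mulrDr; congr (_ + _); ring.
Qed.
HB.instance Definition _ q := GRing.isLinear.Build C (ext R k) (ext R k) *:%R (anni q) (anni_linear q).

Lemma anni_vac q : anni q (ebasis finset.set0) = 0.
Proof.
apply/ffunP => D; rewrite ext0E !ffunE; case: ifPn => // qD.
have -> : (sdiff [set q]%SET D == finset.set0) = false; last by rewrite mulr0.
by apply/negbTE/set0Pn; exists q; rewrite in_sdiff inE eqxx (negPf qD).
Qed.

Lemma crea_ebasis q A : q \notin A ->
  crea q (ebasis A) = psg C (ltp q A) *: ebasis (q |: A)%SET.
Proof.
move=> qA; apply/ffunP => D; rewrite extZE !ffunE.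
have -> : (D == (q |: A)%SET) = (q \in D) && (sdiff [set q]%SET D == A).
  apply/eqP/andP => [->|[qD /eqP <-]].
    rewrite finset.setU11; split=> //; apply/eqP/setP => i; rewrite in_sdiff !inE.
    by case: eqVneq => [->|//]; rewrite (negPf qA).
  by apply/setP => i; rewrite !inE; case: eqVneq => [->|]; rewrite ?qD//; case: (i \in D).
case: (q \in D) => /=; last by rewrite mulr0.
case: eqP => [<-|]; last by rewrite !mulr0.
by rewrite ltp_sdiff ltnn addbF.
Qed.

End ExtModule.

Lemma sqrt2_gt0 : 0 < Num.sqrt 2 :> R. Proof. by rewrite sqrtr_gt0. Qed.

Lemma isqrt2_neq0 : isqrt2 != 0 :> C.
Proof. by rewrite eq_complex /= eqxx /= gt_eqF// sqrt2_gt0. Qed.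

Lemma isqrt2E : isqrt2 = (Num.sqrt 2)%:C%C * 'i%C :> C.
Proof. by rewrite /isqrt2; apply/eqP; rewrite eq_complex /= !mulr0 !mul0r mulr1 subr0 addr0 !eqxx. Qed.

Lemma sqrt2_isqrt2 : ((Num.sqrt 2)^-1)%:C%C * isqrt2 = 'i%C :> C.
Proof. by rewrite isqrt2E mulrA -rmorphM /= mulVf ?gt_eqF ?sqrt2_gt0// mul1r. Qed.

Lemma sqr_iC : 'i%C * 'i%C = -1 :> C. Proof. by rewrite -expr2 sqr_i. Qed.

(** * The Clifford action on the exterior algebra and its trace form *)

Section SpinRep.
Variable N : nat.
Hypothesis eN : ~~ odd N.
Implicit Types (x y : ext R N./2) (j l : 'I_N) (mu nu : Cl R N).

Lemma half_lt (j : 'I_N) : (j./2 < N./2)%N.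
Proof. by rewrite ltn_half_double even_halfK. Qed.

Definition qof j : 'I_(N./2) := Ordinal (half_lt j).

(** Both kinds of generator move the coefficient at D + {q} to D with a scalar, so the Clifford
    relations reduce to comparisons of scalars. *)
Lemma cliff_genE j x D : cliff_gen j x D =
  (if odd j then psg C (qof j \notin D) else 'i%C) * psg C (ltp (qof j) D) *
    x (sdiff [set qof j]%SET D).
Proof.
rewrite /cliff_gen; case: insubP => [q _ qj|]; last by rewrite half_lt.
have {qj}-> : q = qof j by apply/val_inj.
rewrite /cliff_y /cliff_x wedge1E int_prodE !escaleE; case: ifP => _.
  rewrite -scalerBr scalerA mulVf ?isqrt2_neq0// scale1r extDE extNE !ffunE.
  by case: (_ \in D); rewrite /= /psg ?expr0 ?expr1 ?subr0 ?sub0r ?mul1r ?mulN1r ?mulNr.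
rewrite -scalerDr scalerA sqrt2_isqrt2 extZE extDE !ffunE -mulrA; congr (_ * _).
by case: (_ \in D); rewrite ?addr0 ?add0r.
Qed.

Lemma cliff_gen_linear j : linear (@cliff_gen R N j).
Proof.
move=> c x y; apply/ffunP => D; rewrite extDE extZE !cliff_genE extDE extZE; ring.
Qed.
HB.instance Definition _ j := GRing.isLinear.Build C (ext R N./2) (ext R N./2) *:%R
  (@cliff_gen R N j) (cliff_gen_linear j).

Lemma cliff_gen_sqr j x : cliff_gen j (cliff_gen j x) = - x.
Proof.
apply/ffunP => D; rewrite extNE !cliff_genE sdiffK ltp_sdiff ltnn addbF in_sdiff set11.
rewrite mulrA [_ * (_ * psg _ _)]mulrACA -psgD addbb mulr1.
case: ifP => _; last by rewrite sqr_iC mulN1r.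
by rewrite -psgD; case: (_ \in D); rewrite /psg expr1 mulN1r.
Qed.

Lemma cliff_gen_anti j l x : j != l -> cliff_gen j (cliff_gen l x) = - cliff_gen l (cliff_gen j x).
Proof.
move=> jl; apply/ffunP => D; rewrite extNE !cliff_genE !ltp_sdiff !in_sdiff !inE !sdiffA.
rewrite [sdiff [set qof l]%SET _]sdiffC !mulrA -mulNr; congr (_ * _).
(* In one plane j and l have opposite parity, and the sign comes from the factor recording whether q
   lies in D; in different planes it comes from the order of the two planes. *)
have [e|ql] := eqVneq (qof j) (qof l).
  have : odd j != odd l.
    apply: contra jl => /eqP o; apply/eqP/val_inj; rewrite /= -[LHS]odd_double_half o.
    by rewrite -[RHS]odd_double_half; congr (_ + _.*2)%N; exact: (congr1 val e).
  rewrite e !ltnn !addbF; case: (odd j); case: (odd l) => // _.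
    by case: (_ \in D); rewrite /psg /= ?expr0 ?expr1; ring.
  by case: (_ \in D); rewrite /psg /= ?expr0 ?expr1; ring.
rewrite /=.
have lt : (qof l < qof j)%N = ~~ (qof j < qof l)%N.
  by have : (qof j != qof l :> nat) := ql; case: ltngtP.
rewrite lt; set a := if odd j then _ else _; set b := if odd l then _ else _.
by rewrite !psgD; case: (_ < _)%N; rewrite /psg /= ?expr0 ?expr1; ring.
Qed.

Local Notation cop := (cop (@cliff_gen R N)).

Lemma cop_linear A : linear (cop A).
Proof.
move=> c x y; rewrite /cop; elim: (enum A) => //= i s ->; exact: cliff_gen_linear.
Qed.
HB.instance Definition _ A := GRing.isLinear.Build C (ext R N./2) (ext R N./2) *:%R (cop A) (cop_linear A).

Lemma copM A B x : cop A (cop B x) = sgb (par A B) (cop (sdiff A B) x).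
Proof.
apply: cop_cop; first by move=> i x' y'; rewrite linearB.
  by move=> i x'; exact: cliff_gen_sqr.
by move=> i j x'; exact: cliff_gen_anti.
Qed.

Lemma sgb_psg (V : lmodType C) b (v : V) : sgb b v = psg C b *: v.
Proof. by case: b; rewrite /psg ?expr0 ?expr1 ?scale1r ?scaleN1r. Qed.

Lemma spin_repE mu x : spin_rep mu x = \sum_A (mu A)%:C%C *: cop A x.
Proof. by []. Qed.

Lemma spin_rep_linear mu : linear (@spin_rep R N mu).
Proof.
move=> c x y; rewrite !spin_repE scaler_sumr -big_split; apply: eq_bigr => A _ /=.
by rewrite linearD linearZ scalerDr !scalerA mulrC.
Qed.
HB.instance Definition _ mu := GRing.isLinear.Build C (ext R N./2) (ext R N./2) *:%R
  (@spin_rep R N mu) (spin_rep_linear mu).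

Lemma spin_repD mu nu x : spin_rep (mu + nu) x = spin_rep mu x + spin_rep nu x.
Proof.
by rewrite !spin_repE -big_split; apply: eq_bigr => A _; rewrite claddE rmorphD scalerDl.
Qed.

Lemma spin_repZ (c : R) mu x : spin_rep (c *: mu) x = c%:C%C *: spin_rep mu x.
Proof.
by rewrite !spin_repE scaler_sumr; apply: eq_bigr => A _; rewrite clscaleE rmorphM scalerA.
Qed.

Lemma spin_repN mu x : spin_rep (- mu) x = - spin_rep mu x.
Proof. by rewrite -scaleN1r spin_repZ rmorphN1 scaleN1r. Qed.

Lemma spin_rep1 x : spin_rep (1 : Cl R N) x = x.
Proof.
rewrite spin_repE (bigD1 finset.set0)//= big1 => [|A A0].
  by rewrite cl1E eqxx scale1r addr0 /cop enum_set0.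
by rewrite cl1E (negPf A0) scale0r.
Qed.

Lemma spin_repM mu nu x : spin_rep (mu * nu) x = spin_rep mu (spin_rep nu x).
Proof.
rewrite !spin_repE.
under eq_bigr => D _ do rewrite -clmul_mul clmulE rmorph_sum scaler_suml.
rewrite exchange_big; apply: eq_bigr => A _ /=.
rewrite linear_sum scaler_sumr (reindex_inj (@sdiff_inj _ A)) /=.
apply: eq_bigr => B _; rewrite sdiffK linearZ /= copM sgb_psg !scalerA.
rewrite !rmorphM; congr (_ *: _); rewrite /psg rmorphXn rmorphN1; ring.
Qed.

Lemma spin_rep_suml (I : Type) (r : seq I) (P : pred I) (f : I -> Cl R N) x :
  spin_rep (\sum_(i <- r | P i) f i) x = \sum_(i <- r | P i) spin_rep (f i) x.
Proof.
elim/big_rec2: _ => [|i a b _ <-]; last by rewrite spin_repD.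
by rewrite -(scale0r 0) spin_repZ scale0r.
Qed.

Lemma spin_rep_clE j x : spin_rep (clE R j) x = cliff_gen j x.
Proof.
rewrite spin_repE (bigD1 [set j]%SET)//= big1 => [|A Aj].
  by rewrite ffunE eqxx scale1r addr0 /cop enum_set1.
by rewrite ffunE (negPf Aj) scale0r.
Qed.

Lemma spin_rep_clvec (v : 'rV[R]_N) x :
  spin_rep (clvec v) x = \sum_j (v 0 j)%:C%C *: cliff_gen j x.
Proof.
by rewrite clvecE spin_rep_suml; apply: eq_bigr => j _; rewrite spin_repZ spin_rep_clE.
Qed.

Definition etrace (f : ext R N./2 -> ext R N./2) : C := \sum_B f (ebasis B) B.

(** Conjugation by an anticommuting generator reverses the sign of the trace. The generator permutes
    the basis up to nonzero scalars, so reindexing the diagonal entries replaces cyclicity. *)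
Lemma etrace0 A : A != finset.set0 -> etrace (cop A) = 0.
Proof.
move=> /(exists_anticomm eN)[j hj].
have anti x : cliff_gen j (cop A x) = - cop A (cliff_gen j x).
  have e y : cliff_gen j y = cop [set j]%SET y by rewrite /cop enum_set1.
  rewrite !e !copM hj [sdiff A _]sdiffC.
  by case: par; rewrite //= opprK.
suff e : etrace (cop A) = - etrace (cop A).
  have : etrace (cop A) *+ 2 = 0 by rewrite mulr2n {2}e subrr.
  by move/eqP; rewrite mulrn_eq0 /= => /eqP.
rewrite /etrace {1}(reindex_inj (@sdiff_inj _ [set qof j]%SET)) /= -sumrN; apply: eq_bigr => D _.
have := congr1 (fun x : ext R N./2 => x D) (anti (ebasis (sdiff [set qof j]%SET D))).
rewrite extNE cliff_genE.
set c := (if odd j then psg C (qof j \notin D) else 'i%C) * psg C (ltp (qof j) D).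
have -> : cliff_gen j (ebasis (sdiff [set qof j]%SET D)) = c *: ebasis D.
  apply/ffunP => B; rewrite cliff_genE extZE !ebasisE (inj_eq (@sdiff_inj _ _)).
  by case: eqP => [->//|]; rewrite !mulr0.
have c0 : c != 0.
  rewrite mulf_neq0// /psg ?signr_eq0//; case: ifP; rewrite ?signr_eq0// => _.
  by rewrite eq_complex /= oner_eq0 andbF.
by rewrite linearZ extZE -mulrN; apply: mulfI.
Qed.

(* The trace form recovers the coefficients of an element of the Clifford algebra. *)
Lemma spin_rep_coef mu A : (mu A)%:C%C =
  psg C (par A A) * (2 ^+ N./2)^-1 * \sum_B cop A (spin_rep mu (ebasis B)) B.
Proof.
have e : \sum_B cop A (spin_rep mu (ebasis B)) B =
   \sum_D (mu D)%:C%C * psg C (par A D) * etrace (cop (sdiff A D)).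
  under eq_bigr => B _ do rewrite spin_repE linear_sum ext_sumE.
  rewrite exchange_big; apply: eq_bigr => D _; rewrite mulr_sumr; apply: eq_bigr => B _.
  by rewrite linearZ extZE /= copM sgb_psg extZE mulrA.
rewrite {}e (bigD1 A)//= big1 => [|D DA].
  rewrite sdiffv addr0 /etrace.
  have -> : \sum_B cop finset.set0 (ebasis B) B = 2 ^+ N./2 :> C.
    under eq_bigr => B _ do rewrite /cop enum_set0 /= ebasisE eqxx.
    by rewrite sumr_const -cardsT -powersetT card_powerset cardsT card_ord natrX.
  have two0 : (2 : C) ^+ N./2 != 0 by rewrite expf_neq0// pnatr_eq0.
  have : psg C (par A A) * psg C (par A A) = 1 by rewrite -psgD addbb.
  set p := psg _ _ => pp; rewrite -[LHS]mulr1 -[in LHS]pp.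
  by field.
rewrite etrace0 ?mulr0//; apply: contra DA => /eqP h; rewrite eq_sym -[A]sdiff0 -h sdiffK//.
Qed.

End SpinRep.
End Fock.

(** * Quaternionic reflections and Sp(n) *)

Section Quaternion.
Variable R : realType.
Local Notation H := (quat R).
Implicit Types (x y : H).

Lemma quatP x y : qr x = qr y -> qi x = qi y -> qj x = qj y -> qk x = qk y -> x = y.
Proof. by case: x => ????; case: y => ???? /= -> -> -> ->. Qed.

Lemma qrD x y : qr (x + y) = qr x + qr y. Proof. by []. Qed.
Lemma qiD x y : qi (x + y) = qi x + qi y. Proof. by []. Qed.
Lemma qjD x y : qj (x + y) = qj x + qj y. Proof. by []. Qed.
Lemma qkD x y : qk (x + y) = qk x + qk y. Proof. by []. Qed.
Lemma qrN x : qr (- x) = - qr x. Proof. by []. Qed.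
Lemma qiN x : qi (- x) = - qi x. Proof. by []. Qed.
Lemma qjN x : qj (- x) = - qj x. Proof. by []. Qed.
Lemma qkN x : qk (- x) = - qk x. Proof. by []. Qed.
Lemma qrM x y : qr (x * y) = qr x * qr y - qi x * qi y - qj x * qj y - qk x * qk y.
Proof. by []. Qed.
Lemma qiM x y : qi (x * y) = qr x * qi y + qi x * qr y + qj x * qk y - qk x * qj y.
Proof. by []. Qed.
Lemma qjM x y : qj (x * y) = qr x * qj y - qi x * qk y + qj x * qr y + qk x * qi y.
Proof. by []. Qed.
Lemma qkM x y : qk (x * y) = qr x * qk y + qi x * qj y - qj x * qi y + qk x * qr y.
Proof. by []. Qed.
Definition qE := (qrD, qiD, qjD, qkD, qrN, qiN, qjN, qkN, qrM, qiM, qjM, qkM).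

Definition qreal (c : R) : H := Quat c 0 0 0.
Definition qn2 x : R := qr x ^+ 2 + qi x ^+ 2 + qj x ^+ 2 + qk x ^+ 2.

Lemma qconjM x y : qconj (x * y) = qconj y * qconj x.
Proof. by apply: quatP; rewrite !qE /=; ring. Qed.
Lemma qconjD x y : qconj (x + y) = qconj x + qconj y.
Proof. by apply: quatP; rewrite !qE /=; ring. Qed.
Lemma qconjN x : qconj (- x) = - qconj x.
Proof. by apply: quatP; rewrite !qE /=; ring. Qed.
Lemma qconjK : involutive (@qconj R).
Proof. by move=> x; apply: quatP; rewrite /= ?opprK. Qed.
Lemma qconj0 : qconj (0 : H) = 0. Proof. by apply: quatP; rewrite /= ?oppr0. Qed.
Lemma qconj1 : qconj (1 : H) = 1. Proof. by apply: quatP; rewrite /= ?oppr0. Qed.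
Lemma qconj_real c : qconj (qreal c) = qreal c.
Proof. by apply: quatP; rewrite /= ?oppr0. Qed.
Lemma qrealM c d : qreal (c * d) = qreal c * qreal d.
Proof. by apply: quatP; rewrite !qE /=; ring. Qed.
Lemma qrealD c d : qreal (c + d) = qreal c + qreal d.
Proof. by apply: quatP; rewrite !qE /=; ring. Qed.
Lemma qreal_comm c x : qreal c * x = x * qreal c.
Proof. by apply: quatP; rewrite !qE /=; ring. Qed.
Lemma qmul_conj x : x * qconj x = qreal (qn2 x).
Proof. by apply: quatP; rewrite !qE /qn2 /=; ring. Qed.
Lemma qconj_mul x : qconj x * x = qreal (qn2 x).
Proof. by apply: quatP; rewrite !qE /qn2 /=; ring. Qed.
Lemma qn2_conj x : qn2 (qconj x) = qn2 x. Proof. by rewrite /qn2 /=; ring. Qed.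
Lemma qn2M x y : qn2 (x * y) = qn2 x * qn2 y.
Proof. by rewrite /qn2 !qE; ring. Qed.
Lemma qn2_real c : qn2 (qreal c) = c ^+ 2.
Proof. by rewrite /qn2 /=; ring. Qed.

Lemma qn2_ge0 x : 0 <= qn2 x.
Proof. by rewrite !addr_ge0// sqr_ge0. Qed.

Lemma qn2_eq0 x : qn2 x = 0 -> x = 0.
Proof.
rewrite /qn2 => /eqP h; apply: quatP => /=; apply/eqP; rewrite -sqrf_eq0 eq_le sqr_ge0 andbT;
  have := sqr_ge0 (qr x); have := sqr_ge0 (qi x); have := sqr_ge0 (qj x);
  have := sqr_ge0 (qk x); move: h => /eqP; lra.
Qed.

Lemma quat_of_complexM (z w : R[i]) :
  quat_of_complex (z * w) = quat_of_complex z * quat_of_complex w.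
Proof. by case: z => a b; case: w => c d; apply: quatP; rewrite !qE /=; ring. Qed.

Definition jcx (c s : R) : H := Quat c 0 s 0.

Lemma jcxM c s c' s' : jcx c s * jcx c' s' = jcx (c * c' - s * s') (c * s' + s * c').
Proof. by apply: quatP; rewrite !qE /=; ring. Qed.

Lemma qn2_jcx c s : qn2 (jcx c s) = c ^+ 2 + s ^+ 2.
Proof. by rewrite /qn2 /=; ring. Qed.

(** Half-angle formulas; the sign of s is chosen to match that of [be]. *)
Lemma unit_half (al be : R) : al ^+ 2 + be ^+ 2 = 1 ->
  exists c s, [/\ c ^+ 2 + s ^+ 2 = 1, c ^+ 2 - s ^+ 2 = al & 2 * c * s = be].
Proof.
move=> e; have al1 : -1 <= al <= 1 by apply/andP; split; have := sqr_ge0 be; nra.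
have [p0 m0] : 0 <= (1 + al) / 2 /\ 0 <= (1 - al) / 2 by split; lra.
pose c := Num.sqrt ((1 + al) / 2); pose s := Num.sqrt ((1 - al) / 2).
have c2 : c ^+ 2 = (1 + al) / 2 by rewrite sqr_sqrtr.
have s2 : s ^+ 2 = (1 - al) / 2 by rewrite sqr_sqrtr.
have cs0 : 0 <= 2 * c * s by rewrite !mulr_ge0 ?sqrtr_ge0.
have cs2 : (2 * c * s) ^+ 2 = be ^+ 2 by rewrite !exprMn c2 s2; nra.
have [b0|b0] := leP 0 be.
  exists c, s; split; [lra|lra|]; apply/eqP; move/eqP: cs2.
  by rewrite eqrXn2.
exists c, (- s); split; [rewrite sqrrN; lra|rewrite sqrrN; lra|].
rewrite mulrN; apply/eqP; rewrite eqr_oppLR; move/eqP: cs2.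
by rewrite -[be ^+ 2]sqrrN eqrXn2// oppr_ge0 ltW.
Qed.

(** With m the imaginary part of q and r = |m|, the element y0 = r - m j satisfies m y0 = y0 (r j),
    since m^2 = -r^2; normalised, it conjugates. It vanishes only if m is a multiple of j, and then
    q already has the required form. *)
Lemma unit_quat_conj (q : H) : qn2 q = 1 ->
  exists y c s, [/\ qn2 y = 1, c ^+ 2 + s ^+ 2 = 1 & q = y * jcx c s * qconj y].
Proof.
move=> q1; pose r := Num.sqrt (qi q ^+ 2 + qj q ^+ 2 + qk q ^+ 2).
have r2 : r ^+ 2 = qi q ^+ 2 + qj q ^+ 2 + qk q ^+ 2.
  by rewrite sqr_sqrtr// !addr_ge0// sqr_ge0.
have ar1 : qr q ^+ 2 + r ^+ 2 = 1 by rewrite r2 -q1 /qn2; ring.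
pose m : H := Quat 0 (qi q) (qj q) (qk q).
pose y0 := qreal r - m * q_j R.
have [y00|y00] := eqVneq y0 0.
  exists 1, (qr q), (qj q).
  have [e1 e2] : qi q = 0 /\ qk q = 0.
    move: y00; rewrite /y0 => y00; split.
      by have := congr1 (@qk R) y00; rewrite !qE /=; lra.
    by have := congr1 (@qi R) y00; rewrite !qE /=; lra.
  split; [by rewrite /qn2 /=; ring| |].
    by rewrite -q1 /qn2 e1 e2; ring.
  by rewrite qconj1 mul1r mulr1; apply: quatP.
have n0 : 0 < qn2 y0 by rewrite lt0r qn2_ge0 andbT; apply: contra y00 => /eqP/qn2_eq0->.
pose s := Num.sqrt (qn2 y0).
have s0 : s != 0 by rewrite gt_eqF// sqrtr_gt0.
have s2 : s ^+ 2 = qn2 y0 by rewrite sqr_sqrtr// ltW.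
exists (qreal s^-1 * y0), (qr q), r; split=> //.
  by rewrite qn2M qn2_real exprVn s2 mulVf// gt_eqF.
have key : y0 * jcx (qr q) r = q * y0.
  rewrite /y0; apply: quatP; rewrite !qE /=; ring: r2.
have -> : qreal s^-1 * y0 * jcx (qr q) r * qconj (qreal s^-1 * y0) =
    qreal s^-1 * q * (y0 * qconj y0) * qreal s^-1.
  by rewrite qconjM qconj_real -[_ * y0 * _]mulrA key !mulrA.
rewrite qmul_conj qreal_comm -!mulrA -!qrealM -s2.
by have -> : s^-1 * (s ^+ 2 * s^-1) = 1; [field|rewrite mulr1].
Qed.

End Quaternion.

(** * The group Sp(n) and its generation by reflections *)

Section SpGroup.
Variable R : realType.
Local Notation H := (quat R).

Definition ctr (m n : nat) (A : 'M[H]_(m, n)) : 'M[H]_(n, m) := (map_mx (@qconj R) A)^T.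

Lemma ctrE m n (A : 'M[H]_(m, n)) i j : ctr A i j = qconj (A j i).
Proof. by rewrite !mxE. Qed.

Lemma qconj_sum (I : Type) (r : seq I) (P : pred I) (f : I -> H) :
  qconj (\sum_(i <- r | P i) f i) = \sum_(i <- r | P i) qconj (f i).
Proof. by elim/big_rec2: _ => [|i a b _ <-]; rewrite ?qconj0 ?qconjD. Qed.

Lemma ctrM m n p (A : 'M[H]_(m, n)) (B : 'M[H]_(n, p)) : ctr (A *m B) = ctr B *m ctr A.
Proof.
apply/matrixP => i j; rewrite ctrE !mxE qconj_sum; apply: eq_bigr => k _.
by rewrite qconjM !ctrE.
Qed.

Lemma ctrK m n (A : 'M[H]_(m, n)) : ctr (ctr A) = A.
Proof. by apply/matrixP => i j; rewrite !ctrE qconjK. Qed.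

Lemma ctrD m n (A B : 'M[H]_(m, n)) : ctr (A + B) = ctr A + ctr B.
Proof. by apply/matrixP => i j; rewrite ctrE !mxE qconjD. Qed.

Lemma ctrN m n (A : 'M[H]_(m, n)) : ctr (- A) = - ctr A.
Proof. by apply/matrixP => i j; rewrite ctrE !mxE qconjN. Qed.

Lemma ctr0 m n : ctr (0 : 'M[H]_(m, n)) = 0.
Proof. by apply/matrixP => i j; rewrite ctrE !mxE qconj0. Qed.

Lemma ctr_scalar n (x : H) : ctr (x%:M : 'M[H]_n) = (qconj x)%:M.
Proof.
apply/matrixP => i j; rewrite ctrE !mxE eq_sym.
by case: eqP => _; rewrite ?mulr1n ?mulr0n// qconj0.
Qed.

Lemma ctr1 n : ctr (1%:M : 'M[H]_n) = 1%:M.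
Proof. by rewrite ctr_scalar qconj1. Qed.

Lemma ctrans_ctr n (A : 'M[H]_n) : ctrans A = ctr A. Proof. by []. Qed.

Lemma scalar_mxM n (x y : H) : (x * y)%:M = x%:M *m y%:M :> 'M[H]_n.
Proof. by rewrite mul_scalar_mx scale_scalar_mx. Qed.

Lemma scalar_mxD n (x y : H) : (x + y)%:M = x%:M + y%:M :> 'M[H]_n.
Proof. exact: raddfD. Qed.

(** For a unit column u it sends u x to u q x and fixes every column orthogonal to u. *)
Definition qrefl n (u : 'cV[H]_n) (q : H) : 'M[H]_n :=
  1%:M + u *m ((q - 1)%:M : 'M[H]_1) *m ctr u.

Definition unitc n (u : 'cV[H]_n) := ctr u *m u = 1%:M.

Lemma qrefl_mul n (u : 'cV[H]_n) q q' : unitc u -> qrefl u q *m qrefl u q' = qrefl u (q * q').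
Proof.
move=> uu; rewrite /qrefl mulmxDl mul1mx mulmxDr mulmx1 -addrA; congr (_ + _).
have -> : u *m (q - 1)%:M *m ctr u *m (u *m (q' - 1)%:M *m ctr u) =
    u *m ((q - 1) * (q' - 1))%:M *m ctr u.
  by rewrite scalar_mxM !mulmxA -[_ *m ctr u *m u]mulmxA uu mulmx1.
have -> : q * q' - 1 = (q' - 1) + ((q - 1) + (q - 1) * (q' - 1)).
  by apply: quatP; rewrite !qE /=; ring.
move: (q' - 1) (q - 1) => a b.
by rewrite scalar_mxD (scalar_mxD _ b) !mulmxDr !mulmxDl.
Qed.

Lemma ctr_qrefl n (u : 'cV[H]_n) q : ctr (qrefl u q) = qrefl u (qconj q).
Proof. by rewrite /qrefl ctrD ctr1 !ctrM ctrK ctr_scalar qconjD qconjN qconj1 mulmxA. Qed.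

Lemma qrefl1 n (u : 'cV[H]_n) : qrefl u 1 = 1%:M.
Proof. by rewrite /qrefl subrr raddf0 mulmx0 mul0mx addr0. Qed.

(** Replacing u by u y conjugates q by y; this freedom is what normalises q to the form
    [jcx c s]. *)
Lemma qrefl_conj n (u : 'cV[H]_n) (y q : H) : qn2 y = 1 ->
  qrefl (u *m (y%:M : 'M[H]_1)) q = qrefl u (y * q * qconj y).
Proof.
move=> y1; have e : y * q * qconj y - 1 = y * (q - 1) * qconj y.
  by rewrite mulrBr mulrBl mulr1 qmul_conj y1.
by rewrite /qrefl e !scalar_mxM ctrM ctr_scalar !mulmxA.
Qed.

Lemma qrefl_Sp n (u : 'cV[H]_n) q : unitc u -> qn2 q = 1 -> Sp (qrefl u q).
Proof.
move=> uu q1; rewrite /Sp /= ctrans_ctr ctr_qrefl qrefl_mul// qconj_mul q1; exact: qrefl1.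
Qed.

Lemma SpM n (A B : 'M[H]_n) : Sp A -> Sp B -> Sp (A *m B).
Proof.
rewrite /Sp /= !ctrans_ctr => SA SB.
by rewrite ctrM mulmxA -[_ *m _ *m A]mulmxA SA mulmx1.
Qed.

Lemma Sp1 n : Sp (1%:M : 'M[H]_n).
Proof. by rewrite /Sp /= ctrans_ctr ctr1 mul1mx. Qed.

Lemma unitcE n (u : 'cV[H]_n) : unitc u <-> \sum_i qn2 (u i 0) = 1.
Proof.
have e : ctr u *m u = (qreal (\sum_i qn2 (u i 0)))%:M.
  apply/matrixP => i j; rewrite !ord1 !mxE eqxx mulr1n.
  by elim/big_rec2: _ => // k a b _ ->; rewrite ctrE qconj_mul qrealD.
rewrite /unitc e; split=> [/matrixP/(_ 0 0)|->//].
by rewrite !mxE eqxx !mulr1n => -[].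
Qed.

Lemma unitc_conj n (u : 'cV[H]_n) y : unitc u -> qn2 y = 1 -> unitc (u *m (y%:M : 'M[H]_1)).
Proof.
move=> uu y1; rewrite /unitc ctrM ctr_scalar mulmxA -[_ *m _ *m u]mulmxA uu mulmx1.
by rewrite -scalar_mxM qconj_mul y1.
Qed.

Lemma unitc_delta n (m : 'I_n) : unitc (delta_mx m 0 : 'cV[H]_n).
Proof.
apply/unitcE; rewrite (bigD1 m)//= big1 => [|i im]; rewrite mxE eqxx ?(negPf im) ?eqxx /qn2 /=; ring.
Qed.

(* The reflection moving [e_m] to the unit vector [w]. *)
Lemma qrefl_exists n (m : 'I_n) (w : 'cV[H]_n) : unitc w ->
  exists u q, [/\ unitc u, qn2 q = 1, qrefl u q *m delta_mx m 0 = w &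
    forall v : 'cV[H]_n, ctr w *m v = 0 -> v m 0 = 0 -> qrefl u q *m v = v].
Proof.
move=> w1; pose e : 'cV[H]_n := delta_mx m 0; have [<-|we] := eqVneq e w.
  exists e, 1; rewrite !qrefl1; split; [exact: unitc_delta|by rewrite /qn2 /=; ring| |].
    by rewrite mul1mx.
  by move=> v _ _; rewrite mul1mx.
have /unitcE w1' := w1.
pose d := w - e; pose N2 := \sum_i qn2 (d i 0); pose x := w m 0 - 1.
have dE i : d i 0 = w i 0 - (i == m)%:R by rewrite !mxE eqxx andbT.
have N2E : N2 = 2 - 2 * qr (w m 0).
  rewrite /N2 (bigD1 m)//= dE eqxx; under eq_bigr => i im do rewrite dE (negPf im) subr0.
  move: w1'; rewrite (bigD1 m)//= /qn2 !qE /=; set S := \sum_(_ | _) _; lra.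
have N2x : qn2 x <= N2.
  rewrite /N2 (bigD1 m)//= dE eqxx -/x lerDl sumr_ge0// => i _; exact: qn2_ge0.
(* If the entry of w at m is 1, the unit length of w kills all other entries, and w = e. *)
have x0 : 0 < qn2 x.
  rewrite lt0r qn2_ge0 andbT; apply: contra we => /eqP/qn2_eq0/eqP; rewrite subr_eq0 => /eqP wm.
  apply/eqP/matrixP => i j; rewrite ord1 mxE eqxx andbT.
  have [->|im] := eqVneq i m; first by rewrite wm.
  move: w1'; rewrite (bigD1 m)//= wm => h.
  have : \sum_(j | j != m) qn2 (w j 0) = 0.
    by move: h; rewrite {1}/qn2 /=; set S := \sum_(_ | _) _; lra.
  move=> /psumr_eq0P/(_ i im) -/(_ _)/qn2_eq0 ->// k _; exact: qn2_ge0.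
have N0 : 0 < N2 by apply: lt_le_trans N2x.
pose r := (Num.sqrt N2)^-1.
have r2 : r ^+ 2 * N2 = 1 by rewrite exprVn sqr_sqrtr ?ltW// mulVf// gt_eqF.
pose u : 'cV[H]_n := d *m ((qreal r)%:M : 'M[H]_1).
(* With u = d / |d|, the equation [qrefl u q] e = w amounts to (q - 1) conj(x) = N2, which
   determines q. It has norm one because N2 = -2 Re x. *)
pose q := 1 + qreal (N2 / qn2 x) * x.
have uE i : u i 0 = d i 0 * qreal r.
  by rewrite mxE big_ord1 [X in _ * X]mxE eqxx mulr1n.
have q1 : qn2 q = 1.
  have e2 : qn2 x * (N2 / qn2 x) = N2 by rewrite mulrC divfK// gt_eqF.
  have : qn2 q = 1 + N2 / qn2 x * (2 * qr x + qn2 x * (N2 / qn2 x)).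
    by rewrite /qn2 !qE /=; ring.
  move=> ->; rewrite e2 N2E /x !qE /=; ring.
have uu : unitc u.
  apply/unitcE; under eq_bigr do rewrite uE qn2M qn2_real.
  by rewrite -mulr_suml mulrC.
have ctru : ctr u = (qreal r)%:M *m (ctr w - ctr e).
  by rewrite ctrM ctr_scalar qconj_real -ctrN -ctrD.
have ctre (v : 'cV[H]_n) : ctr e *m v = (v m 0)%:M.
  apply/matrixP => i j; rewrite !ord1 !mxE eqxx mulr1n (bigD1 m)//= big1 => [|k km].
    by rewrite ctrE mxE !eqxx qconj1 mul1r addr0.
  by rewrite ctrE mxE (negPf km) qconj0 mul0r.
have ctrw : ctr w *m delta_mx m 0 = (qconj (w m 0))%:M.
  apply/matrixP => i j; rewrite !ord1 !mxE eqxx mulr1n (bigD1 m)//= big1 => [|k km].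
    by rewrite ctrE mxE !eqxx mulr1 addr0.
  by rewrite [X in _ * X]mxE (negPf km) mulr0.
have cue : ctr u *m delta_mx m 0 = (qreal r * (qconj (w m 0) - 1))%:M.
  rewrite ctru -mulmxA mulmxBl ctre ctrw mxE !eqxx scalar_mxM scalar_mxD.
  by congr (_ *m (_ + _)); exact/esym/raddfN.
exists u, q; split=> //.
  rewrite /qrefl mulmxDl mul1mx -[_ *m ctr u *m _]mulmxA cue /u -!mulmxA -!scalar_mxM.
  have -> : qreal r * ((q - 1) * (qreal r * (qconj (w m 0) - 1))) = 1.
    have -> : qconj (w m 0) - 1 = qconj x by rewrite qconjD qconjN qconj1.
    have -> : q - 1 = qreal (N2 / qn2 x) * x by rewrite /q addrC addKr.
    rewrite -mulrA [x * _]mulrA -qreal_comm -[_ * x * _]mulrA qmul_conj -!qrealM.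
    by congr qreal; rewrite -r2; field; rewrite gt_eqF.
  by rewrite mulmx1 addrC subrK.
move=> v wv vm; rewrite /qrefl mulmxDl mul1mx -[_ *m ctr u *m _]mulmxA.
have -> : ctr u *m v = 0 by rewrite ctru -mulmxA mulmxBl ctre wv vm raddf0 subr0 mulmx0.
by rewrite mulmx0 addr0.
Qed.

(** Elimination by reflections: multiplying A by the inverse of a reflection that moves e_m to A e_m
    fixes one more basis column. Each reflection is then normalised by [unit_quat_conj], and its
    parameter is written as a square by [unit_half]. *)
Lemma Sp_ind n (P : 'M[H]_n -> Prop) : P 1%:M ->
  (forall u c s, unitc u -> c ^+ 2 + s ^+ 2 = 1 -> P (qrefl u (jcx c s * jcx c s))) ->
  (forall A B, Sp A -> Sp B -> P A -> P B -> P (A *m B)) ->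
  forall A, Sp A -> P A.
Proof.
move=> P1 Pr PM.
have Pq u q : unitc u -> qn2 q = 1 -> P (qrefl u q).
  move=> uu /unit_quat_conj[y [c [s [y1 cs ->]]]].
  rewrite -qrefl_conj//; have [c' [s' [cs' e1 e2]]] := unit_half cs.
  have -> : jcx c s = jcx c' s' * jcx c' s'.
    by rewrite jcxM -e1 -e2; congr jcx; ring.
  by apply: Pr => //; exact: unitc_conj.
(* [k] bounds the number of basis columns not yet known to be fixed. *)
suff : forall k (A : 'M[H]_n), (k <= n)%N -> Sp A ->
    (forall i : 'I_n, (i < n - k)%N -> A *m delta_mx i 0 = delta_mx i 0 :> 'cV[H]_n) -> P A.
  by move=> h A SA; apply: (h n) => // i; rewrite subnn.
elim=> [|k ih] A kn SA fixA.
  suff -> : A = 1%:M by [].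
  apply/matrixP => i j; have /matrixP/(_ i 0) : A *m delta_mx j 0 = delta_mx j 0 :> 'cV[H]_n.
    by apply: fixA; rewrite subn0.
  rewrite !mxE eqxx andbT (bigD1 j)//= big1 => [|l lj]; first by rewrite mxE !eqxx mulr1 addr0.
  by rewrite mxE (negPf lj) mulr0.
have mn : (n - k.+1 < n)%N by lia.
pose m := Ordinal mn; pose w : 'cV[H]_n := A *m delta_mx m 0.
have w1 : unitc w.
  by rewrite /unitc /w ctrM mulmxA -[_ *m _ *m A]mulmxA SA mulmx1 unitc_delta.
have [u [q [uu q1 rw rv]]] := qrefl_exists m w1.
have inv : qrefl u q *m qrefl u (qconj q) = 1%:M by rewrite qrefl_mul// qmul_conj q1 qrefl1.
have inv' : qrefl u (qconj q) *m qrefl u q = 1%:M by rewrite qrefl_mul// qconj_mul q1 qrefl1.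
have q1' : qn2 (qconj q) = 1 by rewrite qn2_conj.
have SA' : Sp (qrefl u (qconj q) *m A) by exact: (SpM (qrefl_Sp uu q1') SA).
have -> : A = qrefl u q *m (qrefl u (qconj q) *m A) by rewrite mulmxA inv mul1mx.
apply: (PM _ _ (qrefl_Sp uu q1) SA' (Pq u q uu q1)).
apply: ih => //; first lia.
move=> i ik; rewrite -mulmxA; have [im|im] := eqVneq i m.
  by rewrite im -/w -rw mulmxA inv' mul1mx.
have ilt : (i < n - k.+1)%N by have : (i != (n - k.+1)%N :> nat) := im; lia.
(* An earlier column e_i has entry 0 at m and is orthogonal to w = A e_m, because A preserves the
   form and fixes e_i; so the reflection fixes it. *)
have Ai := fixA i ilt; rewrite Ai -[RHS]mul1mx -inv' -mulmxA; congr (_ *m _).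
apply/esym/rv; last by rewrite mxE eq_sym (negPf im).
rewrite /w ctrM -mulmxA -{1}Ai [ctr A *m _]mulmxA SA mul1mx.
apply/matrixP => a b; rewrite !ord1 !mxE (bigD1 i)//= big1 => [|j ji].
  by rewrite ctrE !mxE (negPf im) /= qconj0 mul0r addr0.
by rewrite [X in _ * X]mxE (negPf ji) mulr0.
Qed.

(** Quaternions do not commute, so no determinant turns the left inverse into a right one; the
    identity is checked on generators instead. *)
Lemma Sp_ctr n (A : 'M[H]_n) : Sp A -> A *m ctr A = 1%:M.
Proof.
move: A; apply: Sp_ind.
- by rewrite ctr1 mulmx1.
- move=> u c s uu cs; rewrite ctr_qrefl qrefl_mul// qmul_conj qn2M qn2_jcx cs mulr1; exact: qrefl1.
- by move=> A B SA SB hA hB; rewrite ctrM mulmxA -[A *m B *m _]mulmxA hB mulmx1.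
Qed.

Lemma Sp_ctr_Sp n (A : 'M[H]_n) : Sp A -> Sp (ctr A).
Proof. by move=> SA; rewrite /Sp /= ctrans_ctr ctrK Sp_ctr. Qed.

End SpGroup.

(** * The isotropy representation *)

Section Isotropy.
Variables (R : realType) (n : nat).
Local Notation H := (quat R).
Local Notation N := (Ndim n).
Implicit Types (u v : 'rV[R]_N) (w : 'rV[H]_n) (x y : H).

Definition vc v (j : nat) : R := v 0 (inord j).

Lemma vcE v (j : 'I_N) : vc v j = v 0 j.
Proof. by rewrite /vc inord_val. Qed.

(* Tangent vectors in the coordinates of the orthonormal basis are pairs of a horizontal row in H^n
   and a vertical quaternion in span(j, k). *)
Definition hv v : 'rV[H]_n :=
  \row_p Quat (- vc v (4 * p + 5)) (vc v (4 * p + 4)) (vc v (4 * p + 2)) (vc v (4 * p + 3)).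
Definition vv v : H := Quat 0 0 (vc v 1) (- vc v 0).

Definition rown w (p : nat) : H := if insub p is Some i then w 0 i else 0.

Lemma rownE w (p : 'I_n) : rown w p = w 0 p.
Proof. by rewrite /rown valK. Qed.

(** Inverse of the coordinates ([vv], [hv]). The order j, k, i, 1 is that of e_{4p}, ..., e_{4p+3};
    the two minus signs come from the entry -1 of E in the first row and from xi_2 = -k F. *)
Definition mkc x w (j : nat) : R :=
  match j with
  | 0 => - qk x
  | 1 => qj x
  | j.+2 => let y := rown w (j %/ 4) in
     match (j %% 4)%N with 0 => qj y | 1 => qk y | 2 => qi y | _ => - qr y end
  end.

Definition mkv x w : 'rV[R]_N := \row_j mkc x w j.

Lemma vc_mkv x w j : (j < N)%N -> vc (mkv x w) j = mkc x w j.
Proof. by move=> jN; rewrite /vc mxE inordK. Qed.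

Lemma Ndim_ltn (p : 'I_n) r : (r < 6)%N -> (4 * p + r < N)%N.
Proof. by have := ltn_ord p; rewrite /Ndim; lia. Qed.

Lemma mkc_block x w (p : 'I_n) r : (r < 4)%N -> mkc x w (4 * p + r.+2) =
  match r with 0 => qj (w 0 p) | 1 => qk (w 0 p) | 2 => qi (w 0 p) | _ => - qr (w 0 p) end.
Proof.
move=> r4; rewrite !addnS /mkc mulnC divnMDl// divn_small// addn0 rownE modnMDl modn_small//.
Qed.

Lemma hv_mkv x w : hv (mkv x w) = w.
Proof.
apply/rowP => p; rewrite mxE !vc_mkv ?Ndim_ltn//.
rewrite (@mkc_block _ _ _ 3)// (@mkc_block _ _ _ 2)// (@mkc_block _ _ _ 1)// (@mkc_block _ _ _ 0)// opprK.
by case: (w 0 p).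
Qed.

Lemma vv_mkv x w : qr x = 0 -> qi x = 0 -> vv (mkv x w) = x.
Proof. by case: x => ? ? ? ? /= -> ->; rewrite /vv !vc_mkv//= opprK. Qed.

Lemma Ndim_case (j : 'I_N) : [\/ j = 0%N :> nat, j = 1%N :> nat |
   exists (p : 'I_n) r, (r < 4)%N /\ j = (4 * p + r.+2)%N :> nat].
Proof.
have := ltn_ord j; case: (nat_of_ord j) => [|[|k]] kN; [by constructor 1|by constructor 2|constructor 3].
have kn : (k %/ 4 < n)%N by rewrite ltn_divLR//; move: kN; rewrite /Ndim; lia.
exists (Ordinal kn), (k %% 4)%N; split; first exact: ltn_pmod.
by rewrite /= !addnS mulnC -divn_eq.
Qed.

Lemma mkvK v : mkv (vv v) (hv v) = v.
Proof.
apply/rowP => j; rewrite mxE -[RHS]vcE; case: (Ndim_case j) => [->|->|[p [r [r4 ->]]]] //=.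
  by rewrite opprK.
rewrite mkc_block// !mxE; by case: r r4 => [|[|[|[|]]]]//= _; rewrite opprK.
Qed.

Lemma vhP u v : vv u = vv v -> hv u = hv v -> u = v.
Proof. by move=> e1 e2; rewrite -[u]mkvK e1 e2 mkvK. Qed.

Definition hdot (w w' : 'rV[H]_n) : R := qr ((w *m ctr w') 0 0).

Lemma sum_Ndim (f : nat -> R) : \sum_(j < N) f j =
  f 0%N + f 1%N + \sum_(p < n) (f (4 * p + 2)%N + f (4 * p + 3)%N + f (4 * p + 4)%N + f (4 * p + 5)%N).
Proof.
rewrite /Ndim !big_ord_recl /= addrA; congr (_ + _).
have -> : \sum_(i < 4 * n) f (bump 0 (bump 0 i)) = \sum_(0 <= i < 4 * n) f (i + 2)%N.
  by rewrite big_mkord; apply: eq_bigr => i _; rewrite /bump /= !add1n addn2.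
rewrite -(big_mkord xpredT (fun p => f (4 * p + 2)%N + f (4 * p + 3)%N + f (4 * p + 4)%N + f (4 * p + 5)%N)).
elim: {1 2}n => [|m ih]; first by rewrite !big_geq.
rewrite mulnS [(4 + _)%N]addnC [in RHS]big_nat_recr//= -ih.
by rewrite !addnS addn0 !big_nat_recr//= !addnS !addn0 -!addrA.
Qed.

Lemma hdotE w w' : hdot w w' =
  \sum_p (qr (w 0 p) * qr (w' 0 p) + qi (w 0 p) * qi (w' 0 p) + qj (w 0 p) * qj (w' 0 p) + qk (w 0 p) * qk (w' 0 p)).
Proof.
rewrite /hdot mxE; elim/big_rec2: _ => // p b c _ <-.
by rewrite qrD ctrE; congr (_ + _); rewrite qrM /=; ring.
Qed.

Lemma vdotE u v : vdot u v = hdot (hv u) (hv v) - qr (vv u * vv v).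
Proof.
rewrite /vdot; under eq_bigr => j _ do rewrite -!vcE.
rewrite (sum_Ndim (fun j => vc u j * vc v j)) hdotE addrC; congr (_ + _).
  by apply: eq_bigr => p _; rewrite !mxE /=; ring.
by rewrite qrM /=; ring.
Qed.

Definition mm x w : 'M[H]_n.+1 := (block_mx (x%:M : 'M[H]_1) w (- ctr w) 0 : 'M[H]_(1 + n)).

Lemma ctr_block p q (A : 'M[H]_p) (B : 'M[H]_(p, q)) (C : 'M[H]_(q, p)) (D : 'M[H]_q) :
  ctr (block_mx A B C D) = block_mx (ctr A) (ctr C) (ctr B) (ctr D).
Proof. by rewrite /ctr map_block_mx tr_block_mx. Qed.

Lemma emb_conj z A x w :
  emb z A *m mm x w *m ctrans (emb z A) =
  mm (quat_of_complex z * x * qconj (quat_of_complex z))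
     (quat_of_complex z *: (w *m ctr A)).
Proof.
change ((block_mx (quat_of_complex z)%:M 0 0 A : 'M[H]_(1 + n)) *m block_mx x%:M w (- ctr w) 0 *m
  ctr (block_mx (quat_of_complex z)%:M 0 0 A : 'M[H]_(1 + n)) =
  block_mx (quat_of_complex z * x * qconj (quat_of_complex z))%:M
    (quat_of_complex z *: (w *m ctr A)) (- ctr (quat_of_complex z *: (w *m ctr A))) 0).
rewrite ctr_block !mulmx_block.
rewrite !(mul0mx, mulmx0, add0r, addr0) !ctr0 !(mul0mx, mulmx0, add0r, addr0) ctr_scalar.
congr block_mx.
- by rewrite !scalar_mxM.
- by rewrite mul_scalar_mx -scalemxAl.
- rewrite mulmxN mulNmx; congr (- _).
  by rewrite -mul_scalar_mx !ctrM ctrK ctr_scalar.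
Qed.

Lemma mm00 x w : mm x w ord0 ord0 = x.
Proof.
change ((block_mx (x%:M : 'M[H]_1) w (- ctr w) 0 : 'M[H]_(1 + n)) ord0 ord0 = x).
have -> : ord0 = lshift n (0 : 'I_1) by apply/val_inj.
by rewrite block_mxEul mxE eqxx mulr1n.
Qed.

Lemma scale_delta00 x : x *: delta_mx ord0 ord0 = mm x 0.
Proof.
change (x *: (delta_mx (lshift n 0) (lshift n 0) : 'M[H]_(1 + n)) =
  block_mx (x%:M : 'M[H]_1) 0 (- ctr 0) 0).
rewrite ctr0 oppr0; apply/matrixP => i j; rewrite [LHS]mxE [delta_mx _ _ _ _]mxE.
case: (split_ordP i) => c ->; case: (split_ordP j) => d ->;
  rewrite ?block_mxEul ?block_mxEur ?block_mxEdl ?block_mxEdr !mxE !eq_shift ?ord1 ?eqxx ?andbF ?mulr0//.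
by rewrite mulr1 mulr1n.
Qed.

Lemma scale_delta_row x (p : 'I_n) :
  x *: delta_mx ord0 (rshift 1 p) - qconj x *: delta_mx (rshift 1 p) ord0 =
  mm 0 (x *: delta_mx 0 p).
Proof.
change (x *: (delta_mx (lshift n 0) (rshift 1 p) : 'M[H]_(1 + n)) -
   qconj x *: delta_mx (rshift 1 p) (lshift n 0) =
  block_mx ((0 : H)%:M : 'M[H]_1) (x *: delta_mx 0 p) (- ctr (x *: delta_mx 0 p)) 0).
apply/matrixP => i j.
transitivity (x * ((i == lshift n 0) && (j == rshift 1 p))%:R -
  qconj x * ((i == rshift 1 p) && (j == lshift n 0))%:R); first by rewrite !mxE.
case: (split_ordP i) => c ->; case: (split_ordP j) => d ->;
  rewrite ?block_mxEul ?block_mxEur ?block_mxEdl ?block_mxEdr !mxE !eq_shift ?ord1 ?eqxx ?andbF ?andbT ?mulr0 ?oppr0 ?addr0 ?add0r//=.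
congr (- _); case: (c == p); rewrite ?mulr1 ?mulr0 ?qconj0//.
Qed.

Lemma vert_mm x w : vert (mm x w) = mm x 0.
Proof. by rewrite /vert mm00 scale_delta00. Qed.

Lemma scale_mm (c : R) x w : qreal c *: mm x w = mm (qreal c * x) (qreal c *: w).
Proof.
change (qreal c *: (block_mx (x%:M : 'M[H]_1) w (- ctr w) 0 : 'M[H]_(1 + n)) =
  block_mx ((qreal c * x)%:M : 'M[H]_1) (qreal c *: w) (- ctr (qreal c *: w)) 0).
rewrite scale_block_mx scaler0 scale_scalar_mx scalerN; congr block_mx; congr (- _).
by apply/matrixP => i j; rewrite [LHS]mxE !ctrE [in RHS]mxE qconjM qconj_real qreal_comm.
Qed.

Lemma horiz_mm x w : horiz (mm x w) = mm 0 w.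
Proof.
rewrite /horiz vert_mm.
change (block_mx (x%:M : 'M[H]_1) w (- ctr w) 0 - block_mx (x%:M : 'M[H]_1) 0 (- ctr 0) 0 =
  block_mx ((0 : H)%:M : 'M[H]_1) w (- ctr w) 0).
by rewrite opp_block_mx add_block_mx ctr0 !subrr !oppr0 !addr0 raddf0.
Qed.

Lemma qr_sum (I : Type) (r : seq I) (P : pred I) (f : I -> H) :
  qr (\sum_(i <- r | P i) f i) = \sum_(i <- r | P i) qr (f i).
Proof. by elim/big_rec2: _ => [//|i a b _ <-]. Qed.

Lemma B0_mm x y w w' : B0 (mm x w) (mm y w') = 2 * hdot w w' - qr (x * y).
Proof.
have tr1 (X : 'M[H]_1) : \tr X = X 0 0 by rewrite /mxtrace big_ord1.
have tr2 : qr (\tr (ctr w *m w')) = hdot w w'.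
  rewrite /mxtrace qr_sum hdotE; apply: eq_bigr => p _.
  by rewrite mxE big_ord1 ctrE !qE /=; ring.
change (- qr (\tr ((block_mx (x%:M : 'M[H]_1) w (- ctr w) 0 : 'M[H]_(1 + n)) *m
    block_mx (y%:M : 'M[H]_1) w' (- ctr w') 0)) = 2 * hdot w w' - qr (x * y)).
rewrite mulmx_block mxtrace_block tr1 !mulmx0 !addr0 mulNmx !mulmxN.
rewrite -scalar_mxM.
have -> : ((x * y)%:M - w *m ctr w') 0 0 = x * y - (w *m ctr w') 0 0.
  by rewrite !mxE eqxx mulr1n.
have -> : \tr (- (ctr w *m w')) = - \tr (ctr w *m w') by exact: raddfN.
rewrite !qrD !qrN tr2 -/(hdot w w').
ring.
Qed.

Variables a t : R.
Hypotheses (a_gt0 : 0 < a) (t_gt0 : 0 < t).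

Lemma gmetric_mm x y w w' : gmetric a t (mm x w) (mm y w') =
  2 * a * hdot w w' + 2 * a * t * (- qr (x * y)).
Proof.
rewrite /gmetric !horiz_mm !vert_mm !B0_mm !(mulr0, mul0r, oppr0).
have h0 (u : 'rV[H]_n) : hdot 0 u = 0 by rewrite /hdot mul0mx mxE.
rewrite !h0; ring.
Qed.

Definition rscv : R := (Num.sqrt (2 * t * a))^-1.
Definition rsch : R := (Num.sqrt (2 * a))^-1.

Lemma rscv2 : rscv ^+ 2 * (2 * a * t) = 1.
Proof.
have p : 0 < 2 * t * a by rewrite !mulr_gt0.
by rewrite exprVn sqr_sqrtr ?ltW//; field; rewrite !gt_eqF.
Qed.

Lemma rsch2 : rsch ^+ 2 * (2 * a) = 1.
Proof.
have p : 0 < 2 * a by rewrite !mulr_gt0.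
by rewrite exprVn sqr_sqrtr ?ltW//; field; rewrite !gt_eqF.
Qed.

(** Isometry of R^N with the complement m carrying g_{a,t}; it takes the standard basis to
    [onbasis]. In these coordinates the isotropy action [act] involves neither a nor t. *)
Definition iom v : 'M[H]_n.+1 := mm (qreal rscv * vv v) (qreal rsch *: hv v).

Lemma hdotZ c d w w' : hdot (qreal c *: w) (qreal d *: w') = c * d * hdot w w'.
Proof.
rewrite !hdotE mulr_sumr; apply: eq_bigr => p _; rewrite !mxE !qE /=; ring.
Qed.

Lemma gmetric_iom u v : gmetric a t (iom u) (iom v) = vdot u v.
Proof.
rewrite gmetric_mm hdotZ vdotE.
have -> : qr (qreal rscv * vv u * (qreal rscv * vv v)) = rscv ^+ 2 * qr (vv u * vv v).
  by rewrite !qE /=; ring.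
have := rscv2; have := rsch2; move: (hdot _ _) (qr _) => X Y e1 e2.
transitivity ((rsch ^+ 2 * (2 * a)) * X - (rscv ^+ 2 * (2 * a * t)) * Y); first by ring.
by rewrite e1 e2 !mul1r.
Qed.

Lemma vc_delta (j : 'I_N) k : (k < N)%N -> vc (delta_mx 0 j) k = (k == j)%:R.
Proof. by move=> kN; rewrite /vc mxE eqxx /= -val_eqE /= inordK. Qed.

Lemma hv_delta (p : 'I_n) r (j : 'I_N) : (r < 4)%N -> j = (4 * p + r.+2)%N :> nat ->
  hv (delta_mx 0 j) =
  (match r with 0 => q_j R | 1 => q_k R | 2 => q_i R | _ => -1 end) *: delta_mx 0 p.
Proof.
move=> r4 jE; apply/rowP => p'; rewrite !mxE eqxx /= !vc_delta ?Ndim_ltn// jE.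
have [->|pp] := eqVneq p' p.
  rewrite !eqn_add2l; case: r r4 jE => [|[|[|[|]]]]//= _ _; apply: quatP; rewrite /= ?mulr1 ?oppr0//; ring.
have {}pp : (p' != p :> nat) by [].
by do !rewrite (_ : (_ == _ :> nat) = false) ?oppr0 ?mulr0//; apply/negbTE/eqP; lia.
Qed.

Lemma hv_delta_vert (j : 'I_N) : (j < 2)%N -> hv (delta_mx 0 j) = 0.
Proof.
move=> j2; apply/rowP => p; rewrite !mxE !vc_delta ?Ndim_ltn//.
by do !rewrite (_ : (_ == _ :> nat) = false) ?oppr0//; apply/negbTE/eqP; lia.
Qed.

Lemma vv_delta_hor (j : 'I_N) : (2 <= j)%N -> vv (delta_mx 0 j) = 0.
Proof.
move=> j2; rewrite /vv !vc_delta//.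
by do !rewrite (_ : (_ == _ :> nat) = false) ?oppr0//; apply/negbTE/eqP; lia.
Qed.

Lemma mbasis_mm (j : 'I_N) : @mbasis R n (j + 2) = mm (vv (delta_mx 0 j)) (hv (delta_mx 0 j)).
Proof.
case: (Ndim_case j) => [j0|j1|[p [r [r4 jr]]]].
- rewrite hv_delta_vert j0// /mbasis /= /Fmx eqxx -scaleNr scale_delta00; congr mm.
  by rewrite /vv !vc_delta// j0 /=; apply: quatP; rewrite /= ?oppr0.
- rewrite hv_delta_vert j1// /mbasis /= /Fmx eqxx scale_delta00; congr mm.
  by rewrite /vv !vc_delta// j1 /=; apply: quatP; rewrite /= ?oppr0.
rewrite vv_delta_hor; last by rewrite jr; lia.
rewrite (hv_delta r4 jr) -scale_delta_row jr.
have -> : ((4 * p + r.+2) + 2 = (p.+1) * 4 + r)%N by lia.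
rewrite /mbasis !gtn_eqF//; try by lia.
rewrite divnMDl// divn_small// addn0 modnMDl modn_small//.
have -> : inord p.+1 = rshift 1 p :> 'I_n.+1.
  by apply/val_inj; rewrite /= inordK ?add1n// ltnS ltn_ord.
have ne : (ord0 == rshift 1 p :> 'I_n.+1) = false by [].
rewrite /Fmx /Emx ne.
case: r r4 {jr} => [|[|[|[|]]]]//= _; rewrite ?scalerDr.
- by congr (_ + _); rewrite -scaleNr; congr (_ *: _); apply: quatP; rewrite /= ?oppr0 ?opprK.
- by congr (_ + _); rewrite -scaleNr; congr (_ *: _); apply: quatP; rewrite /= ?oppr0 ?opprK.
- by congr (_ + _); rewrite -scaleNr; congr (_ *: _); apply: quatP; rewrite /= ?oppr0 ?opprK.
- by rewrite addrC scaleN1r qconjN qconj1 scaleN1r opprK.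
Qed.

Lemma onbasis_iom j : onbasis a t j = iom (delta_mx 0 j).
Proof.
rewrite /onbasis mbasis_mm /iom -/(qreal _) /rscale scale_mm.
case: ltnP => j2; first by rewrite -/rscv (hv_delta_vert j2) !scaler0.
by rewrite -/rsch (vv_delta_hor j2) !mulr0.
Qed.

Lemma vvZD (c : R) u v : vv (c *: u + v) = qreal c * vv u + vv v.
Proof. by rewrite /vv /vc !mxE; apply: quatP; rewrite !qE /=; ring. Qed.

Lemma hvZD (c : R) u v : hv (c *: u + v) = qreal c *: hv u + hv v.
Proof. by apply/rowP => p; rewrite !mxE /vc !mxE; apply: quatP; rewrite !qE /=; ring. Qed.

Lemma mmD x y w w' : mm (x + y) (w + w') = mm x w + mm y w'.
Proof.
change (block_mx ((x + y)%:M : 'M[H]_1) (w + w') (- ctr (w + w')) 0 =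
  block_mx (x%:M : 'M[H]_1) w (- ctr w) 0 + block_mx (y%:M : 'M[H]_1) w' (- ctr w') 0).
by rewrite add_block_mx scalar_mxD ctrD opprD addr0.
Qed.

Lemma iomZD (c : R) u v : iom (c *: u + v) = rscale c (iom u) + iom v.
Proof.
rewrite /iom vvZD hvZD /rscale -/(qreal c) scale_mm -mmD; congr mm.
  by rewrite mulrDr !mulrA -!qrealM mulrC.
by rewrite scalerDr !scalerA -!qrealM mulrC.
Qed.

Definition act (z : R[i]) (A : 'M[H]_n) v : 'rV[R]_N :=
  mkv (quat_of_complex z * vv v * qconj (quat_of_complex z))
      (quat_of_complex z *: (hv v *m ctr A)).

Lemma vv_act z A v : vv (act z A v) = quat_of_complex z * vv v * qconj (quat_of_complex z).
Proof. by apply: vv_mkv; rewrite !qE /=; ring. Qed.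

Lemma hv_act z A v : hv (act z A v) = quat_of_complex z *: (hv v *m ctr A).
Proof. exact: hv_mkv. Qed.

Lemma emb_iom z A v : emb z A *m iom v *m ctrans (emb z A) = iom (act z A v).
Proof.
rewrite emb_conj /iom vv_act hv_act; congr mm.
  by rewrite !mulrA [qreal _ * _]qreal_comm.
by rewrite -scalemxAl !scalerA qreal_comm.
Qed.

Opaque vv hv act.

Lemma act_linear z A : linear (act z A).
Proof.
move=> c u v.
have [e1 e2 e3] := And3 (vv_act z A (c *: u + v)) (vv_act z A u) (vv_act z A v).
have [f1 f2 f3] := And3 (hv_act z A (c *: u + v)) (hv_act z A u) (hv_act z A v).
move: (act z A _) e1 f1 (act z A u) e2 f2 (act z A v) e3 f3 => W e1 f1 U e2 f2 V e3 f3.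
apply: vhP.
  apply: (etrans e1); apply: (etrans _ (esym (vvZD c U V))).
  rewrite e2 e3 (vvZD c u v).
  move: (quat_of_complex z) (qconj _) (vv u) (vv v) => q q' y y'.
  by rewrite (mulrDr q (qreal c * y) y') (mulrDl (q * (qreal c * y)) (q * y') q') !mulrA -(qreal_comm c q).
apply: (etrans f1); apply: (etrans _ (esym (hvZD c U V))).
rewrite f2 f3 (hvZD c u v) mulmxDl scalerDr -scalemxAl !scalerA.
by rewrite (qreal_comm c (quat_of_complex z)).
Qed.
HB.instance Definition _ z A := GRing.isLinear.Build R 'rV[R]_N 'rV[R]_N *:%R (act z A) (act_linear z A).

Lemma isotropyE z A v : v *m (isotropy a t (emb z A))^T = act z A v.
Proof.
rewrite [in RHS](row_sum_delta v) linear_sum; apply/rowP => i; rewrite summxE mxE.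
apply: eq_bigr => j _; rewrite linearZ !mxE.
rewrite !onbasis_iom emb_iom gmetric_iom; congr (_ * _).
rewrite /vdot (bigD1 i)//= big1 => [|k ki]; last by rewrite !mxE (negPf ki) andbF mul0r.
by rewrite !mxE !eqxx mul1r addr0.
Qed.

End Isotropy.

(** * Lifting to the spin group *)

Section Rotation.
Variables (R : realType) (N : nat).
Implicit Types (u v f g : 'rV[R]_N).

Lemma vdotC u v : vdot u v = vdot v u.
Proof. by apply: eq_bigr => i _; rewrite mulrC. Qed.
Lemma vdotDl u v w : vdot (u + v) w = vdot u w + vdot v w.
Proof. by rewrite -big_split; apply: eq_bigr => i _; rewrite mxE mulrDl. Qed.
Lemma vdotZl c u w : vdot (c *: u) w = c * vdot u w.
Proof. by rewrite mulr_sumr; apply: eq_bigr => i _; rewrite mxE mulrA. Qed.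
Lemma vdotNl u w : vdot (- u) w = - vdot u w.
Proof. by rewrite -scaleN1r vdotZl mulN1r. Qed.
Lemma vdotDr u v w : vdot w (u + v) = vdot w u + vdot w v.
Proof. by rewrite vdotC vdotDl !(vdotC w). Qed.
Lemma vdotZr c u w : vdot w (c *: u) = c * vdot w u.
Proof. by rewrite vdotC vdotZl (vdotC w). Qed.

(** For orthonormal f and g and c^2 + s^2 = 1: the rotation by twice the angle of (c, s), from g
    towards f, in their plane, and the identity on the complement. *)
Definition prot f g (c s : R) v :=
  v + (2 * c * s * vdot v g - 2 * s ^+ 2 * vdot v f) *: f
    - (2 * c * s * vdot v f + 2 * s ^+ 2 * vdot v g) *: g.

(** The element c - s f g for orthonormal f and g ([rotvE]), written as a product of two unit
    vectors so that it visibly lies in the spin group. *)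
Definition rotv f g (c s : R) : Cl R N := clvec (- f) * clvec (c *: f + s *: g).

Lemma rotvE f g c s : unitv f -> vdot f g = 0 -> rotv f g c s = c%:A - s *: (clvec f * clvec g).
Proof.
move=> f1 fg; rewrite /rotv linearN mulNr linearD !linearZ /= mulrDr -!scalerAr clvec_sqr f1.
by rewrite scaleN1r !scalerN opprD !opprK.
Qed.

Lemma unitv_comb f g c s : unitv f -> unitv g -> vdot f g = 0 -> c ^+ 2 + s ^+ 2 = 1 ->
  unitv (c *: f + s *: g).
Proof.
rewrite /unitv => f1 g1 fg cs; rewrite vdotDl !vdotDr !vdotZl !vdotZr f1 g1 fg (vdotC g) fg.
by rewrite -[RHS]cs; ring.
Qed.

Lemma rotv_Spin f g c s : unitv f -> unitv g -> vdot f g = 0 -> c ^+ 2 + s ^+ 2 = 1 ->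
  Spin R N (rotv f g c s).
Proof.
move=> f1 g1 fg cs; apply/SpinP; exists [:: - f; c *: f + s *: g]; split=> //; last by rewrite /= mulr1.
by move=> v; rewrite !inE => /orP[]/eqP->; [exact: unitvN|exact: unitv_comb].
Qed.

Lemma rotv_cover f g c s : unitv f -> unitv g -> vdot f g = 0 -> c ^+ 2 + s ^+ 2 = 1 ->
  exists B, spin_cover (rotv f g c s) B /\ forall v, v *m B^T = prot f g c s v.
Proof.
move=> f1 g1 fg cs; exists (rho (- f) *m rho (c *: f + s *: g)); split.
  by apply: coverM; apply: cover_rho; [exact: unitvN|exact: unitv_comb].
move=> v; rewrite trmx_mul mulmxA !rhoE !scalerN -scaleNr.
set h := c *: f + s *: g.
have hf : vdot h f = c by rewrite /h vdotDl !vdotZl f1 (vdotC g) fg mulr1 mulr0 addr0.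
have vh : vdot v h = c * vdot v f + s * vdot v g by rewrite vdotDr !vdotZr.
rewrite -[- f]scaleN1r vdotZr vdotDl vdotNl vdotZl hf vh /prot /h.
rewrite scalerDr !scalerA opprB !addrA.
apply/rowP => i; rewrite !mxE.
move: (vdot v f) (vdot v g) (v 0 i) (f 0 i) (g 0 i) => x y z p q.
have c2 : c * c = 1 - s * s by rewrite -!expr2 -cs addrK.
transitivity (z + (2 * c * s * y + 2 * (c * c) * x - 2 * x) * p -
  (2 * c * s * x + 2 * s ^+ 2 * y) * q); first by ring.
by rewrite c2; ring.
Qed.

Lemma clvec_orth u v : vdot u v = 0 -> clvec u * clvec v = - (clvec v * clvec u).
Proof. by move=> uv; apply/eqP; rewrite -addr_eq0 clvec_anti uv mulr0 oppr0 scale0r. Qed.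

Lemma clvec_orth_sqr u v : unitv u -> unitv v -> vdot u v = 0 ->
  (clvec u * clvec v) * (clvec u * clvec v) = -1.
Proof.
move=> u1 v1 uv; rewrite mulrA -[_ * _ * clvec u]mulrA (clvec_orth (u := v)) 1?vdotC//.
by rewrite mulrN mulrA clvec_sqr u1 scaleN1r mulN1r opprK clvec_sqr v1 scaleN1r.
Qed.

Section FourFrame.
Variables f1 f2 f3 f4 : 'rV[R]_N.
Hypotheses (u1 : unitv f1) (u2 : unitv f2) (u3 : unitv f3) (u4 : unitv f4).
Hypotheses (v12 : vdot f1 f2 = 0) (v13 : vdot f1 f3 = 0) (v14 : vdot f1 f4 = 0).
Hypotheses (v23 : vdot f2 f3 = 0) (v24 : vdot f2 f4 = 0) (v34 : vdot f3 f4 = 0).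
Variables c s : R.
Hypothesis cs : c ^+ 2 + s ^+ 2 = 1.

(* Applied to the frame [w, j w, i w, k w], for which [gd] annihilates the vacuum and commutes with
   multiplication by omega. *)
Definition gmu : Cl R N := rotv f1 f2 c s * rotv f3 f4 c s.
Definition gd : Cl R N := - (clvec f1 * clvec f2 + clvec f3 * clvec f4).

Lemma gmu_Spin : Spin R N gmu.
Proof. by apply: SpinM; exact: rotv_Spin. Qed.

(** The products p = f1 f2 and q = f3 f4 commute and have square -1, so (p + q)^2 = 2 p q - 2. Hence
    (c - s p)(c - s q) is a polynomial in [gd] = -(p + q), and it inherits whatever [gd] kills or
    commutes with. *)
Lemma gmuE : gmu = (c ^+ 2)%:A + (c * s) *: gd + (s ^+ 2) *: (1 + 2^-1 *: (gd * gd)).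
Proof.
rewrite /gmu (rotvE _ _ u1 v12) (rotvE _ _ u3 v34) /gd.
have p2 := clvec_orth_sqr u1 u2 v12; have q2 := clvec_orth_sqr u3 u4 v34.
have : clvec f3 * clvec f4 * (clvec f1 * clvec f2) = clvec f1 * clvec f2 * (clvec f3 * clvec f4).
  have e13 := clvec_orth v13; have e14 := clvec_orth v14.
  have e23 := clvec_orth v23; have e24 := clvec_orth v24.
  move: (clvec f1) (clvec f2) (clvec f3) (clvec f4) e13 e14 e23 e24 => a b d e e13 e14 e23 e24.
  apply/esym; rewrite -mulrA [b * (d * e)]mulrA e23 mulNr mulrN -[d * b * e]mulrA e24 mulrN mulrN opprK.
  by rewrite !mulrA e13 mulNr mulNr -[d * a * e]mulrA e14 mulrN mulNr opprK !mulrA.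
move: (clvec f1 * clvec f2) (clvec f3 * clvec f4) p2 q2 => p q p2 q2 pq.
have -> : - (p + q) * - (p + q) = p * q + p * q - 1 - 1.
  by rewrite mulrNN mulrDl !mulrDr pq p2 q2; apply/ffunP => A; rewrite !(claddE, cloppE); ring.
rewrite mulrBl !mulrBr -!scalerAl -!scalerAr !mul1r !mulr1 !scalerA.
apply/ffunP => A; rewrite !(clscaleE, claddE, cloppE).
move: ((p * q) A) (p A) (q A) ((1 : Cl R N) A) => x y z t; by field.
Qed.

Lemma gmu_cover : exists B, spin_cover gmu B /\
  forall v, v *m B^T = prot f1 f2 c s v + (prot f3 f4 c s v - v).
Proof.
have [B1 [c1 r1]] := rotv_cover u1 u2 v12 cs; have [B2 [c2 r2]] := rotv_cover u3 u4 v34 cs.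
exists (B1 *m B2); split; first exact: coverM.
move=> v; rewrite trmx_mul mulmxA r2 r1 /prot.
rewrite -!addrA; set a := _ *: f3; set b := - (_ *: f4).
have -> : vdot (v + (a + b)) f1 = vdot v f1.
  by rewrite !vdotDl vdotNl !vdotZl (vdotC f3) v13 (vdotC f4) v14 !mulr0 oppr0 !addr0.
have -> : vdot (v + (a + b)) f2 = vdot v f2.
  by rewrite !vdotDl vdotNl !vdotZl (vdotC f3) v23 (vdotC f4) v24 !mulr0 oppr0 !addr0.
by apply/rowP => i; rewrite !mxE; ring.
Qed.
End FourFrame.

End Rotation.

(** * Creation and annihilation along tangent vectors, and multiplication by omega *)

Section Generator.
Variables (R : realType) (n : nat).
Local Notation H := (quat R).
Local Notation C := (R[i]).
Local Notation N := (Ndim n).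
Local Notation k := ((Ndim n)./2).
Implicit Types (v : 'rV[R]_N) (w : 'rV[H]_n) (x : ext R k) (z : 'I_k -> C).

Lemma Ndim_even : ~~ odd N. Proof. by rewrite /Ndim /= oddM. Qed.
Lemma Ndim_half : k = (2 * n).+1. Proof. by rewrite /Ndim; lia. Qed.
Lemma Ndim_gt0 : (0 < N)%N. Proof. by []. Qed.
Local Notation eN := Ndim_even.

(** With [ib p], the zero-based positions of y_{2(p+1)} and y_{2(p+1)+1}; position 0 is y_1. *)
Definition ia (p : 'I_n) : 'I_k := inord (2 * p + 1).
Definition ib (p : 'I_n) : 'I_k := inord (2 * p + 2).

Lemma val_ia p : ia p = (2 * p + 1)%N :> nat.
Proof. by rewrite inordK// -[X in (_ < X)%N]/k Ndim_half; have := ltn_ord p; lia. Qed.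
Lemma val_ib p : ib p = (2 * p + 2)%N :> nat.
Proof. by rewrite inordK// -[X in (_ < X)%N]/k Ndim_half; have := ltn_ord p; lia. Qed.

Lemma idx_case (q : 'I_k) : q = ord0 \/ (exists p, q = ia p) \/ (exists p, q = ib p).
Proof.
have [q0|q0] := eqVneq (q : nat) 0%N; first by left; apply/val_inj.
right; have qk : (q < (2 * n).+1)%N by rewrite -Ndim_half.
have pn : ((q.-1)./2 < n)%N by lia.
have [oq|eq] := boolP (odd q); [left|right]; exists (Ordinal pn); apply/val_inj.
  by rewrite [RHS]val_ia; change (q = 2 * (q.-1)./2 + 1 :> nat)%N; lia.
by rewrite [RHS]val_ib; change (q = 2 * (q.-1)./2 + 2 :> nat)%N; lia.
Qed.

Lemma sum_idx (V : nmodType) (f : 'I_k -> V) :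
  \sum_q f q = f ord0 + \sum_p (f (ia p) + f (ib p)).
Proof.
pose g (j : nat) := f (inord j).
have -> : \sum_q f q = \sum_(j < (2 * n).+1) g j.
  rewrite -Ndim_half; apply: eq_bigr => q _; rewrite /g; congr f.
  by apply/val_inj; rewrite /= inordK.
rewrite big_ord_recl; congr (_ + _); first by congr f; apply/val_inj; rewrite /= inordK.
have -> : \sum_(p < n) (f (ia p) + f (ib p)) = \sum_(0 <= p < n) (g (2 * p + 1)%N + g (2 * p + 2)%N).
  by rewrite big_mkord.
have -> : \sum_(i < 2 * n) g (lift ord0 i) = \sum_(0 <= i < 2 * n) g i.+1 by rewrite big_mkord.
elim: {1 2}n => [|m ih]; first by rewrite !big_geq.
rewrite mulnS [(2 + _)%N]addnC [in RHS]big_nat_recr//= -ih.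
by rewrite !addnS addn0 !big_nat_recr//= -!addrA.
Qed.

Definition cre z x : ext R k := \sum_q z q *: crea q x.
Definition ann z x : ext R k := \sum_q z q *: anni q x.

Lemma cre_linear z : linear (cre z).
Proof.
move=> c x y; rewrite /cre scaler_sumr -big_split; apply: eq_bigr => q _ /=.
by rewrite linearD linearZ scalerDr !scalerA mulrC.
Qed.
HB.instance Definition _ z := GRing.isLinear.Build C (ext R k) (ext R k) *:%R (cre z) (cre_linear z).

Lemma ann_linear z : linear (ann z).
Proof.
move=> c x y; rewrite /ann scaler_sumr -big_split; apply: eq_bigr => q _ /=.
by rewrite linearD linearZ scalerDr !scalerA mulrC.
Qed.
HB.instance Definition _ z := GRing.isLinear.Build C (ext R k) (ext R k) *:%R (ann z) (ann_linear z).

Lemma cre_anti z z' x : cre z (cre z' x) = - cre z' (cre z x).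
Proof.
rewrite /cre; under eq_bigr do rewrite linear_sum scaler_sumr.
under [in RHS]eq_bigr do rewrite linear_sum scaler_sumr.
rewrite [in RHS]exchange_big -sumrN; apply: eq_bigr => q _ /=.
rewrite -sumrN; apply: eq_bigr => q' _ /=.
by rewrite !linearZ /= crea_anti !scalerN !scalerA mulrC.
Qed.

Lemma cre_sqr z x : cre z (cre z x) = 0.
Proof.
have /eqP := cre_anti z z x; rewrite -addr_eq0 -mulr2n -scaler_nat scaler_eq0 pnatr_eq0 /=.
by move/eqP.
Qed.

Lemma cre_ann z z' x : cre z (ann z' x) + ann z' (cre z x) = (\sum_q z q * z' q) *: x.
Proof.
rewrite /cre /ann; under eq_bigr do rewrite linear_sum scaler_sumr.
under [X in _ + X]eq_bigr do rewrite linear_sum scaler_sumr.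
rewrite [X in _ + X]exchange_big -big_split scaler_suml; apply: eq_bigr => q _ /=.
rewrite -big_split /= (bigD1 q)//= big1 ?addr0 => [|q' q'q].
  rewrite !linearZ /= !scalerA [z' q * _]mulrC -scalerDr crea_anni_anti eqxx scale1r//.
by rewrite !linearZ /= !scalerA [z' q' * _]mulrC -scalerDr crea_anni_anti eq_sym (negPf q'q) scale0r scaler0.
Qed.

Lemma ann_vac z : ann z (ebasis finset.set0) = 0.
Proof. by rewrite /ann big1// => q _; rewrite anni_vac scaler0. Qed.

Lemma creZ z c x : cre (fun q => c * z q) x = c *: cre z x.
Proof. by rewrite /cre scaler_sumr; apply: eq_bigr => q _; rewrite scalerA. Qed.
Lemma annZ z c x : ann (fun q => c * z q) x = c *: ann z x.
Proof. by rewrite /ann scaler_sumr; apply: eq_bigr => q _; rewrite scalerA. Qed.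

(** The coefficients of v along the y_q, up to the factor sqrt 2; those along the x_q are their
    conjugates [zetab]. Clifford multiplication by v is i times creation by [zeta] plus annihilation
    by [zetab]. *)
Definition zeta v (q : 'I_k) : C := (vc v (2 * q) +i* - vc v (2 * q + 1))%C.
Definition zetab v (q : 'I_k) : C := (vc v (2 * q) +i* vc v (2 * q + 1))%C.

Lemma cliff_genCA (j : 'I_N) x : cliff_gen j x =
  if odd j then crea (qof eN j) x - anni (qof eN j) x
  else 'i%C *: (crea (qof eN j) x + anni (qof eN j) x).
Proof.
apply/ffunP => D; rewrite (cliff_genE eN); case: ifP => _.
  rewrite extDE extNE !ffunE; case: (_ \in D); rewrite /= /psg ?expr0 ?expr1 ?subr0 ?sub0r ?mul1r//.
  by rewrite !mulNr mul1r.
by rewrite extZE extDE !ffunE -mulrA; congr (_ * _); case: (_ \in D); rewrite ?addr0 ?add0r.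
Qed.

Lemma sum_pairs (V : nmodType) (f : nat -> V) :
  \sum_(j < N) f j = \sum_(q < k) (f (2 * q)%N + f (2 * q + 1)%N).
Proof.
have -> : \sum_(j < N) f j = \sum_(0 <= j < 2 * k) f j.
  have e : N = (2 * k)%N by rewrite Ndim_half /Ndim; lia.
  by rewrite -(big_mkord xpredT) -e.
rewrite -(big_mkord xpredT (fun q => f (2 * q)%N + f (2 * q + 1)%N)).
elim: k => [|m ih]; first by rewrite !big_geq.
rewrite mulnS [(2 + _)%N]addnC [in RHS]big_nat_recr//= -ih.
by rewrite !addnS addn0 !big_nat_recr//= -!addrA.
Qed.

Lemma spin_rep_zeta v x : spin_rep (clvec v) x = 'i%C *: (cre (zeta v) x + ann (zetab v) x).
Proof.
rewrite spin_rep_clvec.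
pose f j := (vc v j)%:C%C *: cliff_gen (inord j : 'I_N) x.
under eq_bigr => j _ do rewrite -vcE -{2}(inord_val j) -/(f j).
rewrite sum_pairs /cre /ann -big_split scaler_sumr; apply: eq_bigr => q _ /=.
have qk : (2 * q + 1 < N)%N.
  have : (q < (2 * n).+1)%N by rewrite -Ndim_half.
  by rewrite /Ndim; lia.
have qk' : (2 * q < N)%N by lia.
rewrite /f !cliff_genCA /= !inordK//.
have -> : odd (2 * q) = false by lia.
have -> : odd (2 * q + 1) = true by lia.
have e1 : qof eN (inord (2 * q)) = q by apply/val_inj; rewrite /= inordK//; lia.
have e2 : qof eN (inord (2 * q + 1)) = q by apply/val_inj; rewrite /= inordK//; lia.
rewrite e1 e2 scalerBr !scalerDr !scalerA addrACA -scalerDl -scaleNr -scalerDl.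
by congr (_ *: _ + _ *: _); apply/eqP; rewrite eq_complex /= !(mul0r, mul1r, mulr0, mulr1); apply/andP; split; apply/eqP; ring.
Qed.

Definition vac : ext R k := ebasis finset.set0.

(* [z] and [z'] are the [zeta]-coordinates of [w] and [j w]; quaternionic structure. *)
Definition jrel (z z' : 'I_k -> C) := [/\ z ord0 = 0, z' ord0 = 0 &
  forall p, z' (ia p) = 'i%C * (z (ib p))^*%C /\ z' (ib p) = - 'i%C * (z (ia p))^*%C].

Definition zconj z : 'I_k -> C := fun q => (z q)^*%C.

Definition Om x : ext R k := \sum_p crea (ia p) (crea (ib p) x).

Lemma Om_linear : linear Om.
Proof.
move=> c x y; rewrite /Om scaler_sumr -big_split; apply: eq_bigr => q _ /=.
by rewrite !linearP.
Qed.
HB.instance Definition _ := GRing.isLinear.Build C (ext R k) (ext R k) *:%R Om Om_linear.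

Lemma cre_Om z x : cre z (Om x) = Om (cre z x).
Proof.
rewrite /Om linear_sum /=; apply: eq_bigr => p _.
rewrite /cre !linear_sum /=; apply: eq_bigr => q _.
rewrite !linearZ /= (crea_anti q (ia p)) (crea_anti q (ib p)).
by congr (_ *: _); rewrite linearN opprK.
Qed.

Lemma anni_crea q q' x : anni q (crea q' x) = (q' == q)%:R *: x - crea q' (anni q x).
Proof. by rewrite -crea_anni_anti addrC addKr. Qed.

Lemma ann_crea z q x : ann z (crea q x) = z q *: x - crea q (ann z x).
Proof.
rewrite /ann linear_sum /=; under eq_bigr do rewrite anni_crea scalerBr scalerA.
rewrite sumrB (bigD1 q)//= eqxx mulr1 big1 ?addr0; last first.
  by move=> q' q'q; rewrite eq_sym (negPf q'q) mulr0 scale0r.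
by congr (_ - _); apply: eq_bigr => q' _; rewrite linearZ.
Qed.

Lemma ann_Om z x : ann z (Om x) = Om (ann z x) +
  \sum_p (z (ia p) *: crea (ib p) x - z (ib p) *: crea (ia p) x).
Proof.
rewrite /Om linear_sum -big_split; apply: eq_bigr => p _ /=.
rewrite !ann_crea linearB linearZ /= opprB addrCA; congr (_ + _).
Qed.

(** Contracting omega with the conjugate of z gives the form with coordinates i z', by the
    quaternionic relation; the commutator of annihilation with [Om] is therefore a creation
    operator. *)
Lemma jrel_ann_Om z z' x : jrel z z' -> ann (zconj z) (Om x) = Om (ann (zconj z) x) + 'i%C *: cre z' x.
Proof.
move=> [_ z0 zz]; rewrite ann_Om; congr (_ + _).
rewrite /cre sum_idx z0 scale0r add0r scaler_sumr; apply: eq_bigr => p _.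
have [-> ->] := zz p; rewrite /zconj scalerDr !scalerA.
have -> (c : C) : 'i%C * ('i%C * c) = - c by rewrite mulrA sqr_iC mulN1r.
have -> (c : C) : 'i%C * (- 'i%C * c) = c by rewrite mulrA mulrN sqr_iC opprK mul1r.
by rewrite scaleNr addrC.
Qed.

Lemma jrel_ann_Om' z z' x : jrel z z' -> ann (zconj z') (Om x) = Om (ann (zconj z') x) - 'i%C *: cre z x.
Proof.
move=> [z0 _ zz]; rewrite ann_Om; congr (_ + _).
rewrite /cre sum_idx z0 scale0r add0r scaler_sumr -sumrN; apply: eq_bigr => p _.
have [e1 e2] := zz p; rewrite /zconj e1 e2.
have -> (c : C) : ('i%C * c^*%C)^*%C = - 'i%C * c.
  by case: c => c d; apply/eqP; rewrite eq_complex /=; apply/andP; split; apply/eqP; ring.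
have -> (c : C) : (- 'i%C * c^*%C)^*%C = 'i%C * c.
  by case: c => c d; apply/eqP; rewrite eq_complex /=; apply/andP; split; apply/eqP; ring.
by rewrite scalerDr !scalerA mulNr scaleNr opprD addrC.
Qed.

Lemma jrel_orth z z' : jrel z z' -> \sum_q z' q * zconj z q = 0.
Proof.
move=> [z0 _ zz]; rewrite sum_idx /zconj z0 conjc0 mulr0 add0r big1// => p _.
by have [-> ->] := zz p; ring.
Qed.

(** The action of [gd] on spinors, by [spin_rep_Dop]. Each term annihilates before it creates, so
    the vacuum is killed. *)
Definition Dop z z' x : ext R k := 2 *: (cre z (ann (zconj z') x) - cre z' (ann (zconj z) x)).

Lemma Dop_vac z z' : Dop z z' vac = 0.
Proof. by rewrite /Dop /vac !ann_vac !(linear0, subrr, addr0, scaler0). Qed.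

(** The commutator of each term with [Om] is a multiple of the square of [cre z] or of [cre z'], and
    both squares vanish. *)
Lemma Dop_Om z z' x : jrel z z' -> Dop z z' (Om x) = Om (Dop z z' x).
Proof.
move=> jr; rewrite /Dop linearZ; congr (_ *: _).
rewrite (jrel_ann_Om _ jr) (jrel_ann_Om' _ jr) linearB linearD linearB /= !linearZ /= !cre_sqr.
by rewrite oppr0 !scaler0 !addr0 !cre_Om.
Qed.

Lemma Dop_crea0 z z' x : jrel z z' -> Dop z z' (crea ord0 x) = crea ord0 (Dop z z' x).
Proof.
move=> [z0 z0' _]; rewrite /Dop linearZ; congr (_ *: _).
have c0 u y : cre u (crea ord0 y) = - crea ord0 (cre u y).
  rewrite /cre linear_sum -sumrN; apply: eq_bigr => q _.
  by rewrite linearZ /= crea_anti scalerN.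
rewrite !ann_crea /zconj z0 z0' conjc0 !scale0r !sub0r !linearN /= !c0 !opprK.
by rewrite linearB.
Qed.

Definition rowv w : 'rV[R]_N := mkv 0 w.

Lemma hv_rowv w : hv (rowv w) = w. Proof. exact: hv_mkv. Qed.
Lemma vv_rowv w : vv (rowv w) = 0. Proof. exact: vv_mkv. Qed.

Lemma zeta0 w : zeta (rowv w) ord0 = 0.
Proof. by rewrite /zeta /rowv !vc_mkv//= !oppr0. Qed.

Lemma zeta_ia w p : zeta (rowv w) (ia p) = (qj (w 0 p) +i* - qk (w 0 p))%C.
Proof.
rewrite /zeta val_ia (_ : (2 * (2 * p + 1) = 4 * p + 2)%N); last by lia.
rewrite (_ : (4 * p + 2 + 1 = 4 * p + 3)%N); last by lia.
by rewrite /rowv !vc_mkv ?Ndim_ltn// (@mkc_block _ _ _ _ p 0)// (@mkc_block _ _ _ _ p 1).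
Qed.

Lemma zeta_ib w p : zeta (rowv w) (ib p) = (qi (w 0 p) +i* qr (w 0 p))%C.
Proof.
rewrite /zeta val_ib (_ : (2 * (2 * p + 2) = 4 * p + 4)%N); last by lia.
rewrite (_ : (4 * p + 4 + 1 = 4 * p + 5)%N); last by lia.
by rewrite /rowv !vc_mkv ?Ndim_ltn// (@mkc_block _ _ _ _ p 2)// (@mkc_block _ _ _ _ p 3)//= opprK.
Qed.

Lemma zetab_conj v : zetab v = zconj (zeta v).
Proof. by apply/funext => q; apply/eqP; rewrite eq_complex /= opprK !eqxx. Qed.

Lemma zeta_jrel w : jrel (zeta (rowv w)) (zeta (rowv (q_j R *: w))).
Proof.
split; try exact: zeta0; move=> p; rewrite !zeta_ia !zeta_ib !mxE !qE /=.
by split; apply/eqP; rewrite eq_complex /=; apply/andP; split; apply/eqP; ring.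
Qed.

(** The coordinates [zeta] are conjugate-linear for left multiplication by i. The same convention
    puts the conjugate of z into the weights of [zeta_actU]. *)
Lemma zeta_i w : zeta (rowv (q_i R *: w)) = fun q => - 'i%C * zeta (rowv w) q.
Proof.
apply/funext => q; case: (idx_case q) => [->|[[p ->]|[p ->]]]; rewrite ?zeta0 ?mulr0// ?zeta_ia ?zeta_ib;
  rewrite !mxE !qE /=; apply/eqP; rewrite eq_complex /=; apply/andP; split; apply/eqP; ring.
Qed.

Lemma zeta_k w : zeta (rowv (q_k R *: w)) = fun q => - 'i%C * zeta (rowv (q_j R *: w)) q.
Proof.
rewrite -zeta_i; congr (zeta (rowv _)); rewrite (scalerA (q_i R)); congr (_ *: _).
by apply: quatP; rewrite !qE /=; ring.
Qed.

(** As the coordinates of v3 and v4 are -i times those of v1 and v2, the pure creation and pure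
    annihilation parts of v1 v2 and v3 v4 cancel, while the mixed parts double. Orthogonality of z'
    and z turns annihilation after creation into minus the reverse order. *)
Lemma spin_rep_Dop (v1 v2 v3 v4 : 'rV[R]_N) x : jrel (zeta v1) (zeta v2) ->
  zeta v3 = (fun q => - 'i%C * zeta v1 q) -> zeta v4 = (fun q => - 'i%C * zeta v2 q) ->
  spin_rep (gd v1 v2 v3 v4) x = Dop (zeta v1) (zeta v2) x.
Proof.
move=> jr e3 e4.
have T v y : spin_rep (clvec v) y = 'i%C *: (cre (zeta v) y + ann (zconj (zeta v)) y).
  by rewrite spin_rep_zeta zetab_conj.
have T' v u y : zeta v = (fun q => - 'i%C * zeta u q) ->
    spin_rep (clvec v) y = cre (zeta u) y - ann (zconj (zeta u)) y.
  move=> e; rewrite T e creZ.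
  have -> : zconj (fun q => - 'i%C * zeta u q) = (fun q => 'i%C * zconj (zeta u) q).
    apply/funext => q; rewrite /zconj.
    by case: (zeta u q) => c d; apply/eqP; rewrite eq_complex /=; apply/andP; split; apply/eqP; ring.
  rewrite annZ scalerDr !scalerA sqr_iC scaleN1r mulrN sqr_iC opprK scale1r//.
rewrite /gd spin_repN spin_repD !(spin_repM eN) (T' _ _ _ e3) (T' _ _ _ e4) !T.
move: (zeta v1) (zeta v2) jr => z z' jr {v1 v2 v3 v4 e3 e4 T T'}.
have ea : ann (zconj z) (cre z' x) = - cre z' (ann (zconj z) x).
  by apply/eqP; rewrite -addr_eq0 addrC cre_ann (jrel_orth jr) scale0r.
rewrite /Dop scaler_nat mulr2n.
have crZ u (c : C) y : cre u (c *: y) = c *: cre u y by rewrite linearZ.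
have anZ u (c : C) y : ann u (c *: y) = c *: ann u y by rewrite linearZ.
have crD u y y' : cre u (y + y') = cre u y + cre u y' by rewrite linearD.
have anD u y y' : ann u (y + y') = ann u y + ann u y' by rewrite linearD.
have crN u y : cre u (- y) = - cre u y by rewrite linearN.
have anN u y : ann u (- y) = - ann u y by rewrite linearN.
rewrite crZ anZ -scalerDr scalerA sqr_iC scaleN1r !crD !anD !crN !anN ea.
move: (cre z (cre z' x)) (cre z (ann _ x)) (cre z' (ann _ x)) (ann _ (ann _ x)) => A B D E.
rewrite !opprD !opprK.
by apply/ffunP => S; rewrite !(extDE, extNE); ring.
Qed.

Section FourFrameAction.
Variables f1 f2 f3 f4 : 'rV[R]_N.
Hypotheses (u1 : unitv f1) (u2 : unitv f2) (u3 : unitv f3) (u4 : unitv f4).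
Hypotheses (v12 : vdot f1 f2 = 0) (v13 : vdot f1 f3 = 0) (v14 : vdot f1 f4 = 0).
Hypotheses (v23 : vdot f2 f3 = 0) (v24 : vdot f2 f4 = 0) (v34 : vdot f3 f4 = 0).
Hypotheses (jr : jrel (zeta f1) (zeta f2)).
Hypotheses (e3 : zeta f3 = (fun q => - 'i%C * zeta f1 q)).
Hypotheses (e4 : zeta f4 = (fun q => - 'i%C * zeta f2 q)).
Variables c s : R.
Hypothesis cs : c ^+ 2 + s ^+ 2 = 1.
Let mu := gmu f1 f2 f3 f4 c s.

Lemma spin_rep_gmu x : spin_rep mu x =
  (c ^+ 2)%:C%C *: x + (c * s)%:C%C *: Dop (zeta f1) (zeta f2) x +
  (s ^+ 2)%:C%C *: (x + (2^-1)%:C%C *: Dop (zeta f1) (zeta f2) (Dop (zeta f1) (zeta f2) x)).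
Proof.
rewrite /mu gmuE// !(spin_repD, spin_repZ) !spin_rep1 (spin_repM eN).
by rewrite !(spin_rep_Dop _ jr e3 e4).
Qed.

Lemma gmu_vac : spin_rep mu vac = vac.
Proof.
have D0 : Dop (zeta f1) (zeta f2) 0 = 0.
  by rewrite /Dop /cre /ann !big1 ?subrr ?scaler0// => q _; rewrite ?big1 ?linear0 ?scaler0// => q' _; rewrite linear0 scaler0.
rewrite spin_rep_gmu Dop_vac D0 !scaler0 !addr0 -scalerDl -rmorphD cs.
exact: scale1r.
Qed.

Lemma gmu_comm (F : {linear ext R k -> ext R k}) x :
  (forall y, Dop (zeta f1) (zeta f2) (F y) = F (Dop (zeta f1) (zeta f2) y)) ->
  spin_rep mu (F x) = F (spin_rep mu x).
Proof.
move=> DF; have FD y y' : F (y + y') = F y + F y' by exact: linearD.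
have FZ d y : F (d *: y) = d *: F y by exact: linearZ.
by rewrite !spin_rep_gmu !DF !(FD, FZ).
Qed.

End FourFrameAction.

Lemma hdot_scale (x y : H) w : w *m ctr w = 1%:M -> hdot (x *: w) (y *: w) = qr (x * qconj y).
Proof.
move=> w1; rewrite /hdot -mul_scalar_mx -[y *: w]mul_scalar_mx ctrM ctr_scalar.
by rewrite mulmxA -[_ *m w *m ctr w]mulmxA w1 mulmx1 -scalar_mxM mxE eqxx mulr1n.
Qed.

Lemma vdot_rowv w w' : vdot (rowv w) (rowv w') = hdot w w'.
Proof. by rewrite vdotE !hv_rowv !vv_rowv mul0r subr0. Qed.

End Generator.

Section Lifts.
Variables (R : realType) (n : nat) (a t : R).
Hypotheses (a_gt0 : 0 < a) (t_gt0 : 0 < t).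
Local Notation H := (quat R).
Local Notation C := (R[i]).
Local Notation N := (Ndim n).
Local Notation k := ((Ndim n)./2).
Local Notation eN := (Ndim_even n).
Local Notation vac := (vac R n).
Implicit Types (v : 'rV[R]_N) (w : 'rV[H]_n) (x : ext R k).

Lemma hvD u v : hv (u + v) = hv u + hv v.
Proof. by have := hvZD 1 u v; rewrite scale1r [qreal 1 *: _]scale1r. Qed.
Lemma hv0 : hv (0 : 'rV[R]_N) = 0.
Proof. by apply/rowP => p; rewrite !mxE /vc !mxE oppr0. Qed.
Lemma hvZ c v : hv (c *: v) = qreal c *: hv v.
Proof. by have := hvZD c v 0; rewrite addr0 hv0 addr0. Qed.
Lemma hvN v : hv (- v) = - hv v.
Proof. by have := hvD v (- v); rewrite subrr hv0 => /esym/eqP; rewrite addrC addr_eq0 => /eqP. Qed.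
Lemma vvD u v : vv (u + v) = vv u + vv v.
Proof. by have := vvZD 1 u v; rewrite scale1r [qreal 1 * _]mul1r. Qed.
Lemma vv0 : vv (0 : 'rV[R]_N) = 0.
Proof. by rewrite /vv /vc !mxE oppr0. Qed.
Lemma vvZ c v : vv (c *: v) = qreal c * vv v.
Proof. by have := vvZD c v 0; rewrite addr0 vv0 addr0. Qed.
Lemma vvN v : vv (- v) = - vv v.
Proof. by have := vvD v (- v); rewrite subrr vv0 => /esym/eqP; rewrite addrC addr_eq0 => /eqP. Qed.

Lemma cover_act mu z A : spin_cover mu (isotropy a t (emb z A)) <->
  forall v, mu * clvec v = clvec (act z A v) * mu.
Proof. by split=> h v; have := h v; rewrite isotropyE. Qed.

Lemma cover_actP mu B z A : spin_cover mu B -> (forall v, v *m B^T = act z A v) ->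
  spin_cover mu (isotropy a t (emb z A)).
Proof. by move=> c h; apply/cover_act => v; rewrite -h; exact: c. Qed.

Lemma quat_of_complex1 : quat_of_complex (1 : C) = 1. Proof. by []. Qed.

Lemma vdot_rowv_l v w : vdot v (rowv w) = hdot (hv v) w.
Proof. by rewrite vdotE hv_rowv vv_rowv mulr0 subr0. Qed.

Lemma hdot_r w w' (y : H) : hdot w (y *: w') = qr ((w *m ctr w') 0 0 * qconj y).
Proof.
rewrite /hdot -[y *: w']mul_scalar_mx ctrM ctr_scalar mulmxA [in LHS]mxE big_ord1.
by rewrite [X in _ * X]mxE eqxx mulr1n.
Qed.

Lemma vv_prot f g c s v : vv f = 0 -> vv g = 0 -> vv (prot f g c s v) = vv v.
Proof.
move=> f0 g0; rewrite /prot; set b := (X in _ + X *: f); set d := (X in _ - X *: g).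
move: b d => b d.
by rewrite vvD (vvN (d *: g)) (vvD v) !vvZ f0 g0 !mulr0 oppr0 !addr0.
Qed.

Lemma hv_prot f g c s v (x y : 'rV[H]_n) (p q : R) :
  hv f = x -> hv g = y -> vdot v f = p -> vdot v g = q ->
  hv (prot f g c s v) = hv v +
  (qreal (2 * c * s * q - 2 * s ^+ 2 * p) *: x - qreal (2 * c * s * p + 2 * s ^+ 2 * q) *: y).
Proof.
move=> <- <- <- <-; rewrite /prot.
set b := 2 * c * s * vdot v g - 2 * s ^+ 2 * vdot v f.
set d := 2 * c * s * vdot v f + 2 * s ^+ 2 * vdot v g.
by rewrite hvD (hvN (d *: g)) (hvD v) !hvZ -addrA.
Qed.

Lemma vv_glue u u' v : vv u = vv v -> vv u' = vv v -> vv (u + (u' - v)) = vv v.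
Proof. by move=> h h'; rewrite vvD (vvD u') vvN h h' subrr addr0. Qed.
Lemma hv_glue u u' v y y' : hv u = hv v + y -> hv u' = hv v + y' ->
  hv (u + (u' - v)) = hv v + (y + y').
Proof. by move=> h h'; rewrite hvD (hvD u') hvN h h' [_ + y']addrC addrK addrA. Qed.

(** The displacement of a generating reflection along the line H w, split into the displacements of
    the plane rotations in (w, j w) and (i w, k w); [ka] is the coordinate of the vector on that
    line. *)
Lemma gen_quat (ka : H) (c s : R) : c ^+ 2 + s ^+ 2 = 1 ->
  ka * (qconj (jcx c s * jcx c s) - 1) =
  qreal (2 * c * s * qr (ka * qconj (q_j R)) - 2 * s ^+ 2 * qr ka)
  - qreal (2 * c * s * qr ka + 2 * s ^+ 2 * qr (ka * qconj (q_j R))) * q_j R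
  + (qreal (2 * c * s * qr (ka * qconj (q_k R)) - 2 * s ^+ 2 * qr (ka * qconj (q_i R))) * q_i R
  - qreal (2 * c * s * qr (ka * qconj (q_i R)) + 2 * s ^+ 2 * qr (ka * qconj (q_k R))) * q_k R).
Proof.
move=> cs; have c2 : c * c = 1 - s * s by rewrite -!expr2 -cs addrK.
rewrite jcxM c2; case: ka => k0 k1 k2 k3; apply: quatP; rewrite !qE /=; ring.
Qed.

Section UnitRow.
Variable w : 'rV[H]_n.
Hypothesis w1 : w *m ctr w = 1%:M.
Variables c s : R.
Hypothesis cs : c ^+ 2 + s ^+ 2 = 1.

Let f1 := rowv w.
Let f2 := rowv (q_j R *: w).
Let f3 := rowv (q_i R *: w).
Let f4 := rowv (q_k R *: w).

Lemma rowv_orth (x y : H) : vdot (rowv (x *: w)) (rowv (y *: w)) = qr (x * qconj y).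
Proof. by rewrite vdot_rowv hdot_scale. Qed.

Let f1E : f1 = rowv (1 *: w). Proof. by rewrite scale1r. Qed.
Let v11 : unitv f1. Proof. by rewrite /unitv f1E rowv_orth !qE /=; ring. Qed.
Let v22 : unitv f2. Proof. by rewrite /unitv rowv_orth !qE /=; ring. Qed.
Let v33 : unitv f3. Proof. by rewrite /unitv rowv_orth !qE /=; ring. Qed.
Let v44 : unitv f4. Proof. by rewrite /unitv rowv_orth !qE /=; ring. Qed.
Let v12 : vdot f1 f2 = 0. Proof. by rewrite f1E rowv_orth !qE /=; ring. Qed.
Let v13 : vdot f1 f3 = 0. Proof. by rewrite f1E rowv_orth !qE /=; ring. Qed.
Let v14 : vdot f1 f4 = 0. Proof. by rewrite f1E rowv_orth !qE /=; ring. Qed.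
Let v23 : vdot f2 f3 = 0. Proof. by rewrite rowv_orth !qE /=; ring. Qed.
Let v24 : vdot f2 f4 = 0. Proof. by rewrite rowv_orth !qE /=; ring. Qed.
Let v34 : vdot f3 f4 = 0. Proof. by rewrite rowv_orth !qE /=; ring. Qed.

(** On the line H w the reflection is right multiplication by the conjugate of (c + s j)^2. This
    rotates the planes (1, j) and (i, k) by equal angles, so two half-angle rotations with the same
    c and s lift it. *)
Lemma gen_lift : exists mu, [/\ Spin R N mu,
  spin_cover mu (isotropy a t (emb 1 (qrefl (ctr w) (jcx c s * jcx c s)))),
  spin_rep mu vac = vac,
  forall x, spin_rep mu (Om x) = Om (spin_rep mu x) &
  forall x, spin_rep mu (crea ord0 x) = crea ord0 (spin_rep mu x)].
Proof.
have jr := zeta_jrel w; have e3 := zeta_i w; have e4 := zeta_k w.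
exists (gmu f1 f2 f3 f4 c s); split.
- exact: gmu_Spin.
- have [B [cB rB]] := gmu_cover v11 v22 v33 v44 v12 v13 v14 v23 v24 v34 cs.
  apply: cover_actP cB _ => v; rewrite rB; apply: vhP.
    rewrite vv_act quat_of_complex1 qconj1 mul1r mulr1.
    by apply: vv_glue; apply: vv_prot; exact: vv_rowv.
  rewrite hv_act quat_of_complex1 scale1r ctr_qrefl /qrefl ctrK mulmxDr mulmx1 !mulmxA.
  set ka := (hv v *m ctr w) 0 0.
  have -> : hv v *m ctr w = ka%:M.
    by apply/matrixP => i j; rewrite !ord1 [RHS]mxE eqxx mulr1n.
  rewrite -scalar_mxM mul_scalar_mx.
  have d1 : vdot v f1 = qr ka by rewrite vdot_rowv_l.
  have d2 : vdot v f2 = qr (ka * qconj (q_j R)) by rewrite vdot_rowv_l hdot_r.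
  have d3 : vdot v f3 = qr (ka * qconj (q_i R)) by rewrite vdot_rowv_l hdot_r.
  have d4 : vdot v f4 = qr (ka * qconj (q_k R)) by rewrite vdot_rowv_l hdot_r.
  apply: etrans.
    apply: hv_glue; [exact: (hv_prot c s (hv_rowv _) (hv_rowv _) d1 d2)|
      exact: (hv_prot c s (hv_rowv _) (hv_rowv _) d3 d4)].
  congr (_ + _); rewrite !scalerA gen_quat//.
  have lin (x y z u : H) : x *: w - y *: w + (z *: w - u *: w) = (x - y + (z - u)) *: w.
    by rewrite scalerDl !scalerBl.
  exact: lin.
- exact: gmu_vac.
- move=> x; apply: (gmu_comm v11 v22 v33 v44 v12 v13 v14 v23 v24 v34 jr e3 e4 c s (F := @Om R n) x) => y.
  exact: Dop_Om.
- move=> x; apply: (gmu_comm v11 v22 v33 v44 v12 v13 v14 v23 v24 v34 jr e3 e4 c s (F := @crea R k ord0) x) => y.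
  exact: Dop_crea0.
Qed.

End UnitRow.

End Lifts.

(** * The circle, the diagonal torus and the transpositions in complex coordinates *)

Section Coordinates.
Variables (R : realType) (n : nat).
Local Notation H := (quat R).
Local Notation C := (R[i]).
Local Notation N := (Ndim n).
Local Notation k := ((Ndim n)./2).
Implicit Types (v : 'rV[R]_N).

Lemma zeta_vv v : zeta v ord0 = (- qk (vv v) +i* - qj (vv v))%C.
Proof. by rewrite /zeta -[v in LHS]mkvK !vc_mkv. Qed.

Lemma zeta_hva v p : zeta v (ia p) = (qj (hv v 0 p) +i* - qk (hv v 0 p))%C.
Proof.
rewrite /zeta val_ia (_ : (2 * (2 * p + 1) = 4 * p + 2)%N); last by lia.
rewrite (_ : (4 * p + 2 + 1 = 4 * p + 3)%N); last by lia.
by rewrite -[v in LHS]mkvK !vc_mkv ?Ndim_ltn// (@mkc_block _ _ _ _ p 0)// (@mkc_block _ _ _ _ p 1).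
Qed.

Lemma zeta_hvb v p : zeta v (ib p) = (qi (hv v 0 p) +i* qr (hv v 0 p))%C.
Proof.
rewrite /zeta val_ib (_ : (2 * (2 * p + 2) = 4 * p + 4)%N); last by lia.
rewrite (_ : (4 * p + 4 + 1 = 4 * p + 5)%N); last by lia.
by rewrite -[v in LHS]mkvK !vc_mkv ?Ndim_ltn// (@mkc_block _ _ _ _ p 2)// (@mkc_block _ _ _ _ p 3)//= opprK.
Qed.

Lemma zeta_inj u v : zeta u =1 zeta v -> u = v.
Proof.
move=> h; apply/rowP => j; rewrite -!vcE.
have := h (qof (Ndim_even n) j); rewrite /zeta /= => -[].
have [e|e] : (j = 2 * j./2 :> nat)%N \/ (j = 2 * j./2 + 1 :> nat)%N by lia.
  by move: (j./2) e => m ->.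
by move: (j./2) e => m -> _ /oppr_inj.
Qed.

Lemma normC_unit (z : C) : `|z| = 1 -> complex.Re z ^+ 2 + complex.Im z ^+ 2 = 1.
Proof.
move=> z1; have := add_Re2_Im2 z; rewrite z1 expr1n => /(congr1 (@complex.Re R)) /=.
by [].
Qed.

Lemma unit_normC (z : C) : complex.Re z ^+ 2 + complex.Im z ^+ 2 = 1 -> `|z| = 1.
Proof. by move=> h; case: z h => x y /= h; rewrite normc_def /= h sqrtr1. Qed.

Lemma unit_conjM (z : C) : `|z| = 1 -> z * z^*%C = 1.
Proof.
move/normC_unit; case: z => x y /= h; apply/eqP; rewrite eq_complex /=.
by rewrite mulrN opprK -!expr2 h eqxx /=; apply/eqP; ring.
Qed.

Lemma unit_normC_conj (z : C) : `|z| = 1 -> `|z^*%C| = 1.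
Proof. by move/normC_unit => h; apply: unit_normC; case: z h => x y /=; rewrite sqrrN. Qed.

Lemma unit_sqrtC (z : C) : `|z| = 1 -> exists2 d : C, `|d| = 1 & d ^+ 2 = z.
Proof.
move/normC_unit/unit_half => [c [s [cs h1 h2]]]; exists (c +i* s)%C; first exact: unit_normC.
case: z h1 h2 => x y /= <- <-; rewrite expr2; apply/eqP; rewrite eq_complex /=.
by apply/andP; split; apply/eqP; ring.
Qed.

Transparent vv.
Lemma qr_vv v : qr (vv v) = 0. Proof. by []. Qed.
Lemma qi_vv v : qi (vv v) = 0. Proof. by []. Qed.
Opaque vv.

Lemma zeta_actU (z : C) v q :
  zeta (act z 1%:M v) q = (if q == ord0 then (z^*%C) ^+ 2 else z^*%C) * zeta v q.
Proof.
case: z => x y; have [eh ev] := conj (hv_act (x +i* y)%C 1%:M v) (vv_act (x +i* y)%C 1%:M v).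
move: (act _ _ _) eh ev => U eh ev.
case: (idx_case q) => [->|[[p ->]|[p ->]]].
- rewrite eqxx !zeta_vv ev; have := qr_vv v; have := qi_vv v.
  move: (vv v) => [v0 v1 v2 v3] /= -> ->; rewrite expr2 /quat_of_complex ?qE /=.
  by apply/eqP; rewrite eq_complex /=; apply/andP; split; apply/eqP; ring.
- have -> : (ia p == ord0) = false by apply/eqP => /(congr1 val) /=; rewrite val_ia; lia.
  rewrite !zeta_hva eh ctr1 mulmx1 mxE; move: (hv v 0 p) => [v0 v1 v2 v3].
  rewrite /quat_of_complex !qE /=.
  by apply/eqP; rewrite eq_complex /=; apply/andP; split; apply/eqP; ring.
have -> : (ib p == ord0) = false by apply/eqP => /(congr1 val) /=; rewrite val_ib; lia.
rewrite !zeta_hvb eh ctr1 mulmx1 mxE; move: (hv v 0 p) => [v0 v1 v2 v3].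
rewrite /quat_of_complex !qE /=.
by apply/eqP; rewrite eq_complex /=; apply/andP; split; apply/eqP; ring.
Qed.

Lemma row_qrefl_delta (w : 'rV[H]_n) p q p' :
  (w *m qrefl (delta_mx p 0) q) 0 p' = if p' == p then w 0 p * q else w 0 p'.
Proof.
rewrite /qrefl mulmxDr mulmx1 !mulmxA mxE.
have -> : w *m delta_mx p 0 *m ((q - 1)%:M : 'M[H]_1) = (w 0 p * (q - 1))%:M.
  rewrite scalar_mxM; congr (_ *m _); apply/matrixP => i j; rewrite !ord1 [LHS]mxE (bigD1 p)//=.
  rewrite big1 ?addr0 => [|l lp]; first by rewrite !mxE !eqxx mulr1 mulr1n.
  by rewrite !mxE (negPf lp) mulr0.
rewrite mul_scalar_mx mxE ctrE mxE eqxx andbT.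
case: eqP => [->|_]; last by rewrite qconj0 mulr0 addr0.
by rewrite qconj1 mulr1 mulrBr mulr1 addrC subrK.
Qed.

(** The diagonal torus: z at position p and 1 elsewhere, presented as a reflection. *)
Definition toral p (z : C) : 'M[H]_n := qrefl (delta_mx p 0) (quat_of_complex z).

Lemma qn2_quat_of_complex (z : C) : `|z| = 1 -> qn2 (quat_of_complex z) = 1.
Proof. by move/normC_unit => h; rewrite /qn2 /= h; ring. Qed.

Lemma toral_Sp p (z : C) : `|z| = 1 -> Sp (toral p z).
Proof. by move=> z1; apply: qrefl_Sp; [exact: unitc_delta|exact: qn2_quat_of_complex]. Qed.

Lemma ia_neq0 (p : 'I_n) : (ia p == ord0) = false.
Proof. by apply/eqP => /(congr1 val) /=; rewrite val_ia; lia. Qed.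
Lemma ib_neq0 (p : 'I_n) : (ib p == ord0) = false.
Proof. by apply/eqP => /(congr1 val) /=; rewrite val_ib; lia. Qed.
Lemma ia_ib (p p' : 'I_n) : (ia p == ib p') = false.
Proof. by apply/eqP => /(congr1 val) /=; rewrite val_ia val_ib; lia. Qed.
Lemma ia_inj : injective (@ia n).
Proof. by move=> p p' /(congr1 val) /=; rewrite !val_ia => e; apply/val_inj => /=; lia. Qed.
Lemma ib_inj : injective (@ib n).
Proof. by move=> p p' /(congr1 val) /=; rewrite !val_ib => e; apply/val_inj => /=; lia. Qed.

(** The weights at [ia p] and [ib p] are inverse on the unit circle, so only monomials containing
    exactly one of the two see this torus element. *)
Definition toral_wt p (z : C) (q : 'I_k) : C :=
  if q == ia p then z^*%C else if q == ib p then z else 1.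

Lemma zeta_act_toral p (z : C) v q :
  zeta (act 1 (toral p z) v) q = toral_wt p z q * zeta v q.
Proof.
have [eh ev] := conj (hv_act 1 (toral p z) v) (vv_act 1 (toral p z) v).
move: (act _ _ _) eh ev => U; rewrite quat_of_complex1 qconj1 mul1r mulr1 scale1r => eh ev.
rewrite /toral_wt; case: (idx_case q) => [->|[[p' ->]|[p' ->]]].
- by rewrite eq_sym ia_neq0 eq_sym ib_neq0 !zeta_vv ev mul1r.
- rewrite ia_ib (inj_eq ia_inj) !zeta_hva eh /toral ctr_qrefl row_qrefl_delta.
  case: eqP => [->|_]; last by rewrite mul1r.
  clear eh; move: (hv v 0 p) => [v0 v1 v2 v3]; case: z => x y; rewrite /quat_of_complex ?qE /=.
  by apply/eqP; rewrite eq_complex /=; apply/andP; split; apply/eqP; ring.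
rewrite [ib p' == _]eq_sym ia_ib (inj_eq ib_inj) !zeta_hvb eh /toral ctr_qrefl row_qrefl_delta.
case: eqP => [->|_]; last by rewrite mul1r.
clear eh; move: (hv v 0 p) => [v0 v1 v2 v3]; case: z => x y; rewrite /quat_of_complex ?qE /=.
by apply/eqP; rewrite eq_complex /=; apply/andP; split; apply/eqP; ring.
Qed.

Definition swap (p p' : 'I_n) : 'M[H]_n := perm_mx (tperm p p').

Lemma ctr_swap p p' : ctr (swap p p') = swap p p'.
Proof.
rewrite -[RHS]trmxK tr_perm_mx tpermV; congr (_^T); apply/matrixP => i j; rewrite !mxE.
by case: (_ == _); rewrite ?qconj1 ?qconj0.
Qed.

Lemma swap_Sp p p' : Sp (swap p p').
Proof. by rewrite /Sp /= ctrans_ctr ctr_swap -perm_mxM tperm2 perm_mx1. Qed.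

Definition swap_idx (p p' : 'I_n) : {perm 'I_k} := (tperm (ia p) (ia p') * tperm (ib p) (ib p'))%g.

Lemma swap_idx0 p p' : swap_idx p p' ord0 = ord0.
Proof. by rewrite permM !tpermD// ?ia_neq0 ?ib_neq0. Qed.
Lemma swap_idxa p p' l : swap_idx p p' (ia l) = ia (tperm p p' l).
Proof.
rewrite permM; have -> : tperm (ia p) (ia p') (ia l) = ia (tperm p p' l).
  by case: (tpermP p p' l) => [->|->|h h']; rewrite ?tpermL ?tpermR// tpermD// (inj_eq ia_inj) eq_sym; apply/eqP.
by apply: tpermD; rewrite eq_sym ia_ib.
Qed.
Lemma swap_idxb p p' l : swap_idx p p' (ib l) = ib (tperm p p' l).
Proof.
rewrite permM [tperm (ia _) _ _]tpermD ?ia_ib//.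
by case: (tpermP p p' l) => [->|->|h h']; rewrite ?tpermL ?tpermR// tpermD// (inj_eq ib_inj) eq_sym; apply/eqP.
Qed.

Lemma zeta_act_swap p p' v q : zeta (act 1 (swap p p') v) (swap_idx p p' q) = zeta v q.
Proof.
have [eh ev] := conj (hv_act 1 (swap p p') v) (vv_act 1 (swap p p') v).
move: (act _ _ _) eh ev => U; rewrite quat_of_complex1 qconj1 mul1r mulr1 scale1r ctr_swap => eh ev.
have {}eh l : hv U 0 (tperm p p' l) = hv v 0 l.
  have -> : hv U = col_perm (tperm p p') (hv v) by rewrite col_permE tpermV.
  by rewrite mxE tpermK.
case: (idx_case q) => [->|[[l ->]|[l ->]]].
- by rewrite swap_idx0 !zeta_vv ev.
- by rewrite swap_idxa !zeta_hva eh.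
by rewrite swap_idxb !zeta_hvb eh.
Qed.

End Coordinates.

Section Monomial.
Variables (R : realType) (n : nat).
Local Notation H := (quat R).
Local Notation C := (R[i]).
Local Notation N := (Ndim n).
Local Notation k := ((Ndim n)./2).
Implicit Types (v : 'rV[R]_N) (x : ext R k) (q : 'I_k).

Definition be q : 'rV[R]_N := delta_mx 0 (inord (2 * q)).
Definition bf q : 'rV[R]_N := delta_mx 0 (inord (2 * q + 1)).

Lemma two_lt q : (2 * q + 1 < N)%N.
Proof. by have := ltn_ord q; rewrite [X in (_ < X)%N -> _]Ndim_half /Ndim; lia. Qed.

Lemma zeta_be q q' : zeta (be q) q' = (q' == q)%:R.
Proof.
have h : (2 * q + 1 < (4 * n).+2)%N := two_lt q; have h' : (2 * q' + 1 < (4 * n).+2)%N := two_lt q'.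
have e1 : (2 * q' < N)%N := leq_ltn_trans (leq_addr 1 _) (two_lt q').
have e2 : (2 * q < N)%N := leq_ltn_trans (leq_addr 1 _) (two_lt q).
rewrite /zeta /be !vc_delta ?two_lt// !inordK ?two_lt//.
have -> : (2 * q' + 1 == 2 * q)%N = false by lia.
have -> : (2 * q' == 2 * q)%N = (q' == q) by rewrite -val_eqE /=; lia.
by rewrite oppr0; case: (_ == _).
Qed.

Lemma zeta_bf q q' : zeta (bf q) q' = - 'i%C * (q' == q)%:R.
Proof.
have h : (2 * q + 1 < (4 * n).+2)%N := two_lt q; have h' : (2 * q' + 1 < (4 * n).+2)%N := two_lt q'.
have e1 : (2 * q' < N)%N := leq_ltn_trans (leq_addr 1 _) (two_lt q').
have e2 : (2 * q < N)%N := leq_ltn_trans (leq_addr 1 _) (two_lt q).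
rewrite /zeta /bf !vc_delta ?two_lt// !inordK ?two_lt//.
have -> : (2 * q' == 2 * q + 1)%N = false by lia.
have -> : (2 * q' + 1 == 2 * q + 1)%N = (q' == q) by rewrite -val_eqE /=; lia.
by case: (_ == _); apply/eqP; rewrite eq_complex /=; apply/andP; split; apply/eqP; ring.
Qed.

Lemma spin_rep_single v (c : C) q x : (forall q', zeta v q' = c * (q' == q)%:R) ->
  spin_rep (clvec v) x = 'i%C *: (c *: crea q x + c^*%C *: anni q x).
Proof.
move=> h; rewrite spin_rep_zeta zetab_conj; congr (_ *: (_ + _)).
  rewrite /cre (bigD1 q)//= big1 => [|q' nq]; first by rewrite h eqxx mulr1 addr0.
  by rewrite h (negPf nq) mulr0 scale0r.
rewrite /ann (bigD1 q)//= big1 => [|q' nq]; first by rewrite /zconj h eqxx mulr1 addr0.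
by rewrite /zconj h (negPf nq) mulr0 conjc0 scale0r.
Qed.

(** The complex combination of two Clifford vectors in which the annihilation parts cancel. Through
    it a covering relation for vectors becomes a relation for creation operators. *)
Lemma crea_clvec q x :
  crea q x = 2^-1 *: (- 'i%C *: spin_rep (clvec (be q)) x + spin_rep (clvec (bf q)) x).
Proof.
rewrite (spin_rep_single (c := 1) (q := q)) => [|q']; last by rewrite zeta_be mul1r.
rewrite (spin_rep_single _ (zeta_bf q)).
have -> : (- 'i%C)^*%C = 'i%C :> C by apply/eqP; rewrite eq_complex /=; apply/andP; split; apply/eqP; ring.
rewrite conjc1 !scale1r; apply/ffunP => D; rewrite !(extZE, extDE).
move: (crea q x D) (anni q x D) => X Y; have i2 := @sqr_iC R.
transitivity (2^-1 * ((- ('i%C * 'i%C) - 'i%C * 'i%C) * X + ('i%C * 'i%C - 'i%C * 'i%C) * Y)); last by ring.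
by rewrite i2; field.
Qed.

(** A rotation that permutes the coordinates [zeta] up to scalars does not mix creation with
    annihilation, so mu carries one creation operator to a multiple of another. *)
Lemma rep_crea mu (F : 'rV[R]_N -> 'rV[R]_N) (s : {perm 'I_k}) (d : 'I_k -> C) q x :
  (forall v, mu * clvec v = clvec (F v) * mu) ->
  (forall v q, zeta (F v) (s q) = d q * zeta v q) ->
  spin_rep mu (crea q x) = d q *: crea (s q) (spin_rep mu x).
Proof.
move=> cF zF; have eN := Ndim_even n.
have st q' : (q' == s q) = ((s^-1)%g q' == q).
  by apply/eqP/eqP => [->|<-]; rewrite ?permK ?permKV.
have ze q' : zeta (F (be q)) q' = d q * (q' == s q)%:R.
  rewrite -[q'](permKV s) zF zeta_be permKV st.
  by case: eqP => [->|] //; rewrite !mulr0.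
have zf q' : zeta (F (bf q)) q' = (- 'i%C * d q) * (q' == s q)%:R.
  rewrite -[q'](permKV s) zF zeta_bf permKV st.
  by case: eqP => [->|] //; rewrite ?mulr0// !mulr1 mulrC.
rewrite crea_clvec linearZ linearD linearZ /= -!(spin_repM eN) !cF !(spin_repM eN).
rewrite (spin_rep_single _ ze) (spin_rep_single _ zf).
have -> : (- 'i%C * d q)^*%C = 'i%C * (d q)^*%C.
  by case: (d q) => ? ?; apply/eqP; rewrite eq_complex /=; apply/andP; split; apply/eqP; ring.
apply/ffunP => D; rewrite !(extZE, extDE).
move: (crea _ _ D) (anni _ _ D) (d q) ((d q)^*%C) => X Y c c'; have i2 := @sqr_iC R.
transitivity (2^-1 * ((- ('i%C * 'i%C) - 'i%C * 'i%C) * c * X + ('i%C * 'i%C - 'i%C * 'i%C) * c' * Y)); first by ring.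
by rewrite i2; field.
Qed.

End Monomial.

(** * The lift normalised by its action on the vacuum *)

Section LiftExistence.
Variables (R : realType) (n : nat) (a t : R).
Hypotheses (a_gt0 : 0 < a) (t_gt0 : 0 < t).
Local Notation H := (quat R).
Local Notation C := (R[i]).
Local Notation N := (Ndim n).
Local Notation k := ((Ndim n)./2).
Local Notation eN := (Ndim_even n).
Local Notation vac := (vac R n).
Implicit Types (v : 'rV[R]_N) (x : ext R k) (q : 'I_k) (z : C) (A : 'M[H]_n).

Lemma vdot_delta v (j : 'I_N) : vdot v (delta_mx 0 j) = v 0 j.
Proof.
rewrite /vdot (bigD1 j)//= big1 => [|i ij]; first by rewrite mxE !eqxx mulr1 addr0.
by rewrite mxE (negPf ij) andbF mulr0.
Qed.

Lemma crea_crea q x : crea q (crea q x) = 0.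
Proof.
have /eqP := crea_anti q q x; rewrite -addr_eq0 -mulr2n -scaler_nat scaler_eq0 pnatr_eq0 /=.
by move/eqP.
Qed.

Lemma spin_repZr mu (c : C) x : spin_rep mu (c *: x) = c *: spin_rep mu x.
Proof.
have s0 : spin_rep mu 0 = 0.
  by have := spin_rep_linear eN mu (-1) 0 0; rewrite scaler0 addr0 scaleN1r addNr.
by have := spin_rep_linear eN mu c x 0; rewrite s0 !addr0.
Qed.

(** The vector [bf] creates y_q from the vacuum and [be] turns it into i times the vacuum. So c - s
    e f multiplies the vacuum by c - i s while it rotates by the double angle. *)
Lemma plane_rotation q (d : C) : `|d| = 1 -> exists mu B, [/\ Spin R N mu, spin_cover mu B,
  forall v q', zeta (v *m B^T) q' = (if q' == q then d ^+ 2 else 1) * zeta v q' &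
  spin_rep mu vac = d^*%C *: vac].
Proof.
case: d => c s /normC_unit /= cs.
have ee : unitv (be R q) by rewrite /unitv vdot_delta mxE !eqxx.
have ff : unitv (bf R q) by rewrite /unitv vdot_delta mxE !eqxx.
have h := two_lt q; have h' : (2 * q < N)%N := leq_ltn_trans (leq_addr 1 _) h.
have ef : vdot (be R q) (bf R q) = 0.
  rewrite vdot_delta mxE eqxx /=; case: eqP => // /(congr1 val); rewrite /= !inordK// => e.
  by exfalso; lia.
have [B [cB rB]] := rotv_cover ee ff ef cs.
exists (rotv (be R q) (bf R q) c s), B; split=> //; first exact: rotv_Spin.
  move=> v q'; rewrite rB /prot !vdot_delta.
  have -> : v 0 (inord (2 * q)) = complex.Re (zeta v q) by [].
  have -> : v 0 (inord (2 * q + 1)) = - complex.Im (zeta v q) by rewrite /= opprK.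
  have zl (x y : R) : zeta (v + x *: be R q - y *: bf R q) q' =
      zeta v q' + (x%:C * zeta (be R q) q' - y%:C * zeta (bf R q) q')%C.
    rewrite /zeta /vc !mxE; apply/eqP; rewrite eq_complex /=.
    by apply/andP; split; apply/eqP; ring.
  rewrite zl zeta_be zeta_bf; case: eqP => [->|_]; last by rewrite !mulr0 subrr addr0 mul1r.
  rewrite !mulr1; have s2 : s * s = 1 - c * c by rewrite -!expr2 -cs; ring.
  case: (zeta v q) => p r; rewrite !expr2 s2; apply/eqP; rewrite eq_complex /= s2.
  by apply/andP; split; apply/eqP; ring.
have e1 : spin_rep (clvec (bf R q)) vac = crea q vac.
  rewrite (spin_rep_single _ (zeta_bf R q)) anni_vac scaler0 addr0 scalerA mulrN sqr_iC opprK.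
  exact: scale1r.
have e2 : spin_rep (clvec (be R q)) (crea q vac) = 'i%C *: vac.
  rewrite (spin_rep_single (c := 1) (q := q)) => [|q']; last by rewrite zeta_be mul1r.
  have c0 : crea q 0 = 0 :> ext R k := linear0 _.
  by rewrite crea_crea anni_crea eqxx anni_vac c0 subr0 conjc1 !scale1r add0r.
rewrite (rotvE _ _ ee ef) spin_repD spin_repN !spin_repZ spin_rep1 (spin_repM eN) e1 e2.
rewrite scalerA -scalerBl; congr (_ *: _).
by apply/eqP; rewrite eq_complex /=; apply/andP; split; apply/eqP; ring.
Qed.

Lemma planes_rotation (d : 'I_k -> C) (s : seq 'I_k) : (forall q, `|d q| = 1) -> uniq s ->
  exists mu B, [/\ Spin R N mu, spin_cover mu B,
  forall v q, zeta (v *m B^T) q = (if q \in s then d q ^+ 2 else 1) * zeta v q &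
  spin_rep mu vac = (\prod_(q <- s) (d q)^*%C) *: vac].
Proof.
move=> d1; elim: s => [_|q s ih /= /andP[qs us]].
  exists 1, 1%:M; split; [exact: Spin1|exact: spin_cover1| |].
    by move=> v q; rewrite trmx1 mulmx1 mul1r.
  by rewrite spin_rep1 big_nil scale1r.
have [mu [B [S1 c1 z1 v1]]] := ih us; have [nu [B' [S2 c2 z2 v2]]] := plane_rotation q (d1 q).
exists (nu * mu), (B' *m B); split; [exact: SpinM|exact: coverM| |].
  move=> v q'; rewrite trmx_mul mulmxA z2 z1 in_cons.
  by case: eqP => [->|_] /=; rewrite ?(negPf qs) ?mul1r.
by rewrite (spin_repM eN) v1 spin_repZr v2 scalerA big_cons mulrC.
Qed.

(* The action on the vacuum removes the sign ambiguity of the lift. *)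
Definition lifts z A mu := [/\ Spin R N mu, spin_cover mu (isotropy a t (emb z A)) &
  spin_rep mu vac = z ^+ n.+1 *: vac].

Lemma act_mul z A z' A' v : act z A (act z' A' v) = act (z * z') (A *m A') v.
Proof.
apply: vhP.
  apply: (etrans (vv_act _ _ _)); apply: (etrans _ (esym (vv_act _ _ _))).
  rewrite (vv_act z') quat_of_complexM.
  by move: (quat_of_complex z) (quat_of_complex z') (vv v) => q q' y; rewrite qconjM !mulrA.
apply: (etrans (hv_act _ _ _)); apply: (etrans _ (esym (hv_act _ _ _))).
by rewrite (hv_act z') quat_of_complexM ctrM -scalemxAl scalerA mulmxA.
Qed.

Lemma lifts1 : lifts 1 1%:M 1.
Proof.
split; [exact: Spin1| |by rewrite spin_rep1 expr1n scale1r].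
apply/cover_act => // v; rewrite mul1r mulr1; congr clvec; apply: vhP; rewrite ?vv_act ?hv_act.
  by rewrite quat_of_complex1 qconj1 mul1r mulr1.
by rewrite quat_of_complex1 scale1r ctr1 mulmx1.
Qed.

Lemma lifts_mul z A z' A' mu nu : lifts z A mu -> lifts z' A' nu ->
  lifts (z * z') (A *m A') (mu * nu).
Proof.
move=> [S1 /cover_act c1 v1] [S2 /cover_act c2 v2]; split; first exact: SpinM.
  apply/cover_act => // v; by rewrite -act_mul -mulrA c2// mulrA c1// -mulrA.
by rewrite (spin_repM eN) v2 spin_repZr v1 scalerA exprMn mulrC.
Qed.

Lemma vac_neq0 : vac != 0.
Proof.
apply/eqP => /ffunP/(_ finset.set0); rewrite /vac ebasisE eqxx ext0E.
by apply/eqP; rewrite oner_eq0.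
Qed.

Lemma unitC_neq0 z : `|z| = 1 -> z != 0.
Proof. by move=> z1; rewrite -normr_eq0 z1 oner_eq0. Qed.

Lemma lifts_unique z A mu nu : `|z| = 1 -> lifts z A mu -> lifts z A nu -> nu = mu.
Proof.
move=> z1 [S1 c1 v1] [S2 c2 v2]; have [//|e] := cover_unique eN S1 S2 c1 c2.
have /eqP : z ^+ n.+1 *: vac = - (z ^+ n.+1 *: vac) by rewrite -[LHS]v2 e spin_repN v1.
rewrite -addr_eq0 -mulr2n -scaler_nat scalerA scaler_eq0 (negPf vac_neq0) orbF.
by rewrite mulf_eq0 pnatr_eq0 expf_eq0 (negPf (unitC_neq0 z1)).
Qed.

Lemma lifts_Sp A : Sp A -> exists mu, [/\ lifts 1 A mu,
  forall x, spin_rep mu (Om x) = Om (spin_rep mu x) &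
  forall x, spin_rep mu (crea ord0 x) = crea ord0 (spin_rep mu x)].
Proof.
move: A; apply: Sp_ind.
- by exists 1; split=> [|x|x]; [exact: lifts1|rewrite !spin_rep1..].
- move=> u c s uu cs; have w1 : ctr u *m ctr (ctr u) = 1%:M by rewrite ctrK.
  have [mu []] := gen_lift a_gt0 t_gt0 w1 cs; rewrite ctrK => S1 c1 v1 o1 y1.
  by exists mu; split=> //; split=> //; rewrite v1 expr1n scale1r.
move=> A B _ _ [mu [l1 o1 y1]] [nu [l2 o2 y2]]; exists (mu * nu); split.
- by have := lifts_mul l1 l2; rewrite mul1r.
- by move=> x; rewrite !(spin_repM eN) o2 o1.
- by move=> x; rewrite !(spin_repM eN) y2 y1.
Qed.

Lemma lifts_U z : `|z| = 1 -> exists mu, lifts z 1%:M mu.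
Proof.
move=> z1; have [e e1 e2] := unit_sqrtC (unit_normC_conj z1).
(* Half-angle parameters: the weight is the square of the conjugate of z at y_1, and the conjugate
   of z elsewhere. The vacuum is multiplied by z and by 2n conjugates of e, that is by z z^n =
   z^(n+1), whichever root e is taken. *)
pose d (q : 'I_k) := if q == ord0 then z^*%C else e.
have d1 q : `|d q| = 1 by rewrite /d; case: ifP => // _; exact: unit_normC_conj.
have [mu [B [S1 c1 zB v1]]] := planes_rotation d1 (enum_uniq 'I_k).
exists mu; split=> //.
  apply: cover_actP c1 _ => // v; apply: zeta_inj => q; rewrite zB mem_enum zeta_actU /d.
  by case: (_ == _); rewrite ?e2.
rewrite v1 big_enum; congr (_ *: _).
have -> : \prod_(q : 'I_k) (d q)^*%C = \prod_(i < (2 * n).+1) (if i == 0%N :> nat then z else e^*%C).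
  rewrite -Ndim_half; apply: eq_bigr => q _; rewrite /d -val_eqE /=.
  by case: (_ == _) => //; rewrite conjcK.
rewrite big_ord_recl /= exprS; congr (_ * _).
rewrite prodr_const card_ord exprM; congr (_ ^+ _).
by rewrite -rmorphXn /= e2 conjcK.
Qed.

Lemma lifts_exists z A : `|z| = 1 -> Sp A -> exists mu, lifts z A mu.
Proof.
move=> z1 SA; have [mu l1] := lifts_U z1; have [nu [l2 _ _]] := lifts_Sp SA.
by exists (mu * nu); have := lifts_mul l1 l2; rewrite mulr1 mul1mx.
Qed.

End LiftExistence.

Lemma set_ind1 (T : finType) (P : {set T} -> Prop) : P finset.set0 ->
  (forall q (D : {set T}), q \in D -> P (D :\ q)%SET -> P D) -> forall D, P D.
Proof.
move=> P0 PS D; move: {2}#|D| (erefl #|D|) => m; elim: m D => [|m ih] D.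
  by move/finset.cards0_eq => ->.
move=> Dm; have [D0|[q qD]] := finset.set_0Vmem D; first by rewrite D0.
by apply: (PS q) => //; apply: ih; move: Dm; rewrite (cardsD1 q D) qD => -[].
Qed.

Lemma T_sum (R : realType) k (T : ext R k -> ext R k) (I : Type) (r : seq I) (F : I -> ext R k) :
  {morph T : x y / x + y} -> (forall a, {morph T : x / a *: x}) ->
  T (\sum_(i <- r) F i) = \sum_(i <- r) T (F i).
Proof.
move=> TD TZ; have T0 : T 0 = 0 by have := TZ 0 0; rewrite !scale0r.
by elim/big_rec2: _ => [|i y1 y2 _ <-].
Qed.

(** * Invariant spinors *)

Section Monomials.
Variables (R : realType) (n : nat).
Local Notation C := (R[i]).
Local Notation k := ((Ndim n)./2).
Local Notation vac := (vac R n).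
Implicit Types (x y : ext R k) (q : 'I_k) (D : {set 'I_k}) (p : 'I_n) (P Q : {set 'I_n}).

Lemma ebasisU1 q D : q \in D ->
  ebasis D = psg C (ltp q (D :\ q)%SET) *: crea q (ebasis (D :\ q)%SET) :> ext R k.
Proof.
move=> qD; rewrite crea_ebasis; last by rewrite !inE eqxx.
by rewrite scalerA -psgD addbb finset.setD1K// [psg _ _]expr0 scale1r.
Qed.

Lemma imset_setD1 (s : {perm 'I_k}) q D : q \in D -> (s @: D = s q |: (s @: (D :\ q)))%SET.
Proof. by move=> qD; rewrite -[in LHS](finset.setD1K qD) finset.imsetU1. Qed.

Lemma imset_notin (s : {perm 'I_k}) q D : s q \notin (s @: (D :\ q))%SET.
Proof.
by apply/negP => /imsetP[q' q'D /perm_inj e]; move: q'D; rewrite -e !inE eqxx.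
Qed.

Lemma creaZ q (c : C) x : crea q (c *: x) = c *: crea q x. Proof. by rewrite linearZ. Qed.

Section Intertwiner.
Variables (T : ext R k -> ext R k) (s : {perm 'I_k}) (d : 'I_k -> C) (c : C).
Hypotheses (TD : {morph T : x y / x + y}) (TZ : forall a, {morph T : x / a *: x}).
Hypotheses (Tvac : T vac = c *: vac) (Tc : forall q x, T (crea q x) = d q *: crea (s q) (T x)).

(** Every monomial arises from the vacuum by creation operators, so T is determined up to scalars by
    the permutation s. *)
Lemma intertwine_ebasis D : exists c', T (ebasis D) = c' *: ebasis (s @: D)%SET.
Proof.
elim/set_ind1: D => [|q D qD [c' e]]; first by exists c; rewrite finset.imset0.
exists (psg C (ltp q (D :\ q)%SET) * d q * c' * psg C (ltp (s q) (s @: (D :\ q))%SET)).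
rewrite (ebasisU1 qD) (imset_setD1 s qD) TZ Tc e creaZ crea_ebasis ?imset_notin//.
by rewrite !scalerA !mulrA.
Qed.

Lemma intertwine_coef x D : T x (s @: D)%SET = x D * T (ebasis D) (s @: D)%SET.
Proof.
rewrite [in LHS](ext_basis x) (T_sum _ _ TD TZ) ext_sumE (bigD1 D)//= TZ extZE big1 ?addr0// => D' D'D.
rewrite TZ; have [c' ->] := intertwine_ebasis D'; rewrite !extZE ebasisE.
by rewrite (inj_eq (imset_inj (@perm_inj _ s))) eq_sym (negPf D'D) !mulr0.
Qed.

Lemma intertwine_diag D : s = 1%g -> T (ebasis D) = (c * \prod_(q in D) d q) *: ebasis D.
Proof.
move=> s1; elim/set_ind1: D => [|q D qD e]; first by rewrite big_set0 mulr1.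
have dp : \prod_(q' in D) d q' = d q * \prod_(q' in (D :\ q)%SET) d q' by rewrite (big_setD1 q).
rewrite (ebasisU1 qD) TZ Tc e s1 perm1 creaZ !scalerA dp; apply: (congr1 (fun b => b *: _)); ring.
Qed.

Lemma intertwine_diag_coef x D : s = 1%g -> T x D = c * \prod_(q in D) d q * x D.
Proof.
move=> s1; have := intertwine_coef x D; rewrite s1.
have -> : ((1%g : {perm 'I_k}) @: D)%SET = D.
  by rewrite -[RHS]finset.imset_id; apply: finset.eq_imset => q; rewrite perm1.
by move=> ->; rewrite (intertwine_diag _ s1) extZE ebasisE eqxx mulr1 mulrC.
Qed.
End Intertwiner.

Definition pairs P : {set 'I_k} := (@ia n @: P :|: @ib n @: P)%SET.

Lemma in_pairs_ia P p : (ia p \in pairs P) = (p \in P).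
Proof.
rewrite inE mem_imset; last exact: ia_inj.
by case: imsetP => [[p' _ /eqP]|]; rewrite ?ia_ib// orbF.
Qed.
Lemma in_pairs_ib P p : (ib p \in pairs P) = (p \in P).
Proof.
rewrite inE [X in _ || X]mem_imset; last exact: ib_inj.
by case: imsetP => [[p' _ /eqP]|]; rewrite 1?eq_sym ?ia_ib.
Qed.
Lemma in_pairs0 P : (ord0 \in pairs P) = false.
Proof.
by rewrite inE; apply/negP => /orP[]/imsetP[p _ /esym/eqP]; rewrite ?ia_neq0 ?ib_neq0.
Qed.

(** The two positions are adjacent, so only membership of [ia p] separates the two parities. This
    makes wedging with a whole pair free of signs in [crea_pair]. *)
Lemma ltp_ib p D : ltp (ib p) D = ltp (ia p) D (+) (ia p \in D).
Proof.
rewrite /ltp; have -> : (ia p \in D) = \big[addb/false]_(b in D) (b == ia p).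
  rewrite big_mkcond (bigD1 (ia p))//= eqxx big1 ?addbF; first by case: ifP.
  by move=> q /negPf->; case: ifP.
rewrite -big_split; apply: eq_bigr => q _ /=.
rewrite -(inj_eq val_inj) /= val_ia val_ib addn1 addn2 !ltnS leq_eqVlt ltnS leq_eqVlt.
case: (eqVneq (q : nat) (2 * p).+1) => [->|_] /=; last by rewrite addbF.
by rewrite addbT; apply/esym/negP; lia.
Qed.

Lemma crea_pair p x D : crea (ia p) (crea (ib p) x) D =
  if (ia p \in D) && (ib p \in D) then x (D :\: [set ia p; ib p])%SET else 0.
Proof.
rewrite !ffunE in_sdiff inE [ib p == _]eq_sym ia_ib /=.
case: (boolP (ia p \in D)) => //= aD; case: (boolP (ib p \in D)) => bD; last by rewrite mulr0.
rewrite mulrA -psgD ltp_sdiff ltp_ib aD val_ia val_ib.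
have -> : (2 * p + 1 < 2 * p + 2)%N by rewrite ltn_add2l.
rewrite addbT addbT negbK addbb [psg _ _]expr0 mul1r; congr (x _).
apply/setP => q; rewrite !in_sdiff !inE.
case: (eqVneq q (ia p)) => [->|_]; first by rewrite ia_ib aD.
by case: (eqVneq q (ib p)) => [->|_]; rewrite ?bD.
Qed.

Lemma pairs_setD P p : (pairs P :\: [set ia p; ib p] = pairs (P :\ p))%SET.
Proof.
apply/setP => q; case: (idx_case q) => [->|[[p' ->]|[p' ->]]].
- by rewrite finset.in_setD !in_pairs0 andbF.
- by rewrite finset.in_setD in_pairs_ia in_pairs_ia !inE ia_ib orbF (inj_eq (@ia_inj n)).
by rewrite finset.in_setD !in_pairs_ib !inE [_ == ia p]eq_sym ia_ib (inj_eq (@ib_inj n)).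
Qed.

Lemma crea_pair_ebasis p P : p \in P ->
  crea (ia p) (crea (ib p) (ebasis (pairs (P :\ p)%SET))) = ebasis (pairs P) :> ext R k.
Proof.
move=> pP; apply/ffunP => D; rewrite crea_pair !ebasisE; case: andP => [[aD bD]|nD].
  congr (nat_of_bool _)%:R; apply/eqP/eqP => [e|->]; last exact: pairs_setD.
  apply/setP => q; have := congr1 (fun E : {set _} => q \in E) e.
  rewrite -pairs_setD !finset.in_setD !finset.in_set2; case: (eqVneq q (ia p)) => [->|_] /=.
    by rewrite aD in_pairs_ia pP.
  by case: (eqVneq q (ib p)) => [->|//] /=; rewrite bD in_pairs_ib pP.
by case: eqP nD => // -> []; rewrite in_pairs_ia in_pairs_ib.
Qed.

Lemma crea0_ebasis D : ord0 \notin D -> crea ord0 (ebasis D) = ebasis (ord0 |: D)%SET :> ext R k.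
Proof.
move=> D0; rewrite crea_ebasis// /ltp big1 => [|q _]; first by rewrite [psg _ _]expr0 scale1r.
by rewrite ltn0.
Qed.

Definition ompow (m : nat) : ext R k := iter m (@Om R n) vac.

(** Each of the m elements of P can be the pair wedged last, which produces the factor m at every
    stage and m! in the end. *)
Lemma ompow_pairs m P : ompow m (pairs P) = if #|P| == m then m`!%:R else 0.
Proof.
elim: m P => [|m ih] P.
  rewrite /ompow /= /vac ebasisE finset.cards_eq0 fact0.
  have -> : (pairs P == finset.set0) = (P == finset.set0); last by case: (P == _).
  apply/eqP/eqP => [h|->]; last by rewrite /pairs !finset.imset0 finset.setU0.
  by apply/setP => p; rewrite -in_pairs_ia h !inE.
rewrite /ompow iterS -/(ompow m) /Om ext_sumE.
under eq_bigr => p _ do rewrite crea_pair in_pairs_ia in_pairs_ib andbb pairs_setD ih.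
rewrite -big_mkcond /=.
under eq_bigr => p pP do rewrite -[#|_| == m]eqSS -(add1n #|_|) -[1%N]/(true : nat) -{1}pP -cardsD1.
rewrite sumr_const; case: eqP => [->|_]; last by rewrite mul0rn.
by rewrite factS natrM mulr_natl.
Qed.

End Monomials.

(** * Weights and the spinors invariant under Sp(n) *)

Section Weights.
Variables (R : realType) (n : nat) (a t : R).
Hypotheses (a_gt0 : 0 < a) (t_gt0 : 0 < t).
Local Notation H := (quat R).
Local Notation C := (R[i]).
Local Notation N := (Ndim n).
Local Notation k := ((Ndim n)./2).
Local Notation eN := (Ndim_even n).
Local Notation vac := (vac R n).
Local Notation lifts := (lifts a t).
Implicit Types (x : ext R k) (q : 'I_k) (D : {set 'I_k}) (p : 'I_n) (P Q : {set 'I_n}).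
Implicit Types (z : C) (A : 'M[H]_n) (mu : Cl R N).

Lemma spin_repDr mu : {morph @spin_rep R N mu : x y / x + y}.
Proof. by move=> x y; have := spin_rep_linear eN mu 1 x y; rewrite !scale1r. Qed.

Lemma lifts_crea z A mu (s : {perm 'I_k}) (d : 'I_k -> C) q x : lifts z A mu ->
  (forall v q, zeta (act z A v) (s q) = d q * zeta v q) ->
  spin_rep mu (crea q x) = d q *: crea (s q) (spin_rep mu x).
Proof. by move=> [_ /cover_act c _]; apply: rep_crea => v; exact: c. Qed.

Lemma lifts_U_crea z mu q x : lifts z 1%:M mu ->
  spin_rep mu (crea q x) = (if q == ord0 then (z^*%C) ^+ 2 else z^*%C) *: crea q (spin_rep mu x).
Proof.
move=> l; have := lifts_crea (s := 1%g) (d := fun q => if q == ord0 then (z^*%C) ^+ 2 else z^*%C) q x l.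
by rewrite perm1; apply=> v q'; rewrite perm1 zeta_actU.
Qed.

Lemma lifts_toral_crea p z mu q x : lifts 1 (toral p z) mu ->
  spin_rep mu (crea q x) = toral_wt p z q *: crea q (spin_rep mu x).
Proof.
move=> l; have := lifts_crea (s := 1%g) (d := toral_wt p z) q x l.
by rewrite perm1; apply=> v q'; rewrite perm1 zeta_act_toral.
Qed.

Lemma lifts_swap_crea p p' mu q x : lifts 1 (swap R p p') mu ->
  spin_rep mu (crea q x) = crea (swap_idx p p' q) (spin_rep mu x).
Proof.
move=> l; have := lifts_crea (s := swap_idx p p') (d := fun _ => 1) q x l.
by rewrite scale1r; apply=> v q'; rewrite zeta_act_swap mul1r.
Qed.

Lemma prod_single D q (u : C) : \prod_(q' in D) (if q' == q then u else 1) = if q \in D then u else 1.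
Proof.
rewrite big_mkcond (bigD1 q)//= eqxx big1 ?mulr1// => q' /negPf->.
by case: ifP.
Qed.

Lemma prod_U D (c : C) :
  \prod_(q in D) (if q == ord0 then c ^+ 2 else c) = c ^+ (#|D| + (ord0 \in D)).
Proof.
transitivity (\prod_(q in D) (c * if q == ord0 then c else 1)).
  by apply: eq_bigr => q _; case: eqP; rewrite ?mulr1// expr2.
rewrite big_split /= prod_single prodr_const exprD; congr (_ * _).
by case: (_ \in _); rewrite ?expr1.
Qed.

Lemma prod_toral D p z : \prod_(q in D) toral_wt p z q =
  (if ia p \in D then z^*%C else 1) * (if ib p \in D then z else 1).
Proof.
rewrite -!prod_single -big_split; apply: eq_bigr => q _; rewrite /toral_wt /=.
by case: eqP => [->|_]; rewrite ?mul1r// ia_ib mulr1.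
Qed.

(** Spinors on which the lift of (z, A) acts by z^-e. These are the components of invariant twisted
    spinors, the factor z^e being contributed by the twist. *)
Definition invs (e : int) : set (ext R k) := [set x |
  forall z A mu, `|z| = 1 -> Sp A -> lifts z A mu -> z ^ e *: spin_rep mu x = x].

(** For j <> 0 a |j|-th root of -1 lies on the unit circle and has j-th power -1, which is not 1. *)
Lemma unit_weight (j : int) : (forall z, `|z| = 1 -> z ^ j = 1) -> j = 0.
Proof.
move=> h; apply/eqP/negP => /negP j0.
have m0 : (0 < `|j|)%N by rewrite absz_gt0.
pose z : C := nthroot `|j| (-1).
have zj : z ^+ `|j|%N = -1 by exact: rootCK.
have z1 : `|z| = 1.
  by apply/eqP; rewrite -(@pexpr_eq1 _ _ `|j|%N)// -normrX zj normrN1.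
have : z ^ j = -1.
  by move: zj; case: (j) => m /= e; rewrite ?e// NegzE -exprnN e invrN1.
by rewrite (h _ z1) => /eqP; rewrite -addr_eq0 -mulr2n pnatr_eq0.
Qed.

Lemma unit_inv z : `|z| = 1 -> z^*%C = z^-1.
Proof. by move=> z1; apply: (mulfI (unitC_neq0 z1)); rewrite unit_conjM// divff// unitC_neq0. Qed.

(** The torus element with i at position p multiplies y_D by i or -i when D contains exactly one
    index of the pair, so the coefficient there must vanish. *)
Lemma invs_pair (e : int) x D p : invs e x -> x D != 0 -> (ia p \in D) = (ib p \in D).
Proof.
move=> xe xD; have i1 : `|'i%C| = 1 :> C by apply: unit_normC => /=; ring.
have St := toral_Sp p i1; have [mu l] := lifts_exists a_gt0 t_gt0 (normr1 C) St.
have := xe 1 _ mu (normr1 _) St l; rewrite exp1rz scale1r => /(congr1 (fun y : ext R k => y D)).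
have Tv : spin_rep mu vac = 1 *: vac by have [_ _ ->] := l; rewrite expr1n.
have Tc q y := lifts_toral_crea q y l.
rewrite (@intertwine_diag_coef _ _ (spin_rep mu) 1%g (toral_wt p 'i%C) 1 (spin_repDr mu) (spin_repZr mu) Tv); last by [].
  rewrite mul1r prod_toral => /eqP; rewrite -subr_eq0 -{2}[x D]mul1r -mulrBl mulf_eq0 (negPf xD) orbF subr_eq0.
  case: (_ \in D); case: (_ \in D) => //; rewrite ?mulr1 ?mul1r eq_complex /= ?oppr0 eq_sym oner_eq0//.
by move=> q y; rewrite perm1.
Qed.

(** The lift of (z, 1) acts on y_D by z^(n+1) from the vacuum and one inverse of z for each index,
    two for y_1; all exponents must cancel. *)
Lemma invs_weight (e : int) x D : invs e x -> x D != 0 ->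
  n.+1%:Z + e = (#|D| + (ord0 \in D))%N%:Z.
Proof.
move=> xe xD; apply/eqP; rewrite -subr_eq0; apply/eqP/unit_weight => z z1.
have [mu l] := lifts_U n a_gt0 t_gt0 z1.
have := xe _ _ _ z1 (@Sp1 R n) l => /(congr1 (fun y : ext R k => y D)).
have [_ _ Tv] := l; have Tc q y := lifts_U_crea q y l.
rewrite extZE (@intertwine_diag_coef _ _ (spin_rep mu) 1%g (fun q => if q == ord0 then (z^*%C) ^+ 2 else z^*%C) _ (spin_repDr mu) (spin_repZr mu) Tv); last by [].
  rewrite prod_U unit_inv// => /eqP; rewrite -subr_eq0 -{2}[x D]mul1r !mulrA -mulrBl mulf_eq0 (negPf xD) orbF subr_eq0 => /eqP h.
  by rewrite !expfzDr ?unitC_neq0// -exprnN -[RHS]h exprVn [in RHS](mulrC (z ^ e)).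
by move=> q y; rewrite perm1.
Qed.

Lemma card_pairs P : #|pairs P| = (2 * #|P|)%N.
Proof.
rewrite /pairs cardsU (card_imset _ (@ia_inj n)) (card_imset _ (@ib_inj n)).
have -> : (@ia n @: P :&: @ib n @: P = finset.set0)%SET.
  apply/setP => q; rewrite !inE; apply/negP => /andP[/imsetP[p _ ->] /imsetP[p' _ /eqP]].
  by rewrite ia_ib.
by rewrite finset.cards0 subn0 addnn mul2n.
Qed.

Lemma invs_support (e : int) x D : invs e x -> x D != 0 ->
  exists P, [/\ D = (if ord0 \in D then ord0 |: pairs P else pairs P)%SET &
    n.+1%:Z + e = (2 * (#|P| + (ord0 \in D)))%N%:Z].
Proof.
move=> xe xD; pose P := [set p | ia p \in D]%SET; exists P.
have eD : D = (if ord0 \in D then ord0 |: pairs P else pairs P)%SET.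
  apply/setP => q; case: (idx_case q) => [->|[[p ->]|[p ->]]].
  - by case: ifP => h; rewrite ?h ?finset.in_setU1 ?eqxx// in_pairs0.
  - by case: ifP => h; rewrite ?finset.in_setU1 ?ia_neq0 in_pairs_ia inE.
  by case: ifP => h; rewrite ?finset.in_setU1 ?ib_neq0 in_pairs_ib inE (invs_pair p xe xD).
split=> //; rewrite (invs_weight xe xD); congr (Posz _).
rewrite {1}eD; case: ifP => h; last by rewrite card_pairs !addn0.
by rewrite cardsU1 in_pairs0 card_pairs mulnDr /=; lia.
Qed.

Lemma swap_pairs p p' P : (swap_idx p p' @: pairs P = pairs (tperm p p' @: P))%SET.
Proof.
rewrite /pairs finset.imsetU -!finset.imset_comp; congr (_ :|: _)%SET.
  by apply: finset.eq_imset => l /=; rewrite swap_idxa.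
by apply: finset.eq_imset => l /=; rewrite swap_idxb.
Qed.

(** No sign arises: the monomial is built from the vacuum by whole pairs, and the transposition
    moves whole pairs. *)
Lemma swap_ebasis p p' P mu : lifts 1 (swap R p p') mu ->
  spin_rep mu (ebasis (pairs P)) = ebasis (pairs (tperm p p' @: P)%SET).
Proof.
move=> l; elim/set_ind1: P => [|q P qP e].
  have p0 : pairs finset.set0 = finset.set0 :> {set 'I_k}.
    by rewrite /pairs !finset.imset0 finset.setU0.
  by have [_ _] := l; rewrite finset.imset0 p0 expr1n scale1r.
rewrite -[in LHS](crea_pair_ebasis R qP) !(lifts_swap_crea _ _ l) e swap_idxa swap_idxb.
have eP : (tperm p p' @: (P :\ q) = (tperm p p' @: P) :\ tperm p p' q)%SET.
  apply/setP => j; rewrite -[j](permKV (tperm p p')) mem_imset ?in_setD1; last exact: perm_inj.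
  by rewrite mem_imset ?(inj_eq perm_inj)//; exact: perm_inj.
by rewrite eP crea_pair_ebasis// mem_imset//; exact: perm_inj.
Qed.

Lemma invs_swap (e : int) x p p' P : invs e x ->
  x (pairs (tperm p p' @: P)%SET) = x (pairs P) /\
  x (ord0 |: pairs (tperm p p' @: P))%SET = x (ord0 |: pairs P)%SET.
Proof.
move=> xe; have S1 := swap_Sp R p p'.
have [mu l] := lifts_exists a_gt0 t_gt0 (normr1 C) S1.
have := xe 1 _ mu (normr1 _) S1 l; rewrite exp1rz scale1r => ex.
have [_ _] := l; rewrite expr1n => Tv.
have Tc q y : spin_rep mu (crea q y) = 1 *: crea (swap_idx p p' q) (spin_rep mu y).
  by rewrite scale1r; exact: lifts_swap_crea.
have co := intertwine_coef (spin_repDr mu) (spin_repZr mu) Tv Tc x; rewrite ex in co.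
split.
  by have := co (pairs P); rewrite swap_pairs (swap_ebasis P l) ebasisE eqxx mulr1.
have := co (ord0 |: pairs P)%SET; rewrite finset.imsetU1 swap_idx0 swap_pairs => ->.
by rewrite -crea0_ebasis ?in_pairs0// Tc scale1r swap_idx0 (swap_ebasis P l) crea0_ebasis ?in_pairs0// ebasisE eqxx mulr1.
Qed.

(** Exchanging an element of P \ Q with one of Q \ P shrinks P \ Q by one, so sets of equal size are
    joined by transpositions. *)
Lemma card_swap_connected (f : {set 'I_n} -> C) P Q :
  (forall p p' P, f (tperm p p' @: P)%SET = f P) -> #|P| = #|Q| -> f P = f Q.
Proof.
move=> fs; move: {2}#|(P :\: Q)%SET| (erefl #|(P :\: Q)%SET|) => m.
elim: m P => [|m ih] P.
  move/finset.cards0_eq/eqP; rewrite finset.setD_eq0 => PQ cPQ.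
  by congr f; apply/eqP; rewrite eqEcard PQ cPQ leqnn.
move=> cm cPQ; have cm' : #|(Q :\: P)%SET| = m.+1.
  by rewrite -cm; have := cardsID Q P; have := cardsID P Q; rewrite finset.setIC; lia.
have [p /setDP[pP pQ]] : exists p, p \in (P :\: Q)%SET by apply/set0Pn; rewrite -card_gt0 cm.
have [p' /setDP[pQ' pP']] : exists p, p \in (Q :\: P)%SET by apply/set0Pn; rewrite -card_gt0 cm'.
rewrite -(fs p p'); apply: ih; last by rewrite card_imset//; exact: perm_inj.
have -> : ((tperm p p' @: P) :\: Q = (P :\: Q) :\ p)%SET.
  apply/setP => j; rewrite -[j](permKV (tperm p p')) !inE mem_imset; last exact: perm_inj.
  rewrite permKV tpermV; case: tpermP => [->|->|/eqP h1 /eqP h2].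
  - by rewrite (negPf pP') eqxx andbF.
  - by rewrite pQ' (negPf pP') !andbF.
  by rewrite h1.
by move: cm; rewrite (cardsD1 p) !inE pP pQ => -[].
Qed.

(** By uniqueness of the normalised lift, mu splits into a lift of (z, 1), acting by weights, and a
    lift of (1, A), which commutes with [Om] and with y_1 and fixes the vacuum. *)
Lemma ompow_lifts z A mu m : `|z| = 1 -> Sp A -> lifts z A mu ->
  spin_rep mu (ompow R n m) = z ^ (n.+1%:Z - (2 * m)%N%:Z) *: ompow R n m /\
  spin_rep mu (crea ord0 (ompow R n m)) =
    z ^ (n.+1%:Z - (2 * m.+1)%N%:Z) *: crea ord0 (ompow R n m).
Proof.
move=> z1 SA l; have [mu1 l1] := lifts_U n a_gt0 t_gt0 z1.
have [mu2 [l2 o2 y2]] := lifts_Sp a_gt0 t_gt0 SA.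
have e : mu = mu1 * mu2.
  apply: (lifts_unique z1 _ l); have := lifts_mul a_gt0 t_gt0 l1 l2.
  by rewrite mulr1 mul1mx.
have A2 : spin_rep mu2 (ompow R n m) = ompow R n m.
  elim: m => [|m ih]; last by rewrite /ompow iterS -/(ompow R n m) o2 ih.
  by have [_ _ ->] := l2; rewrite expr1n scale1r.
have zc : z^*%C = z ^ (-1) by rewrite unit_inv.
have U1 : spin_rep mu1 (ompow R n m) = z ^ (n.+1%:Z - (2 * m)%N%:Z) *: ompow R n m.
  elim: m {A2} => [|m ih]; first by have [_ _ ->] := l1; rewrite muln0 subr0.
  rewrite /ompow iterS -/(ompow R n m) /Om.
  rewrite (T_sum _ _ (spin_repDr mu1) (spin_repZr mu1)) scaler_sumr; apply: eq_bigr => p _.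
  rewrite !(lifts_U_crea _ _ l1) ia_neq0 ib_neq0 ih !creaZ !scalerA; congr (_ *: _).
  rewrite zc -!expfzDr ?unitC_neq0//; congr (_ ^ _); lia.
rewrite e !(spin_repM eN) y2 A2; split=> //.
rewrite (lifts_U_crea _ _ l1) U1 creaZ scalerA; congr (_ *: _).
rewrite /= zc expr2 -!expfzDr ?unitC_neq0//; congr (_ ^ _); lia.
Qed.

Lemma invsB (e : int) x y : invs e x -> invs e y -> invs e (x - y).
Proof.
move=> hx hy z A mu z1 SA l; rewrite -[- y]scaleN1r spin_repDr spin_repZr scalerDr.
by rewrite scalerA mulrC -scalerA (hx _ _ _ z1 SA l) (hy _ _ _ z1 SA l).
Qed.

Lemma invsZ (e : int) x (c : C) : invs e x -> invs e (c *: x).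
Proof.
move=> hx z A mu z1 SA l; rewrite spin_repZr scalerA mulrC -scalerA.
by rewrite (hx _ _ _ z1 SA l).
Qed.

Lemma invs0 (e : int) : invs e 0.
Proof. by move=> z A mu z1 SA l; rewrite -(scale0r 0) spin_repZr !scale0r scaler0. Qed.

Definition ompowz (m : int) : ext R k := if m is Posz j then ompow R n j else 0.

Lemma invs_ompowz (e m : int) : n.+1%:Z + e = 2 * m ->
  invs e (ompowz m) /\ invs e (crea ord0 (ompowz (m - 1))).
Proof.
move=> em; split.
  case: m em => m em /=; last exact: invs0.
  move=> z A mu z1 SA l; have [-> _] := ompow_lifts m z1 SA l.
  rewrite scalerA -expfzDr ?unitC_neq0//.
  have -> : e + (n.+1%:Z - (2 * m)%N%:Z) = 0 by lia.
  by rewrite expr0z scale1r.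
case em' : (m - 1) => [m'|m'] /=; last first.
  by have -> : crea ord0 (0 : ext R k) = 0 by [exact: linear0]; exact: invs0.
move=> z A mu z1 SA l; have [_ ->] := ompow_lifts m' z1 SA l.
rewrite scalerA -expfzDr ?unitC_neq0//.
have -> : e + (n.+1%:Z - (2 * m'.+1)%N%:Z) = 0 by lia.
by rewrite expr0z scale1r.
Qed.

Lemma ompow_ord0 m D : ord0 \in D -> ompow R n m D = 0.
Proof.
elim: m D => [|m ih] D D0.
  by rewrite /ompow /= /vac ebasisE; case: eqP => // e; move: D0; rewrite e inE.
rewrite /ompow iterS -/(ompow R n m) /Om ext_sumE big1// => p _; rewrite crea_pair.
case: ifP => // _; apply: ih; rewrite !inE D0 andbT.
by rewrite ![ord0 == _]eq_sym ia_neq0 ib_neq0.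
Qed.

Lemma crea0_coef x D : ord0 \notin D -> crea ord0 x D = 0 /\ crea ord0 x (ord0 |: D)%SET = x D.
Proof.
move=> D0; rewrite !ffunE (negPf D0) finset.setU11; split=> //.
rewrite /ltp big1 => [|q _]; last by rewrite ltn0.
rewrite [psg _ _]expr0 mul1r; congr (x _); apply/setP => q; rewrite in_sdiff !inE.
by case: eqVneq => // ->; rewrite (negPf D0).
Qed.

(** Subtract the combination with coefficients read off at one set of the right size. The difference
    y is again invariant, so its coefficients depend on the size of P only; it vanishes at the set
    used, hence everywhere on its possible support. *)
Lemma invs_span (e m : int) x : n.+1%:Z + e = 2 * m -> invs e x ->
  exists c d, x = c *: ompowz m + d *: crea ord0 (ompowz (m - 1)).
Proof.
move=> em xe; have [i1 i2] := invs_ompowz em.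
(* Takes a set P with m elements and divides by m!, the coefficient of omega^m there; the value 0
   covers the m for which no such set exists. *)
pose sel (m : int) (f : {set 'I_n} -> C) : C :=
  if [pick P : {set 'I_n} | #|P|%:Z == m] is Some P then f P / (#|P|)`!%:R else 0.
pose c := sel m (fun P => x (pairs P)).
pose d := sel (m - 1) (fun P => x (ord0 |: pairs P)%SET).
exists c, d; apply/eqP; rewrite -subr_eq0; apply/eqP.
set y := x - _; have ye : invs e y.
  rewrite /y opprD addrA; apply: invsB; last exact: invsZ.
  by apply: invsB => //; exact: invsZ.
have yE D : y D = x D - (c * ompowz m D + d * crea ord0 (ompowz (m - 1)) D).
  by rewrite /y extDE extNE extDE !extZE.
have fact0 j : (j`!%:R : C) != 0 by rewrite pnatr_eq0 -lt0n fact_gt0.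
apply/ffunP => D; rewrite ext0E; apply/eqP/negP => /negP yD.
have [P [eD eP]] := invs_support ye yD.
have selP (P' : {set 'I_n}) f : exists2 Q : {set 'I_n}, #|P'| = #|Q| & sel #|P'|%:Z f = f Q / (#|Q|)`!%:R.
  rewrite /sel; case: pickP => [Q /eqP[eQ]|/(_ P')]; last by rewrite eqxx.
  by exists Q.
have yP Q : #|P| = #|Q| -> y (pairs P) = y (pairs Q) /\ y (ord0 |: pairs P)%SET = y (ord0 |: pairs Q)%SET.
  move=> PQ; split.
    by apply: (@card_swap_connected (fun P => y (pairs P))) PQ => p p' P'; case: (invs_swap p p' P' ye).
  by apply: (@card_swap_connected (fun P => y (ord0 |: pairs P)%SET)) PQ => p p' P'; case: (invs_swap p p' P' ye).
move: yD; rewrite eD; case: ifP => D0; rewrite D0 in eP.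
  have mP : m - 1 = #|P|%:Z by lia.
  have [Q PQ dE] := selP P (fun P => x (ord0 |: pairs P)%SET).
  have [_ ->] := yP Q PQ; rewrite yE.
  have [_ ->] := crea0_coef (ompowz (m - 1)) (negbT (in_pairs0 Q)).
  have -> : ompowz m (ord0 |: pairs Q)%SET = 0.
    by case: (m) => j /=; rewrite ?ext0E// ompow_ord0// finset.setU11.
  rewrite /d mP dE /= ompow_pairs PQ eqxx mulr0 add0r => /eqP; apply; apply/eqP.
  by rewrite divfK// subrr.
have mP : m = #|P|%:Z by lia.
have [Q PQ cE] := selP P (fun P => x (pairs P)).
have [-> _] := yP Q PQ; rewrite yE.
have [-> _] := crea0_coef (ompowz (m - 1)) (negbT (in_pairs0 Q)).
rewrite /c mP cE /= ompow_pairs PQ eqxx mulr0 addr0 => /eqP; apply; apply/eqP.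
by rewrite divfK// subrr.
Qed.

Lemma invs_parity (e : int) x : (forall m : int, n.+1%:Z + e <> 2 * m) -> invs e x -> x = 0.
Proof.
move=> em xe; apply/ffunP => D; rewrite ext0E; apply/eqP/negP => /negP xD.
by have [P [_ eP]] := invs_support xe xD; case: (em (#|P| + (ord0 \in D))%N%:Z); rewrite eP.
Qed.

Lemma ompow_neq0 m : (m <= n)%N -> ompow R n m != 0.
Proof.
move=> mn; pose P := [set p : 'I_n | (p < m)%N]%SET.
have cP : #|P| = m.
  rewrite -sum1_card (eq_bigl (fun p : 'I_n => (p < m)%N)) => [|p]; last by rewrite inE.
  by rewrite -(big_ord_widen n (fun=> 1%N) mn) sum_nat_const card_ord muln1.
apply/eqP => /(congr1 (fun y : ext R k => y (pairs P))).
rewrite ompow_pairs cP eqxx ext0E; apply/eqP.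
by rewrite pnatr_eq0 -lt0n fact_gt0.
Qed.

End Weights.

Lemma vdot_deltas (R : realType) m (i j : 'I_m) :
  vdot (delta_mx 0 i) (delta_mx 0 j) = (i == j)%:R :> R.
Proof.
rewrite /vdot (bigD1 j)//= big1 => [|l lj]; first by rewrite !mxE !eqxx mulr1 addr0 eq_sym.
by rewrite !mxE (negPf lj) mulr0.
Qed.

(** * Twisted spinors component by component *)

Section Twisted.
Variables (R : realType) (n : nat).
Local Notation C := (R[i]).
Local Notation N := (Ndim n).
Local Notation k := ((Ndim n)./2).
Local Notation eN := (Ndim_even n).
Local Notation vac := (vac R n).
Implicit Types (x : ext R k) (D : {set 'I_k}) (p : 'I_n).

(* The components of a twisted spinor along the basis of the twisting factor. *)
Definition slice r m (psi : tspinor R N r m) (c : {ffun 'I_m -> {set 'I_r./2}}) : ext R k :=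
  [ffun D => psi (D, c)].

Lemma slice_inj r m (psi psi' : tspinor R N r m) : slice psi =1 slice psi' -> psi = psi'.
Proof. by move=> h; apply/ffunP => -[D c]; have /ffunP/(_ D) := h c; rewrite !ffunE. Qed.

(** The twisting factor acts diagonally in the chosen basis, so components do not mix: each is acted
    on by mu and scaled by a product of eigenvalues. *)
Lemma slice_act r m mu (nu : Cl R r) (chi : {set 'I_r./2} -> C) (psi : tspinor R N r m) c :
  (forall E, spin_rep nu (ebasis E) = chi E *: ebasis E) ->
  slice (tspin_act mu nu psi) c = (\prod_i chi (c i)) *: spin_rep mu (slice psi c).
Proof.
move=> nuE; apply/ffunP => D; rewrite extZE ffunE /tspin_act sum_ffunE.
rewrite (eq_bigr (fun b => psi (b.1, b.2) * (spin_rep mu (ebasis b.1) D *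
  \prod_i (spin_rep nu (ebasis (b.2 i))) (c i)))) => [|b _]; last by rewrite -surjective_pairing ffunE /tensor ffunE.
rewrite -(pair_bigA _ (fun b1 b2 => psi (b1, b2) * (spin_rep mu (ebasis b1) D *
  \prod_i (spin_rep nu (ebasis (b2 i))) (c i)))) /=.
have -> : spin_rep mu (slice psi c) D = \sum_b psi (b, c) * spin_rep mu (ebasis b) D.
  rewrite [slice psi c]ext_basis (T_sum _ _ (spin_repDr mu) (spin_repZr mu)) ext_sumE.
  by apply: eq_bigr => b _; rewrite spin_repZr extZE ffunE.
rewrite mulr_sumr; apply: eq_bigr => b _; rewrite (bigD1 c)//= [X in _ + X]big1 ?addr0 => [|c' c'c].
  have -> : \prod_i spin_rep nu (ebasis (c i)) (c i) = \prod_i chi (c i).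
    by apply: eq_bigr => i _; rewrite nuE extZE ebasisE eqxx mulr1.
  ring.
have [i ic] : exists i, c i != c' i.
  apply/existsP; rewrite -negb_forall; apply: contra c'c => /forallP h.
  by apply/eqP/ffunP => i; apply/esym/eqP/h.
by rewrite (bigD1 i)//= nuE extZE ebasisE (negPf ic) !(mulr0, mul0r).
Qed.

Let e0 : 'rV[R]_2 := delta_mx 0 0.
Let e1 : 'rV[R]_2 := delta_mx 0 1.
Let u0 : unitv e0. Proof. by rewrite /unitv vdot_deltas. Qed.
Let u1 : unitv e1. Proof. by rewrite /unitv vdot_deltas. Qed.
Let e01 : vdot e0 e1 = 0. Proof. by rewrite vdot_deltas. Qed.

(** Covers the rotation by w^2; the sign of the imaginary part is chosen so that hat 1 is multiplied
    by w and hat y_1 by its conjugate. *)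
Definition nu2 (w : C) : Cl R 2 := rotv e0 e1 (complex.Re w) (- complex.Im w).

Lemma nu2E (w : C) : nu2 w = (complex.Re w)%:A + complex.Im w *: (clvec e0 * clvec e1).
Proof. by rewrite /nu2 (rotvE _ _ u0 e01) scaleNr opprK. Qed.

Lemma nu2_Spin (w : C) : `|w| = 1 -> Spin R 2 (nu2 w).
Proof. by move/normC_unit => h; apply: rotv_Spin; rewrite ?sqrrN; [exact: u0|exact: u1|exact: e01|exact: h]. Qed.

Lemma nu2_cover (w : C) : `|w| = 1 -> spin_cover (nu2 w) (so2 (w ^+ 2)).
Proof.
move/normC_unit => h.
have h' : complex.Re w ^+ 2 + (- complex.Im w) ^+ 2 = 1 by rewrite sqrrN.
have [B [cB rB]] := rotv_cover u0 u1 e01 h'.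
have -> : so2 (w ^+ 2) = B.
  apply: trmx_inj; apply/row_matrixP => i; rewrite !rowE rB /prot.
  have c2 : complex.Re w * complex.Re w = 1 - complex.Im w * complex.Im w by rewrite -!expr2 -h addrK.
  apply/rowP => j; rewrite -rowE !mxE /vdot !big_ord_recl !big_ord0 !mxE.
  case: w h h' c2 {B cB rB} => c s /= h h' c2.
  case: i => [[|[|i]] //= Hi]; case: j => [[|[|j]] //= Hj]; rewrite ?expr2 /= ?c2; ring.
exact: cB.
Qed.

Lemma nu2_ebasis (w : C) E :
  spin_rep (nu2 w) (ebasis E) = (if ord0 \in E then w^*%C else w) *: ebasis E :> ext R 2./2.
Proof.
have e2 : ~~ odd 2 by [].
rewrite nu2E spin_repD !spin_repZ spin_rep1 (spin_repM e2) !clvec_delta !spin_rep_clE.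
have -> : cliff_gen 0 (cliff_gen 1 (ebasis E)) = ('i%C * psg C (ord0 \in E)) *: ebasis E :> ext R 2./2.
  apply/ffunP => D; rewrite extZE !(cliff_genE e2).
  have -> : odd (nat_of_ord (0%R : 'I_2)) = false by [].
  have -> : odd (nat_of_ord (1%R : 'I_2)) = true by [].
  have q0 : qof e2 0 = ord0 by apply/val_inj.
  have q1 : qof e2 1 = ord0 by apply/val_inj.
  rewrite q0 q1 sdiffK ltp_sdiff ltnn addbF in_sdiff inE.
  rewrite eqxx !mulrA ebasisE; case: eqP => [->|_]; last by rewrite !mulr0.
  by case: (ltp _ _); case: (_ \in _); rewrite /psg /= ?expr0 ?expr1; ring.
rewrite scalerA -scalerDl; congr (_ *: _).
case: w => c s /=; case: ifP => _; rewrite ?[psg _ _]expr1 ?[psg _ _]expr0;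
  apply/eqP; rewrite eq_complex /=; apply/andP; split; apply/eqP; ring.
Qed.

Lemma wedge_pair p x : wedge (crea (ia p) (ebasis [set ib p]%SET)) x = crea (ia p) (crea (ib p) x).
Proof.
have -> : crea (ia p) (ebasis [set ib p]%SET) = ebasis [set ia p; ib p]%SET :> ext R k.
  rewrite crea_ebasis ?inE ?ia_ib// /ltp big_set1 val_ia val_ib.
  have -> : (2 * p + 2 < 2 * p + 1)%N = false by lia.
  by rewrite [psg _ _]expr0 scale1r.
apply/ffunP => D; rewrite wedge_ebasis crea_pair finset.subUset !finset.sub1set.
case: ifP => // /andP[aD bD]; set B := (D :\: _)%SET.
have disj : ([set ia p; ib p] :&: B = finset.set0)%SET.
  by apply/setP => q; rewrite !inE; case: (_ || _).
have := par_def [set ia p; ib p]%SET B; rewrite disj finset.cards0 addn0 psgE => ->.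
have -> : [set ia p; ib p]%SET = sdiff [set ia p]%SET [set ib p]%SET.
  by apply/setP => q; rewrite in_sdiff !inE; case: eqP => [->|]//; rewrite ia_ib.
(* No index of B lies strictly between the adjacent [ia p] and [ib p], nor equals [ib p], so both
   sums agree and the signs cancel. *)
rewrite par_sdiffl !par1l (eq_bigr (fun b : 'I_k => (b <= ib p)%N)) => [|b].
  by rewrite addbb [psg _ _]expr0 mul1r.
rewrite !inE negb_or => /andP[/andP[_ bb] _]; move: bb.
rewrite -(inj_eq val_inj) /= val_ia val_ib; lia.
Qed.

Lemma wedge_suml (I : Type) (r : seq I) (F : I -> ext R k) x :
  wedge (\sum_(i <- r) F i) x = \sum_(i <- r) wedge (F i) x.
Proof.
have wD y y' : wedge (y + y') x = wedge y x + wedge y' x.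
  apply/ffunP => D; rewrite extDE !ffunE -big_split; apply: eq_bigr => A _ /=.
  by rewrite -big_split; apply: eq_bigr => B _ /=; rewrite extDE mulrDr mulrDl.
have w0 : wedge 0 x = 0.
  apply/ffunP => D; rewrite ext0E ffunE; apply: big1 => A _; apply: big1 => B _.
  by rewrite ext0E mulr0 mul0r.
by elim/big_rec2: _ => // i y1 y2 _ <-; rewrite wD.
Qed.

Lemma wedge_omega x : wedge (omega n) x = Om x.
Proof.
rewrite /omega big_add1 /= big_mkord wedge_suml; apply: eq_bigr => p _.
have ya : yform n (2 * p.+1) = ebasis [set ia p]%SET :> ext R k.
  rewrite /yform; case: insubP => [q _ e|]; last first.
    by rewrite [X in (_ < X)%N]Ndim_half; have := ltn_ord p; lia.
  by congr (ebasis [set _]%SET); apply/val_inj; apply: (etrans e); apply: (etrans _ (esym (val_ia p))); lia.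
have yb : yform n (2 * p.+1 + 1) = ebasis [set ib p]%SET :> ext R k.
  rewrite /yform; case: insubP => [q _ e|]; last first.
    by rewrite [X in (_ < X)%N]Ndim_half; have := ltn_ord p; lia.
  by congr (ebasis [set _]%SET); apply/val_inj; apply: (etrans e); apply: (etrans _ (esym (val_ib p))); lia.
by rewrite ya yb wedge1E wedge_pair.
Qed.

Lemma omega_powE m : omega_pow n m = ompowz R n m.
Proof.
case: m => // m; rewrite /omega_pow /ompowz /ompow.
by elim: m => //= m ->; rewrite wedge_omega.
Qed.

Lemma wedge_y1 x : wedge (yform n 1) x = crea ord0 x.
Proof.
rewrite /yform; case: insubP => [q _ e|] //=.
by rewrite wedge1E; congr (crea _ x); apply/val_inj.
Qed.

End Twisted.

(** * Invariant spinors over phi_s and over Spin(1) *)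

Section Structure.
Variables (R : realType) (n : nat) (a t : R).
Hypotheses (a_gt0 : 0 < a) (t_gt0 : 0 < t).
Local Notation H := (quat R).
Local Notation C := (R[i]).
Local Notation N := (Ndim n).
Local Notation k := ((Ndim n)./2).
Local Notation eN := (Ndim_even n).
Local Notation vac := (vac R n).
Local Notation lifts := (lifts a t).
Local Notation invs := (invs a t).
Implicit Types (z : C) (A : 'M[H]_n) (h : 'M[H]_n.+1) (x : ext R k).

Definition hz h : C := (qr (h ord0 ord0) +i* qi (h ord0 ord0))%C.
Definition hA h : 'M[H]_n := drsubmx (h : 'M[H]_(1 + n)).
Definition muh h : Cl R N := xget 0 [set mu | lifts (hz h) (hA h) mu].

Lemma emb00 z A : emb z A ord0 ord0 = quat_of_complex z.
Proof.
have -> : ord0 = lshift n (ord0 : 'I_1) by apply/val_inj.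
by apply: (etrans (block_mxEul _ _ _ _ _ _)); rewrite mxE eqxx mulr1n.
Qed.

Lemma hz_emb z A : hz (emb z A) = z.
Proof. by rewrite /hz emb00; case: z. Qed.

Lemma hA_emb z A : hA (emb z A) = A.
Proof. by rewrite /hA /emb block_mxKdr. Qed.

Lemma emb_mul z A z' A' : emb z A *m emb z' A' = emb (z * z') (A *m A').
Proof.
rewrite /emb; have := mulmx_block ((quat_of_complex z)%:M : 'M[H]_1) 0 0 A ((quat_of_complex z')%:M : 'M[H]_1) 0 0 A'.
by move=> ->; rewrite !mul0mx !mulmx0 !addr0 add0r quat_of_complexM scalar_mxM.
Qed.

Lemma Hgrp_emb z A : `|z| = 1 -> Sp A -> Hgrp (emb z A).
Proof. by move=> z1 SA; exists z, A. Qed.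

Lemma Hgrp_hz h : Hgrp h -> [/\ `|hz h| = 1, Sp (hA h) & h = emb (hz h) (hA h)].
Proof. by move=> [z [A [z1 SA ->]]]; rewrite hz_emb hA_emb. Qed.

Lemma HgrpM h h' : Hgrp h -> Hgrp h' -> Hgrp (h *m h').
Proof.
move=> [z [A [z1 SA ->]]] [z' [A' [z1' SA' ->]]]; rewrite emb_mul; apply: Hgrp_emb.
  by rewrite normrM z1 z1' mulr1.
exact: SpM.
Qed.

Lemma hzM h h' : Hgrp h -> Hgrp h' -> hz (h *m h') = hz h * hz h'.
Proof. by move=> [z [A [z1 SA ->]]] [z' [A' [z1' SA' ->]]]; rewrite emb_mul !hz_emb. Qed.

Lemma muh_lifts h : Hgrp h -> lifts (hz h) (hA h) (muh h).
Proof.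
move=> /Hgrp_hz[z1 SA _]; have [mu l] := lifts_exists a_gt0 t_gt0 z1 SA.
exact: (@xgetPex _ 0 [set mu | lifts (hz h) (hA h) mu] (ex_intro _ mu l)).
Qed.

Lemma muh_emb z A mu : `|z| = 1 -> Sp A -> lifts z A mu -> muh (emb z A) = mu.
Proof.
move=> z1 SA l; have := muh_lifts (Hgrp_emb z1 SA); rewrite hz_emb hA_emb.
exact: lifts_unique z1 l.
Qed.

Lemma muhM h h' : Hgrp h -> Hgrp h' -> muh (h *m h') = muh h * muh h'.
Proof.
move=> Hh Hh'; have [z1 SA e] := Hgrp_hz Hh; have [z1' SA' e'] := Hgrp_hz Hh'.
have l := lifts_mul a_gt0 t_gt0 (muh_lifts Hh) (muh_lifts Hh').
rewrite {1}e {1}e' emb_mul; apply: muh_emb l; [by rewrite normrM z1 z1' mulr1|exact: SpM].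
Qed.

Section WithNu.
Variables (r : nat) (nu : C -> Cl R r).

Definition phiM h : set (Cl R N * Cl R r) := spinr_cls (muh h, nu (hz h)).

Lemma inv_slices (m : nat) (chi : C -> {set 'I_r./2} -> C) (psi : tspinor R N r m) : odd m ->
  (forall z E, `|z| = 1 -> spin_rep (nu z) (ebasis E) = chi z E *: ebasis E) ->
  inv_spinors (m := m) phiM psi <->
  forall (c : {ffun 'I_m -> {set 'I_r./2}}) z A mu, `|z| = 1 -> Sp A -> lifts z A mu ->
    (\prod_i chi z (c i)) *: spin_rep mu (slice psi c) = slice psi c.
Proof.
move=> om nuE; split=> [hpsi c z A mu z1 SA l|hpsi h Hh mu' nu'].
  have := hpsi _ (Hgrp_emb z1 SA) mu (nu z); rewrite /phiM hz_emb (muh_emb z1 SA l).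
  move=> /(_ (or_introl erefl)) {2}<-; rewrite (slice_act _ _ _ (chi := chi z))// => E.
  exact: nuE.
have [z1 SA e] := Hgrp_hz Hh; have l := muh_lifts Hh.
have main : tspin_act (muh h) (nu (hz h)) psi = psi.
  apply: slice_inj => c; rewrite (slice_act _ _ _ (chi := chi (hz h))) => [|E]; last exact: nuE.
  exact: hpsi l.
case=> -[-> ->]; first exact: main.
(* For the representative (-mu, -nu) the m twisting factors and the spin factor each contribute a
   sign; m is odd, so these m + 1 signs cancel. *)
apply: slice_inj => c; rewrite (slice_act _ _ _ (chi := fun E => - chi (hz h) E)) => [|E].
  rewrite prodrN clopp_opp spin_repN scalerN card_ord -signr_odd om expr1 mulN1r scaleNr opprK.
  exact: hpsi l.
by rewrite clopp_opp spin_repN nuE// scaleNr.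
Qed.
End WithNu.

Definition c0 : {ffun 'I_1 -> {set 'I_2./2}} := [ffun=> finset.set0].
Definition c1 : {ffun 'I_1 -> {set 'I_2./2}} := [ffun=> [set ord0]%SET].

Lemma set_ord1 (E : {set 'I_1}) : E = if ord0 \in E then [set ord0]%SET else finset.set0.
Proof. by apply/setP => i; rewrite (ord1 i); case: ifP => h; rewrite !inE. Qed.

Lemma c01 c : c = c0 \/ c = c1.
Proof.
have e : c = [ffun=> c ord0] by apply/ffunP => i; rewrite ffunE (ord1 i).
by rewrite e [c ord0]set_ord1; case: ifP; [right|left].
Qed.

Lemma slice_tensor x (y : ext R 2./2) c :
  slice (tensor (r := 2) (m := 1) x (fun _ => y)) c = y (c ord0) *: x.
Proof. by apply/ffunP => D; rewrite extZE !ffunE big_ord1 mulrC. Qed.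

Lemma sliceD r m (p q : tspinor R N r m) c : slice (p + q : {ffun _ -> C}) c = slice p c + slice q c.
Proof. by apply/ffunP => D; rewrite extDE !ffunE. Qed.

Lemma slice0 r m (c : {ffun 'I_m -> {set 'I_r./2}}) :
  slice (0 : {ffun {set 'I_k} * {ffun 'I_m -> {set 'I_r./2}} -> C}) c = 0.
Proof. by apply/ffunP => D; rewrite ext0E !ffunE. Qed.

Lemma hat1E : (@hat1 R (c0 ord0) = 1) * (@hat1 R (c1 ord0) = 0).
Proof.
rewrite !ffunE eqxx; split=> //; case: eqP => // /setP/(_ ord0).
by rewrite !inE eqxx.
Qed.
Lemma haty1E : (@haty1 R (c0 ord0) = 0) * (@haty1 R (c1 ord0) = 1).
Proof.
rewrite !ffunE eqxx; split=> //; case: eqP => // /setP/(_ ord0).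
by rewrite !inE eqxx.
Qed.

Lemma direct_sum_slices (S0 S1 : set (ext R k)) (I : set (tspinor R N 2 1)) : S0 0 -> S1 0 ->
  (forall psi, I psi <-> S0 (slice psi c0) /\ S1 (slice psi c1)) ->
  direct_sum (tensor_with S0 (@hat1 R)) (tensor_with S1 (@haty1 R)) I.
Proof.
move=> S00 S10 IE; split.
  apply/seteqP; split=> [psi [[x _ <-] [y _ e]]|psi ->].
    apply: slice_inj => c; rewrite slice0; case: (c01 c) => ->.
      by rewrite -e slice_tensor haty1E scale0r.
    by rewrite slice_tensor hat1E scale0r.
  split; [exists 0 => //|exists 0 => //]; apply: slice_inj => c;
    by rewrite slice0 slice_tensor scaler0.
apply/seteqP; split=> [psi /IE[h0 h1]|psi [u [v [[x Sx <-] [y Sy <-] ->]]]].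
  exists (tensor (r := 2) (m := 1) (slice psi c0) (fun _ => @hat1 R)).
  exists (tensor (r := 2) (m := 1) (slice psi c1) (fun _ => @haty1 R)).
  split; [by exists (slice psi c0)|by exists (slice psi c1)|].
  apply: slice_inj => c; rewrite sliceD !slice_tensor.
  by case: (c01 c) => ->; rewrite !hat1E !haty1E scale1r scale0r ?addr0 ?add0r.
by apply/IE; rewrite !sliceD !slice_tensor !hat1E !haty1E !scale1r !scale0r addr0 add0r.
Qed.

Definition nuS (s' : int) z : Cl R 2 := nu2 (z ^ s').

Lemma norm_expz z (s' : int) : `|z| = 1 -> `|z ^ s'| = 1.
Proof. by move=> z1; case: s' => m; rewrite ?NegzE -?exprnN ?normfV normrX z1 expr1n ?invr1. Qed.

Lemma nuS_ebasis s' z E : `|z| = 1 -> spin_rep (nuS s' z) (ebasis E) =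
  (if ord0 \in E then z ^ (- s') else z ^ s') *: ebasis E.
Proof.
move=> z1; rewrite nu2_ebasis; case: ifP => // _.
by rewrite unit_inv ?norm_expz// invr_expz.
Qed.

Lemma inv_nuS s' (psi : tspinor R N 2 1) : inv_spinors (m := 1) (phiM (nuS s')) psi <->
  invs s' (slice psi c0) /\ invs (- s') (slice psi c1).
Proof.
rewrite (inv_slices (r := 2) (chi := fun z E => if ord0 \in E then z ^ (- s') else z ^ s'))// => [|z E]; last exact: nuS_ebasis.
split=> [hc|[h0 h1] c z A mu z1 SA l].
  split=> z A mu z1 SA l.
    by have := hc c0 z A mu z1 SA l; rewrite big_ord1 ffunE inE.
  by have := hc c1 z A mu z1 SA l; rewrite big_ord1 ffunE inE eqxx.
by rewrite big_ord1; case: (c01 c) => ->; rewrite ffunE inE ?eqxx; [exact: h0 l|exact: h1 l].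
Qed.

Lemma span2_invs (e m : int) : n.+1%:Z + e = 2 * m ->
  span2 (omega_pow n m) (wedge (yform n 1) (omega_pow n (m - 1))) = invs e.
Proof.
move=> em; rewrite wedge_y1 !omega_powE; apply/seteqP; split=> [x [c [d ->]]|x xe].
  have [i1 i2] := invs_ompowz a_gt0 t_gt0 em.
  have -> : escale c (ompowz R n m) + escale d (crea ord0 (ompowz R n (m - 1))) =
    c *: ompowz R n m - (- d) *: crea ord0 (ompowz R n (m - 1)) by rewrite scaleNr opprK.
  by apply: invsB; exact: invsZ.
by have [c [d ->]] := invs_span a_gt0 t_gt0 em xe; exists c, d.
Qed.

Lemma inv_direct_sum (s' : int) : (n%:Z <> s' %[mod 2])%Z ->
  direct_sum
    (tensor_with (span2 (omega_pow n ((n%:Z + 1 + s') %/ 2)%Z)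
       (wedge (yform n 1) (omega_pow n ((n%:Z - 1 + s') %/ 2)%Z))) (@hat1 R))
    (tensor_with (span2 (omega_pow n ((n%:Z + 1 - s') %/ 2)%Z)
       (wedge (yform n 1) (omega_pow n ((n%:Z - 1 - s') %/ 2)%Z))) (@haty1 R))
    (inv_spinors (m := 1) (phiM (nuS s'))).
Proof.
move=> ns.
have [m em] : exists m : int, n.+1%:Z + s' = 2 * m by exists ((n%:Z + 1 + s') %/ 2)%Z; lia.
have em' : n.+1%:Z - s' = 2 * (m - s') by lia.
have -> : ((n%:Z + 1 + s') %/ 2)%Z = m by lia.
have -> : ((n%:Z - 1 + s') %/ 2)%Z = m - 1 by lia.
have -> : ((n%:Z + 1 - s') %/ 2)%Z = m - s' by lia.
have -> : ((n%:Z - 1 - s') %/ 2)%Z = m - s' - 1 by lia.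
rewrite (span2_invs em) (span2_invs em').
by apply: direct_sum_slices; [exact: invs0|exact: invs0|move=> psi; exact: inv_nuS].
Qed.

Lemma inv_zero (s' : int) : (n%:Z = s' %[mod 2])%Z ->
  inv_spinors (m := 1) (phiM (nuS s')) = [set 0].
Proof.
move=> ns; have p1 (m : int) : n.+1%:Z + s' <> 2 * m by lia.
have p2 (m : int) : n.+1%:Z - s' <> 2 * m by lia.
apply/seteqP; split=> [psi /inv_nuS[h0 h1]|psi ->].
  apply: slice_inj => c; rewrite slice0.
  by case: (c01 c) => ->; [exact: (invs_parity a_gt0 t_gt0 p1)|exact: (invs_parity a_gt0 t_gt0 p2)].
by apply/inv_nuS; rewrite !slice0; split; exact: invs0.
Qed.

Lemma tensor_neq0 r m x : x != 0 ->
  tensor (r := r) (m := m) x (fun _ => ebasis finset.set0) <> 0 :> {ffun _ -> C}.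
Proof.
move=> x0 e; case/eqP: x0; apply/ffunP => D; rewrite ext0E.
have := congr1 (fun f : {ffun _ -> C} => f (D, [ffun=> finset.set0])) e.
rewrite !ffunE big1 ?mulr1 => [//|i _].
by rewrite !ffunE eqxx.
Qed.

Lemma exists_inv1 : odd n -> exists2 psi : tspinor R N 1 1,
  inv_spinors (m := 1) (phiM (fun _ => 1 : Cl R 1)) psi & psi <> 0 :> {ffun _ -> C}.
Proof.
move=> on; pose m := (n.+1)./2.
exists (tensor (r := 1) (m := 1) (ompow R n m) (fun _ => ebasis finset.set0)); last first.
  by apply: tensor_neq0; apply: ompow_neq0; rewrite /m; lia.
apply/(inv_slices (r := 1) (chi := fun _ _ => 1)) => // [z E _|c z A mu z1 SA l].
  by rewrite spin_rep1 scale1r.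
have -> : slice (tensor (r := 1) (m := 1) (ompow R n m) (fun _ => ebasis finset.set0)) c =
    ebasis finset.set0 (c ord0) *: ompow R n m.
  by apply/ffunP => D; rewrite extZE [LHS]ffunE [LHS]ffunE big_ord1 mulrC.
rewrite big_ord1 scale1r spin_repZr; have [-> _] := ompow_lifts a_gt0 t_gt0 m z1 SA l.
have -> : n.+1%:Z - (2 * m)%N%:Z = 0 by rewrite /m; lia.
by rewrite expr0z scale1r.
Qed.

(** Taking s' = 1 shifts the weight by one and allows m = (n + 2) / 2, which is at most n because an
    even positive n is at least 2. *)
Lemma exists_inv2 : (1 <= n)%N -> ~~ odd n -> exists2 psi : tspinor R N 2 1,
  inv_spinors (m := 1) (phiM (nuS 1)) psi & psi <> 0 :> {ffun _ -> C}.
Proof.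
move=> n1 en; pose m := (n.+2)./2.
exists (tensor (r := 2) (m := 1) (ompow R n m) (fun _ => ebasis finset.set0)); last first.
  by apply: tensor_neq0; apply: ompow_neq0; rewrite /m; lia.
apply/inv_nuS; rewrite !slice_tensor !hat1E scale0r scale1r; split; last exact: invs0.
have em : n.+1%:Z + 1 = 2 * m%:Z by rewrite /m; lia.
by have [] := invs_ompowz a_gt0 t_gt0 em.
Qed.

Lemma act_opp (v : 'rV[R]_N) : act (-1) (-1)%:M v = v.
Proof.
have qN : quat_of_complex (-1 : C) = -1 by apply: quatP; rewrite /= ?oppr0.
apply: vhP; rewrite ?vv_act ?hv_act.
  by rewrite qN qconjN qconj1 mulrN1 mulN1r opprK.
by rewrite qN ctr_scalar qconjN qconj1 raddfN mulmxN mulmx1 scaleN1r opprK.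
Qed.

Lemma unit_iC : `|'i%C| = 1 :> C.
Proof. by apply: unit_normC => /=; ring. Qed.

Lemma Sp_i : Sp ((q_i R)%:M : 'M[H]_n).
Proof.
rewrite /Sp /= ctrans_ctr ctr_scalar -scalar_mxM.
by have -> : qconj (q_i R) * q_i R = 1 by apply: quatP; rewrite !qE /=; ring.
Qed.

Lemma no_inv1 (m : nat) mu (nu : Cl R 1) (psi : tspinor R N 1 m) : ~~ odd n ->
  Spin R N mu -> spin_cover mu (isotropy a t (emb 'i%C (q_i R)%:M)) -> Spin R 1 nu ->
  tspin_act mu nu psi = psi -> psi = 0 :> {ffun _ -> C}.
Proof.
move=> en Smu cmu Snu inv.
have [L l] := lifts_exists a_gt0 t_gt0 unit_iC Sp_i; have [SL cL vL] := l.
(* The square (-1, -1) of h acts trivially on the tangent space, so L L is 1 or -1; its eigenvalue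
   on the vacuum is (-1)^(n+1), which is -1 for even n. *)
have LL : L * L = -1.
  have := lifts_mul a_gt0 t_gt0 l l; rewrite -scalar_mxM sqr_iC.
  have -> : q_i R * q_i R = -1 by apply: quatP; rewrite !qE /=; ring.
  move=> [S2 c2 v2].
  have c1 : spin_cover (1 : Cl R N) (isotropy a t (emb (-1) (-1)%:M)).
    by apply/cover_act => // v; rewrite act_opp mul1r mulr1.
  have [e|//] := cover_unique eN (Spin1 R N) S2 c1 c2.
  move: v2; rewrite e spin_rep1 -signr_odd /= en expr1 scaleN1r => /eqP.
  by rewrite -addr_eq0 -mulr2n -scaler_nat scaler_eq0 (negPf (vac_neq0 R n)) pnatr_eq0.
have mm : mu * mu = -1.
  by have [->|->] := cover_unique eN SL Smu cL cmu; rewrite ?mulrNN.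
(* As Spin(1) = {1, -1}, the twist acts by a sign chi. Using invariance twice removes that sign and
   leaves mu mu = -1, so every component equals its own opposite. *)
have [chi [chi2 nuE]] : exists chi : C, chi * chi = 1 /\
    forall E, spin_rep nu (ebasis E) = chi *: ebasis E.
  have [->|->] := Spin_1P Snu.
    by exists 1; split=> [|E]; rewrite ?mulr1// spin_rep1 scale1r.
  by exists (-1); split=> [|E]; rewrite ?mulrNN ?mulr1// spin_repN spin_rep1 scaleN1r.
apply: slice_inj => c; rewrite slice0.
have e := slice_act mu psi c nuE; rewrite inv prodr_const card_ord in e.
have : slice psi c = - slice psi c.
  rewrite {1}e {1}e spin_repZr scalerA -exprMn chi2 expr1n scale1r -(spin_repM eN) mm.
  by rewrite spin_repN spin_rep1.
move/eqP; rewrite -addr_eq0 -mulr2n -scaler_nat scaler_eq0 pnatr_eq0 /=.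
by move/eqP.
Qed.

End Structure.

(** * Smoothness of the lift *)

Section QuaternionGerms.
Variables (R : realType) (X : dspace R) (x : X).
Local Notation H := (quat R).
Local Notation C := (R[i]).

Definition gQ (f : X -> H) : Prop :=
  [/\ dgerm x (fun y => qr (f y)), dgerm x (fun y => qi (f y)),
      dgerm x (fun y => qj (f y)) & dgerm x (fun y => qk (f y))].
Definition gM m p (F : X -> 'M[H]_(m, p)) : Prop := forall i j, gQ (fun y => F y i j).
Definition gC (f : X -> C) : Prop :=
  dgerm x (fun y => complex.Re (f y)) /\ dgerm x (fun y => complex.Im (f y)).
Definition gE k (F : X -> ext R k) : Prop := forall D, gC (fun y => F y D).

Lemma gQ_cst q : gQ (fun _ => q).
Proof. by split; exact: germ_cst. Qed.

Lemma gQD f g : gQ f -> gQ g -> gQ (fun y => f y + g y).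
Proof. by move=> [? ? ? ?] [? ? ? ?]; split; exact: germD. Qed.

Lemma gQN f : gQ f -> gQ (fun y => - f y).
Proof. by move=> [? ? ? ?]; split; exact: germN. Qed.

Lemma gQM f g : gQ f -> gQ g -> gQ (fun y => f y * g y).
Proof.
move=> [a1 a2 a3 a4] [b1 b2 b3 b4]; split.
- by apply: germB; [apply: germB; [apply: germB|]|]; exact: germM.
- by apply: germB; [apply: germD; [apply: germD|]|]; exact: germM.
- by apply: germD; [apply: germD; [apply: germB|]|]; exact: germM.
- by apply: germD; [apply: germB; [apply: germD|]|]; exact: germM.
Qed.

Lemma gQ_conj f : gQ f -> gQ (fun y => qconj (f y)).
Proof. by move=> [? ? ? ?]; split=> //; exact: germN. Qed.

Lemma gQ_real (f : X -> R) : dgerm x f -> gQ (fun y => qreal (f y)).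
Proof. by move=> gf; split=> //; exact: germ_cst. Qed.

Lemma gQ_sum (I : Type) (r : seq I) (F : I -> X -> H) :
  (forall i, gQ (F i)) -> gQ (fun y => \sum_(i <- r) F i y).
Proof.
move=> gF; elim: r => [|i r ih].
  have -> : (fun y => \sum_(i <- [::]) F i y) = fun _ => 0 by apply/funext => y; rewrite big_nil.
  exact: gQ_cst.
have -> : (fun y => \sum_(i <- i :: r) F i y) = fun y => F i y + \sum_(i <- r) F i y.
  by apply/funext => y; rewrite big_cons.
exact: gQD.
Qed.

Lemma gM_cst m p (A : 'M[H]_(m, p)) : gM (fun _ => A).
Proof. by move=> i j; exact: gQ_cst. Qed.

Lemma gMM m p q (F : X -> 'M[H]_(m, p)) (G : X -> 'M[H]_(p, q)) :
  gM F -> gM G -> gM (fun y => F y *m G y).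
Proof.
move=> gF gG i j; have -> : (fun y => (F y *m G y) i j) = fun y => \sum_l F y i l * G y l j.
  by apply/funext => y; rewrite mxE.
by apply: gQ_sum => l; exact: gQM.
Qed.

Lemma gMD m p (F G : X -> 'M[H]_(m, p)) : gM F -> gM G -> gM (fun y => F y + G y).
Proof.
move=> gF gG i j; have -> : (fun y => (F y + G y) i j) = fun y => F y i j + G y i j.
  by apply/funext => y; rewrite mxE.
exact: gQD.
Qed.

Lemma gMN m p (F : X -> 'M[H]_(m, p)) : gM F -> gM (fun y => - F y).
Proof.
move=> gF i j; have -> : (fun y => (- F y) i j) = fun y => - F y i j.
  by apply/funext => y; rewrite mxE.
exact: gQN.
Qed.

Lemma gM_ctr m p (F : X -> 'M[H]_(m, p)) : gM F -> gM (fun y => ctr (F y)).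
Proof.
move=> gF i j; have -> : (fun y => ctr (F y) i j) = fun y => qconj (F y j i).
  by apply/funext => y; rewrite ctrE.
exact: gQ_conj.
Qed.

Lemma gMZ m p (f : X -> H) (F : X -> 'M[H]_(m, p)) : gQ f -> gM F -> gM (fun y => f y *: F y).
Proof.
move=> gf gF i j; have -> : (fun y => (f y *: F y) i j) = fun y => f y * F y i j.
  by apply/funext => y; rewrite mxE.
exact: gQM.
Qed.

Lemma gM_sum (I : Type) (r : seq I) m p (F : I -> X -> 'M[H]_(m, p)) :
  (forall i, gM (F i)) -> gM (fun y => \sum_(i <- r) F i y).
Proof.
move=> gF i j; have -> : (fun y => (\sum_(l <- r) F l y) i j) = fun y => \sum_(l <- r) F l y i j.
  by apply/funext => y; rewrite summxE.
by apply: gQ_sum => l; exact: gF.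
Qed.

Lemma gC_cst c : gC (fun _ => c). Proof. by split; exact: germ_cst. Qed.
Lemma gCD f g : gC f -> gC g -> gC (fun y => f y + g y).
Proof.
move=> [a1 a2] [b1 b2]; split.
  have -> : (fun y => complex.Re (f y + g y)) = fun y => complex.Re (f y) + complex.Re (g y).
    by apply/funext => y; case: (f y) (g y) => ? ? [].
  exact: germD.
have -> : (fun y => complex.Im (f y + g y)) = fun y => complex.Im (f y) + complex.Im (g y).
  by apply/funext => y; case: (f y) (g y) => ? ? [].
exact: germD.
Qed.
Lemma gCM f g : gC f -> gC g -> gC (fun y => f y * g y).
Proof.
move=> [a1 a2] [b1 b2]; split.
  have -> : (fun y => complex.Re (f y * g y)) =
      fun y => complex.Re (f y) * complex.Re (g y) - complex.Im (f y) * complex.Im (g y).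
    by apply/funext => y; case: (f y) (g y) => ? ? [].
  by apply: germB; exact: germM.
have -> : (fun y => complex.Im (f y * g y)) =
    fun y => complex.Re (f y) * complex.Im (g y) + complex.Im (f y) * complex.Re (g y).
  by apply/funext => y; case: (f y) (g y) => ? ? [].
by apply: germD; exact: germM.
Qed.
Lemma gCX f m : gC f -> gC (fun y => f y ^+ m).
Proof.
move=> gf; elim: m => [|m ih]; first exact: gC_cst.
have -> : (fun y => f y ^+ m.+1) = fun y => f y * f y ^+ m by apply/funext => y; rewrite exprS.
exact: gCM.
Qed.
Lemma gC_conj f : gC f -> gC (fun y => (f y)^*%C).
Proof.
move=> [a1 a2]; split.
  by have -> : (fun y => complex.Re (f y)^*%C) = fun y => complex.Re (f y) by apply/funext => y; case: (f y).
have -> : (fun y => complex.Im (f y)^*%C) = fun y => - complex.Im (f y) by apply/funext => y; case: (f y).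
exact: germN.
Qed.
Lemma gC_real (f : X -> R) : dgerm x f -> gC (fun y => (f y)%:C%C).
Proof. by move=> gf; split=> //; exact: germ_cst. Qed.
Lemma gC_near f g : dnear x (fun y => f y = g y) -> gC g -> gC f.
Proof.
by move=> fg [a1 a2]; split; [apply: germ_near a1|apply: germ_near a2]; apply: nearD_sub fg => y _ /= ->.
Qed.
Lemma gC_sum (I : Type) (r : seq I) (F : I -> X -> C) :
  (forall i, gC (F i)) -> gC (fun y => \sum_(i <- r) F i y).
Proof.
move=> gF; elim: r => [|i r ih].
  have -> : (fun y => \sum_(i <- [::]) F i y) = fun _ => 0 by apply/funext => y; rewrite big_nil.
  exact: gC_cst.
have -> : (fun y => \sum_(i <- i :: r) F i y) = fun y => F i y + \sum_(i <- r) F i y.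
  by apply/funext => y; rewrite big_cons.
exact: gCD.
Qed.

Lemma gE_cst k (u : ext R k) : gE (fun _ => u).
Proof. by move=> D; exact: gC_cst. Qed.
Lemma gED k (F G : X -> ext R k) : gE F -> gE G -> gE (fun y => F y + G y).
Proof.
move=> gF gG D; have -> : (fun y => (F y + G y) D) = fun y => F y D + G y D.
  by apply/funext => y; rewrite extDE.
exact: gCD.
Qed.
Lemma gEZ k (f : X -> C) (F : X -> ext R k) : gC f -> gE F -> gE (fun y => f y *: F y).
Proof.
move=> gf gF D; have -> : (fun y => (f y *: F y) D) = fun y => f y * F y D.
  by apply/funext => y; rewrite extZE.
exact: gCM.
Qed.
Lemma gE_near k (F G : X -> ext R k) : dnear x (fun y => F y = G y) -> gE G -> gE F.
Proof. by move=> FG gG D; apply: gC_near (gG D); apply: nearD_sub FG => y _ ->. Qed.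
Lemma gE_sum k (I : Type) (r : seq I) (F : I -> X -> ext R k) :
  (forall i, gE (F i)) -> gE (fun y => \sum_(i <- r) F i y).
Proof.
move=> gF D; have -> : (fun y => (\sum_(i <- r) F i y) D) = fun y => \sum_(i <- r) F i y D.
  by apply/funext => y; rewrite ext_sumE.
by apply: gC_sum => i; exact: gF.
Qed.

Lemma gE_linear k (T : ext R k -> ext R k) (F : X -> ext R k) : linear T -> gE F -> gE (fun y => T (F y)).
Proof.
move=> Tl gF; have TD : {morph T : u v / u + v} by move=> u v; have := Tl 1 u v; rewrite !scale1r.
have T0 : T 0 = 0 by have := TD 0 0; rewrite addr0 => /eqP; rewrite eq_sym -subr_eq0 addrK => /eqP.
have TZ c : {morph T : u / c *: u} by move=> u; have := Tl c u 0; rewrite T0 !addr0.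
have -> : (fun y => T (F y)) = fun y => \sum_D F y D *: T (ebasis D).
  apply/funext => y; rewrite [in LHS](ext_basis (F y)) (T_sum _ _ TD TZ).
  by apply: eq_bigr => D _; rewrite TZ.
by apply: gE_sum => D; apply: gEZ; [exact: gF|exact: gE_cst].
Qed.

Lemma gM_mx_space m (D : set 'M[H]_m) (f : X -> 'M[H]_m) : dom x ->
  dnear x (fun y => D (f y)) -> gM f -> @sat _ X (mx_space D) f x.
Proof.
move=> Dx Df gf; apply: sat_gen => // g [i [j [] ->]]; by have [? ? ? ?] := gf i j.
Qed.

Lemma sat_mx_space m (D : set 'M[H]_m) (f : X -> 'M[H]_m) :
  @sat _ X (mx_space D) f x -> gM f.
Proof.
move=> [_ gf] i j; have g h : qcoords h -> dgerm x (h \o f).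
  by move=> hq; apply: gf; exact: gens_generated.
split.
- by apply: (g (fun A => qr (A i j))); exists i, j; exact: Or41.
- by apply: (g (fun A => qi (A i j))); exists i, j; exact: Or42.
- by apply: (g (fun A => qj (A i j))); exists i, j; exact: Or43.
- by apply: (g (fun A => qk (A i j))); exists i, j; exact: Or44.
Qed.

End QuaternionGerms.

Section MetricGerms.
Variables (R : realType) (n : nat) (a t : R) (X : dspace R) (x : X).
Local Notation H := (quat R).

Lemma germ_B0 m (F G : X -> 'M[H]_m) : gM x F -> gM x G -> dgerm x (fun y => B0 (F y) (G y)).
Proof.
move=> gF gG; have gFG := gMM gF gG.
have [g _ _ _] : gQ x (fun y => \tr (F y *m G y)).
  by apply: gQ_sum => i; exact: gFG.
exact: germN g.
Qed.

Lemma gM_vert (F : X -> 'M[H]_n.+1) : gM x F -> gM x (fun y => vert (F y)).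
Proof. by move=> gF; apply: gMZ; [exact: gF|exact: gM_cst]. Qed.

Lemma gM_horiz (F : X -> 'M[H]_n.+1) : gM x F -> gM x (fun y => horiz (F y)).
Proof. by move=> gF; apply: gMD => //; apply: gMN; exact: gM_vert. Qed.

Lemma germ_gmetric (F G : X -> 'M[H]_n.+1) : gM x F -> gM x G ->
  dgerm x (fun y => gmetric a t (F y) (G y)).
Proof.
move=> gF gG; apply: germD; apply: germM; try exact: germ_cst.
  by apply: germ_B0; exact: gM_horiz.
by apply: germ_B0; exact: gM_vert.
Qed.

Lemma germ_isotropy (F : X -> 'M[H]_n.+1) i j : gM x F ->
  dgerm x (fun y => isotropy a t (F y) i j).
Proof.
move=> gF.
have -> : (fun y => isotropy a t (F y) i j) =
    fun y => gmetric a t (onbasis a t i) (F y *m onbasis a t j *m ctr (F y)).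
  by apply/funext => y; rewrite mxE ctrans_ctr.
apply: germ_gmetric; first exact: gM_cst.
by apply: gMM; [apply: gMM => //; exact: gM_cst|exact: gM_ctr].
Qed.

End MetricGerms.

Section SmoothLift.
Variables (R : realType) (n : nat) (a t : R).
Hypotheses (a_gt0 : 0 < a) (t_gt0 : 0 < t).
Local Notation H := (quat R).
Local Notation C := (R[i]).
Local Notation N := (Ndim n).
Local Notation k := ((Ndim n)./2).
Local Notation eN := (Ndim_even n).
Local Notation muh := (muh a t).
Let Hs : dspace R := mx_space (@Hgrp R n).
Variable x : Hs.
Hypothesis Hx : Hgrp x.

Lemma gM_Hs : @gM R Hs x _ _ id.
Proof. by apply: (sat_mx_space (D := @Hgrp R n)); exact: sat_id. Qed.

Lemma gC_hz : @gC R Hs x (@hz R n).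
Proof. by have [? ? _ _] := gM_Hs ord0 ord0; split. Qed.

Lemma Hs_near (P : Hs -> Prop) : (forall h, Hgrp h -> P h) -> dnear x P.
Proof. by move=> h; apply: nearD_all => y; exact: h. Qed.

(** Induction on B: the covering relation moves mu(h) past a Clifford vector, leaving entries of the
    isotropy matrix, which are smooth in h. The base case is the prescribed eigenvalue on the
    vacuum. *)
Lemma gE_muh_ebasis B : @gE R Hs x k (fun h => spin_rep (muh h) (ebasis B)).
Proof.
elim/set_ind1: B => [|q B qB ih].
  apply: (gE_near (G := fun h : Hs => hz h ^+ n.+1 *: vac R n)).
    by apply: Hs_near => h Hh; have [_ _] := muh_lifts a_gt0 t_gt0 Hh.
  by apply: gEZ; [apply: gCX; exact: gC_hz|exact: gE_cst].
have S v : @gE R Hs x k (fun h => spin_rep (muh h) (spin_rep (clvec v) (ebasis (B :\ q)%SET))).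
  apply: (gE_near (G := fun h : Hs => \sum_j ((v *m (isotropy a t h)^T) 0 j)%:C%C *:
      cliff_gen j (spin_rep (muh h) (ebasis (B :\ q)%SET)))).
    apply: Hs_near => h Hh; have [_ c _] := muh_lifts a_gt0 t_gt0 Hh.
    have [_ _ eh] := Hgrp_hz Hh; rewrite -eh in c.
    rewrite -(spin_repM eN); have := c v; rewrite !clmul_mul => ->.
    by rewrite (spin_repM eN) spin_rep_clvec.
  apply: gE_sum => j; apply: gEZ; last exact: gE_linear (cliff_gen_linear eN j) ih.
  apply: gC_real.
  have -> : (fun h : Hs => (v *m (isotropy a t h)^T) 0 j) = fun h => \sum_l v 0 l * isotropy a t h j l.
    by apply/funext => h; rewrite mxE; apply: eq_bigr => l _; rewrite mxE.
  by apply: germ_sum => l _; apply: germM; [exact: germ_cst|apply: germ_isotropy; exact: gM_Hs].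
have -> : (fun h : Hs => spin_rep (muh h) (ebasis B)) = fun h => psg C (ltp q (B :\ q)%SET) *:
   (2^-1 *: (- 'i%C *: spin_rep (muh h) (spin_rep (clvec (be R q)) (ebasis (B :\ q)%SET))
     + spin_rep (muh h) (spin_rep (clvec (bf R q)) (ebasis (B :\ q)%SET)))).
  apply/funext => h; rewrite (ebasisU1 R qB) crea_clvec !spin_repZr spin_repDr spin_repZr.
  by [].
apply: gEZ; first exact: gC_cst; apply: gEZ; first exact: gC_cst; apply: gED => //.
by apply: gEZ => //; exact: gC_cst.
Qed.

Lemma germ_muh A : @dgerm R Hs x (fun h => muh h A).
Proof.
have -> : (fun h => muh h A) = fun h => complex.Re (psg C (par A A) * (2 ^+ k)^-1 *
    \sum_B cop (@cliff_gen R N) A (spin_rep (muh h) (ebasis B)) B).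
  by apply/funext => h; rewrite -(spin_rep_coef eN).
have [] // : @gC R Hs x (fun h => psg C (par A A) * (2 ^+ k)^-1 *
    \sum_B cop (@cliff_gen R N) A (spin_rep (muh h) (ebasis B)) B).
apply: gCM; first exact: gC_cst.
by apply: gC_sum => B; exact: gE_linear (cop_linear eN A) (gE_muh_ebasis B) B.
Qed.

Lemma sat_muh : @sat R Hs (Spin_space N) muh x.
Proof.
apply: sat_gen => //.
  by apply: Hs_near => h Hh; have [] := muh_lifts a_gt0 t_gt0 Hh.
by move=> g [A ->]; exact: germ_muh.
Qed.

Lemma gC_hz_expz (s' : int) : @gC R Hs x (fun h => hz h ^ s').
Proof.
case: s' => m; first by apply: gCX; exact: gC_hz.
(* On the unit circle the inverse is the conjugate, so negative powers are polynomial too. *)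
apply: (gC_near (g := fun h : Hs => (hz h)^*%C ^+ m.+1)).
  apply: Hs_near => h Hh; have [z1 _ _] := Hgrp_hz Hh.
  by rewrite unit_inv// exprVn.
by apply: gCX; apply: gC_conj; exact: gC_hz.
Qed.

Lemma sat_nuS (s' : int) : @sat R Hs (Spin_space 2) (fun h => nuS s' (hz h)) x.
Proof.
apply: sat_gen => //.
  apply: Hs_near => h Hh; have [z1 _ _] := Hgrp_hz Hh.
  by apply: nu2_Spin; exact: norm_expz.
move=> g [A ->].
have -> : (fun y : Cl R 2 => y A) \o (fun h : Hs => nuS s' (hz h)) =
   fun h => complex.Re (hz h ^ s') * (1 : Cl R 2) A +
     complex.Im (hz h ^ s') * (clvec (delta_mx 0 0) * clvec (delta_mx 0 1)) A.
  by apply/funext => h; rewrite /= /nuS nu2E claddE !clscaleE.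
have [g1 g2] := gC_hz_expz s'.
by apply: germD; apply: germM => //; exact: germ_cst.
Qed.

Lemma sat_phiM r (nu : C -> Cl R r) : @sat R Hs (Spin_space r) (fun h => nu (hz h)) x ->
  @sat R Hs (Spinr R N r) (phiM a t nu) x.
Proof.
move=> sn; pose f : Hs -> dspace_prod (Spin_space N) (Spin_space r) := fun h => (muh h, nu (hz h)).
apply: (@sat_comp R Hs (dspace_prod (Spin_space N) (Spin_space r)) (Spinr R N r) f (@spinr_cls R N r)) => //.
  by apply: sat_pair => //; exact: sat_muh.
by apply: sat_smooth; exact: smooth_cls.
Qed.

End SmoothLift.

Section SpinrClasses.
Variables (R : realType) (N r : nat).

Lemma spinr_clsP (x : Cl R N * Cl R r) mu nu :
  spinr_cls (mu, nu) x <-> x = (mu, nu) \/ x = (- mu, - nu).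
Proof. by rewrite /spinr_cls /= !clopp_opp. Qed.

Lemma spinr_mul_cls (mu mu' : Cl R N) (nu nu' : Cl R r) :
  spinr_mul (spinr_cls (mu, nu)) (spinr_cls (mu', nu')) = spinr_cls (mu * mu', nu * nu').
Proof.
apply/seteqP; split=> [z [x [y [/spinr_clsP hx /spinr_clsP hy ->]]]|z /spinr_clsP].
  apply/spinr_clsP; case: hx => ->; case: hy => ->; rewrite !clmul_mul /= ?mulNr ?mulrN ?opprK;
    by [left|right].
case=> ->; first by exists (mu, nu), (mu', nu'); split; [apply/spinr_clsP; left|apply/spinr_clsP; left|].
exists (mu, nu), (- mu', - nu'); split; [by apply/spinr_clsP; left|by apply/spinr_clsP; right|].
by rewrite /= !clmul_mul !mulrN.
Qed.

Lemma spinr_clsN (mu : Cl R N) (nu : Cl R r) : spinr_cls (- mu, - nu) = spinr_cls (mu, nu).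
Proof.
apply/seteqP; split=> y /spinr_clsP h; apply/spinr_clsP; case: h => ->; rewrite ?opprK;
  by [left|right].
Qed.

End SpinrClasses.

(** * Existence and uniqueness of phi_s *)

Section SpincLift.
Variables (R : realType) (n : nat) (a t : R).
Hypotheses (a_gt0 : 0 < a) (t_gt0 : 0 < t).
Local Notation H := (quat R).
Local Notation C := (R[i]).
Local Notation N := (Ndim n).
Local Notation eN := (Ndim_even n).

Lemma phiM_hom r (nu : C -> Cl R r) : (forall z z', `|z| = 1 -> `|z'| = 1 -> nu (z * z') = nu z * nu z') ->
  forall h h' : 'M[H]_n.+1, Hgrp h -> Hgrp h' ->
    phiM a t nu (h *m h') = spinr_mul (phiM a t nu h) (phiM a t nu h').
Proof.
move=> nuM h h' Hh Hh'; rewrite /phiM spinr_mul_cls muhM// hzM// nuM//.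
  by have [] := Hgrp_hz Hh.
by have [] := Hgrp_hz Hh'.
Qed.

Lemma nu2M (w w' : C) : nu2 (w * w') = nu2 w * nu2 w'.
Proof.
have e0 : unitv (delta_mx 0 0 : 'rV[R]_2) by rewrite /unitv vdot_deltas.
have e1 : unitv (delta_mx 0 1 : 'rV[R]_2) by rewrite /unitv vdot_deltas.
have e01 : vdot (delta_mx 0 0 : 'rV[R]_2) (delta_mx 0 1) = 0 by rewrite vdot_deltas.
have := clvec_orth_sqr e0 e1 e01; rewrite !nu2E; move: (_ * clvec (delta_mx 0 1)) => J J2.
rewrite mulrDl !mulrDr -!scalerAl -!scalerAr J2 !mul1r !mulr1.
apply/ffunP => A; rewrite !(claddE, clscaleE, cloppE) -[1]/(1 : Cl R 2).
by case: w w' => p q [p' q'] /=; ring.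
Qed.

Lemma nuSM (s' : int) (z z' : C) : nuS s' (z * z') = nuS s' z * nuS s' z'.
Proof. by rewrite /nuS -nu2M expfzMl. Qed.

Lemma phiM_spinc (s' : int) : spinc_lift a t (2 * s') (phiM (n := n) a t (nuS s')).
Proof.
split.
- apply: smooth_sat; first exact: complete_generated.
    move=> h Hh; apply: (sat_dom (X := mx_space (@Hgrp R n)) Hh).
    by apply: sat_phiM => //; exact: sat_nuS.
  by move=> h Hh; apply: sat_phiM => //; exact: sat_nuS.
- by apply: phiM_hom => z z' _ _; exact: nuSM.
move=> z A z1 SA mu nu; have [_ cm _] := muh_lifts a_gt0 t_gt0 (Hgrp_emb z1 SA).
rewrite hz_emb hA_emb in cm.
have cn : spin_cover (nuS s' z) (so2 (z ^ (2 * s'))).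
  by rewrite mulrC -exprz_exp; apply: nu2_cover; exact: norm_expz.
rewrite /phiM hz_emb => -[[-> ->]|[-> ->]] //; rewrite !clopp_opp.
by split; exact: coverN.
Qed.

Lemma phiM_unique (s' : int) phi' : spinc_lift a t (2 * s') phi' ->
  forall h : 'M[H]_n.+1, Hgrp h -> phi' h = phiM a t (nuS s') h.
Proof.
move=> [[dp _] hom' cov'].
have homM := phiM_hom (nu := nuS s') (fun z z' _ _ => nuSM s' z z').
have [_ _ covM] := phiM_spinc s'.
(* There are four choices of signs in the two spin factors; the diagonal -1 identifies them in
   pairs, so two classes remain. *)
have near h : Hgrp h -> phi' h = phiM a t (nuS s') h \/
    phi' h = spinr_cls (muh a t h, - nuS s' (hz h)).
  move=> Hh; have [[mu nu] [/= S1 S2] e] := dp h Hh; have [z1 SA eh] := Hgrp_hz Hh.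
  have [c1 c2] : spin_cover mu (isotropy a t h) /\ spin_cover nu (so2 (hz h ^ (2 * s'))).
    by rewrite [X in isotropy _ _ X]eh; apply: cov' => //; rewrite -eh -e; left.
  have [d1 d2] : spin_cover (muh a t h) (isotropy a t h) /\ spin_cover (nuS s' (hz h)) (so2 (hz h ^ (2 * s'))).
    by rewrite [X in isotropy _ _ X]eh; apply: covM => //; rewrite -eh; left.
  have [S1' _ _] := muh_lifts a_gt0 t_gt0 Hh.
  have S2' : Spin R 2 (nuS s' (hz h)) by apply: nu2_Spin; exact: norm_expz.
  rewrite -e /phiM.
  have [->|->] := cover_unique eN S1' S1 d1 c1; have [->|->] := cover_unique (isT : ~~ odd 2) S2' S2 d2 c2.
  - by left.
  - by right.
  - by right; rewrite -spinr_clsN opprK.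
  by left; rewrite spinr_clsN.
have sq h : Hgrp h -> phi' (h *m h) = phiM a t (nuS s') (h *m h).
  move=> Hh; rewrite (hom' _ _ Hh Hh) (homM _ _ Hh Hh); case: (near h Hh) => -> //.
  by rewrite /phiM !spinr_mul_cls mulrNN.
have stable h h' : Hgrp h -> Hgrp h' -> phi' h = phiM a t (nuS s') h ->
    phi' h' = phiM a t (nuS s') h' -> phi' (h *m h') = phiM a t (nuS s') (h *m h').
  by move=> Hh Hh' e e'; rewrite (hom' _ _ Hh Hh') (homM _ _ Hh Hh') e e'.
have n1 := normr1 C; have S1 := @Sp1 R n.
move=> h Hh; have [z1 SA ->] := Hgrp_hz Hh.
have -> : emb (hz h) (hA h) = emb (hz h) 1%:M *m emb 1 (hA h) by rewrite emb_mul mulr1 mul1mx.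
apply: (stable _ _); [exact: Hgrp_emb|exact: Hgrp_emb| |].
  have [d d1 <-] := unit_sqrtC z1.
  have -> : emb (d ^+ 2) 1%:M = emb d 1%:M *m emb d (1%:M : 'M[H]_n) by rewrite emb_mul mulmx1 expr2.
  by apply: sq; exact: Hgrp_emb.
move: (hA h) SA; apply: Sp_ind.
- have -> : emb 1 1%:M = emb 1 1%:M *m emb 1 (1%:M : 'M[H]_n) by rewrite emb_mul mulmx1 mulr1.
  by apply: sq; exact: Hgrp_emb.
- move=> u c s uu cs; have -> : emb 1 (qrefl u (jcx c s * jcx c s)) =
    emb 1 (qrefl u (jcx c s)) *m emb 1 (qrefl u (jcx c s)) by rewrite emb_mul mulr1 qrefl_mul.
  by apply: sq; apply: Hgrp_emb => //; apply: qrefl_Sp => //; rewrite qn2_jcx.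
move=> A B SA SB hA hB; have -> : emb 1 (A *m B) = emb 1 A *m emb 1 B by rewrite emb_mul mulr1.
by apply: (stable _ _) => //; exact: Hgrp_emb.
Qed.

End SpincLift.

(** * The invariant principal bundle *)

Section QuotientMaps.
Context {R : realType}.
Implicit Types X Y Z : dspace R.

Lemma sat_swap X Y Z (f : dspace_prod X Y -> Z) x y : dom x -> dom y ->
  @sat R (dspace_prod Y X) Z (fun z => f (z.2, z.1)) (y, x) -> @sat R (dspace_prod X Y) Z f (x, y).
Proof.
move=> Dx Dy sf; have Dz : @dom _ (dspace_prod X Y) (x, y) by [].
apply: (@sat_local _ _ _ _ ((fun z => f (z.2, z.1)) \o (fun z : dspace_prod X Y => (z.2, z.1) : dspace_prod Y X))).
  by apply: nearD_all => -[].
apply: (@sat_comp _ _ (dspace_prod Y X)) => //.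
by apply: sat_pair => //; [exact: sat_snd|exact: sat_fst].
Qed.

Definition section X (cls : X -> set X) (s : set X -> X) (q : set X) : Prop :=
  [/\ @dom _ (dspace_quot cls) q, @sat R (dspace_quot cls) X s q &
      @dnear R (dspace_quot cls) q (fun q' => cls (s q') = q')].

Lemma sat_section1 X Y Z (cls : X -> set X) s q (f : set X * Y -> Z) y :
  section cls s q -> dom y ->
  @sat R (dspace_prod X Y) Z (fun z => f (cls z.1, z.2)) (s q, y) ->
  @sat R (dspace_prod (dspace_quot cls) Y) Z f (q, y).
Proof. by move=> [Dq ss sq] Dy; exact: sat_section. Qed.

Lemma sat_section2 X Y Z (cls : X -> set X) (cls' : Y -> set Y) s s' q q'
    (f : set X * set Y -> Z) :
  section cls s q -> section cls' s' q' ->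
  @sat R (dspace_prod X Y) Z (fun z => f (cls z.1, cls' z.2)) (s q, s' q') ->
  @sat R (dspace_prod (dspace_quot cls) (dspace_quot cls')) Z f (q, q').
Proof.
move=> sec sec' sf; have [Dq ss _] := sec; have [Dq' ss' _] := sec'.
have Ds := sat_dom Dq ss; have Ds' := sat_dom Dq' ss'.
apply: (sat_section1 sec) => //.
apply: sat_swap => //; apply: (sat_section1 sec') => //=.
exact: sat_swap.
Qed.

Section Representatives.
Variables (X : dspace R) (cls : X -> set X) (x0 : X).

Definition rep (S : set X) : X :=
  if pselect (exists x, dom x /\ cls x = S) is left h then projT1 (cid h) else x0.

Lemma repP S : @dom _ (dspace_quot cls) S -> dom (rep S) /\ cls (rep S) = S.
Proof.
move=> [x Dx e]; rewrite /rep; case: pselect => [h|[]]; last by exists x.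
exact: projT2 (cid h).
Qed.

Lemma rep_cls x : dom x -> dom (rep (cls x)) /\ cls (rep (cls x)) = cls x.
Proof. by move=> Dx; apply: repP; exists x. Qed.

Definition qlift (T : Type) (F : X -> T) (S : set X) : T := F (rep S).

Definition respects (T : Type) (F : X -> T) : Prop :=
  forall x y, dom x -> dom y -> cls x = cls y -> F x = F y.

Lemma qliftE (T : Type) (F : X -> T) x : respects F -> dom x -> qlift F (cls x) = F x.
Proof. by move=> iF Dx; have [Dr e] := rep_cls Dx; exact: iF. Qed.

Lemma sat_qlift Z (F : X -> Z) q : complete X -> respects F -> @dom _ (dspace_quot cls) q ->
  @dnear R (dspace_quot cls) q (fun q' => forall x, dom x -> cls x = q' -> sat F x) ->
  @sat R (dspace_quot cls) Z (qlift F) q.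
Proof.
move=> cX iF Dq h; apply: sat_quot => //; apply: nearD_sub h => q' _ sF x Dx xq.
apply: sat_local (sF x Dx xq); apply: nearD_all => y Dy; exact: qliftE.
Qed.

Lemma smooth_qlift Z (F : X -> Z) : complete X -> respects F ->
  (forall x, dom x -> sat F x) -> smooth_map (qlift F : dspace_quot cls -> Z).
Proof.
move=> cX iF sF; apply: smooth_sat; first exact: complete_quot.
  move=> _ [x Dx <-]; rewrite qliftE//; exact: sat_dom (sF x Dx).
by move=> q Dq; apply: sat_qlift => //; apply: nearD_all => _ [y Dy _] x Dx _; exact: sF.
Qed.

Lemma dgerm_qlift (F : X -> R) q : complete X -> respects F -> @dom _ (dspace_quot cls) q ->
  (forall x, dom x -> dgerm x F) -> @dgerm R (dspace_quot cls) q (qlift F).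
Proof.
move=> cX iF Dq gF; apply: germ_gen; change (dsm (d := X) (qlift F \o cls)).
apply: completeP => // x Dx; apply: germ_near (gF x Dx).
by apply: nearD_all => y Dy /=; exact: qliftE.
Qed.

(** A normal form s of representatives, smooth and valid where the invariant function c is positive,
    descends to a smooth section near the class of x. *)
Lemma section_qlift (s : X -> X) (c : X -> R) x : complete X -> respects s -> respects c ->
  dom x -> (forall y, dom y -> dgerm y c) -> 0 < c x ->
  (forall y, dom y -> 0 < c y -> sat s y /\ cls (s y) = cls y) ->
  @dnear R (dspace_quot cls) (cls x) (section cls (qlift s)).
Proof.
move=> cX is_ ic Dx gc cx h.
have Dq : @dom _ (dspace_quot cls) (cls x) by exists x.
have near q : @dom _ (dspace_quot cls) q -> 0 < qlift c q ->
    @dnear R (dspace_quot cls) q (fun q' => 0 < qlift c q').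
  by move=> Dq' c0; apply: (@germ_gt _ _ _ _ _ (qlift c)) => //; exact: dgerm_qlift.
apply: nearD_sub (near _ Dq _); last by rewrite qliftE.
move=> q Dq' cq; split=> //.
  apply: sat_qlift => //; apply: nearD_sub (near _ Dq' cq) => q' Dq'' cq' y Dy yq.
  by case: (h y Dy) => //; move: cq'; rewrite -yq qliftE.
apply: nearD_sub (near _ Dq' cq) => _ [y Dy <-]; rewrite !qliftE// => cy.
by case: (h y Dy cy).
Qed.

End Representatives.

Lemma dnear_open X (x : X) (P : X -> Prop) : dom x -> dnear x P ->
  exists U : set X, [/\ dspace_open U, U x & forall y, U y -> P y].
Proof.
move=> Dx [k [u [e [gu e0 uP]]]].
exists [set y | dom y /\ forall i, `|u i y - u i x| < e]; split.
- split=> [y []//|y [Dy hy]].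
  have [r r0 re] : exists2 r, 0 < r & forall i, r <= e - `|u i y - u i x|.
    by apply: finpos_min => i; rewrite subr_gt0.
  exists k, u, r; split=> // z Dz hz; split=> // i.
  have -> : u i z - u i x = (u i z - u i y) + (u i y - u i x) by ring.
  apply: le_lt_trans (ler_normD _ _) _; have := re i; have := hz i; lra.
- by split=> // i; rewrite subrr normr0.
by move=> y [Dy hy]; exact: uP.
Qed.

End QuotientMaps.

(** * Local sections over Spin^r(N) *)

Section SpinrSections.
Variables (R : realType) (N r : nat).
Hypotheses (N0 : (0 < N)%N) (r0 : (0 < r)%N).
Let Y : dspace R := dspace_prod (Spin_space N) (Spin_space r).

Lemma dom_opp (x : Y) : dom x -> @dom _ Y (- x.1, - x.2).
Proof. by move=> [S1 S2]; split; exact: SpinN. Qed.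

Lemma spinr_cls_refl (x : Y) : spinr_cls x x.
Proof. by case: x => mu nu; left. Qed.

Lemma spinr_cls_eq (x y : Y) : spinr_cls x = spinr_cls y -> x = y \/ x = (- y.1, - y.2).
Proof.
move=> e; have := spinr_cls_refl x; rewrite e; case: y {e} => mu nu.
exact: (spinr_clsP x mu nu).1.
Qed.

Lemma germ_fst_coef (y : Y) A : dom y -> dgerm y (fun x : Y => x.1 A).
Proof.
move=> Dy; have [_ h] := sat_fst (X := Spin_space N) (Y := Spin_space r) y.
by apply: (h (fun x : Cl R N => x A)); apply: gens_generated; exists A.
Qed.
Lemma germ_snd_coef (y : Y) A : dom y -> dgerm y (fun x : Y => x.2 A).
Proof.
move=> Dy; have [_ h] := sat_snd (X := Spin_space N) (Y := Spin_space r) y.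
by apply: (h (fun x : Cl R r => x A)); apply: gens_generated; exists A.
Qed.

Section Base.
Variable m0 : Cl R N.
Let c (x : Y) : R := clip x.1 m0.
(** The sign of c, written through the square root of c^2 so that it is visibly smooth wherever c is
    nonzero. *)
Definition sgc (x : Y) : R := c x * (Num.sqrt (c x ^+ 2))^-1.
(* Choosing the sign that makes one coefficient positive gives a local section. *)
Definition align (x : Y) : Y := (sgc x *: x.1, sgc x *: x.2).

Lemma sgc_sign x : 0 < c x ^+ 2 -> sgc x = 1 \/ sgc x = -1.
Proof.
move=> c2; rewrite /sgc sqrtr_sqr; have c0 : c x != 0 by rewrite -sqrf_eq0 gt_eqF.
have [cp|cn] := leP 0 (c x); first by left; rewrite ger0_norm// divff.
by right; rewrite ltr0_norm// invrN mulrN divff.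
Qed.

Lemma align_eq x : 0 < c x ^+ 2 -> align x = x \/ align x = (- x.1, - x.2).
Proof.
by case: x => mu nu /sgc_sign[] e; rewrite /align e; [left|right]; rewrite ?scale1r ?scaleN1r.
Qed.

Lemma align_invariant : respects (X := Y) (@spinr_cls R N r) align.
Proof.
move=> x y _ _ /spinr_cls_eq[->//|->]; rewrite /align /sgc /c /= clipNl sqrrN mulNr.
by rewrite !scaleNr !scalerN !opprK.
Qed.

Lemma sqr_invariant : respects (X := Y) (@spinr_cls R N r) (fun x => c x ^+ 2).
Proof. by move=> x y _ _ /spinr_cls_eq[->//|->]; rewrite /c /= clipNl sqrrN. Qed.

Lemma germ_c (y : Y) : dom y -> dgerm y c.
Proof. by move=> Dy; apply: germ_sum => A _; apply: germM; [exact: germ_fst_coef|exact: germ_cst]. Qed.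

Lemma sat_align (y : Y) : dom y -> 0 < c y ^+ 2 -> sat align y.
Proof.
move=> Dy cy; have gc2 : dgerm y (fun x => c x ^+ 2) by apply: germX; exact: germ_c.
have gs : dgerm y sgc.
  apply: germM; first exact: germ_c.
  by apply: germV => //; [apply: germ_sqrt|rewrite sqrtr_gt0].
have near : dnear y (fun x => @dom _ Y (align x)).
  apply: nearD_sub (germ_gt Dy gc2 cy) => x Dx /align_eq[]->//; exact: dom_opp.
apply: sat_pair => //; apply: sat_gen => //.
- by apply: nearD_sub near => x _ [].
- move=> g [A ->].
  have -> : (fun x : Cl R N => x A) \o (fun x : Y => sgc x *: x.1) = fun x => sgc x * x.1 A.
    by apply/funext => x; rewrite /= clscaleE.
  by apply: germM => //; exact: germ_fst_coef.
- by apply: nearD_sub near => x _ [].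
move=> g [A ->].
have -> : (fun x : Cl R r => x A) \o (fun x : Y => sgc x *: x.2) = fun x => sgc x * x.2 A.
  by apply/funext => x; rewrite /= clscaleE.
by apply: germM => //; exact: germ_snd_coef.
Qed.

End Base.

Lemma spinr_section (q : Spinr R N r) : dom q ->
  exists s : set Y -> Y, dnear q (section (X := Y) (@spinr_cls R N r) s).
Proof.
move=> [x Dx <-]; exists (qlift (X := Y) (@spinr_cls R N r) x (align x.1)).
apply: (@section_qlift _ Y _ x (align x.1) (fun y => clip y.1 x.1 ^+ 2)) => //.
- exact: complete_prod.
- exact: align_invariant.
- exact: sqr_invariant.
- by move=> y Dy; apply: germX; exact: germ_c.
- have [S1 _] := Dx; have := Spin_clip 1 S1; rewrite mulr1 => ->.
  by rewrite clip11 expr1n.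
move=> y Dy cy; split; first exact: sat_align.
by case: (align_eq cy) => ->//; case: (y) => mu nu; exact: spinr_clsN.
Qed.

End SpinrSections.

(** * Local sections over the projective space *)

Section ProjectiveSections.
Variables (R : realType) (n : nat).
Local Notation H := (quat R).
Local Notation C := (R[i]).
Let G : dspace R := Sp_space n.+1.
Implicit Types (w g : 'M[H]_n.+1).

Definition ns w : R := complex.Re (hz w) ^+ 2 + complex.Im (hz w) ^+ 2.
(** Normalised conjugate of the complex part of the corner entry. Right multiplication by (z, A)
    multiplies the first column by z, and this phase undoes it; it also makes the real part of the
    corner positive. *)
Definition phase w : H := qreal (Num.sqrt (ns w))^-1 * quat_of_complex (hz w)^*%C.
Definition e0 : 'cV[H]_n.+1 := delta_mx ord0 0.
Definition ncol w : 'cV[H]_n.+1 := w *m e0 *m ((phase w)%:M : 'M[H]_1).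
Definition qinv (b : H) : H := qreal (qn2 b)^-1 * qconj b.

(* Skew reflection taking [e0] to the normalised first column of [w]. *)
Definition sv w : 'M[H]_n.+1 :=
  - 1%:M + (ncol w + e0) *m ((qinv (1 + qconj (ncol w ord0 0)))%:M : 'M[H]_1) *m ctr (ncol w + e0).

Lemma qinv_mul b : 0 < qn2 b -> qinv b * b = 1 /\ b * qinv b = 1.
Proof.
move=> b0; have e : qreal (qn2 b)^-1 * qreal (qn2 b) = 1.
  by rewrite -qrealM mulVf ?gt_eqF.
split; first by rewrite /qinv -mulrA qconj_mul e.
by rewrite /qinv mulrA -qreal_comm -mulrA qmul_conj e.
Qed.

Lemma qn2_phase w : 0 < ns w -> qn2 (phase w) = 1.
Proof.
move=> w0; rewrite /phase qn2M qn2_real exprVn sqr_sqrtr ?ltW//.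
have -> : qn2 (quat_of_complex (hz w)^*%C) = ns w by rewrite /qn2 /ns /=; ring.
by rewrite mulVf ?gt_eqF.
Qed.

Lemma ncolE w i : ncol w i 0 = w i ord0 * phase w.
Proof.
have -> : ncol w = w *m e0 *m ((phase w)%:M : 'M[H]_1) by [].
rewrite mxE big_ord1 [X in _ * X]mxE eqxx mulr1n; congr (_ * _).
rewrite mxE (bigD1 ord0)//= big1 => [|l l0]; first by rewrite mxE !eqxx mulr1 addr0.
by rewrite mxE (negPf l0) mulr0.
Qed.

Lemma qr_ncol w : 0 < ns w -> 0 < qr (ncol w ord0 0).
Proof.
move=> w0; rewrite ncolE /phase.
have -> : qr (w ord0 ord0 * (qreal (Num.sqrt (ns w))^-1 * quat_of_complex (hz w)^*%C)) =
   (Num.sqrt (ns w))^-1 * ns w.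
  by rewrite /ns !qE /=; ring.
by rewrite mulr_gt0// invr_gt0 sqrtr_gt0.
Qed.

(** Write f = v + e0, with v the normalised column, and b = 1 + conj(v_0), invertible because Re v_0
    > 0. Then [ctr f] e0 = b gives sv e0 = -e0 + f = v. With c the inverse of b, membership in Sp
    reduces to conj(c) (b + conj(b)) c = conj(c) + c, since [ctr f] f = b + conj(b). *)
Lemma sv_props w : Sp w -> 0 < ns w -> Sp (sv w) /\ sv w *m e0 = ncol w.
Proof.
move=> Sw w0; have p1 := qn2_phase w0; have v0 := qr_ncol w0.
have uv : unitc (ncol w).
  by apply: unitc_conj => //; rewrite /unitc ctrM mulmxA -[_ *m _ *m w]mulmxA Sw mulmx1 unitc_delta.
rewrite /sv; move: (ncol w) uv v0 => v uv v0.
set b := 1 + qconj (v ord0 0); set f := v + e0.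
have b0 : 0 < qn2 b.
  rewrite /qn2 /b /=; set x := qr (v ord0 0); have x0 : 0 < x by [].
  have h : 0 < (1 + x) ^+ 2 by rewrite exprn_gt0// addr_gt0.
  have := sqr_ge0 (0 - qi (v ord0 0)); have := sqr_ge0 (0 - qj (v ord0 0)).
  have := sqr_ge0 (0 - qk (v ord0 0)); lra.
have [cb bc] := qinv_mul b0; set c := qinv b in cb bc *.
have ce : ctr e0 *m v = (v ord0 0)%:M.
  apply/matrixP => i j; rewrite !ord1 [RHS]mxE eqxx mulr1n mxE (bigD1 ord0)//= big1 => [|l l0].
    by rewrite ctrE mxE !eqxx qconj1 mul1r addr0.
  by rewrite ctrE mxE (negPf l0) qconj0 mul0r.
have ec : ctr v *m e0 = (qconj (v ord0 0))%:M.
  by rewrite -[LHS]ctrK ctrM ctrK ce ctr_scalar.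
have ee : ctr e0 *m e0 = 1%:M by exact: unitc_delta.
have fe : ctr f *m e0 = b%:M.
  by rewrite /f ctrD mulmxDl ec ee /b scalar_mxD addrC.
have ff : ctr f *m f = (b + qconj b)%:M.
  rewrite /f ctrD mulmxDl !mulmxDr uv ec ce ee -!scalar_mxD; congr (_%:M).
  by rewrite /b qconjD qconj1 qconjK; move: (v ord0 0) => y; apply: quatP; rewrite !qE /=; ring.
split; last first.
  rewrite mulmxDl mulNmx mul1mx -!mulmxA fe -scalar_mxM cb mulmx1 /f addrC addrK.
  by [].
rewrite /Sp /= ctrans_ctr ctrD ctrN ctr1 !ctrM ctrK ctr_scalar.
rewrite mulmxDl !mulmxDr mulNmx mul1mx mulNmx mul1mx mulmxN mulmx1 opprK.
have gen (F : 'cV[H]_n.+1) (P Q : 'M[H]_1) :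
    F *m (P *m ctr F) *m (F *m Q *m ctr F) = F *m (P *m (ctr F *m F) *m Q *m ctr F).
  by rewrite !mulmxA.
rewrite gen ff -!scalar_mxM.
have -> : qconj c * (b + qconj b) * c = qconj c + c.
  have cb' : qconj c * qconj b = 1 by rewrite -qconjM bc qconj1.
  by rewrite mulrDr mulrDl cb' mul1r -mulrA bc mulr1.
have -> : f *m ((qconj c + c)%:M *m ctr f) = f *m ((qconj c)%:M *m ctr f) + f *m (c%:M *m ctr f).
  by rewrite -(mulmxDr f) -(mulmxDl (qconj c)%:M) -scalar_mxD.
by rewrite -mulmxA addKr subrK.
Qed.

(** Orthogonality of the other columns to the first, which is concentrated in the corner, kills the
    rest of the first row; the matrix is then block diagonal. *)
Lemma Hgrp_col w (zt : C) : Sp w -> `|zt| = 1 -> w *m e0 = e0 *m (quat_of_complex zt)%:M -> Hgrp w.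
Proof.
move=> Sw z1 ew; have qz := qn2_quat_of_complex z1.
have c0 i : w i ord0 = (i == ord0)%:R * quat_of_complex zt.
  have /matrixP/(_ i 0) := ew; rewrite mxE (bigD1 ord0)//= big1 => [|l l0]; last first.
    by rewrite mxE (negPf l0) mulr0.
  rewrite mxE !eqxx mulr1 addr0 => ->.
  by rewrite mxE big_ord1 !mxE !eqxx mulr1n andbT.
have r0 j : j != ord0 -> w ord0 j = 0.
  move=> j0; have /matrixP/(_ ord0 j) := Sw; rewrite ctrans_ctr mxE (bigD1 ord0)//= big1 => [|l l0].
    rewrite ctrE c0 eqxx mul1r addr0 mxE eq_sym (negPf j0) => /(congr1 (fun y => quat_of_complex zt * y)).
    by rewrite mulr0 mulrA qmul_conj qz mul1r.
  by rewrite ctrE c0 (negPf l0) mul0r qconj0 mul0r.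
have ew' : w = emb zt (hA w).
  apply: (etrans (esym (submxK (w : 'M[H]_(1 + n))))); rewrite /emb /hA; congr block_mx.
  - apply/matrixP => i j; rewrite !ord1 !mxE eqxx mulr1n.
    by have -> : lshift n (0 : 'I_1) = ord0 :> 'I_n.+1; [exact/val_inj|rewrite c0 eqxx mul1r].
  - apply/matrixP => i j; rewrite !ord1 !mxE.
    have -> : lshift n (0 : 'I_1) = ord0 :> 'I_n.+1 by exact/val_inj.
    exact: r0.
  apply/matrixP => i j; rewrite !ord1 !mxE.
  have -> : lshift n (0 : 'I_1) = ord0 :> 'I_n.+1 by exact/val_inj.
  by rewrite c0 mul0r.
rewrite ew'; apply: Hgrp_emb => //.
move: Sw; rewrite /Sp /= ctrans_ctr ew' hA_emb.
change (ctr (block_mx (quat_of_complex zt)%:M 0 0 (hA w) : 'M[H]_(1 + n)) *m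
  block_mx (quat_of_complex zt)%:M 0 0 (hA w) = 1%:M -> ctr (hA w) *m hA w = 1%:M).
rewrite ctr_block mulmx_block scalar_mx_block !(ctr0, mul0mx, mulmx0, add0r, addr0).
by move/eq_block_mx => [_ _ _].
Qed.

Lemma emb_ctr z (A : 'M[H]_n) : ctr (emb z A) = emb z^*%C (ctr A).
Proof.
change (ctr (block_mx (quat_of_complex z)%:M 0 0 A : 'M[H]_(1 + n)) = block_mx (quat_of_complex z^*%C)%:M 0 0 (ctr A)).
rewrite ctr_block !ctr0 ctr_scalar; congr (block_mx _%:M _ _ _).
by case: z => x y; apply: quatP; rewrite /= ?oppr0.
Qed.

Lemma Hgrp_ctr h : Hgrp h -> Hgrp (ctr h : 'M[H]_n.+1).
Proof.
by move=> [z [A [z1 SA ->]]]; rewrite emb_ctr; apply: Hgrp_emb; [exact: unit_normC_conj|exact: Sp_ctr_Sp].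
Qed.

Lemma Hgrp_Sp h : Hgrp h -> Sp (h : 'M[H]_n.+1).
Proof.
move=> [z [A [z1 SA ->]]]; rewrite /Sp /= ctrans_ctr emb_ctr emb_mul mulrC unit_conjM//.
rewrite -ctrans_ctr SA; change (block_mx (quat_of_complex (1 : C))%:M 0 0 1%:M = 1%:M :> 'M[H]_(1 + n)).
by rewrite scalar_mx_block.
Qed.

Lemma Hgrp_mul_ctr h : Hgrp h -> h *m ctr h = 1%:M :> 'M[H]_n.+1.
Proof. by move/Hgrp_Sp/Sp_ctr. Qed.
Lemma Hgrp_ctr_mul h : Hgrp h -> ctr h *m h = 1%:M :> 'M[H]_n.+1.
Proof. by move/Hgrp_Sp. Qed.

Lemma coset_mul g h : Hgrp h -> coset (g *m h) = coset g.
Proof.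
move=> Hh; apply/seteqP; split=> x [h' Hh' <-].
  by exists (h *m h'); [exact: HgrpM|rewrite mulmxA].
exists (ctr h *m h'); first by apply: HgrpM => //; exact: Hgrp_ctr.
by rewrite mulmxA -[g *m h *m _]mulmxA Hgrp_mul_ctr// mulmx1.
Qed.

Lemma Hgrp1 : Hgrp (1%:M : 'M[H]_n.+1).
Proof.
have -> : 1%:M = emb 1 1%:M :> 'M[H]_n.+1.
  by apply: (etrans (scalar_mx_block 1 n (1 : H))).
by apply: Hgrp_emb; [exact: normr1|exact: Sp1].
Qed.

Lemma coset_eq g g' : coset g = coset g' -> exists2 h, Hgrp h & g = g' *m h.
Proof.
move=> e; have : coset g g by exists 1%:M; [exact: Hgrp1|exact: mulmx1].
by rewrite e => -[h Hh <-]; exists h.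
Qed.

Lemma mul_emb_col g z (A : 'M[H]_n) i : (g *m emb z A) i ord0 = g i ord0 * quat_of_complex z.
Proof.
rewrite mxE (bigD1 ord0)//= emb00 big1 ?addr0// => l l0.
have -> : emb z A l ord0 = 0; last by rewrite mulr0.
case: (unliftP ord0 l) l0 => [j ->|->]; last by rewrite eqxx.
have -> : lift ord0 j = rshift 1 j by apply/val_inj.
have -> : ord0 = lshift n (0 : 'I_1) by apply/val_inj.
by move=> _; apply: (etrans (block_mxEdl _ _ _ _ _ _)); rewrite mxE.
Qed.

Lemma hz_mul g h : Hgrp h -> hz (g *m h) = hz g * hz h.
Proof.
move=> [z [A [z1 SA ->]]]; rewrite hz_emb /hz mul_emb_col.
by case: z {z1} => x y; rewrite !qE /=; apply/eqP; rewrite eq_complex /=; apply/andP; split; apply/eqP; ring.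
Qed.

Lemma ns_norm g : (ns g)%:C%C = hz g * (hz g)^*%C.
Proof.
rewrite /ns; case: (hz g) => x y; apply/eqP; rewrite eq_complex /=.
by apply/andP; split; apply/eqP; ring.
Qed.

Lemma ns_mul g h : Hgrp h -> ns (g *m h) = ns g.
Proof.
move=> Hh; have [z1 _ _] := Hgrp_hz Hh.
suff : (ns (g *m h))%:C%C = (ns g)%:C%C :> C by move/(congr1 (@complex.Re R)).
by rewrite !ns_norm hz_mul// rmorphM mulrACA (unit_conjM z1) mulr1.
Qed.

Lemma ncol_mul g h : Hgrp h -> ncol (g *m h) = ncol g.
Proof.
move=> Hh; apply/matrixP => i j; rewrite ord1 !ncolE /phase ns_mul// hz_mul//.
have [z1 _ eh] := Hgrp_hz Hh; rewrite {1}eh mul_emb_col.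
rewrite rmorphM quat_of_complexM -!mulrA; congr (_ * _).
rewrite !mulrA -[quat_of_complex (hz h) * _]qreal_comm -!mulrA; congr (_ * _).
by rewrite -!quat_of_complexM mulrCA unit_conjM// mulr1.
Qed.

Section BasePoint.
Variable g0 : 'M[H]_n.+1.
Hypothesis Sg0 : Sp g0.

Definition secm g := g0 *m sv (ctr g0 *m g).

(** [secm g] and g have first columns that differ by a unit complex factor on the right, so their
    quotient stabilises the line of e0. *)
Lemma secm_Hgrp g : Sp g -> 0 < ns (ctr g0 *m g) -> Hgrp (ctr (secm g) *m g) /\ Sp (secm g).
Proof.
move=> Sg w0; have Sw : Sp (ctr g0 *m g) by apply: SpM => //; exact: Sp_ctr_Sp.
have [Ss es] := sv_props Sw w0; split; last exact: SpM.
have p1 := qn2_phase w0.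
rewrite /secm ctrM -mulmxA; set w := ctr g0 *m g in Sw w0 Ss es p1 *.
pose zt : C := ((Num.sqrt (ns w))^-1)%:C%C * (hz w)^*%C.
have pz : phase w = quat_of_complex zt.
  by rewrite /phase /zt; case: (hz w) => x y; apply: quatP; rewrite !qE /=; ring.
have zt1 : `|zt| = 1.
  by apply: unit_normC; move: p1; rewrite pz /qn2 /= => <-; ring.
apply: (@Hgrp_col _ zt^*%C); last 1 first.
- rewrite -mulmxA; have -> : w *m e0 = ncol w *m (quat_of_complex zt^*%C)%:M.
    rewrite /ncol -mulmxA -scalar_mxM pz -quat_of_complexM unit_conjM//.
    by rewrite [quat_of_complex 1]quat_of_complex1 mulmx1.
  by rewrite -es !mulmxA -ctrans_ctr Ss mul1mx.
- exact: (SpM (Sp_ctr_Sp Ss) Sw).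
exact: unit_normC_conj.
Qed.

Lemma gM_ncol (y : G) : Sp y -> 0 < ns (ctr g0 *m y) -> gM y (fun g : G => ncol (ctr g0 *m g)).
Proof.
move=> Sy w0.
have gid : @gM R G y _ _ id by apply: (sat_mx_space (D := @Sp R n.+1)); exact: sat_id.
have gw : @gM R G y _ _ (fun g => ctr g0 *m g) by apply: gMM => //; exact: gM_cst.
have [g1 g2 _ _] := gw ord0 ord0.
have gns : dgerm (X := G) y (fun g => ns (ctr g0 *m g)) by apply: germD; exact: germX.
have gp : @gQ R G y (fun g => phase (ctr g0 *m g)).
  apply: gQM; first by apply: gQ_real; apply: germV => //; [exact: germ_sqrt|rewrite sqrtr_gt0].
  by split; [exact: g1|exact: germN|exact: germ_cst|exact: germ_cst].
move=> i j; rewrite (_ : (fun g : G => _) = fun g => (ctr g0 *m g) i ord0 * phase (ctr g0 *m g)).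
  exact: gQM.
by apply/funext => g; rewrite ord1 ncolE.
Qed.
End BasePoint.

Lemma CP_section (q : @CP_space R n) : dom q ->
  exists s : set G -> G, dnear q (section (X := G) (@coset R n) s).
Proof.
move=> [g0 /= Sg0 <-]; exists (qlift (X := G) (@coset R n) g0 (secm g0)).
have Sg0' := Sp_ctr_Sp Sg0.
apply: (@section_qlift _ G _ g0 (secm g0) (fun g => ns (ctr g0 *m g))).
- exact: complete_generated.
- by move=> x y _ _ /coset_eq[h Hh ->]; rewrite /secm /sv mulmxA ncol_mul.
- by move=> x y _ _ /coset_eq[h Hh ->]; rewrite mulmxA ns_mul.
- exact: Sg0.
- move=> y Dy; have gid : @gM R G y _ _ id by apply: (sat_mx_space (D := @Sp R n.+1)); exact: sat_id.
  have gw : @gM R G y _ _ (fun g => ctr g0 *m g) by apply: gMM => //; exact: gM_cst.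
  by have [g1 g2 _ _] := gw ord0 ord0; apply: germD; exact: germX.
- by rewrite -ctrans_ctr Sg0 /ns /hz !mxE eqxx mulr1n /=; lra.
move=> y Sy w0; have [Hk Ss] := secm_Hgrp Sg0 Sy w0; split; last first.
  by have := coset_mul (secm g0 y) Hk; rewrite mulmxA (Sp_ctr Ss) mul1mx => ->.
have gid : @gM R G y _ _ id by apply: (sat_mx_space (D := @Sp R n.+1)); exact: sat_id.
have gw : @gM R G y _ _ (fun g => ctr g0 *m g) by apply: gMM => //; exact: gM_cst.
have [g1 g2 _ _] := gw ord0 ord0.
have gns : dgerm (X := G) y (fun g => ns (ctr g0 *m g)) by apply: germD; exact: germX.
apply: gM_mx_space => //.
  by apply: nearD_sub (germ_gt Sy gns w0) => g Sg wg; have [] := secm_Hgrp Sg0 Sg wg.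
have gn := gM_ncol Sy w0.
have gf : @gM R G y _ _ (fun g => ncol (ctr g0 *m g) + e0) by apply: gMD => //; exact: gM_cst.
have Sw : Sp (ctr g0 *m y) by exact: SpM.
have gb : @gQ R G y (fun g => 1 + qconj (ncol (ctr g0 *m g) ord0 0)).
  by apply: gQD; [exact: gQ_cst|apply: gQ_conj; exact: gn].
have b0 : 0 < qn2 (1 + qconj (ncol (ctr g0 *m y) ord0 0)).
  have v0 := qr_ncol w0; move: (ncol _ _ _) v0 => v v0.
  have h : 0 < (1 + qr v) ^+ 2 by rewrite exprn_gt0// addr_gt0.
  have := sqr_ge0 (0 - qi v); have := sqr_ge0 (0 - qj v); have := sqr_ge0 (0 - qk v).
  by rewrite /qn2 /=; lra.
apply: gMM; first exact: gM_cst.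
apply: gMD; first exact: gM_cst.
apply: gMM; last exact: gM_ctr.
apply: gMM => //.
have gq : @gQ R G y (fun g => qinv (1 + qconj (ncol (ctr g0 *m g) ord0 0))).
  have [h1 h2 h3 h4] := gb.
  apply: gQM; last exact: gQ_conj.
  apply: gQ_real; apply: germV => //.
  by apply: germD; [apply: germD; [apply: germD|]|]; exact: germX.
move=> i j; rewrite (_ : (fun g : G => _) = fun g => qinv (1 + qconj (ncol (ctr g0 *m g) ord0 0))) => //.
by apply/funext => g; rewrite !ord1 mxE eqxx mulr1n.
Qed.

End ProjectiveSections.

(** * Oriented orthonormal frames as matrices *)

Section Frames.
Variables (R : realType) (n : nat) (a t : R).
Hypotheses (a_gt0 : 0 < a) (t_gt0 : 0 < t).
Local Notation H := (quat R).
Local Notation N := (Ndim n).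
Local Notation iom := (iom a t).
Implicit Types (h g : 'M[H]_n.+1) (B : 'M[R]_N) (b : 'I_N -> 'M[H]_n.+1).

Definition fr B : 'I_N -> 'M[H]_n.+1 := fun j => iom (row j B^T).
Definition fract b B : 'I_N -> 'M[H]_n.+1 := fun j => \sum_i rscale (B i j) (b i).

Lemma rscaleE m c (X : 'M[H]_m) : rscale c X = qreal c *: X. Proof. by []. Qed.

Lemma rscale_mul m c d (X : 'M[H]_m) : rscale c (rscale d X) = rscale (c * d) X.
Proof. by rewrite !rscaleE scalerA qrealM. Qed.

Lemma rscale_mulr m c (X Y : 'M[H]_m) : X *m rscale c Y = rscale c (X *m Y).
Proof.
apply/matrixP => i j; rewrite !rscaleE !mxE mulr_sumr; apply: eq_bigr => l _.
by rewrite mxE !mulrA qreal_comm.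
Qed.

Lemma rscale_mull m c (X Y : 'M[H]_m) : rscale c X *m Y = rscale c (X *m Y).
Proof. by rewrite !rscaleE scalemxAl. Qed.

Lemma iom_sum (I : Type) (s : seq I) (c : I -> R) (v : I -> 'rV[R]_N) :
  iom (\sum_(i <- s) c i *: v i) = \sum_(i <- s) rscale (c i) (iom (v i)).
Proof.
have iom0 : iom (0 : 'rV[R]_N) = 0.
  have := iomZD a t (-1) (0 : 'rV[R]_N) 0; rewrite scaler0 addr0 rscaleE => ->.
  by rewrite (_ : qreal (-1) = -1 :> H) ?scaleN1r ?addNr//; apply: quatP; rewrite /= ?oppr0.
by elim: s => [|i s ih]; rewrite ?big_nil// !big_cons iomZD ih.
Qed.

Lemma iom_onbasis (v : 'rV[R]_N) : iom v = \sum_j rscale (v 0 j) (onbasis a t j).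
Proof.
rewrite {1}(row_sum_delta v) iom_sum; apply: eq_bigr => j _.
by rewrite onbasis_iom.
Qed.

Lemma mspace_iom (v : 'rV[R]_N) : mspace (iom v).
Proof.
rewrite iom_onbasis; eexists; apply: eq_bigr => j _; rewrite /onbasis rscale_mul.
reflexivity.
Qed.

Lemma gmetric_fr B i j : gmetric a t (onbasis a t i) (fr B j) = B i j.
Proof.
rewrite (onbasis_iom a_gt0 t_gt0) /fr gmetric_iom//.
rewrite /vdot (bigD1 i)//= big1 => [|k ki]; last by rewrite !mxE (negPf ki) andbF mul0r.
by rewrite !mxE !eqxx mul1r addr0.
Qed.

Lemma fr_inj : injective fr.
Proof. by move=> A B e; apply/matrixP => i j; rewrite -gmetric_fr e gmetric_fr. Qed.

Lemma is_frame_fr B : B^T *m B = 1%:M -> 0 < \det B -> is_frame a t (fr B).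
Proof.
move=> oB dB; split=> [j|i j|]; first exact: mspace_iom.
  have := congr1 (fun M : 'M[R]_N => M i j) oB; rewrite mxE [in RHS]mxE => <-; rewrite /fr gmetric_iom//.
  by apply: eq_bigr => l _; rewrite !mxE.
rewrite (_ : \matrix_(i, j) gmetric a t (onbasis a t i) (fr B j) = B)//; apply/matrixP => i j.
by rewrite [LHS]mxE gmetric_fr.
Qed.

Lemma fr_mul A B : fract (fr A) B = fr (A *m B).
Proof.
apply/funext => j; rewrite /fract -iom_sum; congr iom; apply/rowP => i.
by rewrite summxE !mxE; apply: eq_bigr => l _; rewrite !mxE mulrC.
Qed.

Lemma fr1 : fr 1%:M = onbasis a t.
Proof. by apply/funext => j; rewrite /fr trmx1 row1 onbasis_iom. Qed.

Lemma fr_conj h B : Hgrp h -> (fun j => h *m fr B j *m ctrans h) = fr (isotropy a t h *m B).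
Proof.
move=> [z [A [z1 SA ->]]]; apply/funext => j; rewrite /fr emb_iom -(isotropyE a_gt0 t_gt0).
by rewrite trmx_mul row_mul.
Qed.

Lemma frame_cls_mul g b h : Hgrp h ->
  frame_cls (g *m h, (fun j => ctrans h *m b j *m h)) = frame_cls (g, b).
Proof.
move=> Hh; have Hc := Hgrp_ctr Hh; apply/seteqP; split=> y [h' Hh' <-] /=.
  exists (h *m h'); first exact: HgrpM.
  by congr (_, _); [rewrite mulmxA|apply/funext => j; rewrite !ctrans_ctr ctrM !mulmxA].
exists (ctr h *m h'); first exact: HgrpM.
congr (_, _) => /=; first by rewrite mulmxA -(mulmxA g) Hgrp_mul_ctr// mulmx1.
apply/funext => j; rewrite !ctrans_ctr ctrM ctrK; have := Hgrp_mul_ctr Hh.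
move: (ctr h) (ctr h') (b j) => k k' X e.
by rewrite !mulmxA -(mulmxA k') e mulmx1 -(mulmxA _ h k) e mulmx1.
Qed.

Lemma frame_cls_fr g B h : Hgrp h ->
  frame_cls (g *m h, fr (isotropy a t (ctr h) *m B)) = frame_cls (g, fr B).
Proof.
move=> Hh; rewrite -(fr_conj _ (Hgrp_ctr Hh)) -(frame_cls_mul g (fr B) Hh).
by congr (frame_cls (_, _)); apply/funext => j; rewrite !ctrans_ctr ctrK.
Qed.

Lemma FM_right_cls g b B : FM_right (frame_cls (g, b) : FM_space n a t) B = frame_cls (g, fract b B).
Proof.
have e h : fract (fun j => ctrans h *m b j *m h) B = (fun j => ctrans h *m fract b B j *m h).
  apply/funext => j; rewrite /fract mulmx_sumr mulmx_suml; apply: eq_bigr => i _.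
  by rewrite rscale_mulr rscale_mull.
apply/seteqP; split=> [_ [_ [h Hh <-] <-]|_ [h Hh <-]] /=.
  by exists h; rewrite // -e.
by exists (g *m h, (fun j => ctrans h *m b j *m h)); [exists h|rewrite /= -e].
Qed.

Lemma FM_left_cls g g' b : FM_left g (frame_cls (g', b) : FM_space n a t) = frame_cls (g *m g', b).
Proof.
apply/seteqP; split=> [_ [_ [h Hh <-] <-]|_ [h Hh <-]] /=.
  by exists h; rewrite /= ?mulmxA.
by exists (g' *m h, (fun j => ctrans h *m b j *m h)); [exists h|rewrite /= mulmxA].
Qed.

Lemma FM_proj_cls g b : FM_proj (frame_cls (g, b) : FM_space n a t) = coset g.
Proof.
apply/seteqP; split=> [_ [_ [h Hh <-] <-]|_ [h Hh <-]] /=; first by exists h.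
by exists (g *m h, (fun j => ctrans h *m b j *m h)) => //; exists h.
Qed.

Lemma CP_left_coset g g' : CP_left g (coset g' : @CP_space R n) = coset (g *m g').
Proof.
apply/seteqP; split=> [_ [_ [h Hh <-] <-]|_ [h Hh <-]] /=; first by exists h; rewrite ?mulmxA.
by exists (g' *m h); [exists h|rewrite mulmxA].
Qed.

Lemma is_frame_lam (mu : Cl R N) : Spin R N mu -> is_frame a t (fr (lam mu)).
Proof.
move=> Smu; apply: is_frame_fr; first exact: lam_orth.
by have [_ ->] := Spin_cover Smu; exact: ltr01.
Qed.

Lemma germ_lam (mu : Cl R N) i j : @dgerm R (Spin_space N) mu (fun mu => lam mu i j).
Proof.
have -> : (fun mu : Cl R N => lam mu i j) = fun mu => \sum_A
  (\sum_B psg R (par B (sdiff B A)) * clE R i B * mu (sdiff B A)) *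
  (\sum_B psg R (par B (sdiff B A)) * mu B * clE R j (sdiff B A)).
  by apply/funext => x; rewrite mxE /clip; apply: eq_bigr => A _; rewrite -!clmul_mul !clmulE.
have gm A : @dgerm R (Spin_space N) mu (fun mu : Cl R N => mu A).
  by apply: germ_gen; apply: gens_generated; exists A.
apply: germ_sum => A _; apply: germM; apply: germ_sum => B _; apply: germM;
  try exact: gm; try exact: germ_cst.
by apply: germM; [exact: germ_cst|exact: gm].
Qed.

Lemma sat_fr_lam (mu : Cl R N) : Spin R N mu ->
  @sat R (Spin_space N) (frame_space n a t) (fun mu => fr (lam mu)) mu.
Proof.
move=> Smu; apply: sat_gen => //; first by apply: nearD_all => y; exact: is_frame_lam.
move=> _ [j [f [fq ->]]].
have : @gM R (Spin_space N) mu _ _ (fun mu => fr (lam mu) j).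
  have -> : (fun mu : Cl R N => fr (lam mu) j) =
      fun mu => \sum_i qreal (lam mu i j) *: onbasis a t i.
    by apply/funext => x; rewrite /fr iom_onbasis; apply: eq_bigr => i _; rewrite rscaleE !mxE.
  apply: gM_sum => i; apply: gMZ; last exact: gM_cst.
  by apply: gQ_real; exact: germ_lam.
by move=> g; case: fq => p [q [] ->]; have [? ? ? ?] := g p q.
Qed.

End Frames.

(** * The bundle associated with a lift of the isotropy representation *)

Section Bundle.
Variables (R : realType) (n : nat) (a t : R) (r : nat) (nu : R[i] -> Cl R r).
Hypotheses (a_gt0 : 0 < a) (t_gt0 : 0 < t) (r_gt0 : (0 < r)%N).
Local Notation H := (quat R).
Local Notation C := (R[i]).
Local Notation N := (Ndim n).
Local Notation muh := (muh a t).
Let Hs : dspace R := mx_space (@Hgrp R n).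
Let G : dspace R := Sp_space n.+1.
Let Y : dspace R := dspace_prod (Spin_space N) (Spin_space r).
Let K : dspace R := Spinr R N r.
Let CP : dspace R := @CP_space R n.
Let X0 : dspace R := dspace_prod G Y.
Hypotheses (nu_Spin : forall z, `|z| = 1 -> Spin R r (nu z))
  (nuM : forall z z', `|z| = 1 -> `|z'| = 1 -> nu (z * z') = nu z * nu z')
  (nu_sat : forall x, Hgrp x -> @sat R Hs (Spin_space r) (fun h => nu (hz h)) x).
Implicit Types (x y : X0) (h g : 'M[H]_n.+1) (k l : Y).

Definition ym k l : Y := (k.1 * l.1, k.2 * l.2).
Definition yo k : Y := (- k.1, - k.2).
(** The lift on representatives, before the common sign is divided out; at this level it is
    multiplicative on the nose. *)
Definition mh h : Y := (muh h, nu (hz h)).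

Lemma ymA k l m : ym k (ym l m) = ym (ym k l) m.
Proof. by rewrite /ym /= !mulrA. Qed.
Lemma ymNl k l : ym (yo k) l = yo (ym k l).
Proof. by rewrite /ym /yo /= !mulNr. Qed.
Lemma ymNr k l : ym k (yo l) = yo (ym k l).
Proof. by rewrite /ym /yo /= !mulrN. Qed.
Lemma yoK k : yo (yo k) = k.
Proof. by case: k => ? ?; rewrite /yo /= !opprK. Qed.
Lemma ym1 k : ym (1, 1) k = k.
Proof. by case: k => ? ?; rewrite /ym /= !mul1r. Qed.
Lemma ymr1 k : ym k (1, 1) = k.
Proof. by case: k => ? ?; rewrite /ym /= !mulr1. Qed.

Lemma spinr_mulE k l : spinr_mul (spinr_cls k) (spinr_cls l) = spinr_cls (ym k l).
Proof. by case: k => p q; case: l => p' q'; rewrite spinr_mul_cls. Qed.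

Lemma dom_ym k l : dom k -> dom l -> dom (ym k l).
Proof. by move=> [? ?] [? ?]; split; exact: SpinM. Qed.

Lemma dom_y1 : dom ((1, 1) : Y).
Proof. by split; exact: Spin1. Qed.

Lemma spinr_clsE k l : spinr_cls k l <-> l = k \/ l = yo k.
Proof. by case: k => p q; exact: spinr_clsP. Qed.

Lemma spinr_cls_yo k : spinr_cls (yo k) = spinr_cls k.
Proof. by case: k => p q; exact: spinr_clsN. Qed.

Lemma dom_mh h : Hgrp h -> dom (mh h).
Proof.
move=> Hh; have [z1 _ _] := Hgrp_hz Hh; have [S1 _ _] := muh_lifts a_gt0 t_gt0 Hh.
by split=> //; exact: nu_Spin.
Qed.

Lemma mhM h h' : Hgrp h -> Hgrp h' -> mh (h *m h') = ym (mh h) (mh h').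
Proof.
move=> Hh Hh'; have [z1 _ _] := Hgrp_hz Hh; have [z1' _ _] := Hgrp_hz Hh'.
by rewrite /mh muhM// hzM// nuM.
Qed.

Lemma nu1 : nu 1 = 1.
Proof.
have := nuM (normr1 C) (normr1 C); rewrite mulr1 => e.
have [v [_ vn _]] := Spin_inv (nu_Spin (normr1 C)).
by have := congr1 (fun y : Cl R r => y * v) e; rewrite -mulrA vn mulr1 => <-.
Qed.

Lemma mh1 : mh 1%:M = (1, 1).
Proof.
have e1 : 1%:M = emb 1 1%:M :> 'M[H]_n.+1 by apply: (etrans (scalar_mx_block 1 n (1 : H))).
rewrite /mh e1 hz_emb nu1; congr (_, _).
by apply: (muh_emb a_gt0 t_gt0 (normr1 C) (@Sp1 R n)); exact: lifts1.
Qed.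

(* [(g, k) ~ (g h, +- phi(h)^-1 k)]; on [Hgrp], [ctr] is the inverse. *)
Definition cls x : set X0 :=
  [set y | exists h, [/\ Hgrp h, y.1 = x.1 *m h & spinr_cls (ym (mh (ctr h)) x.2) y.2]].

Lemma cls_mul x h : Hgrp h -> cls (x.1 *m h, ym (mh (ctr h)) x.2) = cls x.
Proof.
move=> Hh; have Hc := Hgrp_ctr Hh; apply/seteqP; split=> y [h' [Hh' e1 e2]] /=.
  exists (h *m h'); split; [exact: HgrpM|by rewrite e1 mulmxA|].
  by move: e2; rewrite /= ctrM mhM ?ymA//; exact: Hgrp_ctr.
exists (ctr h *m h'); split; first exact: HgrpM.
  by rewrite e1 /= mulmxA -[x.1 *m h *m _]mulmxA Hgrp_mul_ctr// mulmx1.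
rewrite /= ymA -mhM//; last by rewrite ctrM ctrK; apply: HgrpM => //; exact: Hgrp_ctr.
by rewrite ctrM ctrK -mulmxA Hgrp_mul_ctr// mulmx1.
Qed.

Lemma cls_yo x : cls (x.1, yo x.2) = cls x.
Proof.
by apply/seteqP; split=> y [h [Hh e1 e2]]; exists h; split=> //; move: e2;
  rewrite /= ymNr spinr_cls_yo.
Qed.

Lemma cls_refl x : cls x x.
Proof.
exists 1%:M; split; [exact: Hgrp1|by rewrite mulmx1|].
by rewrite ctr1 mh1 ym1; apply/spinr_clsE; left.
Qed.

Lemma cls_eq x y : cls x = cls y -> exists h, [/\ Hgrp h, x.1 = y.1 *m h &
  x.2 = ym (mh (ctr h)) y.2 \/ x.2 = yo (ym (mh (ctr h)) y.2)].
Proof.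
by move=> e; have := cls_refl x; rewrite e => -[h [Hh e1 /spinr_clsE e2]]; exists h.
Qed.

Let P : dspace R := dspace_quot cls.
Let x0 : X0 := (1%:M, (1, 1)).
Let y0 : Y := (1, 1).
Local Notation repP := (rep cls x0).
Local Notation repK := (rep (X := Y) (@spinr_cls R N r) y0).

Lemma dom_x0 : dom x0.
Proof. by split; [exact: Sp1|exact: dom_y1]. Qed.

Lemma complete_X0 : complete X0. Proof. exact: complete_prod. Qed.
Lemma complete_P : complete P. Proof. exact: complete_quot complete_X0. Qed.

Lemma rep_clsP x : dom x -> [/\ dom (repP (cls x)), cls (repP (cls x)) = cls x &
  exists h, [/\ Hgrp h, (repP (cls x)).1 = x.1 *m h &
  (repP (cls x)).2 = ym (mh (ctr h)) x.2 \/ (repP (cls x)).2 = yo (ym (mh (ctr h)) x.2)]].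
Proof. by move=> Dx; have [Dr e] := rep_cls cls x0 Dx; split=> //; exact: cls_eq. Qed.

Lemma repK_cls k : dom k -> dom (repK (spinr_cls k)) /\
  (repK (spinr_cls k) = k \/ repK (spinr_cls k) = yo k).
Proof.
move=> Dk; have [Dr e] := rep_cls (X := Y) (@spinr_cls R N r) y0 Dk; split=> //.
exact: spinr_cls_eq e.
Qed.

Lemma cls_act x h k : Hgrp h -> cls (x.1 *m h, ym (ym (mh (ctr h)) x.2) k) = cls (x.1, ym x.2 k).
Proof. by move=> Hh; rewrite -ymA; exact: (@cls_mul (x.1, ym x.2 k)). Qed.

Definition ract0 (S : P) (k : K) : P := cls ((repP S).1, ym (repP S).2 (repK k)).

Lemma ract0E x k : dom x -> dom k -> ract0 (cls x) (spinr_cls k) = cls (x.1, ym x.2 k).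
Proof.
move=> Dx Dk; rewrite /ract0; have [_ _ [h [Hh -> e2]]] := rep_clsP Dx.
have [_ ek] := repK_cls Dk.
by case: e2 => ->; case: ek => ->; rewrite ?ymNl ?ymNr ?yoK -?(cls_act x k Hh)//;
  exact: (@cls_yo (x.1 *m h, ym (ym (mh (ctr h)) x.2) k)).
Qed.

Definition lact0 g (S : P) : P := cls (g *m (repP S).1, (repP S).2).

Lemma lact0E g x : dom x -> lact0 g (cls x) = cls (g *m x.1, x.2).
Proof.
move=> Dx; rewrite /lact0; have [_ _ [h [Hh -> e2]]] := rep_clsP Dx.
rewrite mulmxA; have e := @cls_mul (g *m x.1, x.2) h Hh; rewrite /= in e.
by case: e2 => ->; rewrite -e//; exact: (@cls_yo (g *m x.1 *m h, ym (mh (ctr h)) x.2)).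
Qed.

Definition pr0 : P -> CP := qlift cls x0 (fun x : X0 => coset x.1 : CP).

Lemma pr0_inv : respects (X := X0) cls (fun x : X0 => coset x.1).
Proof. by move=> x y _ _ /cls_eq[h [Hh -> _]]; exact: coset_mul. Qed.

Lemma pr0E x : dom x -> pr0 (cls x) = coset x.1.
Proof. by move=> Dx; exact: (qliftE x0 pr0_inv Dx). Qed.

Lemma sat_coset g : Sp g -> @sat R G CP (@coset R n) g.
Proof. by move=> Sg; apply: sat_smooth; exact: smooth_cls. Qed.

Lemma sat_coset1 x : dom x -> @sat R X0 CP (fun x => coset x.1) x.
Proof.
move=> Dx; have [Sx _] := Dx.
apply: (@sat_comp R X0 G CP fst (@coset R n) x Dx); [exact: sat_fst|exact: sat_coset].
Qed.

Lemma pr0_smooth : smooth_map pr0.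
Proof. by apply: smooth_qlift; [exact: complete_X0|exact: pr0_inv|exact: sat_coset1]. Qed.

Lemma sat_cls x : dom x -> @sat R X0 P cls x.
Proof. by move=> Dx; apply: sat_smooth; exact: smooth_cls. Qed.

Lemma sat_ym k l : dom k -> dom l -> @sat R (dspace_prod Y Y) Y (fun z => ym z.1 z.2) (k, l).
Proof.
move=> Dk Dl; have Dz : @dom R (dspace_prod Y Y) (k, l) by [].
have near : @dnear R (dspace_prod Y Y) (k, l) (fun z => dom (ym z.1 z.2)).
  by apply: nearD_all => -[k' l'] [/= ? ?]; exact: dom_ym.
have g1 := sat_fst (X := Y) (Y := Y) (k, l); have g2 := sat_snd (X := Y) (Y := Y) (k, l).
have s1 : forall A, @dgerm R (dspace_prod Y Y) (k, l) (fun z => z.1.1 A).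
  by move=> A; exact: (sat_germ Dz g1 (germ_fst_coef A Dk)).
have s2 : forall A, @dgerm R (dspace_prod Y Y) (k, l) (fun z => z.1.2 A).
  by move=> A; exact: (sat_germ Dz g1 (germ_snd_coef A Dk)).
have s3 : forall A, @dgerm R (dspace_prod Y Y) (k, l) (fun z => z.2.1 A).
  by move=> A; exact: (sat_germ Dz g2 (germ_fst_coef A Dl)).
have s4 : forall A, @dgerm R (dspace_prod Y Y) (k, l) (fun z => z.2.2 A).
  by move=> A; exact: (sat_germ Dz g2 (germ_snd_coef A Dl)).
apply: sat_pair => //; apply: sat_gen => //.
- by apply: nearD_sub near => z _ [].
- move=> g [A ->].
  have -> : (fun p : Cl R N => p A) \o (fun z : dspace_prod Y Y => z.1.1 * z.2.1) =
    fun z => \sum_B psg R (par B (sdiff B A)) * z.1.1 B * z.2.1 (sdiff B A).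
    by apply/funext => z; rewrite /= -clmul_mul clmulE.
  by apply: germ_sum => B _; apply: germM; last exact: s3; apply: germM; [exact: germ_cst|exact: s1].
- by apply: nearD_sub near => z _ [].
move=> g [A ->].
have -> : (fun p : Cl R r => p A) \o (fun z : dspace_prod Y Y => z.1.2 * z.2.2) =
  fun z => \sum_B psg R (par B (sdiff B A)) * z.1.2 B * z.2.2 (sdiff B A).
  by apply/funext => z; rewrite /= -clmul_mul clmulE.
by apply: germ_sum => B _; apply: germM; last exact: s4; apply: germM; [exact: germ_cst|exact: s2].
Qed.

Lemma sat_mh h : Hgrp h -> @sat R Hs Y mh h.
Proof. by move=> Hh; apply: sat_pair => //; [exact: sat_muh|exact: nu_sat]. Qed.

Section Trivialization.
Variables (U : set CP) (sg : set G -> G).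
Hypotheses (oU : dspace_open U) (sgU : forall c, U c -> section (X := G) (@coset R n) sg c).

(** Fibre coordinate: with h = [ctr sg] g in H one has g = sg h, so (g, k) is equivalent to (sg,
    mh(h) k). *)
Definition tr0 x : Y := ym (mh (ctr (sg (coset x.1)) *m x.1)) x.2.

Lemma U_near (c : CP) : U c -> dnear c U.
Proof.
move=> Uc; have [_ h] := oU; have [k [u [e [gu e0 uU]]]] := h c Uc.
by exists k, u, e.
Qed.

Lemma sg_spec c : U c -> Sp (sg c) /\ coset (sg c) = c.
Proof. by move=> /sgU[Dc sc cc]; split; [exact: sat_dom sc|exact: nearD_pt cc]. Qed.

Lemma sg_Hgrp g : Sp g -> U (coset g) ->
  Hgrp (ctr (sg (coset g)) *m g) /\ sg (coset g) *m (ctr (sg (coset g)) *m g) = g.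
Proof.
move=> Sg /sg_spec[Ss cs]; have [h Hh e] := coset_eq cs.
have e' : g = sg (coset g) *m ctr h by rewrite e -mulmxA Hgrp_mul_ctr// mulmx1.
split; last by rewrite mulmxA Sp_ctr// mul1mx.
by rewrite {2}e' mulmxA -ctrans_ctr Ss mul1mx; exact: Hgrp_ctr.
Qed.

Lemma tr0_inv x y : dom x -> dom y -> U (coset y.1) -> cls x = cls y ->
  spinr_cls (tr0 x) = spinr_cls (tr0 y).
Proof.
move=> [Sx _] [Sy _] Uy /cls_eq[h [Hh e1 e2]]; rewrite /tr0 e1 coset_mul//.
have [Hk _] := sg_Hgrp Sy Uy; rewrite mulmxA mhM//.
have e : ym (ym (mh (ctr (sg (coset y.1)) *m y.1)) (mh h)) (ym (mh (ctr h)) y.2) =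
    ym (mh (ctr (sg (coset y.1)) *m y.1)) y.2.
  rewrite -ymA [ym (mh h) _]ymA -mhM//; last exact: Hgrp_ctr.
  by rewrite Hgrp_mul_ctr// mh1 ym1.
by case: e2 => ->; rewrite ?ymNr e ?spinr_cls_yo.
Qed.

Definition psi0 (S : P) : CP * K := (coset (repP S).1, spinr_cls (tr0 (repP S))).

Lemma psi0E x : dom x -> U (coset x.1) -> psi0 (cls x) = (coset x.1, spinr_cls (tr0 x)).
Proof.
move=> Dx Ux; have [Dr e _] := rep_clsP Dx; rewrite /psi0; congr (_, _).
  exact: (pr0_inv Dr Dx e).
exact: tr0_inv.
Qed.

Lemma sat_tr0 x : dom x -> U (coset x.1) -> @sat R X0 Y tr0 x.
Proof.
move=> Dx Ux; have [Sx Dx2] := Dx; have [Dc sc _] := sgU Ux.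
have s1 : @sat R X0 G (fun x => sg (coset x.1)) x.
  exact: (@sat_comp R X0 CP G (fun x => coset x.1) sg x Dx (sat_coset1 Dx) sc).
have s2 : @sat R X0 G fst x by exact: sat_fst.
have g1 := sat_mx_space (D := @Sp R n.+1) s1.
have g2 := sat_mx_space (D := @Sp R n.+1) s2.
have near : @dnear R X0 x (fun x => Hgrp (ctr (sg (coset x.1)) *m x.1)).
  apply: nearD_sub (sat_near Dx (sat_coset1 Dx) (U_near Ux)) => y [Sy _] Uy.
  by have [] := sg_Hgrp Sy Uy.
have s3 : @sat R X0 Hs (fun x => ctr (sg (coset x.1)) *m x.1) x.
  by apply: gM_mx_space => //; apply: gMM => //; exact: gM_ctr.
have Hx := nearD_pt Dx near.
have s4 : @sat R X0 Y (fun x => mh (ctr (sg (coset x.1)) *m x.1)) x.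
  exact: (@sat_comp R X0 Hs Y _ mh x Dx s3 (sat_mh Hx)).
have s5 : @sat R X0 (dspace_prod Y Y) (fun x => (mh (ctr (sg (coset x.1)) *m x.1), x.2)) x.
  by apply: sat_pair => //; exact: sat_snd.
apply: (@sat_comp R X0 (dspace_prod Y Y) Y _ (fun z => ym z.1 z.2) x Dx s5).
by apply: sat_ym => //; exact: dom_mh.
Qed.

Lemma sat_spinr_cls k : dom k -> @sat R Y K (@spinr_cls R N r) k.
Proof. by move=> Dk; apply: sat_smooth; exact: smooth_cls. Qed.

Lemma pr0_near (q : P) : dom q -> U (pr0 q) -> dnear q (fun q => U (pr0 q)).
Proof. by move=> Dq Uq; exact: (sat_near Dq (sat_smooth _ pr0_smooth) (U_near Uq)). Qed.

Lemma sat_psi0 (q : P) : dom q -> U (pr0 q) -> @sat R P (dspace_prod CP K) psi0 q.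
Proof.
move=> Dq Uq; apply: (sat_quot complete_X0 Dq).
apply: nearD_sub (pr0_near Dq Uq) => q' _ Uq' x Dx e; move: Uq'; rewrite -e pr0E// => Ux.
have near : @dnear R X0 x (fun y => U (coset y.1)) := sat_near Dx (sat_coset1 Dx) (U_near Ux).
apply: (@sat_local R X0 (dspace_prod CP K) _ (fun x : X0 => (coset x.1, spinr_cls (tr0 x)) : CP * K)).
  by apply: nearD_sub near => y Dy Uy; exact: psi0E.
apply: sat_pair => //; first exact: sat_coset1.
have st := sat_tr0 Dx Ux.
exact: (@sat_comp R X0 Y K tr0 _ x Dx st (sat_spinr_cls (sat_dom Dx st))).
Qed.

Definition inv0 (z : CP * K) : P := cls (sg z.1, repK z.2).

Lemma inv0E c k : dom k -> inv0 (c, spinr_cls k) = cls (sg c, k).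
Proof.
move=> Dk; rewrite /inv0 /=; have [_ [->|->]] := repK_cls Dk => //.
exact: (@cls_yo (sg c, k)).
Qed.

Lemma sat_inv0 (c : CP) (k : K) : U c -> dom k -> @sat R (dspace_prod CP K) P inv0 (c, k).
Proof.
move=> Uc Dk; have [Dc sc _] := sgU Uc; have [Ss _] := sg_spec Uc.
have [tau tauP] := spinr_section (Ndim_gt0 n) r_gt0 Dk.
have sec := nearD_pt Dk tauP; have [_ st _] := sec; have Dt := sat_dom Dk st.
apply: sat_swap => //; apply: (sat_section1 sec) => //=.
have Dz : @dom R (dspace_prod Y CP) (tau k, c) by [].
apply: (@sat_local R (dspace_prod Y CP) P _ ((cls : X0 -> P) \o (fun z : Y * CP => (sg z.2, z.1) : X0))).
  by apply: nearD_all => -[k' c'] [/= Dk' _]; rewrite /= inv0E.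
apply: (@sat_comp R (dspace_prod Y CP) X0 P) => //; last by apply: sat_cls; split.
apply: sat_pair => //; last exact: sat_fst.
exact: (@sat_comp R (dspace_prod Y CP) CP G snd sg _ Dz (sat_snd _) sc).
Qed.

Lemma psi0K (q : P) : dom q -> U (pr0 q) -> inv0 (psi0 q) = q.
Proof.
move=> [x Dx <-]; rewrite pr0E// => Ux; have [Sx Dx2] := Dx.
have [Hk e] := sg_Hgrp Sx Ux; rewrite psi0E// inv0E; last by apply: dom_ym => //; exact: dom_mh.
rewrite -(@cls_mul (sg (coset x.1), tr0 x) _ Hk) /= /tr0 ymA -mhM//; last exact: Hgrp_ctr.
by rewrite Hgrp_ctr_mul// mh1 ym1 e; case: (x).
Qed.

Lemma inv0K (c : CP) (k : K) : U c -> dom k -> psi0 (inv0 (c, k)) = (c, k).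
Proof.
move=> Uc [y Dy <-]; have [Ss cs] := sg_spec Uc; have D : @dom R X0 (sg c, y) by [].
rewrite inv0E// (psi0E D); last by rewrite /= cs.
by rewrite /tr0 /= cs -ctrans_ctr Ss mh1 ym1.
Qed.

Lemma pr0_inv0 (c : CP) (k : K) : U c -> dom k -> dom (inv0 (c, k)) /\ pr0 (inv0 (c, k)) = c.
Proof.
move=> Uc [y Dy <-]; have [Ss cs] := sg_spec Uc; rewrite inv0E//.
have D : @dom R X0 (sg c, y) by [].
by split; [exists (sg c, y)|rewrite pr0E].
Qed.

Lemma psi0_ract (q : P) (k : K) : dom q -> U (pr0 q) -> dom k ->
  psi0 (ract0 q k) = (pr0 q, spinr_mul (psi0 q).2 k).
Proof.
move=> [x Dx <-] + [y Dy <-]; rewrite pr0E// => Ux; have [Sx Dx2] := Dx.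
have D : @dom R X0 (x.1, ym x.2 y) by split=> //; exact: dom_ym.
rewrite ract0E// !psi0E//=; congr (_, _); rewrite /tr0 /= ymA.
by rewrite spinr_mulE.
Qed.

(** The trivialisation followed by local sections of Sp(n+1) over the base and of Spin(N) x Spin(r)
    over the fibre. *)
Lemma P_section1 (q : P) : dom q -> U (pr0 q) ->
  exists s : set X0 -> X0, dnear q (section (X := X0) cls s).
Proof.
move=> Dq Uq; have sp := sat_psi0 Dq Uq; have [Dc Dk] := sat_dom Dq sp.
have [tau tauP] := spinr_section (Ndim_gt0 n) r_gt0 Dk.
exists (fun q => (sg (psi0 q).1, tau (psi0 q).2)).
have s2 : @sat R P K (fun q => (psi0 q).2) q.
  exact: (@sat_comp R P (dspace_prod CP K) K psi0 snd q Dq sp (sat_snd _)).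
have near : dnear q (fun q => U (pr0 q) /\ section (X := Y) (@spinr_cls R N r) tau (psi0 q).2).
  by apply: nearD_and; [exact: pr0_near|exact: (sat_near Dq s2 tauP)].
apply: nearD_sub near => p Dp [Up secp].
have sp' := sat_psi0 Dp Up; have [_ st tt] := secp.
have s2' : @sat R P K (fun q => (psi0 q).2) p.
  exact: (@sat_comp R P (dspace_prod CP K) K psi0 snd p Dp sp' (sat_snd _)).
have s1' : @sat R P CP (fun q => (psi0 q).1) p.
  exact: (@sat_comp R P (dspace_prod CP K) CP psi0 fst p Dp sp' (sat_fst _)).
have [_ sc _] := sgU Up.
split=> //.
  apply: sat_pair => //.
    exact: (@sat_comp R P CP G (fun q => (psi0 q).1) sg p Dp s1' sc).
  exact: (@sat_comp R P K Y (fun q => (psi0 q).2) tau p Dp s2' st).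
have near2 : dnear p (fun q => dom (tau (psi0 q).2) /\ spinr_cls (tau (psi0 q).2) = (psi0 q).2).
  exact: (sat_near Dp s2' (nearD_and st.1 tt)).
apply: nearD_sub (nearD_and (pr0_near Dp Up) near2) => q' Dq' [Uq' [Dt et]].
by rewrite -inv0E// et; rewrite -[RHS](psi0K Dq' Uq'); case: (psi0 q').
Qed.

End Trivialization.

Lemma local_trivial (c : CP) : dom c ->
  exists U sg, [/\ dspace_open U, U c & forall c', U c' -> section (X := G) (@coset R n) sg c'].
Proof.
move=> Dc; have [sg h] := CP_section Dc; have [U [oU Uc hU]] := dnear_open Dc h.
by exists U, sg.
Qed.

Lemma P_section (q : P) : dom q -> exists s : set X0 -> X0, dnear q (section (X := X0) cls s).
Proof.
move=> Dq; have [U [sg [oU Uc sgU]]] := local_trivial (pr0_smooth.1 q Dq).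
exact: P_section1 oU sgU _ Dq Uc.
Qed.

(** Both factors of the source are quotients. Sections of both replace them by the spaces upstairs,
    where the action is Clifford multiplication. *)
Lemma ract0_smooth : @smooth_map R (dspace_prod P K) P (fun z => ract0 z.1 z.2).
Proof.
have D0 z : @dom R (dspace_prod P K) z -> dom (ract0 z.1 z.2).
  case: z => q k [/= [x Dx <-] [y Dy <-]]; rewrite ract0E//.
  exists (x.1, ym x.2 y) => //; case: Dx => Sx Dx2; split=> //; exact: dom_ym.
apply: smooth_sat => //; first exact: complete_prod.
move=> [q k] [Dq Dk]; have [s sP] := P_section Dq; have [tau tauP] := spinr_section (Ndim_gt0 n) r_gt0 Dk.
have sec := nearD_pt Dq sP; have sec' := nearD_pt Dk tauP.
apply: (sat_section2 sec sec') => /=.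
have [_ ss _] := sec; have [_ st _] := sec'.
have Ds := sat_dom Dq ss; have Dt := sat_dom Dk st.
have Dz : @dom R (dspace_prod X0 Y) (s q, tau k) by [].
apply: (@sat_local R (dspace_prod X0 Y) P _ ((cls : X0 -> P) \o (fun z : X0 * Y => (z.1.1, ym z.1.2 z.2) : X0))).
  by apply: nearD_all => -[x y] [/= Dx Dy]; exact: ract0E.
have [Ds1 Ds2] := Ds.
apply: (@sat_comp R (dspace_prod X0 Y) X0 P) => //; last first.
  by apply: sat_cls; split=> //; exact: dom_ym.
have f1 : @sat R (dspace_prod X0 Y) G (fun z => z.1.1) (s q, tau k).
  exact: (@sat_comp R (dspace_prod X0 Y) X0 G fst fst _ Dz (sat_fst _) (sat_fst _)).
have f2 : @sat R (dspace_prod X0 Y) Y (fun z => z.1.2) (s q, tau k).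
  exact: (@sat_comp R (dspace_prod X0 Y) X0 Y fst snd _ Dz (sat_fst _) (sat_snd _)).
apply: sat_pair => //.
have f3 : @sat R (dspace_prod X0 Y) (dspace_prod Y Y) (fun z => (z.1.2, z.2)) (s q, tau k).
  by apply: sat_pair => //; exact: sat_snd.
exact: (@sat_comp R (dspace_prod X0 Y) (dspace_prod Y Y) Y _ (fun z => ym z.1 z.2) _ Dz f3 (sat_ym Ds2 Dt)).
Qed.

Lemma sat_mulG (g g' : G) : Sp g -> Sp g' -> @sat R (dspace_prod G G) G (fun z => z.1 *m z.2) (g, g').
Proof.
move=> Sg Sg'; have Dz : @dom R (dspace_prod G G) (g, g') by [].
apply: gM_mx_space => //; first by apply: nearD_all => -[x y] [/= ? ?]; exact: SpM.
by apply: gMM; apply: (sat_mx_space (D := @Sp R n.+1)); [exact: sat_fst|exact: sat_snd].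
Qed.

Lemma lact0_smooth : @smooth_map R (dspace_prod G P) P (fun z => lact0 z.1 z.2).
Proof.
have D0 z : @dom R (dspace_prod G P) z -> dom (lact0 z.1 z.2).
  case: z => g q [/= Sg [x Dx <-]]; rewrite lact0E//.
  by exists (g *m x.1, x.2) => //; case: Dx => Sx Dx2; split=> //; exact: SpM.
apply: smooth_sat => //; first exact: complete_prod.
move=> [g q] [Sg Dq]; have [s sP] := P_section Dq; have sec := nearD_pt Dq sP.
apply: sat_swap => //; apply: (sat_section1 sec) => //=.
have [_ ss _] := sec; have Ds := sat_dom Dq ss; have [Ds1 Ds2] := Ds.
have Dz : @dom R (dspace_prod X0 G) (s q, g) by [].
apply: (@sat_local R (dspace_prod X0 G) P _ ((cls : X0 -> P) \o (fun z : X0 * G => (z.2 *m z.1.1, z.1.2) : X0))).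
  by apply: nearD_all => -[x y] [/= Dx Dy]; exact: lact0E.
apply: (@sat_comp R (dspace_prod X0 G) X0 P) => //; last first.
  by apply: sat_cls; split=> //; exact: SpM.
have f1 : @sat R (dspace_prod X0 G) G (fun z => z.1.1) (s q, g).
  exact: (@sat_comp R (dspace_prod X0 G) X0 G fst fst _ Dz (sat_fst _) (sat_fst _)).
have f2 : @sat R (dspace_prod X0 G) Y (fun z => z.1.2) (s q, g).
  exact: (@sat_comp R (dspace_prod X0 G) X0 Y fst snd _ Dz (sat_fst _) (sat_snd _)).
apply: sat_pair => //.
have f3 : @sat R (dspace_prod X0 G) (dspace_prod G G) (fun z => (z.2, z.1.1)) (s q, g).
  by apply: sat_pair => //; exact: sat_snd.
exact: (@sat_comp R (dspace_prod X0 G) (dspace_prod G G) G _ (fun z => z.1 *m z.2) _ Dz f3 (sat_mulG Sg Ds1)).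
Qed.

Lemma ract0M (q : P) (k l : K) : dom q -> dom k -> dom l ->
  ract0 (ract0 q k) l = ract0 q (spinr_mul k l).
Proof.
move=> [x Dx <-] [y Dy <-] [z Dz <-]; have [Sx Dx2] := Dx.
have D : @dom R X0 (x.1, ym x.2 y) by split=> //; exact: dom_ym.
by rewrite ract0E// ract0E// spinr_mulE ract0E ?ymA//; exact: dom_ym.
Qed.

Lemma loc_triv0 (c : CP) : dom c ->
  exists (U : set CP) (psi : P -> CP * K),
    [/\ dspace_open U, U c,
        @diffeo R (dspace_sub (pr0 @^-1` U)) (dspace_prod (dspace_sub U) K) psi,
        forall p : P, dom p -> U (pr0 p) -> (psi p).1 = pr0 p &
        forall (p : P) (k : K), dom p -> U (pr0 p) -> dom k ->
          psi (ract0 p k) = (pr0 p, spinr_mul (psi p).2 k)].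
Proof.
move=> Dc; have [U [sg [oU Uc sgU]]] := local_trivial Dc.
exists U, (psi0 sg); split=> //; last by move=> p k; exact: psi0_ract.
have Dpsi (x : P) : @dom R (dspace_sub (pr0 @^-1` U)) x ->
    @dom R (dspace_prod (dspace_sub U) K) (psi0 sg x).
  by move=> [Dx Ux]; have [D1 D2] := sat_dom Dx (sat_psi0 oU sgU Dx Ux).
have Dinv (x : CP * K) : @dom R (dspace_prod (dspace_sub U) K) x ->
    @dom R (dspace_sub (pr0 @^-1` U)) (inv0 sg x).
  by case: x => c' k [[_ Uc'] Dk]; have [D1 D2] := pr0_inv0 sgU Uc' Dk; split=> //; rewrite /preimage /= D2.
split.
  apply: smooth_sat => //; first exact: complete_sub.
  move=> q [Dq Uq]; have sp := sat_psi0 oU sgU Dq Uq.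
  have s1 : @sat R P CP (fun q => (psi0 sg q).1) q.
    exact: (@sat_comp R P (dspace_prod CP K) CP _ fst q Dq sp (sat_fst _)).
  have s2 : @sat R P K (fun q => (psi0 sg q).2) q.
    exact: (@sat_comp R P (dspace_prod CP K) K _ snd q Dq sp (sat_snd _)).
  have h : @sat R P (dspace_prod (dspace_sub U) K) (fun q => ((psi0 sg q).1, (psi0 sg q).2)) q.
    by apply: sat_pair => //; apply: sat_sub => //; exact: (pr0_near oU Dq Uq).
  apply: (@sat_local R (dspace_sub (pr0 @^-1` U)) (dspace_prod (dspace_sub U) K) (psi0 sg) _ q _ (sat_incl _ h)).
  by apply: nearD_all => p _; case: (psi0 sg p).
exists (inv0 sg); split.
- apply: smooth_sat => //; first exact: complete_prod.
  move=> [c' k] [[Dc' Uc'] Dk].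
  have Dz : @dom R (dspace_prod (dspace_sub U) K) (c', k) by [].
  have sp := sat_inv0 sgU Uc' Dk.
  have si : @sat R (dspace_prod (dspace_sub U) K) (dspace_prod CP K) (fun z => (z.1, z.2)) (c', k).
    apply: sat_pair => //; last exact: sat_snd.
    exact: (@sat_comp R (dspace_prod (dspace_sub U) K) (dspace_sub U) CP fst id _ Dz (sat_fst _) (sat_incl _ (sat_id _))).
  apply: sat_sub => //.
    apply: (@sat_local R (dspace_prod (dspace_sub U) K) P (inv0 sg) (inv0 sg \o (fun z => (z.1, z.2)))).
      by apply: nearD_all => -[].
    exact: (@sat_comp R (dspace_prod (dspace_sub U) K) (dspace_prod CP K) P _ (inv0 sg) _ Dz si sp).
  by apply: nearD_all => z Dz'; have [] := Dinv z Dz'.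
- by move=> q [Dq Uq]; exact: (psi0K sgU).
by move=> [c' k] [[_ Uc'] Dk]; exact: (inv0K sgU).
Qed.

Definition bundle0 : principal_bundle CP (@spinr_mul R N r) :=
  @PrincipalBundle R CP K (@spinr_mul R N r) P pr0 ract0 complete_P pr0_smooth ract0_smooth
    ract0M loc_triv0.

Definition frame0 x : FM_space n a t := frame_cls (x.1, fr a t (lam x.2.1)).
Definition Phi0 : P -> FM_space n a t := qlift cls x0 frame0.

(** The element mh([ctr h]) covers the isotropy of [ctr h], so changing the representative moves the
    frame by exactly the relation that defines frame classes; the sign is invisible to [lam]. *)
Lemma frame0_inv : respects (X := X0) cls frame0.
Proof.
move=> x y [Sx [Dx _]] [Sy [Dy _]] /cls_eq[h [Hh e1 e2]]; have Hc := Hgrp_ctr Hh.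
have [Sm c _] := muh_lifts a_gt0 t_gt0 Hc; have [_ _ e] := Hgrp_hz Hc.
have lm : lam (muh (ctr h) * y.2.1) = isotropy a t (ctr h) *m lam y.2.1.
  by rewrite lamM// [in RHS]e (lam_cover Sm c).
have lx : lam x.2.1 = isotropy a t (ctr h) *m lam y.2.1.
  by rewrite -lm; case: e2 => ->; rewrite //= lam_opp//; exact: SpinM.
by rewrite /frame0 e1 lx; exact: frame_cls_fr.
Qed.

Lemma Phi0E x : dom x -> Phi0 (cls x) = frame_cls (x.1, fr a t (lam x.2.1)).
Proof. by move=> Dx; exact: (qliftE x0 frame0_inv Dx). Qed.

Lemma sat_frame0 x : dom x -> @sat R X0 (FM_space n a t) frame0 x.
Proof.
move=> Dx; have [Sx [Dx2 _]] := Dx.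
pose F x : dspace_prod G (frame_space n a t) := (x.1, fr a t (lam x.2.1)).
apply: (@sat_comp R X0 (dspace_prod G (frame_space n a t)) (FM_space n a t) F (@frame_cls R n) x Dx).
  apply: sat_pair => //; first exact: sat_fst.
  have s2 : @sat R X0 (Spin_space N) (fun x => x.2.1) x.
    exact: (@sat_comp R X0 Y (Spin_space N) snd fst x Dx (sat_snd _) (sat_fst _)).
  exact: (@sat_comp R X0 (Spin_space N) (frame_space n a t) (fun x => x.2.1) (fun mu => fr a t (lam mu))
    x Dx s2 (sat_fr_lam a_gt0 t_gt0 Dx2)).
by apply: sat_smooth; exact: smooth_cls.
Qed.

Lemma Phi0_smooth : smooth_map Phi0.
Proof. by apply: smooth_qlift; [exact: complete_X0|exact: frame0_inv|exact: sat_frame0]. Qed.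

Lemma Phi0_over (q : P) : dom q -> FM_proj (Phi0 q) = pr0 q.
Proof. by move=> [x Dx <-]; rewrite Phi0E// pr0E// FM_proj_cls. Qed.

Lemma Phi0_equiv (q : P) mu (nu' : Cl R r) B : dom q -> Spin R N mu -> Spin R r nu' -> spin_cover mu B ->
  Phi0 (ract0 q (spinr_cls (mu, nu'))) = FM_right (Phi0 q) B.
Proof.
move=> [x Dx <-] Smu Snu cB; have [Sx [Dx2 Dx3]] := Dx.
have Dk : @dom R Y (mu, nu') by [].
rewrite (ract0E Dx Dk) (Phi0E Dx) Phi0E; last by split=> //; exact: dom_ym.
apply: (etrans _ (esym (FM_right_cls a t x.1 (fr a t (lam x.2.1)) B))).
have e : fr a t (lam (x.2.1 * mu)) = fract (fr a t (lam x.2.1)) B.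
  apply: (etrans _ (esym (fr_mul a t (lam x.2.1) B))).
  have := lamM Dx2 Smu; move: (_ * mu) (lam x.2.1) => xmu L ->.
  by rewrite (lam_cover Smu cB).
by rewrite -e.
Qed.

Lemma lact01 (q : P) : dom q -> lact0 1%:M q = q.
Proof. by move=> [x Dx <-]; rewrite lact0E// mul1mx; case: (x). Qed.

Lemma dom_left g x : Sp g -> dom x -> @dom R X0 (g *m x.1, x.2).
Proof. by move=> Sg [Sx Dx]; split=> //; exact: SpM. Qed.

Lemma lact0M g g' (q : P) : Sp g -> Sp g' -> dom q -> lact0 g (lact0 g' q) = lact0 (g *m g') q.
Proof.
move=> Sg Sg' [x Dx <-]; rewrite !(lact0E _ Dx) lact0E; last exact: dom_left.
by rewrite mulmxA.
Qed.

Lemma lact0_ract g (q : P) (k : K) : Sp g -> dom q -> dom k ->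
  lact0 g (ract0 q k) = ract0 (lact0 g q) k.
Proof.
move=> Sg [x Dx <-] [y Dy <-]; have [Sx Dx2] := Dx.
rewrite (ract0E Dx Dy) (lact0E g Dx) lact0E; last by split=> //; exact: dom_ym.
by rewrite (ract0E (dom_left Sg Dx) Dy).
Qed.

Lemma lact0_pr g (q : P) : Sp g -> dom q -> pr0 (lact0 g q) = CP_left g (pr0 q).
Proof.
move=> Sg [x Dx <-]; rewrite (lact0E g Dx) (pr0E Dx) (pr0E (dom_left Sg Dx)).
by rewrite CP_left_coset.
Qed.

Lemma lact0_Phi g (q : P) : Sp g -> dom q -> Phi0 (lact0 g q) = FM_left g (Phi0 q).
Proof.
move=> Sg [x Dx <-]; rewrite (lact0E g Dx) (Phi0E Dx) (Phi0E (dom_left Sg Dx)).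
by rewrite FM_left_cls.
Qed.

Definition structure0 : inv_spinr_structure n a t r :=
  @InvSpinr R n a t r bundle0 Phi0 Phi0_smooth Phi0_over Phi0_equiv lact0 lact0_smooth
    lact01 lact0M lact0_ract lact0_pr lact0_Phi.

(** At the base point p = [1, 1] one has h p = [h, 1] = [1, mh(h)] = p phi(h). *)
Lemma isotropy_lift0 : isotropy_lift structure0 (phiM a t nu).
Proof.
exists (cls x0); split=> [||h Hh]; first by exists x0 => //; exact: dom_x0.
  by rewrite [LHS](Phi0E dom_x0) /= lam1 fr1.
have Dm := dom_mh Hh; split; first by exists (mh h).
rewrite [LHS](lact0E h dom_x0) [RHS](ract0E dom_x0 Dm) /= mulmx1 ym1.
have Hc := Hgrp_ctr Hh.
by rewrite -(cls_mul (h, (1, 1) : Y) Hc) /= ctrK ymr1 Hgrp_mul_ctr.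
Qed.

End Bundle.

(** * The invariant spinor type *)

Section SpinorType.
Variables (R : realType) (n : nat) (a t : R).
Hypotheses (n_gt0 : (1 <= n)%N) (a_gt0 : 0 < a) (t_gt0 : 0 < t).
Local Notation N := (Ndim n).

Lemma admits1 : odd n -> admits_inv_spinor n a t 1.
Proof.
move=> on; have S1 (z : R[i]) : `|z| = 1 -> Spin R 1 1 by move=> _; exact: Spin1.
have M1 (z z' : R[i]) : `|z| = 1 -> `|z'| = 1 -> (1 : Cl R 1) = 1 * 1 by rewrite mulr1.
have sat1 (x : 'M[quat R]_n.+1) : Hgrp x ->
    @sat R (mx_space (@Hgrp R n)) (Spin_space 1) (fun h => 1) x.
  move=> Hx; apply: sat_gen => //; first by apply: nearD_all => y _; exact: Spin1.
  by move=> g [A ->]; exact: germ_cst.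
exists (structure0 (nu := fun _ => 1) a_gt0 t_gt0 (ltn0Sn 0) S1 M1 sat1), (phiM a t (fun _ => 1)), 1%N.
split=> //; first exact: isotropy_lift0.
exact: exists_inv1.
Qed.

Lemma admits2 : ~~ odd n -> admits_inv_spinor n a t 2.
Proof.
move=> en; have S1 (z : R[i]) : `|z| = 1 -> Spin R 2 (nuS 1 z).
  by move=> z1; apply: nu2_Spin; exact: norm_expz.
have M1 (z z' : R[i]) : `|z| = 1 -> `|z'| = 1 -> nuS 1 (z * z') = nuS 1 z * nuS 1 z'.
  by move=> _ _; exact: nuSM.
have sat2 (x : 'M[quat R]_n.+1) : Hgrp x ->
    @sat R (mx_space (@Hgrp R n)) (Spin_space 2) (fun h => nuS 1 (hz h)) x.
  by move=> Hx; exact: sat_nuS.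
exists (structure0 (nu := nuS 1) a_gt0 t_gt0 (ltn0Sn 1) S1 M1 sat2), (phiM a t (nuS 1)), 1%N.
split=> //; first exact: isotropy_lift0.
exact: exists_inv2.
Qed.

(* Over the frame [1, onbasis], comparing [Phi (h p)] with [Phi (p phi(h))]. *)
Lemma isotropy_lift_cover r (r_gt0 : (0 < r)%N) (P : inv_spinr_structure n a t r) phi h mu nu :
  isotropy_lift P phi -> Hgrp h -> phi h (mu, nu) ->
  [/\ Spin R N mu, Spin R r nu & spin_cover mu (isotropy a t h)].
Proof.
move=> [p [Dp Pp lift]] Hh hmn; have [[[m0 n0] [/= S0 T0] e0] lp] := lift h Hh.
have [Smu Snu] : Spin R N mu /\ Spin R r nu.
  by move: hmn; rewrite -e0 => /spinr_clsP[[-> ->]|[-> ->]]; split=> //; apply: SpinN.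
split=> //; have [c _] := Spin_cover Smu.
have e : phi h = spinr_cls (mu, nu).
  by move: hmn; rewrite -e0 => /spinr_clsP[[-> ->]|[-> ->]] //; rewrite spinr_clsN.
have := lact_Phi (Hgrp_Sp Hh) Dp; rewrite lp e (Phi_equiv Dp Smu Snu c) Pp FM_right_cls FM_left_cls.
rewrite mulmx1 -(fr1 n a_gt0 t_gt0) fr_mul mul1mx => E.
have : frame_cls (1%:M, fr a t (lam mu)) (1%:M, fr a t (lam mu)).
  exists 1%:M; first exact: Hgrp1.
  congr (_, _) => /=; first by rewrite mulmx1.
  by apply/funext => j; rewrite ctrans_ctr ctr1 mul1mx mulmx1.
(* [k] matches the representatives of the two frame classes. Its first component gives h k = 1, so k
   is the inverse of h, and the second says that conjugation by h acts on [onbasis] by [lam mu]. *)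
rewrite E => -[k Hk [/= hk fk]].
have kE : k = ctr h by rewrite -[k]mul1mx -(Hgrp_ctr_mul Hh) -mulmxA hk mulmx1.
suff <- : lam mu = isotropy a t h by [].
apply: (fr_inj a_gt0 t_gt0); rewrite -fk -[isotropy a t h]mulmx1 -(fr_conj a_gt0 t_gt0 _ Hh).
by apply/funext => j; rewrite kE !ctrans_ctr ctrK.
Qed.

Lemma not_admits1 : ~~ odd n -> ~ admits_inv_spinor n a t 1.
Proof.
move=> en [P [phi [m [lift _ [psi inv psi0]]]]]; apply: psi0.
have Hh : Hgrp (emb 'i%C (q_i R)%:M : 'M[quat R]_n.+1) by apply: Hgrp_emb; [exact: unit_iC|exact: Sp_i].
have [p [_ _ /(_ _ Hh)[[[mu nu] _ e] _]]] := lift.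
have hmn : phi (emb 'i%C (q_i R)%:M) (mu, nu) by rewrite -e; apply/spinr_clsP; left.
have [Smu Snu c] := isotropy_lift_cover (ltn0Sn 0) lift Hh hmn.
exact: (no_inv1 a_gt0 t_gt0 en Smu c Snu (inv _ Hh _ _ hmn)).
Qed.

End SpinorType.

Theorem theorem3p9 (R : realType) (n : nat) (a t : R)
    (hn : (1 <= n)%N) (ha : 0 < a) (ht : 0 < t) :
  (forall s s' : int, s = 2 * s' ->
     exists phi : 'M[quat R]_n.+1 -> set (Cl R (Ndim n) * Cl R 2),
       [/\ spinc_lift a t s phi,
           (forall phi', spinc_lift a t s phi' ->
              forall h, Hgrp h -> phi' h = phi h),
           (n%:Z <> s' %[mod 2])%Z ->
             direct_sum
               (tensor_with
                  (span2 (omega_pow n ((n%:Z + 1 + s') %/ 2)%Z)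
                         (wedge (yform n 1)
                            (omega_pow n ((n%:Z - 1 + s') %/ 2)%Z)))
                  hat1)
               (tensor_with
                  (span2 (omega_pow n ((n%:Z + 1 - s') %/ 2)%Z)
                         (wedge (yform n 1)
                            (omega_pow n ((n%:Z - 1 - s') %/ 2)%Z)))
                  haty1)
               (inv_spinors (m := 1) phi) &
           (n%:Z = s' %[mod 2])%Z -> inv_spinors (m := 1) phi = [set 0]]) /\
  spinor_type n a t (if odd n then 1 else 2)%N.
Proof.
split=> [_ s' ->|].
  exists (phiM a t (nuS s')); split; first exact: phiM_spinc.
  - exact: phiM_unique.
  - exact: inv_direct_sum.
  exact: inv_zero.
case: ifPn => on; split=> //; first exact: admits1.
  exact: admits2.
by move=> [|[|r]]// _ /(not_admits1 ha ht on).
Qed.
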